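(* Let $d\in\{2,3\}$, $T>0$, $p\ge2$, and let $W$ satisfy (H1)–(H3), listed in the context. For $\nu>0$, let $(u^\nu,F^\nu)$ be a weak solution on $(0,T)\times\mathbb{T}^d$, in the sense of the context, of $$\partial_tu^\nu=\operatorname{div}S(F^\nu)+\nu\Delta u^\nu-\nabla\Delta F^\nu,\qquad\partial_tF^\nu=\nabla u^\nu,\qquad\operatorname{curl}F^\nu=0,$$ with periodic boundary conditions and initial data $(u_0^\nu,F_0^\nu)$, where $F_0^\nu$ is a gradient. Assume that the data satisfy, as a sequence in $\nu$, the uniform bounds: $u_0^\nu$ is bounded in $L^2(\mathbb{T}^d)$, $\nabla F_0^\nu$ is bounded in $L^2(\mathbb{T}^d)$, and $F_0^\nu$ is bounded in $L^p(\mathbb{T}^d)$. Then there exists a weak solution $(\hat u,\hat F)$ of $$\partial_t\hat u=\operatorname{div}S(\hat F)-\nabla\Delta\hat F,\qquad\partial_t\hat F=\nabla\hat u,\qquad\operatorname{curl}\hat F=0,$$ with initial data $\hat u|_{t=0}=\hat u_0$, $\hat F|_{t=0}=\hat F_0$ and periodic boundary conditions, such that, as $\nu\to0$, $$u^\nu\rightharpoonup\hat u\ \text{ weak-* in }L^\infty\big(0,T;L^2(\mathbb{T}^d)\big),\qquad F^\nu\to\hat F\ \text{ in }C\big(0,T;L^q(\mathbb{T}^d)\big)$$ for any $q<p$.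
   Context: $\mathbb{T}^d$ is the flat torus with $|\mathbb{T}^d|=1$. The unknowns are $u$ with values in $\mathbb{R}^d$ and $F$ with values in the $d\times d$ matrices. $W$ is the stored energy and $S(F)=\partial W(F)/\partial F$. Notation: $(\operatorname{div}G)_i=\sum_\alpha\partial_\alpha G_{i\alpha}$, $(\nabla u)_{i\alpha}=\partial_\alpha u_i$, $(\nabla\Delta F)_i=\sum_\alpha\partial_\alpha\Delta F_{i\alpha}$; $\operatorname{curl}F=0$ means $\partial_\alpha F_{i\beta}=\partial_\beta F_{i\alpha}$. The dispersion coefficient is fixed to $1$. $C(0,T;X)$ denotes continuous functions of time with values in $X$. (H1) $W\in C^3(\mathbb{R}^{d\times d};\mathbb{R})$. (H2) There are $c,C>0$ with $c(|F|^p-1)\le W(F)\le C(|F|^p+1)$ for all $F$. (H3) $\tilde W(F):=W(F)+\frac K2|F|^2$ is convex for some $K>0$. $D^2\tilde W:(\nabla F,\nabla F)=\sum\frac{\partial^2\tilde W(F)}{\partial F_{i\alpha}\partial F_{k\gamma}}\partial_\beta F_{i\alpha}\partial_\beta F_{k\gamma}$. Weak solution for $\nu>0$: a pair $(u,F)$, with an associated $y:(0,T)\times\mathbb{T}^d\to\mathbb{R}^d$, is a weak solution with initial data $(u_0,F_0)$ if: (i) over $\mathbb{T}^d$, $u\in C(0,T;L^2)\cap L^2(0,T;H^1)$; $F\in C(0,T;L^p\cap H^1)\cap L^2(0,T;H^1\cap H^2)$; $y\in C(0,T;L^2)\cap L^\infty(0,T;H^1\cap H^2)\cap H^1(0,T;L^2)$.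 (ii) For all smooth $\phi$ ($\mathbb{R}^d$-valued) and $\psi$ ($\mathbb{R}^{d\times d}$-valued) on $[0,T)\times\mathbb{T}^d$, compactly supported in time in $[0,T)$, $$\iint u\cdot\phi_t-\iint S(F):\nabla\phi-\nu\iint\nabla u:\nabla\phi+\iint\Delta F:\nabla\phi+\int u_0\cdot\phi(0,x)\,dx=0,$$ $$\iint F:\psi_t+\iint\nabla u:\psi+\int F_0:\psi(0,x)\,dx=0,$$ and $F=\nabla y$ a.e. in $(0,T)\times\mathbb{T}^d$. (iii) For a.e. $t\in(0,T)$, $$\int\tfrac12|u|^2+W(F)+\tfrac12|\nabla F|^2\,dx+\nu\int_0^t\!\int|\nabla u|^2\,dx\,ds\le\int\tfrac12|u_0|^2+W(F_0)+\tfrac12|\nabla F_0|^2\,dx.$$ (iv) For a.e. $t\in(0,T)$, $$\int\Big(\tfrac12|u-\tfrac\nu2\operatorname{div}F|^2+\tfrac{\nu^2}8|\operatorname{div}F|^2+W(F)+\tfrac12|\nabla F|^2\Big)dx+\tfrac\nu2\int_0^t\!\int|\Delta F|^2\,dx\,ds+\tfrac\nu2\int_0^t\!\int\big(D^2\tilde W:(\nabla F,\nabla F)+|\nabla u|^2\big)dx\,ds$$ $$\le\tfrac{K}2\int_0^t\!\int|\nabla F|^2\,dx\,ds+\int\Big(\tfrac12|u_0-\tfrac\nu2\operatorname{div}F_0|^2+\tfrac{\nu^2}8|\operatorname{div}F_0|^2+W(F_0)+\tfrac12|\nabla F_0|^2\Big)dx.$$ For the limit system ($\nu=0$), no separate definition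 of weak solution is given; the term is used in the usual sense that the equations hold in the sense of distributions. The limit data $(\hat u_0,\hat F_0)$ are not further specified.
   Formalization: Convergence as ν→0 is stated along a subsequence of any sequence ν_n→0, since for merely bounded data the full family need not converge (e.g. constant velocities of alternating sign with F=0). *)

(* Defs.v *)
From HB Require Import structures.
From mathcomp Require Import all_boot all_order all_algebra.
From mathcomp Require Import all_classical all_reals all_analysis.

Set Implicit Arguments.
Unset Strict Implicit.
Unset Printing Implicit Defensive.

Import Order.TTheory GRing.Theory Num.Theory.
Import numFieldNormedType.Exports.

Local Open Scope classical_set_scope.
Local Open Scope ring_scope.

Section torus_measure.
Context (R : realType).

Definition tcons n (z : measurableTypeR R * n.-tuple R) : n.+1.-tuple R :=
  [tuple of (z.1 : R) :: z.2].

Lemma measurable_tcons n : measurable_fun setT (@tcons n).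
Proof. by apply: measurable_cons. Qed.

HB.instance Definition _ n :=
  isMeasurableFun.Build _ _ _ _ (@tcons n) (@measurable_tcons n).

(* The flat torus T^n is the unit cube with opposite faces identified: its
   measure is the n-fold product of the uniform probability on [0, 1]. It lives
   on all of R^n, so that functions on T^n are functions on R^n whose values
   off the unit cube are irrelevant; the identification of the faces is carried
   by the periodicity of the test functions below. *)
Fixpoint torus (n : nat) : probability (n.-tuple R) R :=
  match n with
  | 0 => \d_ [tuple]
  | m.+1 => distribution (uniform_prob (@ltr01 R) \x torus m)%E (@tcons m)
  end.

End torus_measure.
Arguments torus {R} n.

Section smoothness.
Context (R : realType) (V W : normedModType R).

Fixpoint Ck (k : nat) (f : V -> W) : Prop :=
  match k with
  | 0 => continuous f
  | l.+1 => continuous f /\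
      forall v, (forall x, derivable f x v) /\ Ck l (fun x => 'D_v f x)
  end.

Definition smooth (f : V -> W) := forall k, Ck k f.

End smoothness.

Section matrices.
Context (R : realType).

Definition mdot m n (A B : 'M[R]_(m, n)) : R := \sum_i \sum_j A i j * B i j.

Definition msq m n (A : 'M[R]_(m, n)) : R := mdot A A.

(* The Euclidean (Frobenius) norm; `|A| would be the maximum norm. *)
Definition frob m n (A : 'M[R]_(m, n)) : R := Num.sqrt (msq A).

Definition partial d (W : 'M[R]_d -> R) (i a : 'I_d) (F : 'M[R]_d) : R :=
  'D_(delta_mx i a) W F.

Definition stress d (W : 'M[R]_d -> R) (F : 'M[R]_d) : 'M[R]_d :=
  \matrix_(i, a) partial W i a F.

Definition Wtilde d (W : 'M[R]_d -> R) (K : R) (F : 'M[R]_d) : R :=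
  W F + K / 2 * msq F.

Definition W_C3 d (W : 'M[R]_d -> R) : Prop := Ck 3 W.

Definition W_growth d (p : R) (W : 'M[R]_d -> R) : Prop :=
  exists c C : R, [/\ 0 < c, 0 < C &
    forall F, c * (frob F `^ p - 1) <= W F <= C * (frob F `^ p + 1)].

Definition W_semiconvex d (W : 'M[R]_d -> R) (K : R) : Prop :=
  0 < K /\ convex_function setT (Wtilde W K).

End matrices.

Section torus_functions.
Context (R : realType) (d : nat).
Local Notation X := (d.-tuple R).
Local Notation lambda := (@lebesgue_measure R).

Definition vec (x : X) : 'rV[R]_d := \row_i tnth x i.

Definition basis (a : 'I_d) : 'rV[R]_d := delta_mx ord0 a.

Definition periodic (U : Type) (phi : 'rV[R]_d -> U) : Prop :=
  forall a x, phi (x + basis a) = phi x.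

Definition is_wpd (a : 'I_d) (f g : X -> R) : Prop :=
  [/\ (@torus R d).-integrable setT (EFin \o f),
      (@torus R d).-integrable setT (EFin \o g) &
      forall phi : 'rV[R]_d -> R, smooth phi -> periodic phi ->
        \int[torus d]_x (f x * 'D_(basis a) phi (vec x)) =
        - \int[torus d]_x (g x * phi (vec x))].

(* A representative of the weak derivative if there is one, and 0 otherwise. *)
Definition wpd1 (a : 'I_d) (f : X -> R) : X -> R :=
  xget (cst 0) [set g | is_wpd a f g].

Section matrix_valued.
Context (m n : nat).
Implicit Types f g : X -> 'M[R]_(m, n).

Definition wpd (a : 'I_d) f : X -> 'M[R]_(m, n) :=
  fun x => \matrix_(i, j) wpd1 a (fun z => f z i j) x.

Definition has_wpd (a : 'I_d) f : Prop :=
  forall i j, exists g : X -> R, is_wpd a (fun z => f z i j) g.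

Definition grad2 f (x : X) : R := \sum_b msq (wpd b f x).

Definition laplacian f (x : X) : 'M[R]_(m, n) := \sum_b wpd b (wpd b f) x.

Definition LpN (p : R) f : \bar R :=
  'N[torus d]_(p%:E)[EFin \o (@frob R m n \o f)]%E.

Definition Lp (p : R) f : Prop :=
  (forall i j, measurable_fun setT (fun x => f x i j)) /\ (LpN p f < +oo)%E.

Fixpoint Hk (k : nat) f : Prop :=
  match k with
  | 0 => Lp 2 f
  | l.+1 => Lp 2 f /\ forall b, has_wpd b f /\ Hk l (wpd b f)
  end.

(* The square of the norm of H^k. *)
Fixpoint HkN2 (k : nat) f : \bar R :=
  match k with
  | 0 => \int[torus d]_x (msq (f x))%:E
  | l.+1 => \int[torus d]_x (msq (f x))%:E + \sum_b HkN2 l (wpd b f)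
  end%E.

End matrix_valued.

Definition grad (v : X -> 'rV[R]_d) (x : X) : 'M[R]_d :=
  \matrix_(i, a) wpd a v x ord0 i.

Definition divergence (G : X -> 'M[R]_d) (x : X) : 'rV[R]_d :=
  \row_i \sum_a wpd a G x i a.

Definition is_gradient (G : X -> 'M[R]_d) : Prop :=
  exists y : X -> 'rV[R]_d, forall i a,
    is_wpd a (fun x => y x ord0 i) (fun x => G x i a).

Section evolution.
Context (T : R) (m n : nat).
Implicit Types f : R -> X -> 'M[R]_(m, n).

(* Elements of the evolution spaces are represented by jointly measurable
   functions on [0,T] x T^d. *)
Definition jmeas f : Prop := forall i j,
  measurable_fun (`[0, T] `*` setT) (fun z : measurableTypeR R * X => f z.1 z.2 i j).

(* Time intervals in C(0,T;X) are closed, so that such functions have values at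
   0 and T. *)
Definition CLp (p : R) f : Prop :=
  [/\ jmeas f, forall t, t \in `[0, T] -> Lp p (f t) &
      forall t, t \in `[0, T] ->
        LpN p (fun x => f s x - f t x) @[s --> within `[0, T] (nbhs t)] --> 0%E].

Definition CHk (k : nat) f : Prop :=
  [/\ jmeas f, forall t, t \in `[0, T] -> Hk k (f t) &
      forall t, t \in `[0, T] ->
        HkN2 k (fun x => f s x - f t x) @[s --> within `[0, T] (nbhs t)] --> 0%E].

Definition L2Hk (k : nat) f : Prop :=
  [/\ jmeas f, \forall t \ae lambda, t \in `]0, T[ -> Hk k (f t) &
      (\int[lambda]_(t in `]0%R, T[) HkN2 k (f t) < +oo)%E].

Definition LinfHk (k : nat) f : Prop :=
  jmeas f /\ exists M : R, \forall t \ae lambda, t \in `]0, T[ ->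
    Hk k (f t) /\ (HkN2 k (f t) <= M%:E)%E.

Definition LinfLp (p : R) f : Prop :=
  jmeas f /\ exists M : R, \forall t \ae lambda, t \in `]0, T[ ->
    Lp p (f t) /\ (LpN p (f t) <= M%:E)%E.

End evolution.

Section test_functions.
Context (T : R) (U : normedModType R).
Implicit Types phi : R * 'rV[R]_d -> U.

Definition dt phi (z : R * 'rV[R]_d) : U := 'D_(1, 0) phi z.

Definition dx (a : 'I_d) phi (z : R * 'rV[R]_d) : U := 'D_(0, basis a) phi z.

Definition smooth_periodic phi : Prop :=
  smooth phi /\ forall t, periodic (fun x => phi (t, x)).

(* Smooth functions on [0,T) x T^d with compact support in time, given as the
   restrictions of smooth functions on R x T^d. *)
Definition test phi : Prop :=
  smooth_periodic phi /\
  exists2 b, b < T & forall t x, b <= t -> phi (t, x) = 0.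

Definition test0 phi : Prop :=
  smooth_periodic phi /\
  exists a b, [/\ 0 < a, b < T &
    forall t x, t \notin `[a, b] -> phi (t, x) = 0].

End test_functions.

Definition dgrad (phi : R * 'rV[R]_d -> 'rV[R]_d) (z : R * 'rV[R]_d) : 'M[R]_d :=
  \matrix_(i, a) dx a phi z ord0 i.

Definition ddiv (psi : R * 'rV[R]_d -> 'M[R]_d) (z : R * 'rV[R]_d) : 'rV[R]_d :=
  \row_i \sum_a dx a psi z i a.

Definition dlap (U : normedModType R) (phi : R * 'rV[R]_d -> U)
  (z : R * 'rV[R]_d) : U := \sum_b dx b (dx b phi) z.

(* An iterated integral rather than one over a product measure, because the
   representatives [wpd] of the spatial derivatives are chosen separately for
   each t and need not be jointly measurable. *)
Definition STint (T : R) (h : R -> X -> R) : R :=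
  \int[lambda]_(t in `]0, T[) \int[torus d]_x h t x.

Definition H1L2 (T : R) m n (f : R -> X -> 'M[R]_(m, n)) : Prop :=
  L2Hk T 0 f /\ exists g, L2Hk T 0 g /\
    forall phi : R * 'rV[R]_d -> R, test0 T phi -> forall i j,
      STint T (fun t x => f t x i j * dt phi (t, vec x)) =
      - STint T (fun t x => g t x i j * phi (t, vec x)).

Definition energy (W : 'M[R]_d -> R) (u : X -> 'rV[R]_d) (F : X -> 'M[R]_d)
  (x : X) : R :=
  1 / 2 * msq (u x) + W (F x) + 1 / 2 * grad2 F x.

Definition energy_nu (nu : R) (W : 'M[R]_d -> R) (u : X -> 'rV[R]_d)
  (F : X -> 'M[R]_d) (x : X) : R :=
  1 / 2 * msq (u x - (nu / 2) *: divergence F x)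
  + nu ^+ 2 / 8 * msq (divergence F x) + W (F x) + 1 / 2 * grad2 F x.

Definition hess_grad (V : 'M[R]_d -> R) (F : X -> 'M[R]_d) (x : X) : R :=
  \sum_i \sum_a \sum_k \sum_c \sum_b
    partial (partial V i a) k c (F x) * wpd b F x i a * wpd b F x k c.

Record weak_solution (T p : R) (W : 'M[R]_d -> R) (K nu : R)
    (u0 : X -> 'rV[R]_d) (F0 : X -> 'M[R]_d)
    (u : R -> X -> 'rV[R]_d) (F : R -> X -> 'M[R]_d)
    (y : R -> X -> 'rV[R]_d) : Prop := WeakSolution {
  ws_u : CLp T 2 u /\ L2Hk T 1 u ;
  ws_F : [/\ CLp T p F, CHk T 1 F, L2Hk T 1 F & L2Hk T 2 F] ;
  ws_y : [/\ CLp T 2 y, LinfHk T 1 y, LinfHk T 2 y & H1L2 T y] ;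
  ws_momentum : forall phi : R * 'rV[R]_d -> 'rV[R]_d, test T phi ->
    STint T (fun t x => mdot (u t x) (dt phi (t, vec x)))
    - STint T (fun t x => mdot (stress W (F t x)) (dgrad phi (t, vec x)))
    - nu * STint T (fun t x => mdot (grad (u t) x) (dgrad phi (t, vec x)))
    + STint T (fun t x => mdot (laplacian (F t) x) (dgrad phi (t, vec x)))
    + \int[torus d]_x mdot (u0 x) (phi (0, vec x)) = 0 ;
  ws_compat : forall psi : R * 'rV[R]_d -> 'M[R]_d, test T psi ->
    STint T (fun t x => mdot (F t x) (dt psi (t, vec x)))
    + STint T (fun t x => mdot (grad (u t) x) (psi (t, vec x)))
    + \int[torus d]_x mdot (F0 x) (psi (0, vec x)) = 0 ;
  ws_grad : \forall t \ae lambda, t \in `]0, T[ ->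
    \forall x \ae torus d, F t x = grad (y t) x ;
  ws_energy : \forall t \ae lambda, t \in `]0, T[ ->
    (\int[torus d]_x (energy W (u t) (F t) x)%:E
     + nu%:E * \int[lambda]_(s in `]0%R, t[)
                 \int[torus d]_x (msq (grad (u s) x))%:E
     <= \int[torus d]_x (energy W u0 F0 x)%:E)%E ;
  ws_energy_nu : \forall t \ae lambda, t \in `]0, T[ ->
    (\int[torus d]_x (energy_nu nu W (u t) (F t) x)%:E
     + (nu / 2)%:E * \int[lambda]_(s in `]0%R, t[)
         \int[torus d]_x (msq (laplacian (F s) x))%:E
     + (nu / 2)%:E * \int[lambda]_(s in `]0%R, t[)
         \int[torus d]_x (hess_grad (Wtilde W K) (F s) x
                          + msq (grad (u s) x))%:E
     <= (K / 2)%:E * \int[lambda]_(s in `]0%R, t[)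
          \int[torus d]_x (grad2 (F s) x)%:E
        + \int[torus d]_x (energy_nu nu W u0 F0 x)%:E)%E
}.

(* Weak solutions of the inviscid system, in the sense of distributions: since
   no derivative of u or F need be a function, all of them are moved to the
   test functions. *)
Record weak_solution0 (T p : R) (W : 'M[R]_d -> R)
    (u0 : X -> 'rV[R]_d) (F0 : X -> 'M[R]_d)
    (u : R -> X -> 'rV[R]_d) (F : R -> X -> 'M[R]_d) : Prop :=
  WeakSolution0 {
  ws0_data : Lp 2 u0 /\ Lp p F0 ;
  ws0_u : LinfLp T 2 u ;
  ws0_F : LinfLp T p F ;
  ws0_stress :
    (\int[lambda]_(t in `]0%R, T[) \int[torus d]_x (frob (stress W (F t x)))%:E
     < +oo)%E ;
  ws0_momentum : forall phi : R * 'rV[R]_d -> 'rV[R]_d, test T phi ->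
    STint T (fun t x => mdot (u t x) (dt phi (t, vec x)))
    - STint T (fun t x => mdot (stress W (F t x)) (dgrad phi (t, vec x)))
    + STint T (fun t x => mdot (F t x) (dgrad (dlap phi) (t, vec x)))
    + \int[torus d]_x mdot (u0 x) (phi (0, vec x)) = 0 ;
  ws0_compat : forall psi : R * 'rV[R]_d -> 'M[R]_d, test T psi ->
    STint T (fun t x => mdot (F t x) (dt psi (t, vec x)))
    - STint T (fun t x => mdot (u t x) (ddiv psi (t, vec x)))
    + \int[torus d]_x mdot (F0 x) (psi (0, vec x)) = 0 ;
  ws0_curl : forall zeta : R * 'rV[R]_d -> R, test T zeta -> forall i a b,
    STint T (fun t x => F t x i b * dx a zeta (t, vec x)) =
    STint T (fun t x => F t x i a * dx b zeta (t, vec x))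
}.

(* Weak-* convergence in L^oo(0,T;L^2), tested against L^1(0,T;L^2). *)
Definition weak_star_LinfL2 (T : R) (m n : nat)
    (f_ : nat -> R -> X -> 'M[R]_(m, n)) (f : R -> X -> 'M[R]_(m, n)) : Prop :=
  [/\ forall k, LinfLp T 2 (f_ k), LinfLp T 2 f &
    forall g : R -> X -> 'M[R]_(m, n), jmeas T g ->
      (\int[lambda]_(t in `]0%R, T[) LpN 2 (g t) < +oo)%E ->
      STint T (fun t x => mdot (f_ k t x) (g t x)) @[k --> \oo] -->
      STint T (fun t x => mdot (f t x) (g t x))].

Definition cvg_CLp (T q : R) (m n : nat)
    (f_ : nat -> R -> X -> 'M[R]_(m, n)) (f : R -> X -> 'M[R]_(m, n)) : Prop :=
  [/\ forall k, CLp T q (f_ k), CLp T q f &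
    ereal_sup [set LpN q (fun x => f_ k t x - f t x) | t in `[0, T]]
      @[k --> \oo] --> 0%E].

End torus_functions.

(* Main.v *)
(** The energy inequality bounds u in L^2 and F in L^p and H^1, uniformly in time
    and in nu. Tested against a fixed Fourier mode, with all derivatives moved to the
    mode, the equations make the corresponding coefficients of u and F Lipschitz in
    time, uniformly in nu; a diagonal extraction then makes all of them converge
    uniformly on [0, T]. For F the H^1 bound controls the high modes, so that F
    converges in L^2 uniformly in time, and in L^q for q < p by interpolation with
    the L^p bound; u converges weakly in L^2 at every time. Semiconvexity turns the
    growth of W into (1 + |F|) |S(F)| <= C (1 + |F|^p), hence S(F) has uniformly small
    integral over the sets where |F| is large, which suffices to pass to the
    limit in the stress; the viscous term vanishes because it carries the factor nu
    and falls on the test function. *)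

From HB Require Import structures.
Require Import Defs.
From mathcomp Require Import all_boot all_order all_algebra.
From mathcomp Require Import all_classical all_reals all_analysis.
From mathcomp Require Import measurable_realfun zify ring lra.

Set Implicit Arguments.
Unset Strict Implicit.
Unset Printing Implicit Defensive.

Import Order.TTheory GRing.Theory Num.Theory.
Import numFieldNormedType.Exports.

Local Open Scope classical_set_scope.
Local Open Scope ring_scope.

(** Two obstacles shape the proof. The limits must be jointly measurable in time and space, whereas
    compactness yields a limit at each time separately. Velocities are therefore rebuilt from their
    limiting Fourier coefficients, by a form of the Riesz-Fischer theorem in which the coefficients
    depend measurably on a parameter; strains are upper limits of the sequence itself, taken at
    every point. To this end the subsequence is thinned until consecutive strains differ, in squared
    L^2 norm and at every time, by at most [(1/4)^n]: at each single time the strains then converge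
    almost everywhere in space, as the nonlinear stress requires. Secondly, representatives of weak
    derivatives are chosen time by time and need not be measurable in time, so all derivatives are
    moved to the test function, slice by slice, before any theorem on space-time integrals is
    applied. The L^2 and L^p bounds of the energy, valid at almost every time, extend to every time
    by continuity, at the cost of a constant; the H^1 bound on the strains is used only at nearby
    good times. *)

Lemma sqrD_le (R : realDomainType) (a b : R) : (a + b) ^+ 2 <= 2 * (a ^+ 2 + b ^+ 2).
Proof. by have := sqr_ge0 (a - b); rewrite sqrrB sqrrD; lra. Qed.

(** * Square integrable functions and orthonormal families *)

Section square_integrable.
Context d (T : measurableType d) (R : realType) (mu : probability T R).
Implicit Types f g : T -> R.

Definition integ f := mu.-integrable setT (EFin \o f).
Definition RI f : R := \int[mu]_x f x.
Definition sqint f := measurable_fun setT f /\ integ (fun x => f x ^+ 2).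

Lemma integ_meas f : integ f -> measurable_fun setT f.
Proof. by move=> /integrableP[/measurable_EFinP]. Qed.

Lemma integ_le f g : measurable_fun setT f -> (forall x, `|f x| <= g x) ->
  integ g -> integ f.
Proof.
move=> mf fg ig; apply: (le_integrable _ _ _ ig) => //=.
  exact/measurable_EFinP.
by move=> x _; rewrite lee_fin (le_trans (fg x))// ler_norm.
Qed.

Lemma integ_cst c : integ (fun=> c).
Proof. exact: finite_measure_integrable_cst. Qed.

Lemma integ_bdd f c : measurable_fun setT f -> (forall x, `|f x| <= c) -> integ f.
Proof. by move=> mf fc; apply: integ_le mf fc (integ_cst c). Qed.

Lemma integD f g : integ f -> integ g -> integ (fun x => f x + g x).
Proof. by move=> fi gi; have := integrableD measurableT fi gi. Qed.

Lemma integZ c f : integ f -> integ (fun x => c * f x).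
Proof. by move=> fi; have := integrableZl measurableT c fi. Qed.

Lemma integN f : integ f -> integ (fun x => - f x).
Proof. by move=> fi; have := integrableN fi. Qed.

Lemma integB f g : integ f -> integ g -> integ (fun x => f x - g x).
Proof. by move=> fi gi; have := integrableB measurableT fi gi. Qed.

Lemma integ_sum (I : Type) (s : seq I) (P : pred I) (f : I -> T -> R) :
  (forall i, P i -> integ (f i)) -> integ (fun x => \sum_(i <- s | P i) f i x).
Proof.
move=> fi; elim: s => [|i s IH].
  by under [X in integ X]eq_fun do rewrite big_nil; exact: integ_cst.
under [X in integ X]eq_fun do rewrite big_cons.
by case Pi : (P i) => //; apply: integD => //; exact: fi.
Qed.

Lemma integ_abs f : integ f -> integ (fun x => `|f x|).
Proof. by move=> fi; have := integrable_norm fi. Qed.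

Lemma RID f g : integ f -> integ g -> RI (fun x => f x + g x) = RI f + RI g.
Proof. by move=> fi gi; apply: RintegralD. Qed.

Lemma RIB f g : integ f -> integ g -> RI (fun x => f x - g x) = RI f - RI g.
Proof. by move=> fi gi; apply: RintegralB. Qed.

Lemma RIZ c f : integ f -> RI (fun x => c * f x) = c * RI f.
Proof. by move=> fi; apply: RintegralZl. Qed.

Lemma RIN f : integ f -> RI (fun x => - f x) = - RI f.
Proof.
move=> fi; rewrite -[RHS]mulN1r -RIZ//; congr RI.
by apply/funext => x; rewrite mulN1r.
Qed.

Lemma RI_cst c : RI (fun=> c) = c.
Proof.
by rewrite /RI Rintegral_cst//= [X in fine X]probability_setT mulr1.
Qed.

Lemma RI_sum (I : Type) (s : seq I) (P : pred I) (f : I -> T -> R) :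
  (forall i, P i -> integ (f i)) ->
  RI (fun x => \sum_(i <- s | P i) f i x) = \sum_(i <- s | P i) RI (f i).
Proof.
move=> fi; elim: s => [|i s IH].
  by under [X in RI X]eq_fun do rewrite big_nil; rewrite RI_cst big_nil.
under [X in RI X]eq_fun do rewrite big_cons.
rewrite big_cons; case Pi : (P i) => //; rewrite RID ?IH//; first exact: fi.
exact: integ_sum.
Qed.

Lemma RI_ge0 f : (forall x, 0 <= f x) -> 0 <= RI f.
Proof. by move=> f0; apply: Rintegral_ge0. Qed.

Lemma RI_le f g : integ f -> integ g -> (forall x, f x <= g x) -> RI f <= RI g.
Proof. by move=> fi gi fg; apply: le_Rintegral. Qed.

Lemma RI_abs f : integ f -> `|RI f| <= RI (fun x => `|f x|).
Proof. by move=> fi; apply: le_normr_Rintegral. Qed.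

Lemma RI_EFin f : integ f -> (\int[mu]_x (f x)%:E = (RI f)%:E)%E.
Proof. by move=> fi; rewrite fineK//; exact: integrable_fin_num. Qed.

Lemma eq_RI f g : f =1 g -> RI f = RI g.
Proof. by move=> /funext ->. Qed.

Lemma ae_RI f g : measurable_fun setT f -> measurable_fun setT g ->
  {ae mu, forall x, f x = g x} -> RI f = RI g.
Proof.
move=> mf mg fg; rewrite /RI /Rintegral; congr fine; apply: ae_eq_integral => //.
- exact/measurable_EFinP.
- exact/measurable_EFinP.
- by apply: filterS fg => x /= ->.
Qed.

Lemma integ_lty f : measurable_fun setT f -> (forall x, 0 <= f x) ->
  (\int[mu]_x (f x)%:E < +oo)%E -> integ f.
Proof.
move=> mf f0 lty; apply/integrableP; split; first exact/measurable_EFinP.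
by under eq_integral => x _ do rewrite gee0_abs ?lee_fin//.
Qed.

Lemma RI_eq0 f : integ f -> (forall x, 0 <= f x) -> RI f = 0 ->
  {ae mu, forall x, f x = 0}.
Proof.
move=> fi f0 fI.
have mf : measurable_fun setT (EFin \o f) by exact/measurable_EFinP/integ_meas.
have : (\int[mu]_x `|(EFin \o f) x| = 0)%E.
  under eq_integral => x _ do rewrite gee0_abs ?lee_fin//.
  by rewrite [LHS]RI_EFin// fI.
move/(ae_eq_integral_abs _ measurableT mf); apply: filterS => x /= /(_ I).
by case.
Qed.

Lemma sqint_meas f : sqint f -> measurable_fun setT f. Proof. by case. Qed.

Lemma sqintM f g : sqint f -> sqint g -> integ (fun x => f x * g x).
Proof.
move=> [mf fi] [mg gi].
apply: (@integ_le _ (fun x => f x ^+ 2 + g x ^+ 2)).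
- exact: measurable_funM.
- move=> x; rewrite ler_norml; apply/andP; split; nra.
- exact: integD.
Qed.

Lemma sqint2 f : sqint f -> integ (fun x => f x ^+ 2). Proof. by case. Qed.

Lemma sqintD f g : sqint f -> sqint g -> sqint (fun x => f x + g x).
Proof.
move=> fs gs; have [mf fi] := fs; have [mg gi] := gs.
split; first exact: measurable_funD.
apply: (@integ_le _ (fun x => 2 * (f x ^+ 2 + g x ^+ 2))).
- by apply: measurable_funX; exact: measurable_funD.
- by move=> x; rewrite ger0_norm ?sqr_ge0//; exact: sqrD_le.
- by apply: integZ; exact: integD.
Qed.

Lemma sqintZ c f : sqint f -> sqint (fun x => c * f x).
Proof.
move=> [mf fi]; split; first exact: measurable_funM.
by under [X in integ X]eq_fun do rewrite exprMn; exact: integZ.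
Qed.

Lemma sqintN f : sqint f -> sqint (fun x => - f x).
Proof.
by move=> /(sqintZ (-1)); under eq_fun do rewrite mulN1r.
Qed.

Lemma sqintB f g : sqint f -> sqint g -> sqint (fun x => f x - g x).
Proof. by move=> fs gs; apply: sqintD => //; exact: sqintN. Qed.

Lemma sqint_bdd f c : measurable_fun setT f -> (forall x, `|f x| <= c) -> sqint f.
Proof.
move=> mf fc; split => //; apply: (@integ_bdd _ (c ^+ 2)).
  exact: measurable_funX.
by move=> x; rewrite normrX lerXn2r// nnegrE// (le_trans _ (fc x)).
Qed.

Lemma sqint_cst c : sqint (fun=> c).
Proof. by apply: (@sqint_bdd _ `|c|). Qed.

Lemma sqint_sum (I : Type) (s : seq I) (P : pred I) (f : I -> T -> R) :
  (forall i, P i -> sqint (f i)) -> sqint (fun x => \sum_(i <- s | P i) f i x).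
Proof.
move=> fi; elim: s => [|i s IH].
  by under [X in sqint X]eq_fun do rewrite big_nil; exact: sqint_cst.
under [X in sqint X]eq_fun do rewrite big_cons.
by case Pi : (P i) => //; apply: sqintD => //; exact: fi.
Qed.

Lemma sqintMb f g c : sqint f -> measurable_fun setT g -> (forall x, `|g x| <= c) ->
  sqint (fun x => f x * g x).
Proof.
move=> [mf fi] mg gc; split; first exact: measurable_funM.
apply: (@integ_le _ (fun x => c ^+ 2 * f x ^+ 2)).
- by apply: measurable_funX; exact: measurable_funM.
- move=> x; rewrite ger0_norm ?sqr_ge0// exprMn mulrC ler_wpM2r ?sqr_ge0//.
  by rewrite -[leLHS]real_normK ?num_real// lerXn2r// nnegrE// (le_trans _ (gc x)).
- exact: integZ.
Qed.

Lemma sqint_int f : sqint f -> integ f.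
Proof.
move=> fs; have := sqintM fs (sqint_cst 1).
by under [X in integ X]eq_fun do rewrite mulr1.
Qed.

Lemma RI_sqr_ge0 f : 0 <= RI (fun x => f x ^+ 2).
Proof. by apply: RI_ge0 => x; exact: sqr_ge0. Qed.

(** Both signs come from [c^-1 * (c * f x + g x) ^+ 2 >= 0] and its analogue with a minus sign. The
    weight [c] is free, and replaces the Cauchy-Schwarz inequality: it is chosen so large that the
    term with the fixed factor is small, after which the other factor is made small enough to absorb
    [c]. *)
Lemma RI_young f g c : 0 < c -> sqint f -> sqint g ->
  `|RI (fun x => f x * g x)| <=
  c * RI (fun x => f x ^+ 2) + c^-1 * RI (fun x => g x ^+ 2).
Proof.
move=> c0 fs gs; apply: (le_trans (RI_abs (sqintM fs gs))).
rewrite -RIZ ?(sqint2 fs)// -RIZ ?(sqint2 gs)// -RID; last 2 first.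
- exact/integZ/sqint2.
- exact/integZ/sqint2.
apply: RI_le.
- exact/integ_abs/sqintM.
- by apply: integD; exact/integZ/sqint2.
- move=> x; have cV : c * c^-1 = 1 by rewrite divff// gt_eqF.
  have c'0 : 0 < c^-1 by rewrite invr_gt0.
  rewrite ler_norml; apply/andP; split.
    have : 0 <= c^-1 * (c * f x + g x) ^+ 2 by rewrite mulr_ge0// ?sqr_ge0// ltW.
    have -> : c^-1 * (c * f x + g x) ^+ 2 = (c * c^-1) * (c * f x ^+ 2) + 2 * (c * c^-1) * (f x * g x) + c^-1 * g x ^+ 2 by ring.
    rewrite cV; have : 0 <= c * f x ^+ 2 by rewrite mulr_ge0// ?sqr_ge0// ltW.
    have : 0 <= c^-1 * g x ^+ 2 by rewrite mulr_ge0// ?sqr_ge0// ltW.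
    lra.
  have : 0 <= c^-1 * (c * f x - g x) ^+ 2 by rewrite mulr_ge0// ?sqr_ge0// ltW.
  have -> : c^-1 * (c * f x - g x) ^+ 2 = (c * c^-1) * (c * f x ^+ 2) - 2 * (c * c^-1) * (f x * g x) + c^-1 * g x ^+ 2 by ring.
  rewrite cV; have : 0 <= c * f x ^+ 2 by rewrite mulr_ge0// ?sqr_ge0// ltW.
  have : 0 <= c^-1 * g x ^+ 2 by rewrite mulr_ge0// ?sqr_ge0// ltW.
  lra.
Qed.

End square_integrable.
(** The upper limit, read as a real number (0 if infinite). It exists for every sequence and is
    measurable in parameters without any convergence, and it is the limit where there is one; all
    limit functions below are built from it. *)
Definition lims {R : realType} (h : nat -> R) : R := fine (limn_esup (EFin \o h)).

Lemma lims_cvg {R : realType} (h : nat -> R) l : h @ \oo --> l -> lims h = l.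
Proof.
move=> hl; have /cvg_limn_einf_sup[_] : (EFin \o h) @ \oo --> l%:E.
  by apply: cvg_EFin => //; exact: nearW.
by rewrite /lims => ->.
Qed.

Lemma measurable_lims d (T : measurableType d) (R : realType) (h : nat -> T -> R) :
  (forall n, measurable_fun setT (h n)) ->
  measurable_fun setT (fun x => lims (h ^~ x)).
Proof.
move=> mh; apply: measurableT_comp => //.
apply: (@measurable_fun_limn_esup _ _ _ _ (fun n => EFin \o h n)) => n.
exact/measurable_EFinP.
Qed.

Lemma geo_half (R : realType) (e : R) : 0 < e -> exists n, 2^-1 ^+ n < e.
Proof.
move=> e0; have : (2^-1 : R) ^+ n @[n --> \oo] --> (0 : R).
  by apply: cvg_expr; rewrite ger0_norm// invf_lt1// ltr1n.
move=> /cvgrPdist_lt /(_ _ e0)[n _ /(_ n (leqnn n))]; rewrite sub0r normrN => h.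
by exists n; apply: le_lt_trans h; rewrite ler_norm.
Qed.

(** * The Riesz-Fischer theorem for sequences with a geometric rate *)

Section riesz_fischer.
Context d (T : measurableType d) (R : realType) (mu : probability T R).
Variable G : nat -> T -> R.
Hypothesis sG : forall j, sqint mu (G j).
Hypothesis GG : forall j,
  RI mu (fun x => (G j.+1 x - G j x) ^+ 2) <= (1/4) ^+ j.

(** The weight shares the rate [(1/4)^j] between two needs: [D j] still has integral at most [2^-j],
    so the series of the [D j] is integrable, and a bound on this series still leaves a factor
    [2^-j] for the squared increments of [G]. *)
Let D j x := 2 ^+ j * (G j.+1 x - G j x) ^+ 2.

Let D0 j x : 0 <= D j x.
Proof. by rewrite /D mulr_ge0 ?sqr_ge0// exprn_ge0. Qed.

Let h0 j : 0 <= 2^-1 ^+ j :> R. Proof. by rewrite exprn_ge0. Qed.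

Let mD j : measurable_fun setT (D j).
Proof.
apply: measurable_funM => //; apply: measurable_funX; apply: measurable_funB.
  exact: (sG _).1.
exact: (sG _).1.
Qed.

Let iD j : (\int[mu]_x (D j x)%:E <= (2^-1 ^+ j)%:E)%E.
Proof.
have i1 : integ mu (fun x => (G j.+1 x - G j x) ^+ 2).
  exact: sqint2 (sqintB (sG _) (sG _)).
rewrite RI_EFin; last exact: integZ.
rewrite lee_fin /D RIZ//.
apply: (@le_trans _ _ (2 ^+ j * (1/4) ^+ j)).
  by rewrite ler_wpM2l// exprn_ge0.
by rewrite -exprMn (_ : 2 * (1 / 4) = 2^-1 :> R)//; field.
Qed.

Let H j x : \bar R := (\sum_(i <oo) (D (j + i)%N x)%:E)%E.

Let mH j : measurable_fun setT (H j).
Proof.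
apply: (@ge0_emeasurable_sum _ _ _ setT (fun i x => (D (j + i)%N x)%:E) xpredT) => [k x _ _|k _].
  by rewrite lee_fin; exact: D0.
by apply/measurable_EFinP; exact: mD.
Qed.

Let H0 j x : (0 <= H j x)%E.
Proof. by apply: nneseries_ge0 => i _ _; rewrite lee_fin; exact: D0. Qed.

Let geo n j : \sum_(0 <= i < n) 2^-1 ^+ (j + i) = 2 * (2^-1 ^+ j - 2^-1 ^+ (j + n)) :> R.
Proof.
elim: n => [|n IH]; first by rewrite addn0 big_geq// subrr mulr0.
by rewrite addnS big_nat_recr//= IH exprS; field.
Qed.

Let iH j : (\int[mu]_x H j x <= (2 * 2^-1 ^+ j)%:E)%E.
Proof.
rewrite /H integral_nneseries//; last 2 first.
- by move=> i; apply/measurable_EFinP; exact: mD.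
- by move=> i x _; rewrite lee_fin; exact: D0.
apply: (@le_trans _ _ (\sum_(i <oo) (2^-1 ^+ (j + i))%:E)%E).
  apply: lee_nneseries => [i _ _|i _]; last by have := iD (j + i)%N.
  by apply: integral_ge0 => x _; rewrite lee_fin; exact: D0.
apply: lime_le.
  by apply: is_cvg_nneseries => i _ _; rewrite lee_fin; exact: h0.
apply: nearW => n; rewrite sumEFin lee_fin geo ler_wpM2l// lerBlDr lerDl.
exact: h0.
Qed.

(** Induction along the telescoping sum: each use of [sqrD_le] costs a factor 2, which passing from
    [2^-j] to [2^-(j+1)] pays back, so the constant stays 2 for every [n]. *)
Let GD n j x : (G (j + n)%N x - G j x) ^+ 2 <=
  2 * 2^-1 ^+ j * \sum_(0 <= i < n) D (j + i)%N x.
Proof.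
elim: n j => [|n IH] j.
  by rewrite addn0 subrr expr0n/= big_geq// mulr0.
rewrite big_nat_recl//= addn0.
have -> : G (j + n.+1)%N x - G j x = (G j.+1 x - G j x) + (G (j.+1 + n)%N x - G j.+1 x).
  by rewrite addSn addnS; ring.
apply: (le_trans (sqrD_le _ _)); rewrite !mulrDr; apply: lerD.
  rewrite /D -mulrA (mulrA (2^-1 ^+ j)) -exprMn mulVf// expr1n mul1r//.
apply: (@le_trans _ _ (2 * (2 * 2^-1 ^+ j.+1 * \sum_(0 <= i < n) D (j.+1 + i)%N x))).
  by rewrite ler_wpM2l.
have -> : \sum_(0 <= i < n) D (j.+1 + i)%N x = \sum_(0 <= i < n) D (j + i.+1)%N x.
  by apply: eq_bigr => i _; rewrite addSnnS.
by rewrite exprS; set S := \sum_(_ <= _ < _) _; rewrite le_eqVlt; apply/orP; left; apply/eqP; field.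
Qed.

Let GH j k x : (j <= k)%N -> (((G k x - G j x) ^+ 2)%:E <= (2 * 2^-1 ^+ j)%:E * H j x)%E.
Proof.
move=> jk; rewrite -(subnKC jk).
apply: (@le_trans _ _ ((2 * 2^-1 ^+ j)%:E * \sum_(0 <= i < k - j) (D (j + i)%N x)%:E)%E).
  by rewrite sumEFin -EFinM lee_fin; exact: GD.
apply: lee_wpmul2l; first by rewrite lee_fin mulr_ge0//; exact: h0.
by apply: nneseries_lim_ge => i _ _; rewrite lee_fin; exact: D0.
Qed.

Let ulim x := lims (G ^~ x).

Let Hfin : {ae mu, forall x, H 0 x < +oo}%E.
Proof.
have : mu.-integrable setT (H 0).
  apply/integrableP; split; first exact: mH.
  under eq_integral => x _ do rewrite gee0_abs ?H0//.
  by apply: le_lt_trans (iH 0) _; rewrite ltry.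
move/(integrable_ae measurableT); apply: filterS => x /(_ I).
by rewrite ge0_fin_numE.
Qed.

(** Wherever the integrable series [H 0] is finite, the squared increments after [j] are at most a
    constant times [2^-j], so the sequence is Cauchy there. *)
Lemma riesz_fischer_ae : {ae mu, forall x, G ^~ x @ \oo --> ulim x}.
Proof.
apply: filterS Hfin => x Hx.
suff : cvg (G ^~ x @ \oo).
  by move=> /cvg_ex[l hl]; rewrite /ulim (lims_cvg hl).
have H0fin : H 0 x \is a fin_num by rewrite ge0_fin_numE.
set C := 2 * fine (H 0 x).
have C0 : 0 <= C by rewrite mulr_ge0// fine_ge0.
have hC j k : (j <= k)%N -> (G k x - G j x) ^+ 2 <= C * 2^-1 ^+ j.
  move=> jk; rewrite -lee_fin (le_trans (GH _ jk))//.
  rewrite /C mulrAC [in leRHS]EFinM fineK//; apply: lee_wpmul2l.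
    by rewrite lee_fin mulr_ge0//; exact: h0.
  apply: lime_le; first by apply: is_cvg_nneseries => i _ _; rewrite lee_fin; exact: D0.
  apply: nearW => n; apply: (@le_trans _ _ (\sum_(0 <= i < j + n) (D i x)%:E)%E); last first.
    by apply: nneseries_lim_ge => i _ _; rewrite lee_fin; exact: D0.
  have -> : (\sum_(0 <= i < n) (D (j + i)%N x)%:E = \sum_(j <= i < j + n) (D i x)%:E)%E.
    rewrite -{2}(add0n j) big_addn addKn.
    by apply: eq_bigr => i _; rewrite addnC.
  rewrite [leRHS](@big_cat_nat _ _ _ j)//= ?leq_addr//.
  by rewrite leeDr// sume_ge0// => i _; rewrite lee_fin; exact: D0.
apply: cauchy_cvg; apply/cauchy_ballP => e e0; near_simpl.
have [n hn] : exists n, (C + 1) * 2^-1 ^+ n < (e / 2) ^+ 2.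
  have [|n hn] := @geo_half R ((e / 2) ^+ 2 / (C + 1)).
    by rewrite divr_gt0// ?exprn_gt0// ?divr_gt0// ltr_wpDl.
  by exists n; rewrite mulrC -ltr_pdivlMr// ltr_wpDl.
have hk k : (n <= k)%N -> `|G k x - G n x| < e / 2.
  move=> nk; rewrite -(@ltr_pXn2r _ 2)// ?nnegrE ?ltW ?divr_gt0//.
  rewrite real_normK ?num_real//; apply: le_lt_trans hn.
  apply: (le_trans (hC _ _ nk)); rewrite ler_wpM2r ?exprn_ge0// lerDl//.
exists ([set k | n <= k]%N, [set k | n <= k]%N) => /=.
  by split; exists n.
move=> [k l] /= [nk nl]; rewrite /ball/=.
have hy := hk _ nk; have hz := hk _ nl.
have -> : G k x - G l x = (G k x - G n x) - (G l x - G n x) by ring.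
by rewrite (le_lt_trans (ler_normB _ _))// (splitr e) ltrD.
Unshelve. all: by end_near. Qed.

(** Letting [k] tend to infinity in [GH] and integrating: the factor [2 * 2^-j] occurs once in front
    of [H j] and once as the bound of its integral, whence [4 * (1/4)^j]. *)
Lemma riesz_fischer : sqint mu ulim /\
  forall j, RI mu (fun x => (G j x - ulim x) ^+ 2) <= 4 * (1/4) ^+ j.
Proof.
have mu' : measurable_fun setT ulim.
  by apply: measurable_lims => n; exact: (sG n).1.
have ineq j : (\int[mu]_x ((G j x - ulim x) ^+ 2)%:E <= (4 * (1/4) ^+ j)%:E)%E.
  apply: (@le_trans _ _ (\int[mu]_x ((2 * 2^-1 ^+ j)%:E * H j x))%E).
    apply: ae_ge0_le_integral => //.
    - by move=> x _; rewrite lee_fin sqr_ge0.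
    - apply/measurable_EFinP; apply: measurable_funX; apply: measurable_funB => //.
      exact: (sG j).1.
    - by move=> x _; rewrite mule_ge0// lee_fin mulr_ge0//; exact: h0.
    - by apply: emeasurable_funM => //.
    - apply: filterS riesz_fischer_ae => x hx _.
      have : ((G k x - G j x) ^+ 2)%:E @[k --> \oo] --> ((ulim x - G j x) ^+ 2)%:E.
        apply: cvg_EFin; first exact: nearW.
        by apply: (@cvgM _ _ _ _ (fun k => G k x - G j x) (fun k => G k x - G j x)); apply: cvgB => //; exact: cvg_cst.
      rewrite -sqrrN opprB => hc.
      rewrite -(cvg_lim _ hc)//; apply: lime_le; first by apply/cvg_ex; eexists; exact: hc.
      by near=> k; apply: GH; near: k; exists j.
  rewrite ge0_integralZl//.
  apply: (@le_trans _ _ ((2 * 2^-1 ^+ j)%:E * (2 * 2^-1 ^+ j)%:E)%E).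
    by apply: lee_wpmul2l => //; rewrite ?lee_fin ?mulr_ge0//; exact: h0.
  rewrite -EFinM lee_fin le_eqVlt; apply/orP; left; apply/eqP.
  have <- : (2^-1 * 2^-1 = 1 / 4 :> R) by field.
  by rewrite exprMn mulrACA (_ : 2 * 2 = 4 :> R)// -natrM.
have iu j : sqint mu (fun x => G j x - ulim x).
  split; first by apply: measurable_funB => //; exact: (sG j).1.
  apply: integ_lty.
  - by apply: measurable_funX; apply: measurable_funB => //; exact: (sG j).1.
  - by move=> x; exact: sqr_ge0.
  - by apply: le_lt_trans (ineq j) _; rewrite ltry.
split.
  have := sqintB (sG 0) (iu 0%N); under [X in sqint _ X]eq_fun do rewrite opprB addrC subrK.
  by [].
by move=> j; rewrite -lee_fin -RI_EFin//; exact: sqint2 (iu j).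
Unshelve. all: by end_near. Qed.

End riesz_fischer.

(** * Fourier series in an abstract orthonormal family *)

Section orthonormal.
Context d (T : measurableType d) (R : realType) (mu : probability T R).
Variable e : nat -> T -> R.
Hypothesis se : forall m, sqint mu (e m).
Hypothesis oe : forall m l, m != l -> RI mu (fun x => e m x * e l x) = 0.
Hypothesis ne : forall m, RI mu (fun x => e m x ^+ 2) = 1 \/ (forall x, e m x = 0).

Definition coef (f : T -> R) (m : nat) : R := RI mu (fun x => f x * e m x).
Definition enorm m : R := RI mu (fun x => e m x ^+ 2).
Definition lin (s : seq nat) (a : nat -> R) (x : T) : R := \sum_(m <- s) a m * e m x.

Lemma enorm_le1 m : 0 <= enorm m <= 1.
Proof.
rewrite /enorm; have [->|e0] := ne m; first by rewrite ler01 lexx.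
by under eq_RI do rewrite e0 expr0n/=; rewrite RI_cst lexx ler01.
Qed.

Lemma coef_enorm f m : coef f m * enorm m = coef f m.
Proof.
rewrite /enorm /coef; have [->|e0] := ne m; first by rewrite mulr1.
by under eq_RI do rewrite e0 mulr0; rewrite RI_cst mul0r.
Qed.

Lemma coef_sub f g m : sqint mu f -> sqint mu g ->
  coef (fun x => f x - g x) m = coef f m - coef g m.
Proof.
move=> sf sg; rewrite /coef -RIB; [|exact: sqintM..].
by congr RI; apply/funext => x; rewrite mulrBl.
Qed.

Lemma sqint_lin s a : sqint mu (lin s a).
Proof. by apply: sqint_sum => i _; exact: sqintZ. Qed.

Lemma RI_mul_lin f s a : sqint mu f ->
  RI mu (fun x => f x * lin s a x) = \sum_(m <- s) a m * coef f m.
Proof.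
move=> sf; under eq_RI do rewrite /lin big_distrr/=.
rewrite RI_sum; last by move=> m _; apply: sqintM => //; exact: sqintZ.
apply: eq_bigr => m _; rewrite -RIZ; last exact: sqintM.
by congr RI; apply/funext => x; ring.
Qed.

Lemma coef_lin s a m : uniq s -> coef (lin s a) m = if m \in s then a m * enorm m else 0.
Proof.
move=> us; rewrite /coef; under eq_RI do rewrite mulrC.
rewrite RI_mul_lin//; case: ifPn => ms.
  rewrite (bigD1_seq m)//= big1 ?addr0.
    by rewrite /coef /enorm; under [in LHS]eq_RI do rewrite -expr2.
  by move=> l lm; rewrite /coef oe ?mulr0// eq_sym.
rewrite big_seq big1// => l ls; rewrite /coef oe ?mulr0//.
by apply: contraNneq ms => ->.
Qed.

Lemma lin_sqr s a : uniq s ->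
  RI mu (fun x => lin s a x ^+ 2) = \sum_(m <- s) a m ^+ 2 * enorm m.
Proof.
move=> us; under eq_RI do rewrite expr2.
rewrite (RI_mul_lin _ _ (sqint_lin s a)) big_seq [RHS]big_seq.
by apply: eq_bigr => m ms; rewrite coef_lin// ms expr2 mulrA.
Qed.

Lemma RI_sqrB f g : sqint mu f -> sqint mu g ->
  RI mu (fun x => (f x - g x) ^+ 2) = RI mu (fun x => f x ^+ 2)
   - 2 * RI mu (fun x => f x * g x) + RI mu (fun x => g x ^+ 2).
Proof.
move=> sf sg; rewrite -RIZ; last exact: sqintM.
rewrite -RIB; [|exact: sqint2|by apply: integZ; exact: sqintM].
rewrite -RID; [|apply: integB; [exact: sqint2|by apply: integZ; exact: sqintM]|exact: sqint2].
by congr RI; apply/funext => x; ring.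
Qed.

Lemma pythagoras f s : sqint mu f -> uniq s ->
  RI mu (fun x => (f x - lin s (coef f) x) ^+ 2) =
  RI mu (fun x => f x ^+ 2) - \sum_(m <- s) coef f m ^+ 2.
Proof.
move=> sf us; rewrite RI_sqrB//; last exact: sqint_lin.
rewrite RI_mul_lin// lin_sqr//.
have -> : \sum_(m <- s) coef f m ^+ 2 * enorm m = \sum_(m <- s) coef f m ^+ 2.
  by apply: eq_bigr => m _; rewrite expr2 -mulrA coef_enorm.
rewrite -/(\sum_(m <- s) coef f m ^+ 2).
by move: (RI _ _) (\sum_(m <- s) _) => A B; ring.
Qed.

Lemma bessel f s : sqint mu f -> uniq s ->
  \sum_(m <- s) coef f m ^+ 2 <= RI mu (fun x => f x ^+ 2).
Proof.
by move=> sf us; rewrite -subr_ge0 -pythagoras//; exact: RI_sqr_ge0.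
Qed.

Section synthesis.
Context d' (P : measurableType d') (a : P -> nat -> R) (M : R).
Hypothesis ma : forall m, measurable_fun setT (a ^~ m).
Hypothesis aM : forall t N, \sum_(0 <= m < N) a t m ^+ 2 <= M.
Hypothesis ae : forall t m, a t m * enorm m = a t m.

Let psum t N := \sum_(0 <= m < N) a t m ^+ 2.

Let psum_nd t : nondecreasing_seq (psum t).
Proof.
apply/nondecreasing_seqP => n; rewrite /psum big_nat_recr//= lerDl sqr_ge0//.
Qed.

Let psum_cvg t : psum t @ \oo --> lims (psum t).
Proof.
have : cvgn (psum t).
  apply: nondecreasing_is_cvgn => //; exists M => _ [n _ <-]; exact: aM.
by move=> /cvg_ex[l hl]; rewrite (lims_cvg hl).
Qed.

Let tail t N := lims (psum t) - psum t N.

Let mpsum N : measurable_fun setT (psum ^~ N).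
Proof. by apply: measurable_sum => m; exact: measurable_funX. Qed.

Let mtail N : measurable_fun setT (tail ^~ N).
Proof. by apply: measurable_funB => //; exact: measurable_lims. Qed.

Let tail_small t eps : 0 < eps -> exists N, tail t N <= eps.
Proof.
move=> eps0; have /cvgrPdist_le /(_ _ eps0)[N _ /(_ N (leqnn N))] := @psum_cvg t.
by move=> h; exists N; apply: le_trans h; rewrite /tail ler_norm.
Qed.

Let tail_ni t m n : (m <= n)%N -> tail t n <= tail t m.
Proof. by move=> mn; rewrite lerB// psum_nd. Qed.

Let tail_diff t m n : (m <= n)%N -> \sum_(m <= k < n) a t k ^+ 2 <= tail t m.
Proof.
move=> mn; rewrite /tail lerBrDl /psum -big_cat_nat//=.
have <- := cvg_lim (@Rhausdorff R) (@psum_cvg t).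
apply: limr_ge; first by apply/cvg_ex; eexists; exact: (@psum_cvg t).
by exists n => // k /= nk; exact: psum_nd.
Qed.

(* The coefficients that are kept are those before the first index at which the
   tail of the series is below (1/4)^j; that index is a measurable function of
   the parameter, and the partial sums so obtained converge almost everywhere
   for every value of it. *)
Let b t j m := if tail t m > (1/4) ^+ j then a t m else 0.

Let mb j m : measurable_fun setT (fun t => b t j m).
Proof.
apply: measurable_fun_ifT => //; apply: measurable_fun_ltr => //.
Qed.

(** Only finitely many [b t j m] are nonzero, so this is a finite partial sum. Writing it as a limit
    keeps the truncation index, which depends on [t], out of the formula and makes joint
    measurability immediate. *)
Let G j t x := lims (fun N => lin (index_iota 0 N) (b t j) x).

Let bE t j : exists N, [/\ (forall m, (m < N)%N -> b t j m = a t m),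
  (forall m, (N <= m)%N -> b t j m = 0) & tail t N <= (1/4) ^+ j].
Proof.
have e0 : 0 < (1/4) ^+ j :> R by rewrite exprn_gt0.
have ex : exists N, tail t N <= (1/4) ^+ j by exact: tail_small.
exists (ex_minn ex); case: ex_minnP => N hN Nmin; split => // m hm; rewrite /b.
  case: ifPn => //; rewrite -leNgt => /Nmin; by rewrite leqNgt hm.
case: ifPn => //; rewrite ltNge => /negP[]; exact: le_trans (tail_ni _ hm) hN.
Qed.

Let GE t j : exists N, (G j t = lin (index_iota 0 N) (a t)) /\ tail t N <= (1/4) ^+ j.
Proof.
have [N [b1 b2 hN]] := bE t j; exists N; split => //; apply/funext => x.
apply: lims_cvg; apply: cvg_near_cst; exists N => // n /= Nn.
rewrite /lin (@big_cat_nat _ _ _ N)//= [X in _ + X]big_nat_cond [X in _ + X]big1 ?addr0.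
  by rewrite big_nat_cond [RHS]big_nat_cond; apply: eq_bigr => m /andP[/andP[_ /b1 ->]].
by move=> m /andP[/andP[/b2 ->]]; rewrite mul0r.
Qed.

Let mG j : measurable_fun setT (fun z : P * T => G j z.1 z.2).
Proof.
apply: (@measurable_lims _ _ _ (fun N z => lin (index_iota 0 N) (b z.1 j) z.2)) => N.
apply: measurable_sum => m; apply: measurable_funM.
  by apply: (measurableT_comp (mb j m)).
by apply: (measurableT_comp (se m).1).
Qed.

Let GG t j : RI mu (fun x => (G j.+1 t x - G j t x) ^+ 2) <= (1/4) ^+ j.
Proof.
have [N [-> hN]] := GE t j; have [N' [-> hN']] := GE t j.+1.
have aux p q eps : (p <= q)%N -> tail t p <= eps ->
  RI mu (fun x => (lin (index_iota 0 q) (a t) x - lin (index_iota 0 p) (a t) x) ^+ 2) <= eps.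
  move=> pq hp.
  have -> : (fun x => (lin (index_iota 0 q) (a t) x - lin (index_iota 0 p) (a t) x) ^+ 2)
          = (fun x => lin (index_iota p q) (a t) x ^+ 2).
    apply/funext => x; congr (_ ^+ 2); rewrite /lin (@big_cat_nat _ _ _ p 0 q)//=.
    by rewrite addrAC subrr add0r.
  rewrite lin_sqr ?iota_uniq//; apply: le_trans hp; apply: le_trans (tail_diff t pq).
  apply: ler_sum => m _; rewrite ler_piMr ?sqr_ge0//.
  by have /andP[] := enorm_le1 m.
have [NN|NN] := leqP N N'; first exact: aux.
under eq_RI do rewrite -sqrrN opprB.
apply: aux; first exact: ltnW.
apply: (le_trans hN'); rewrite exprS ler_piMl// ?exprn_ge0//; lra.
Qed.

(** Riesz-Fischer with a measurable parameter: coefficients with bounded square sums are those of a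
    function that is measurable jointly in the parameter and the variable. The truncated sums
    [G j t] meet the rate of [riesz_fischer] for every [t], because squared distances between
    partial sums are bounded by tails of the series. *)
Lemma synthesis : exists U : P -> T -> R,
  measurable_fun setT (fun z : P * T => U z.1 z.2) /\
  forall t, [/\ sqint mu (U t), forall m, coef (U t) m = a t m
    & RI mu (fun x => U t x ^+ 2) <= M].
Proof.
exists (fun t x => lims (fun j => G j t x)); split.
  by apply: (@measurable_lims _ _ _ (fun j (z : P * T) => G j z.1 z.2)).
move=> t; set U := fun x => _.
have sG j : sqint mu (G j t) by have [N [-> _]] := GE t j; exact: sqint_lin.
have [sU hU] := riesz_fischer sG (GG t).
have h4 eps : 0 < eps -> exists j0, forall j, (j0 <= j)%N -> 4 * (1/4) ^+ j < eps :> R.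
  move=> eps0; have : (1/4 : R) ^+ n @[n --> \oo] --> (0 : R).
    by apply: cvg_expr; rewrite ger0_norm//; lra.
  have e4 : 0 < eps / 4 by rewrite divr_gt0.
  move=> /cvgrPdist_lt /(_ _ e4)[n _ hn]; exists n => j /hn /=.
  rewrite sub0r normrN ger0_norm ?exprn_ge0// ltr_pdivlMr//; by rewrite mulrC.
have cU m : coef U m = a t m.
  apply/eqP; rewrite -subr_eq0 -normr_le0; apply/ler_addgt0Pr => eps eps0; rewrite add0r.
  have [j0 hj0] := h4 (eps ^+ 2) (exprn_gt0 _ eps0).
  have [N [b1 b2 _]] := bE t j0.
  (* The level [j] must be fine enough for the precision and also keep the mode [m]. A nonzero
     [a t m] is kept as soon as the tail is below its square, since the tail at [m] is at least
     [a t m ^+ 2]. *)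
  have [j [jj0 [N' [GN mN]]]] : exists j, (j0 <= j)%N /\ exists N, G j t = lin (index_iota 0 N) (a t) /\
     (a t m = 0 \/ (m < N)%N).
    have [am|am] := eqVneq (a t m) 0.
      by exists j0; split => //; have [N' [? _]] := GE t j0; exists N'; split => //; left.
    have am2 : 0 < a t m ^+ 2 by rewrite exprn_even_gt0.
    have [j1 hj1] := h4 _ am2.
    exists (maxn j0 j1); split; first exact: leq_maxl.
    have [N' [GN' tN']] := GE t (maxn j0 j1); exists N'; split => //; right.
    rewrite ltnNge; apply/negP => Nm.
    have := hj1 _ (leq_maxr j0 j1); apply/negP; rewrite -leNgt.
    apply: (@le_trans _ _ (tail t m)).
      have := tail_diff t (leqnSn m); rewrite big_nat1//.
    apply: (le_trans (tail_ni t Nm)); apply: (le_trans tN').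
    by rewrite ler_peMl ?exprn_ge0//; lra.
  have cG : coef (G j t) m = a t m.
    rewrite GN coef_lin ?iota_uniq// mem_index_iota/=.
    case: mN => [am|->]; last exact: ae.
    by rewrite am mul0r; case: ifP.
  rewrite -cG -coef_sub// /coef.
  have sD : sqint mu (fun x => U x - G j t x) by exact: sqintB.
  have := bessel (s := [:: m]) sD isT; rewrite big_seq1.
  under eq_RI do rewrite -sqrrN opprB.
  move=> /le_trans /(_ (hU j)) /le_lt_trans /(_ (hj0 _ jj0)).
  by rewrite -[ltLHS]real_normK ?num_real// ltr_pXn2r ?nnegrE// ?(ltW eps0)// => /ltW.
split => //.
apply/ler_addgt0Pr => eps eps0.
have [j0 hj0] := h4 _ eps0.
have [N [GN _]] := GE t j0.
(* Pythagoras: [G j0 t] is a partial Fourier sum of [U], hence orthogonal to the remainder. *)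
have -> : RI mu (fun x => U x ^+ 2) = RI mu (fun x => G j0 t x ^+ 2) + RI mu (fun x => (G j0 t x - U x) ^+ 2).
  rewrite RI_sqrB//.
  have -> : RI mu (fun x => G j0 t x * U x) = RI mu (fun x => G j0 t x ^+ 2).
    under eq_RI do rewrite mulrC.
    rewrite GN RI_mul_lin// lin_sqr ?iota_uniq//; apply: eq_bigr => m _.
    by rewrite cU expr2 -mulrA ae.
  by move: (RI _ _) (RI _ _) => A B; ring.
apply: lerD; last by apply: (le_trans (hU j0)); exact/ltW/hj0.
rewrite GN lin_sqr ?iota_uniq//; apply: le_trans (aM t N).
apply: ler_sum => m _; rewrite ler_piMr ?sqr_ge0//.
by have /andP[] := enorm_le1 m.
Qed.

End synthesis.

Hypothesis complete : forall f, sqint mu f -> (forall m, coef f m = 0) ->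
  RI mu (fun x => f x ^+ 2) = 0.

(** Completeness is assumed in its weak form, that vanishing coefficients force a null function. It
    gives Parseval: the function [U] synthesized from the coefficients of [f] agrees with [f] almost
    everywhere, and its square integral is at most the sum [l] of the squared coefficients. *)
Lemma fourier_tail f eps : sqint mu f -> 0 < eps ->
  exists N, RI mu (fun x => (f x - lin (index_iota 0 N) (coef f) x) ^+ 2) <= eps.
Proof.
move=> sf eps0; set a := fun (_ : unit) m => coef f m.
pose ps N := \sum_(0 <= m < N) coef f m ^+ 2.
have psb N : ps N <= RI mu (fun x => f x ^+ 2) by apply: bessel => //; exact: iota_uniq.
have psn : nondecreasing_seq ps.
  by apply/nondecreasing_seqP => n; rewrite /ps big_nat_recr//= lerDl sqr_ge0.
have : cvgn ps by apply: nondecreasing_is_cvgn => //; exists (RI mu (fun x => f x ^+ 2)) => _ [n _ <-].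
move=> /cvg_ex[l hl].
have psl N : ps N <= l.
  have <- := cvg_lim (@Rhausdorff R) hl.
  apply: limr_ge; first by apply/cvg_ex; eexists; exact: hl.
  by exists N => // k /= nk; exact: psn.
have [m|t m|U' [_ /(_ tt)[]]] := @synthesis _ unit a l _ (fun _ => psl).
- exact: measurable_cst.
- exact: coef_enorm.
move: (U' tt) => U sU cU UM.
have fU : RI mu (fun x => (f x - U x) ^+ 2) = 0.
  by apply: complete; [exact: sqintB|move=> m; rewrite coef_sub// cU subrr].
have fl : RI mu (fun x => f x ^+ 2) <= l.
  apply/ler_addgt0Pr => del del0.
  apply: le_trans (lerD UM (lexx del)).
  rewrite -subr_ge0.
  have sd : sqint mu (fun x => f x - U x) by exact: sqintB.
  have sD : sqint mu (fun x => f x + U x) by exact: sqintD.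
  (* The square integrals of [f] and [U] differ by the pairing of [f - U] with [f + U]. As [f - U]
     has zero norm, only the second Young term remains, and this [c] makes it at most [del]. *)
  have := RI_young (c := (4 * (1 + RI mu (fun x => (f x + U x) ^+ 2))) / del) _ sd sD.
  have S0 : 0 <= RI mu (fun x => (f x + U x) ^+ 2) by exact: RI_sqr_ge0.
  set S := RI mu (fun x => (f x + U x) ^+ 2) in S0 *.
  rewrite fU mulr0 add0r => /(_ _)/wrap[].
    by rewrite divr_gt0// mulr_gt0// ltr_wpDr.
  have -> : RI mu (fun x => (f x - U x) * (f x + U x)) = RI mu (fun x => f x ^+ 2) - RI mu (fun x => U x ^+ 2).
    rewrite -RIB; [|exact: sqint2..]; congr RI; apply/funext => x; ring.
  move=> /(le_trans (ler_norm _)) h.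
  suff : (4 * (1 + S) / del)^-1 * S <= del by lra.
  rewrite invf_div mulrAC ler_pdivrMr ?mulr_gt0// ?ltr_wpDr// ler_wpM2l ?ltW//; lra.
have /cvgrPdist_le /(_ _ eps0)[N _ /(_ N (leqnn N)) hN] := hl.
exists N; rewrite pythagoras ?iota_uniq//.
have := ler_norm (l - ps N); rewrite /ps in psl hN *; lra.
Qed.

End orthonormal.

(** * Completeness of the trigonometric system on the torus *)

Section circle.
Context (R : realType).
Notation U1 := (uniform_prob (@ltr01 R)).

Lemma integral_U1 (f : R -> R) : measurable_fun setT f ->
  (\int[U1]_x (f x)%:E = \int[lebesgue_measure]_(x in `[0%R, 1%R]) (f x)%:E)%E.
Proof.
move=> mf; have mEf : measurable_fun setT (EFin \o f) by exact/measurable_EFinP.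
rewrite integralE [RHS]integralE.
rewrite !integral_uniform//; last 2 first.
- exact: measurable_funeneg.
- exact: measurable_funepos.
by rewrite subr0 invr1 !mul1e.
Qed.

Lemma continuous_measurable (f : R -> R) : continuous f -> measurable_fun setT f.
Proof. by move=> cf; exact: continuous_measurable_fun. Qed.

Lemma RI_U1 (f F : R -> R) : continuous f -> (forall x : R, is_derive x (1 : R) F (f x)) ->
  RI U1 f = F 1 - F 0.
Proof.
move=> cf dF; rewrite /RI /Rintegral integral_U1; last exact: continuous_measurable.
rewrite (@continuous_FTC2 _ f F)//.
- exact: continuous_subspaceT.
- have cF : continuous F.
    by move=> x; apply: differentiable_continuous; apply/derivable1_diffP; have [] := dF x.
  split.
  + by move=> x _; have [] := dF x.
  + exact/cvg_at_right_filter/cF.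
  + exact/cvg_at_left_filter/cF.
- by move=> x _; rewrite derive1E; have [_ ->] := dF x.
Qed.

Definition tw (n : nat) (x : R) : R := 2 * pi * n%:R * x.

Lemma continuous_tw n : continuous (tw n).
Proof. by move=> x; apply: cvgM; [exact: cvg_cst|exact: cvg_id]. Qed.

Lemma continuous_cos_tw n : continuous (fun x => cos (tw n x)).
Proof. by move=> x; apply: continuous_comp; [exact: continuous_tw|exact: continuous_cos]. Qed.

Lemma continuous_sin_tw n : continuous (fun x => sin (tw n x)).
Proof. by move=> x; apply: continuous_comp; [exact: continuous_tw|exact: continuous_sin]. Qed.

Lemma is_derive_tw n (x : R) : is_derive x (1 : R) (tw n) (2 * pi * n%:R).
Proof.
have -> : tw n = (2 * pi * n%:R) \*: (id : R -> R) by apply/funext.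
by apply: is_derive_eq; rewrite /GRing.scale/= mulr1.
Qed.

Lemma is_derive_sin_tw n (x : R) :
  is_derive x (1 : R) (fun y => sin (tw n y)) (2 * pi * n%:R * cos (tw n x)).
Proof.
have h := is_derive_tw n x.
by rewrite mulrC; exact: is_derive1_comp (is_derive_sin (tw n x)) h.
Qed.

Lemma is_derive_cos_tw n (x : R) :
  is_derive x (1 : R) (fun y => cos (tw n y)) (- (2 * pi * n%:R * sin (tw n x))).
Proof.
have h := is_derive_tw n x.
by rewrite mulrC -mulNr; exact: is_derive1_comp (is_derive_cos (tw n x)) h.
Qed.

Lemma cos_tw1 n : cos (tw n 1) = 1.
Proof.
have := @periodicn _ _ (@cos R) (pi *+ 2) (@cosD2pi R) n 0.
by rewrite add0r cos0 => h; rewrite -[RHS]h; congr cos; rewrite /tw mulr1 -mulr_natr -(mulr_natr pi 2); ring.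
Qed.

Lemma sin_tw1 n : sin (tw n 1) = 0.
Proof.
have := @periodicn _ _ (@sin R) (pi *+ 2) (@sinD2pi R) n 0.
by rewrite add0r sin0 => h; rewrite -[RHS]h; congr sin; rewrite /tw mulr1 -mulr_natr -(mulr_natr pi 2); ring.
Qed.

Lemma tw0 n : tw n 0 = 0. Proof. by rewrite /tw mulr0. Qed.

Lemma RI_cos n : RI U1 (fun x => cos (tw n x)) = (n == 0%N)%:R.
Proof.
have [->|n0] := eqVneq n 0%N.
  have -> : (fun x => cos (tw 0 x)) = (fun=> 1 : R).
    by apply/funext => x; rewrite /tw mulr0 mul0r cos0.
  by rewrite RI_cst.
have a0 : 2 * pi * n%:R != 0 :> R.
  by rewrite !mulf_neq0 ?pnatr_eq0//; apply: lt0r_neq0; exact: pi_gt0.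
have dF (x : R) : is_derive x (1 : R) ((2 * pi * n%:R)^-1 \*: (fun y => sin (tw n y))) (cos (tw n x)).
  have h := is_derive_sin_tw n x; have := is_deriveZ ((2 * pi * n%:R)^-1) h.
  by rewrite /GRing.scale/= mulrA mulVf// mul1r.
rewrite (RI_U1 (@continuous_cos_tw n) dF) /= sin_tw1 tw0 sin0.
by rewrite /GRing.scale/= mulr0 subrr.
Qed.

Lemma RI_sin n : RI U1 (fun x => sin (tw n x)) = 0.
Proof.
have [->|n0] := eqVneq n 0%N.
  have -> : (fun x => sin (tw 0 x)) = (fun=> 0 : R).
    by apply/funext => x; rewrite /tw mulr0 mul0r sin0.
  by rewrite RI_cst.
have a0 : 2 * pi * n%:R != 0 :> R.
  by rewrite !mulf_neq0 ?pnatr_eq0//; apply: lt0r_neq0; exact: pi_gt0.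
have dF (x : R) : is_derive x (1 : R) (- (2 * pi * n%:R)^-1 \*: (fun y => cos (tw n y))) (sin (tw n x)).
  have h := is_derive_cos_tw n x; have := is_deriveZ (- (2 * pi * n%:R)^-1) h.
  by rewrite /GRing.scale/= mulrN mulNr opprK mulrA mulVf// mul1r.
by rewrite (RI_U1 (@continuous_sin_tw n) dF) /= cos_tw1 tw0 cos0 subrr.
Qed.

Lemma twD i j x : tw (i + j) x = tw i x + tw j x.
Proof. by rewrite /tw natrD; ring. Qed.

Lemma twB i j x : (j <= i)%N -> tw (i - j) x = tw i x - tw j x.
Proof. by move=> ji; rewrite /tw natrB//; ring. Qed.

Lemma sq_cos n : sqint U1 (fun x => cos (tw n x)).
Proof.
apply: (@sqint_bdd _ _ _ _ _ 1); first exact: continuous_measurable (@continuous_cos_tw n).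
by move=> x; exact: cos_max.
Qed.

Lemma sq_sin n : sqint U1 (fun x => sin (tw n x)).
Proof.
apply: (@sqint_bdd _ _ _ _ _ 1); first exact: continuous_measurable (@continuous_sin_tw n).
by move=> x; exact: sin_max.
Qed.

Lemma RI_coscos i j : (i <= j)%N -> RI U1 (fun x => cos (tw i x) * cos (tw j x)) =
  2^-1 * ((i == j)%:R + (j == 0%N)%:R).
Proof.
move=> ij.
have -> : (fun x => cos (tw i x) * cos (tw j x)) =
   (fun x => 2^-1 * (cos (tw (j - i) x) + cos (tw (j + i) x))).
  by apply/funext => x; rewrite twD twB// cosB cosD; field.
rewrite RIZ; last by apply: integD; apply: sqint_int; exact: sq_cos.
rewrite RID ?RI_cos; [|by apply: sqint_int; exact: sq_cos..].
congr (_ * (_%:R + _%:R)); last by rewrite addn_eq0; case: j ij => [|j _ //]; rewrite leqn0 => ->.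
by rewrite subn_eq0 eqn_leq ij.
Qed.

Lemma RI_sinsin i j : (i <= j)%N -> RI U1 (fun x => sin (tw i x) * sin (tw j x)) =
  2^-1 * ((i == j)%:R - (j == 0%N)%:R).
Proof.
move=> ij.
have -> : (fun x => sin (tw i x) * sin (tw j x)) =
   (fun x => 2^-1 * (cos (tw (j - i) x) - cos (tw (j + i) x))).
  by apply/funext => x; rewrite twD twB// cosB cosD; field.
rewrite RIZ; last by apply: integB; apply: sqint_int; exact: sq_cos.
rewrite RIB ?RI_cos; [|by apply: sqint_int; exact: sq_cos..].
congr (_ * (_%:R - _%:R)); last by rewrite addn_eq0; case: j ij => [|j _ //]; rewrite leqn0 => ->.
by rewrite subn_eq0 eqn_leq ij.
Qed.

Lemma RI_sincos i j : RI U1 (fun x => sin (tw i x) * cos (tw j x)) = 0.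
Proof.
have [ij|/ltnW ji] := leqP i j.
  have -> : (fun x => sin (tw i x) * cos (tw j x)) =
     (fun x => 2^-1 * (sin (tw (j + i) x) - sin (tw (j - i) x))).
    by apply/funext => x; rewrite twD twB// sinB sinD; field.
  rewrite RIZ; last by apply: integB; apply: sqint_int; exact: sq_sin.
  by rewrite RIB ?RI_sin ?subrr ?mulr0//; apply: sqint_int; exact: sq_sin.
have -> : (fun x => sin (tw i x) * cos (tw j x)) =
   (fun x => 2^-1 * (sin (tw (i + j) x) + sin (tw (i - j) x))).
  by apply/funext => x; rewrite twD twB// sinB sinD; field.
rewrite RIZ; last by apply: integD; apply: sqint_int; exact: sq_sin.
by rewrite RID ?RI_sin ?addr0 ?mulr0//; apply: sqint_int; exact: sq_sin.
Qed.

(** The real Fourier basis as one sequence: the constant, then for each frequency the sine at the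
    odd index and the cosine at the next even one; [Num.sqrt 2] normalizes them. *)
Definition trig (k : nat) (x : R) : R :=
  if k == 0%N then 1 else
  Num.sqrt 2 * (if odd k then sin (tw (uphalf k) x) else cos (tw (uphalf k) x)).

Lemma continuous_trig k : continuous (trig k).
Proof.
rewrite /trig; case: (k == 0%N) => x; first exact: cvg_cst.
apply: cvgM; first exact: cvg_cst.
by case: (odd k); [exact: continuous_sin_tw|exact: continuous_cos_tw].
Qed.

Lemma trig_le k x : `|trig k x| <= 2.
Proof.
rewrite /trig; case: ifP => _; first by rewrite normr1 ler1n.
have s2 : Num.sqrt 2 <= 2 :> R.
  by rewrite -[leRHS]sqr_sqrtr// expr2 ler_peMr ?sqrtr_ge0// -{1}sqrtr1 ler_wsqrtr// ler1n.
rewrite normrM ger0_norm ?sqrtr_ge0//; apply: le_trans s2.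
by rewrite ler_piMr ?sqrtr_ge0//; case: ifP => _; [exact: sin_max|exact: cos_max].
Qed.

Lemma trig_period k x : trig k (x + 1) = trig k x.
Proof.
rewrite /trig; case: ifP => // _; congr (_ * _).
have -> : tw (uphalf k) (x + 1) = tw (uphalf k) x + tw (uphalf k) 1 by rewrite /tw; ring.
by case: ifP => _; rewrite ?sinD ?cosD cos_tw1 sin_tw1 !mulr0 !mulr1 ?addr0 ?subr0.
Qed.

Lemma sq_trig k : sqint U1 (trig k).
Proof.
apply: (@sqint_bdd _ _ _ _ _ 2); first exact: continuous_measurable (@continuous_trig k).
exact: trig_le.
Qed.

Lemma trig_orth k l : RI U1 (fun x => trig k x * trig l x) = (k == l)%:R.
Proof.
wlog kl : k l / (uphalf k <= uphalf l)%N.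
  move=> h; have [|/ltnW] := leqP (uphalf k) (uphalf l); first exact: h.
  by move/h; rewrite eq_sym => <-; apply: eq_RI => x; rewrite mulrC.
have s22 : Num.sqrt 2 * Num.sqrt 2 = 2 :> R by rewrite -expr2 sqr_sqrtr.
have uE n : uphalf n = (odd n + n./2)%N by rewrite uphalf_half.
rewrite /trig; have [->|k0] := eqVneq k 0%N.
  have [l0|l0] := eqVneq l 0%N; first by subst l; under eq_RI do rewrite mulr1; rewrite RI_cst.
  under eq_RI do rewrite mul1r.
  have ul : uphalf l != 0%N by case: (l) l0.
  rewrite RIZ; last by apply: sqint_int; case: (odd l); [exact: sq_sin|exact: sq_cos].
  by case: (odd l); rewrite ?RI_sin ?RI_cos ?(negbTE ul) mulr0.
have [l0|l0] := eqVneq l 0%N.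
  by move: kl; rewrite l0; case: (k) k0.
have ul : uphalf l != 0%N by case: (l) l0.
have -> : (fun x => Num.sqrt 2 * (if odd k then sin (tw (uphalf k) x) else cos (tw (uphalf k) x)) *
   (Num.sqrt 2 * (if odd l then sin (tw (uphalf l) x) else cos (tw (uphalf l) x)))) =
  (fun x => 2 * ((if odd k then sin (tw (uphalf k) x) else cos (tw (uphalf k) x)) *
   (if odd l then sin (tw (uphalf l) x) else cos (tw (uphalf l) x)))).
  by apply/funext => x; rewrite mulrACA s22.
rewrite RIZ; last by apply: sqintM; [case: (odd k)|case: (odd l)]; [exact: sq_sin|exact: sq_cos|exact: sq_sin|exact: sq_cos].
(* An index is recovered from its frequency and its parity. *)
have kuE n : n = (uphalf n + uphalf n - odd n)%N.
  by rewrite addnn uphalf_half doubleD -{1}(odd_double_half n); case: (odd n) => /=; lia.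
case ok: (odd k); case ol: (odd l).
- rewrite RI_sinsin// (negbTE ul) subr0 mulrA divff ?pnatr_eq0// mul1r; congr (_%:R).
  by congr nat_of_bool; apply/eqP/eqP => [h|-> //]; rewrite (kuE k) (kuE l) h ok ol.
- rewrite RI_sincos mulr0; case: eqP => // kl'; by rewrite -kl' ok in ol.
- under eq_RI do rewrite mulrC.
  rewrite RI_sincos mulr0; case: eqP => // kl'; by rewrite -kl' ok in ol.
- rewrite RI_coscos// (negbTE ul) addr0 mulrA divff ?pnatr_eq0// mul1r; congr (_%:R).
  by congr nat_of_bool; apply/eqP/eqP => [h|-> //]; rewrite (kuE k) (kuE l) h ok ol.
Qed.

End circle.

Lemma ae_imp d (T : measurableType d) (R : realType) (mu : probability T R)
    (P Q : T -> Prop) : (forall x, P x -> Q x) ->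
  {ae mu, forall x, P x} -> {ae mu, forall x, Q x}.
Proof. by move=> PQ; apply: filterS. Qed.

Lemma RI_dct d (T : measurableType d) (R : realType) (mu : probability T R)
    (h : nat -> T -> R) (l g : T -> R) :
  (forall n, measurable_fun setT (h n)) -> measurable_fun setT l ->
  {ae mu, forall x, h n x @[n --> \oo] --> l x} -> integ mu g ->
  (forall n x, `|h n x| <= g x) ->
  integ mu l /\ RI mu (h n) @[n --> \oo] --> RI mu l.
Proof.
move=> mh ml hl ig hg.
have ih n : integ mu (h n) by exact: integ_le ig.
have [i1 _ i3] : [/\ mu.-integrable setT (EFin \o l),
   [sequence \int[mu]_(x in setT) `|(EFin \o h n) x - (EFin \o l) x|]_n @ \oo --> 0 &
   [sequence \int[mu]_(x in setT) ((EFin \o h n) x)]_n @ \oo --> \int[mu]_(x in setT) (EFin \o l) x]%E.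
  apply: (@dominated_convergence _ _ _ _ setT measurableT (fun n => EFin \o h n) (EFin \o l) (EFin \o g)) => //.
  - by move=> n; exact/measurable_EFinP.
  - exact/measurable_EFinP.
  - apply: filterS hl => x hx _; apply: cvg_EFin => //; exact: nearW.
  - by apply: aeW => x n _; rewrite lee_fin.
have E : (\int[mu]_(x in setT) (EFin \o l) x = (RI mu l)%:E)%E by exact: RI_EFin.
split => //; rewrite E in i3.
exact: (fine_cvg i3).
Qed.

(** * Completeness of the trigonometric system on the circle *)

Section circle_complete.
Context (R : realType).
Notation U1 := (uniform_prob (@ltr01 R)).
Variable f : R -> R.
Hypothesis fi : integ U1 f.
Hypothesis f0 : forall k, RI U1 (fun x => f x * trig k x) = 0.

Let mc n : measurable_fun setT (fun x : R => cos (tw n x)).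
Proof. exact: continuous_measurable (@continuous_cos_tw R n). Qed.

Let ms n : measurable_fun setT (fun x : R => sin (tw n x)).
Proof. exact: continuous_measurable (@continuous_sin_tw R n). Qed.

(** The bounded multipliers that keep [f] orthogonal to every mode. This class is stable under
    linear combinations and, by the addition formulas, under multiplication by the sine and cosine
    of frequency 1, so it contains every trigonometric polynomial generated from them, including the
    high powers used below. *)
Let ortho (g : R -> R) := [/\ measurable_fun setT g, (exists c : R, forall x : R, `|g x| <= c) &
  forall j, RI U1 (fun x => f x * g x * cos (tw j x)) = 0 /\
            RI U1 (fun x => f x * g x * sin (tw j x)) = 0].

Let integM (g : R -> R) (c : R) : measurable_fun setT g -> (forall x : R, `|g x| <= c) ->
  integ U1 (fun x => f x * g x).
Proof.
move=> mg gc; apply: (@integ_le _ _ _ U1 _ (fun x : R => c * `|f x|)).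
- by apply: measurable_funM => //; exact: integ_meas fi.
- by move=> x; rewrite normrM mulrC ler_wpM2r.
- by apply: integZ; exact: integ_abs.
Qed.

Let ortho_int (g h : R -> R) : ortho g -> measurable_fun setT h -> (forall x : R, `|h x| <= 1) ->
  integ U1 (fun x => f x * g x * h x).
Proof.
move=> [mg [c gc] _] mh h1; under [X in integ _ X]eq_fun do rewrite -mulrA.
apply: (@integM _ c); first exact: measurable_funM.
move=> x; rewrite normrM; apply: le_trans (gc x).
by rewrite ler_piMr.
Qed.

Let ortho1 : ortho (fun=> 1).
Proof.
split=> [|| j]; [exact: measurable_cst|by exists 1 => x; rewrite normr1|].
under [X in RI _ X = _ /\ _]eq_fun do rewrite mulr1.
under [X in _ /\ RI _ X = _]eq_fun do rewrite mulr1.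
have s2 : Num.sqrt 2 != 0 :> R by rewrite gt_eqF// sqrtr_gt0.
have fi' (g : R -> R) : measurable_fun setT g -> (forall x : R, `|g x| <= 1) -> integ U1 (fun x => f x * g x) by exact: integM.
case: j => [|j].
  have := f0 0%N; rewrite /trig/= => h; split.
    by rewrite -[RHS]h; congr RI; apply/funext => x; rewrite /tw mulr0 mul0r cos0.
  by rewrite -[RHS](RI_cst U1); congr RI; apply/funext => x; rewrite /tw mulr0 mul0r sin0 mulr0.
split.
  have := f0 j.*2.+2; rewrite /trig/= odd_double/= ?uphalf_double ?doubleK.
  under eq_RI do rewrite mulrCA; rewrite RIZ.
    by move/eqP; rewrite mulf_eq0 (negbTE s2)/= => /eqP.
  by apply: fi' => // x; exact: cos_max.
have := f0 j.*2.+1; rewrite /trig/= odd_double/= ?uphalf_double ?doubleK.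
under eq_RI do rewrite mulrCA; rewrite RIZ.
  by move/eqP; rewrite mulf_eq0 (negbTE s2)/= => /eqP.
by apply: fi' => // x; exact: sin_max.
Qed.

Let orthoD a g b h : ortho g -> ortho h -> ortho (fun x => a * g x + b * h x).
Proof.
move=> og oh; have [mg [c gc] gz] := og; have [mh [c' hc] hz] := oh.
split.
- by apply: measurable_funD; apply: measurable_funM.
- exists (`|a| * c + `|b| * c') => x; apply: (le_trans (ler_normD _ _)).
  by rewrite !normrM lerD// ler_wpM2l.
- move=> j; have [g1 g2] := gz j; have [h1 h2] := hz j.
  have aux (q : R -> R) : measurable_fun setT q -> (forall x : R, `|q x| <= 1) ->
    RI U1 (fun x => f x * (a * g x + b * h x) * q x) =
    a * RI U1 (fun x => f x * g x * q x) + b * RI U1 (fun x => f x * h x * q x).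
    move=> mq q1; rewrite -!RIZ -?RID; try by [exact: ortho_int|apply: integZ; exact: ortho_int].
    by congr RI; apply/funext => x; ring.
  have cm x := cos_max (tw j x); have sm x := sin_max (tw j x).
  split; rewrite aux//.
    by rewrite g1 h1 !mulr0 addr0.
  by rewrite g2 h2 !mulr0 addr0.
Qed.

Let RI_half (g a b : R -> R) : integ U1 a -> integ U1 b -> (forall x, g x = 2^-1 * a x + 2^-1 * b x) ->
  RI U1 a = 0 -> RI U1 b = 0 -> RI U1 g = 0.
Proof.
move=> ia ib gE a0 b0; under eq_RI do rewrite gE.
by rewrite RID ?RIZ ?a0 ?b0 ?mulr0 ?addr0//; apply: integZ.
Qed.

(** Frequencies are natural numbers. At [j = 0] the shift would give frequency -1, which the parity
    of cosine and sine turns back into frequency 1. *)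
Let ortho_shift g j : ortho g ->
  RI U1 (fun x => f x * g x * cos (tw j x - tw 1 x)) = 0 /\
  RI U1 (fun x => f x * g x * sin (tw j x - tw 1 x)) = 0.
Proof.
move=> og; have [_ _ gz] := og.
case: j => [|j].
  have [g1 g2] := gz 1%N; split.
    by rewrite -[RHS]g1; apply: eq_RI => x; rewrite {1}/tw mulr0 mul0r sub0r cosN.
  rewrite -[RHS]oppr0 -[X in - X]g2 -RIN; last by apply: ortho_int => // x; exact: sin_max.
  by apply: eq_RI => x; rewrite {1}/tw mulr0 mul0r sub0r sinN mulrN.
have e x : tw j.+1 x - tw 1 x = tw j x :> R by rewrite -addn1 twD addrK.
have [g1 g2] := gz j; split.
  by rewrite -[RHS]g1; apply: eq_RI => x; rewrite e.
by rewrite -[RHS]g2; apply: eq_RI => x; rewrite e.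
Qed.

Let ortho_cos g : ortho g -> ortho (fun x => g x * cos (tw 1 x)).
Proof.
move=> og; have [mg [c gc] gz] := og.
split; first exact: measurable_funM.
  by exists c => x; rewrite normrM; apply: le_trans (gc x); rewrite ler_piMr// cos_max.
move=> j; have [a1 a2] := ortho_shift j og; have [b1 b2] := gz (j + 1)%N.
have mB (q : R -> R) : continuous q -> measurable_fun setT (fun x : R => q (tw j x - tw 1 x)).
  move=> cq; apply: continuous_measurable => x.
  by apply: continuous_comp; [apply: cvgB; exact: continuous_tw|exact: cq].
split.
  apply: (RI_half _ _ _ b1 a1).
  - by apply: ortho_int => // x; exact: cos_max.
  - by apply: ortho_int => // [|x]; [apply: mB; exact: continuous_cos|exact: cos_max].
  - by move=> x; rewrite twD cosB cosD; field.
apply: (RI_half _ _ _ b2 a2).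
- by apply: ortho_int => // x; exact: sin_max.
- by apply: ortho_int => // [|x]; [apply: mB; exact: continuous_sin|exact: sin_max].
- by move=> x; rewrite twD sinB sinD; field.
Qed.

Let ortho_sin g : ortho g -> ortho (fun x => g x * sin (tw 1 x)).
Proof.
move=> og; have [mg [c gc] gz] := og.
split; first exact: measurable_funM.
  by exists c => x; rewrite normrM; apply: le_trans (gc x); rewrite ler_piMr// sin_max.
move=> j; have [a1 a2] := ortho_shift j og; have [b1 b2] := gz (j + 1)%N.
have mB (q : R -> R) : continuous q -> measurable_fun setT (fun x : R => q (tw j x - tw 1 x)).
  move=> cq; apply: continuous_measurable => x.
  by apply: continuous_comp; [apply: cvgB; exact: continuous_tw|exact: cq].
have i1 : integ U1 (fun x => f x * g x * cos (tw j x - tw 1 x)).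
  by apply: ortho_int => // [|x]; [apply: mB; exact: continuous_cos|exact: cos_max].
have i2 : integ U1 (fun x => f x * g x * sin (tw j x - tw 1 x)).
  by apply: ortho_int => // [|x]; [apply: mB; exact: continuous_sin|exact: sin_max].
have i3 : integ U1 (fun x => f x * g x * cos (tw (j + 1) x)).
  by apply: ortho_int => // x; exact: cos_max.
have i4 : integ U1 (fun x => f x * g x * sin (tw (j + 1) x)).
  by apply: ortho_int => // x; exact: sin_max.
split.
  apply: (RI_half i4 (integN i2) _ b2); last by rewrite RIN// a2 oppr0.
  by move=> x; rewrite twD sinB sinD; field.
apply: (RI_half i1 (integN i3) _ a1); last by rewrite RIN// b1 oppr0.
by move=> x; rewrite twD cosB cosD; field.
Qed.

Section arc.
Variables (al be ga : R).
Let a x := al + be * cos (tw 1 x) + ga * sin (tw 1 x).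

Let orthoMa g : ortho g -> ortho (fun x => g x * a x).
Proof.
move=> og; have := orthoD 1 ga (orthoD al be og (ortho_cos og)) (ortho_sin og).
rewrite (_ : (fun x => g x * a x) = (fun x => 1 * (al * g x + be * (g x * cos (tw 1 x))) +
  ga * (g x * sin (tw 1 x))))//.
by apply/funext => x; rewrite /a; ring.
Qed.

Let orthoMax g n : ortho g -> ortho (fun x => g x * a x ^+ n).
Proof.
move=> og; elim: n => [|n IH].
  by under [X in ortho X]eq_fun do rewrite expr0 mulr1.
by under [X in ortho X]eq_fun do rewrite exprSr mulrA; exact: orthoMa.
Qed.

(** The function [a] is a trigonometric polynomial of degree one, so [(1 - a x ^+ n) ^+ m] stays in
    the class [ortho]; pairing with the mode of frequency 0 gives the integral. *)
Lemma ortho_arc n m : RI U1 (fun x => f x * (1 - a x ^+ n) ^+ m) = 0.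
Proof.
have : ortho (fun x => (1 - a x ^+ n) ^+ m).
  elim: m => [|m IH]; first by under [X in ortho X]eq_fun do rewrite expr0; exact: ortho1.
  have := orthoD 1 (-1) IH (orthoMax n IH).
  rewrite (_ : (fun x => (1 - a x ^+ n) ^+ m.+1) = (fun x => 1 * (1 - a x ^+ n) ^+ m +
    -1 * ((1 - a x ^+ n) ^+ m * a x ^+ n)))//.
  by apply/funext => x; rewrite exprSr; ring.
case=> _ _ /(_ 0%N)[h _]; rewrite -[RHS]h; apply: eq_RI => x.
by rewrite /tw mulr0 mul0r cos0 mulr1.
Qed.

Lemma measurable_arc n m : measurable_fun setT (fun x => (1 - a x ^+ n) ^+ m).
Proof.
apply: measurable_funX; apply: measurable_funB => //; apply: measurable_funX.
by apply: measurable_funD; [apply: measurable_funD => //|]; apply: measurable_funM.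
Qed.

End arc.

(** The polynomials of an elementary proof of the Stone-Weierstrass theorem, which turn a comparison
    with 1/2 into an indicator. Bernoulli's inequality bounds the power below by [1 - (2 * r) ^+ n],
    and above by [(2 * r)^-1 ^+ n] after multiplication by [(1 + r ^+ n) ^+ (2 ^ n)]. *)
Lemma peak_cvg (r : R) : 0 <= r <= 1 -> r != 1/2 ->
  (1 - r ^+ n) ^+ (2 ^ n) @[n --> \oo] --> (if r < 1/2 then 1 else 0 : R).
Proof.
move=> /andP[r0 r1] r12; have rn n : 0 <= r ^+ n <= 1 by rewrite exprn_ge0// exprn_ile1.
have bern (q : R) n : 0 <= q <= 1 -> 1 - n%:R * q <= (1 - q) ^+ n.
  move=> /andP[q0 q1]; elim: n => [|n IH]; first by rewrite mul0r subr0.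
  rewrite exprS; apply: (@le_trans _ _ ((1 - q) * (1 - n%:R * q))).
    rewrite -natr1; have : 0 <= q * (n%:R * q) by rewrite !mulr_ge0.
    by move: (n%:R : R) => N; nra.
  by rewrite ler_wpM2l// subr_ge0.
case: ifPn => rlt.
  have h : (2 * r) ^+ n @[n --> \oo] --> (0 : R).
    by apply: cvg_expr; rewrite ger0_norm ?mulr_ge0//; lra.
  have h' : 1 - (2 * r) ^+ n @[n --> \oo] --> (1 : R).
    by rewrite -[X in _ --> X]subr0; apply: cvgB => //; exact: cvg_cst.
  apply: (@squeeze_cvgr _ _ _ _ (fun n => 1 - (2 * r) ^+ n) (fun=> 1 : R)); [|exact: h'|exact: cvg_cst].
  apply: nearW => n; apply/andP; split; last first.
    by rewrite exprn_ile1//; have /andP[] := rn n; lra.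
  by have := bern (r ^+ n) (2 ^ n)%N (rn n); rewrite natrX -exprMn.
have {rlt r12}r12 : 1/2 < r by rewrite lt_neqAle eq_sym r12 leNgt.
have r2 : 1 < 2 * r by lra.
have h : (2 * r)^-1 ^+ n @[n --> \oo] --> (0 : R).
  by apply: cvg_expr; rewrite ger0_norm ?invr_ge0 ?invf_lt1//; lra.
apply: (@squeeze_cvgr _ _ _ _ (fun=> 0 : R) (fun n => (2 * r)^-1 ^+ n)); [|exact: cvg_cst|exact: h].
apply: nearW => n; have /andP[rn0 rn1] := rn n.
apply/andP; split; first by rewrite exprn_ge0// subr_ge0.
have rp : 0 < (2 * r) ^+ n by rewrite exprn_gt0//; lra.
rewrite exprVn -[leRHS]mul1r ler_pdivlMr//.
(* (1-q)^N (N q) <= (1-q)^N (1+q)^N = (1-q^2)^N <= 1 *)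
have bern' (q : R) N : 0 <= q -> N%:R * q <= (1 + q) ^+ N.
  move=> q0; apply: (@le_trans _ _ (1 + N%:R * q)); first by rewrite lerDr.
  elim: N => [|N IH]; first by rewrite mul0r addr0.
  rewrite exprS; apply: (@le_trans _ _ ((1 + q) * (1 + N%:R * q))).
    rewrite -natr1; have : 0 <= q * (N%:R * q) by rewrite !mulr_ge0.
    by move: (N%:R : R) => M; nra.
  by rewrite ler_wpM2l// addr_ge0.
apply: (@le_trans _ _ ((1 - r ^+ n) ^+ (2 ^ n) * (1 + r ^+ n) ^+ (2 ^ n))).
  rewrite ler_wpM2l ?exprn_ge0 ?subr_ge0//.
  by rewrite exprMn -natrX; exact: bern'.
rewrite -exprMn; apply: exprn_ile1; nra.
Qed.

Let ae01 (al : R) : {ae U1, forall x : R, [/\ 0 < x, x < 1 & x != al]}.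
Proof.
have n1 (z : R) : U1.-negligible [set z].
  exists [set z]; split => //.
  have /null_content_dominatesP := dominates_uniform_prob (@ltr01 R).
  by apply => //; exact: lebesgue_measure_set1.
have n2 : U1.-negligible (~` `[0, 1]).
  exists (~` `[0, 1]); split => //; first exact: measurableC.
  rewrite /= /uniform_prob integral_uniform_pdf setICl integral_set0 //.
apply: (@negligibleS _ _ _ U1 ((~` `[0, 1] `|` [set 0]) `|` ([set 1] `|` [set al]))); last first.
  by apply: negligibleU; apply: negligibleU.
move=> x /= h; apply: contrapT => /not_orP[/not_orP[h1 h2] /not_orP[h3 h4]]; apply: h.
move: h1 => /contrapT; rewrite in_itv/= => /andP[x0 x1].
split; [rewrite lt_neqAle x0 andbT eq_sym|rewrite lt_neqAle x1 andbT|]; exact/eqP.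
Qed.

(** The arc from [al] to 1 has centre [y] and half-length [r], and the cosine decreases with the
    distance from the centre up to half a turn. A point further than 1/2 from [y] on the line is
    reached the other way round the circle, at distance [1 - (y - x)], still larger than [r]. *)
Let arc_geometry (al x : R) : 0 <= al -> 0 < x -> x < 1 -> x != al -> al < 1 ->
  let y := (al + 1) / 2 in let r := (1 - al) / 2 in
  (al < x -> cos (tw 1 r) < cos (tw 1 (x - y))) /\
  (x < al -> cos (tw 1 (x - y)) < cos (tw 1 r)).
Proof.
move=> al0 x0 x1 xal al1 y r.
have pi0 : 0 < pi :> R := pi_gt0 R.
have twE z : tw 1 z = 2 * z * pi :> R by rewrite /tw; ring.
have dec (z z' : R) : 0 <= z -> z < z' -> z' <= 1/2 -> cos (tw 1 z') < cos (tw 1 z).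
  move=> z0 zz z'1; have z'0 := ltW (le_lt_trans z0 zz).
  have aux (w : R) : 0 <= w -> w <= 1/2 -> 2 * w * pi \in `[0, pi].
    move=> w0 w1; rewrite in_itv/= mulr_ge0 ?ler_piMl ?(ltW pi0)//; first lra.
    by rewrite mulr_ge0.
  rewrite !twE (ltr_cos (aux z z0 _) (aux z' z'0 z'1)); last lra.
  by rewrite ltr_pM2r// ltr_pM2l.
have cabs z : cos (tw 1 z) = cos (tw 1 `|z|) :> R.
  have [z0|z0] := leP 0 z; first by rewrite ger0_norm.
  by rewrite ltr0_norm// !twE mulrN mulNr cosN.
have c1 z : cos (tw 1 (1 - z)) = cos (tw 1 z) :> R.
  have -> : tw 1 (1 - z) = - tw 1 z + pi *+ 2 :> R by rewrite !twE -(mulr_natr pi); ring.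
  by rewrite cosD2pi cosN.
split => h.
  rewrite (cabs (x - y)); apply: dec => //.
  - rewrite ltr_norml /y /r; apply/andP; split; lra.
  - by rewrite /r; lra.
rewrite (cabs (x - y)) distrC ger0_norm; last by rewrite /y; lra.
have [z2|z2] := leP (y - x) (1/2).
  by apply: dec => //; rewrite /y /r; lra.
by rewrite -(c1 (y - x)); apply: dec; move: z2; rewrite /y /r; lra.
Qed.

(** Up to null sets the ray cuts out of the circle the arc where a trigonometric polynomial [a]
    exceeds 1/2. The functions [(1 - a x ^+ n) ^+ (2 ^ n)] are orthogonal to [f], bounded by 1, and
    converge almost everywhere to the indicator of the complementary arc. *)
Lemma RI_ray (al : R) : RI U1 (fun x => f x * \1_(`]al, +oo[) x) = 0.
Proof.
have mf : measurable_fun setT f := integ_meas fi.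
have m1 : measurable_fun setT (fun x : R => \1_(`]al, +oo[) x : R) by exact: measurable_indic.
have RIf : RI U1 f = 0.
  by rewrite -[RHS](f0 0%N); apply: eq_RI => x; rewrite /trig/= mulr1.
have [al0|al0] := ltP al 0.
  rewrite -[RHS]RIf; apply: ae_RI => //; first exact: measurable_funM.
  apply: (ae_imp _ (ae01 0)) => x [x0 x1 _].
  by rewrite indicE mem_set ?mulr1//= in_itv/= andbT (lt_trans al0).
have [al1|al1] := leP 1 al.
  rewrite -[RHS](RI_cst U1); apply: ae_RI => //; first exact: measurable_funM.
  apply: (ae_imp _ (ae01 0)) => x [x0 x1 _].
  by rewrite indicE memNset ?mulr0//= in_itv/= andbT; apply/negP; rewrite -leNgt (le_trans (ltW x1)).
pose y := (al + 1) / 2; pose r := (1 - al) / 2.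
pose be := cos (tw 1 y) / 4; pose ga := sin (tw 1 y) / 4.
(* Equal to 1/2 plus a quarter of a difference of two cosines; the quarter keeps the values in
   [0, 1], where [peak_cvg] applies. *)
pose a x := (1/2 - cos (tw 1 r) / 4) + be * cos (tw 1 x) + ga * sin (tw 1 x).
have aE x : a x = 1/2 + (cos (tw 1 (x - y)) - cos (tw 1 r)) / 4.
  have -> : tw 1 (x - y) = tw 1 x - tw 1 y :> R by rewrite /tw; ring.
  by rewrite /a /be /ga cosB; field.
have a01 x : 0 <= a x <= 1.
  rewrite aE; have := cos_max (tw 1 (x - y)); have := cos_max (tw 1 r).
  by rewrite !ler_norml => /andP[? ?] /andP[? ?]; apply/andP; split; lra.
have mS n : measurable_fun setT (fun x => f x * (1 - a x ^+ n) ^+ (2 ^ n)).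
  by apply: measurable_funM => //; exact: measurable_arc.
pose lm x := f x - f x * \1_(`]al, +oo[) x.
have mlm : measurable_fun setT lm.
  by apply: measurable_funB => //; exact: measurable_funM.
have cv : {ae U1, forall x : R, f x * (1 - a x ^+ n) ^+ (2 ^ n) @[n --> \oo] --> lm x}.
  apply: (ae_imp _ (ae01 al)) => x [x0 x1 xal].
  have [g1 g2] := arc_geometry al0 x0 x1 xal al1.
  have [alx|xlt] := ltP al x.
    have ax : 1/2 < a x by rewrite aE; have := g1 alx; rewrite -/y -/r; lra.
    rewrite /lm indicE mem_set/= ?in_itv/= ?alx//= mulr1 subrr.
    rewrite -[X in _ --> X](mulr0 (f x)); apply: cvgM; first exact: cvg_cst.
    have := peak_cvg (a01 x); rewrite gt_eqF// => /(_ isT).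
    by rewrite ltNge ltW.
  have xlt' : x < al by rewrite lt_neqAle xal.
  have ax : a x < 1/2 by rewrite aE; have := g2 xlt'; rewrite -/y -/r; lra.
  rewrite /lm indicE memNset/= ?mulr0 ?subr0; last first.
    by rewrite in_itv/= andbT; apply/negP; rewrite -leNgt.
  rewrite -[X in _ --> X](mulr1 (f x)); apply: cvgM; first exact: cvg_cst.
  by have := peak_cvg (a01 x); rewrite lt_eqF// ax => /(_ isT).
have h1 n x : `|f x * (1 - a x ^+ n) ^+ (2 ^ n)| <= `|f x|.
  have /andP[a0 a1] := a01 x; have an0 : 0 <= a x ^+ n by rewrite exprn_ge0.
  have an1 : a x ^+ n <= 1 by rewrite exprn_ile1.
  rewrite normrM ler_piMr// normrX exprn_ile1// ger0_norm; lra.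
have [|_] := @RI_dct _ _ _ U1 _ _ _ mS mlm _ (integ_abs fi) h1; first exact: (ae_imp _ cv).
under eq_fun do rewrite ortho_arc.
move=> /(cvg_unique (@Rhausdorff R) (cvg_cst (0 : R))).
rewrite RIB ?RIf ?sub0r//; last by apply: (integM m1 (c := 1)) => x; rewrite indicE; case: (_ \in _); rewrite ?normr1 ?normr0.
by move=> /esym/eqP; rewrite oppr_eq0 => /eqP.
Qed.

Let integ_indic (E : set R) : measurable E -> integ U1 (fun x => f x * \1_E x).
Proof.
move=> mE; apply: (integM _ (c := 1)); first exact: measurable_indic.
by move=> x; rewrite indicE; case: (_ \in _); rewrite ?normr1 ?normr0.
Qed.

(** Open rays are stable under intersection and generate the Borel sets, while the sets over which
    [f] integrates to 0 form a Dynkin class. *)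
Lemma RI_borel (E : set R) : measurable E -> RI U1 (fun x => f x * \1_E x) = 0.
Proof.
have RIf : RI U1 f = 0.
  by rewrite -[RHS](f0 0%N); apply: eq_RI => x; rewrite /trig/= mulr1.
move=> mE.
suff : (@RGenOInfty.G R).-sigma.-measurable E -> RI U1 (fun x => f x * \1_E x) = 0.
  by apply; rewrite -RGenOInfty.measurableE.
move: E {mE}.
apply: (@dynkin_induction _ (measurableTypeR R) (@RGenOInfty.G R)
  [set E | RI U1 (fun x => f x * \1_E x) = 0]).
- exact: RGenOInfty.measurableE.
- move=> A B [a ->] [b ->]; exists (Num.max a b).
  apply/seteqP; split => x /=; rewrite !in_itv/= !andbT gt_max.
    by move=> [-> ->].
  by move=> /andP[].
- by rewrite /= -[RHS]RIf; apply: eq_RI => x; rewrite indicT mulr1.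
- by move=> _ [a ->]; exact: RI_ray.
- move=> S mS /= S0; rewrite -[RHS]subr0 -[X in _ = _ - X]S0 -[X in _ = X - _]RIf -RIB//; last exact: integ_indic.
  apply: eq_RI => x; rewrite !indicE in_setC; case: (x \in S); rewrite /= ?mulr1 ?mulr0 ?subr0 ?subrr//.
- move=> F mF tF F0 /=.
  have mU : measurable (\bigcup_k F k) by exact: bigcup_measurable.
  have mf : measurable_fun setT f := integ_meas fi.
  have [|||||] := @RI_dct _ _ _ U1 (fun n x => f x * \1_(\big[setU/set0]_(i < n) F i) x)
    (fun x => f x * \1_(\bigcup_k F k) x) (fun x => `|f x|).
  + move=> n; apply: measurable_funM => //; apply: measurable_indic.
    exact: bigsetU_measurable.
  + by apply: measurable_funM => //; exact: measurable_indic.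
  + apply: aeW => x; apply: cvgM; first exact: cvg_cst.
    apply: cvg_near_cst; have [[k _ Fk]|nF] := pselect ((\bigcup_k F k) x).
      exists k.+1 => // n /= kn; rewrite !indicE; congr (nat_of_bool _)%:R.
      have h1 : (\big[setU/set0]_(i < n) F i) x by rewrite -bigcup_mkord; exists k.
      have h2 : (\bigcup_k F k) x by exists k.
      by rewrite (mem_set h1) (mem_set h2).
    apply: nearW => n; rewrite !indicE; congr (nat_of_bool _)%:R.
    by rewrite !memNset// -bigcup_mkord => -[k _ Fk]; apply: nF; exists k.
  + exact: integ_abs.
  + by move=> n x; rewrite indicE normrM ler_piMr//; case: (_ \in _); rewrite ?normr1 ?normr0.
  move=> _; have mB n : measurable (\big[setU/set0]_(i < n) F i).
    by apply: bigsetU_measurable => i _; exact: mF.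
  have sum0 n : RI U1 (fun x => f x * \1_(\big[setU/set0]_(i < n) F i) x) = 0.
    elim: n => [|n IH].
      by rewrite -[RHS](RI_cst U1); apply: eq_RI => x; rewrite big_ord0 indic0 mulr0.
    rewrite -[RHS]addr0 -[X in _ = X + _]IH -[X in _ = _ + X](F0 n) -(RID (integ_indic (mB n)) (integ_indic (mF n))).
    apply: eq_RI => x; rewrite big_ord_recr/= -mulrDr; congr (_ * _).
    rewrite !indicE in_setU; case xn: (x \in F n); rewrite ?orbT ?orbF ?addr0//.
    rewrite memNset ?add0r// -bigcup_mkord => -[k/= kn Fk].
    have Fn := set_mem xn; have := tF k n I I => /(_ _)/wrap[]; first by exists x.
    by move=> e; rewrite e ltnn in kn.
  under eq_fun do rewrite sum0.
  by move=> /(cvg_unique (@Rhausdorff R) (cvg_cst (0 : R))) <-.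
Qed.

Lemma circle_complete : RI U1 (fun x => `|f x|) = 0.
Proof.
have mf : measurable_fun setT f := integ_meas fi.
have : ae_eq U1 setT (EFin \o f) (cst 0)%E.
  apply: integral_ae_eq => // E _ mE.
  rewrite integral0 integral_mkcond.
  have := RI_borel mE; rewrite /RI /Rintegral => h.
  have i := integ_indic mE.
  have h2 := RI_EFin i; rewrite RI_borel// in h2; rewrite -[RHS]h2.
  apply: eq_integral => x _; rewrite patchE indicE.
  by case: (x \in E); rewrite ?mulr1 ?mulr0.
move=> ae; rewrite -[RHS](RI_cst U1); apply: ae_RI => //.
  exact: measurableT_comp.
by apply: (ae_imp _ ae) => x /= /(_ I) [->]; rewrite normr0.
Qed.

End circle_complete.

Lemma ae_and d (T : measurableType d) (R : realType) (mu : probability T R)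
    (P Q : T -> Prop) : {ae mu, forall x, P x} -> {ae mu, forall x, Q x} ->
  {ae mu, forall x, P x /\ Q x}.
Proof. by apply: filterS2. Qed.

(** * Fubini's theorem and completeness on the torus *)

Section torus_fubini.
Context (R : realType).
Notation U1 := (uniform_prob (@ltr01 R)).
Notation prodT n := ((U1 \x torus n)%E : probability _ R).

Lemma tconsE n x (y : n.-tuple R) : tcons (x, y) = [tuple of x :: y].
Proof. by []. Qed.

Lemma integ_tcons n (f : n.+1.-tuple R -> R) : integ (torus n.+1) f ->
  integ (prodT n) (fun z => f (tcons z)).
Proof.
move=> fi; have mf := integ_meas fi.
have mft : measurable_fun setT (fun z : measurableTypeR R * n.-tuple R => f (tcons z)).
  by apply: (measurableT_comp mf); exact: measurable_tcons.
apply/integrableP; split; first exact/measurable_EFinP.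
case/integrableP : fi => _; apply: le_lt_trans.
rewrite /= /distribution ge0_integral_pushforward//=; last first.
  by apply/measurable_EFinP; exact: measurableT_comp.
Qed.

Lemma RI_tcons n (f : n.+1.-tuple R -> R) : integ (torus n.+1) f ->
  RI (torus n.+1) f = RI (prodT n) (fun z => f (tcons z)).
Proof.
move=> fi; have mf := integ_meas fi; have h := integ_tcons fi.
rewrite /RI /Rintegral; congr fine.
rewrite /= /distribution integral_pushforward//=.
exact/measurable_EFinP.
Qed.

Lemma integ_section n (f : n.+1.-tuple R -> R) : integ (torus n.+1) f ->
  {ae U1, forall x : R, integ (torus n) (fun y => f (tcons (x, y)))}.
Proof. by move=> /integ_tcons /ae_integrable1. Qed.

Lemma RI_torusS n (f : n.+1.-tuple R -> R) : integ (torus n.+1) f ->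
  integ U1 (fun x : R => RI (torus n) (fun y => f (tcons (x, y)))) /\
  RI (torus n.+1) f = RI U1 (fun x : R => RI (torus n) (fun y => f (tcons (x, y)))).
Proof.
move=> fi; have h := integ_tcons fi.
pose F (x : R) := (\int[torus n]_y (f (tcons (x, y)))%:E)%E.
have iF : U1.-integrable setT F := integrable_fubini_F h.
have FE : {ae U1, forall x : R, F x = (RI (torus n) (fun y => f (tcons (x, y))))%:E}.
  by apply: (ae_imp _ (integ_section fi)) => x; exact: RI_EFin.
have mR : measurable_fun setT (fun x : R => RI (torus n) (fun y => f (tcons (x, y)))).
  by apply: (measurableT_comp (f := fine)) => //; exact: measurable_int iF.
have FE' : ae_eq U1 setT F (fun x : R => (RI (torus n) (fun y => f (tcons (x, y))))%:E).
  by apply: (ae_imp _ FE) => x /= -> _.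
have iR : integ U1 (fun x : R => RI (torus n) (fun y => f (tcons (x, y)))).
  apply/integrableP; split; first exact/measurable_EFinP.
  case/integrableP : iF => mF; apply: le_lt_trans.
  rewrite le_eqVlt; apply/orP; left; apply/eqP; apply: ae_eq_integral => //.
  - by apply: measurableT_comp => //; exact/measurable_EFinP.
  - by apply: measurableT_comp.
  - by apply: (ae_imp _ FE) => x /= -> _.
split => //; rewrite RI_tcons//; apply: EFin_inj; rewrite -(RI_EFin h) -(RI_EFin iR).
have <- := integral12_prod_meas1 h.
apply: ae_eq_integral => //; [exact: measurable_int iF|exact/measurable_EFinP].
Qed.

Definition eb n (k : n.-tuple nat) (x : n.-tuple R) : R :=
  \prod_(i < n) trig (tnth k i) (tnth x i).

Lemma eb_cons n (k : n.+1.-tuple nat) (x : R) (y : n.-tuple R) :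
  eb k (tcons (x, y)) = trig (thead k) x * eb [tuple of behead k] y.
Proof.
rewrite /eb big_ord_recl; congr (trig _ _ * _).
apply: eq_bigr => i _; rewrite tconsE tnthS; congr trig.
by rewrite [in LHS](tuple_eta k) tnthS.
Qed.

Lemma measurable_trig k : measurable_fun setT (@trig R k).
Proof. exact: continuous_measurable (@continuous_trig R k). Qed.

Lemma measurable_eb n (k : n.-tuple nat) : measurable_fun setT (@eb n k).
Proof.
apply: measurable_prod => i _; apply: (measurableT_comp (measurable_trig _)).
exact: measurable_tnth.
Qed.

Lemma eb_le n (k : n.-tuple nat) x : `|eb k x| <= 2 ^+ n.
Proof.
rewrite /eb normr_prod; apply: (@le_trans _ _ (\prod_(i < n) 2)).
  by apply: ler_prod => i _; rewrite normr_ge0 trig_le.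
by rewrite prodr_const card_ord.
Qed.

Lemma sqint_eb n (k : n.-tuple nat) : sqint (torus n) (eb k).
Proof. exact: sqint_bdd (measurable_eb k) (eb_le k). Qed.

Lemma eb_orth n (k l : n.-tuple nat) :
  RI (torus n) (fun x => eb k x * eb l x) = (k == l)%:R.
Proof.
elim: n k l => [|n IH] k l.
  rewrite (tuple0 k) (tuple0 l) eqxx -[RHS](RI_cst (torus 0)).
  by apply: eq_RI => x; rewrite /eb !big_ord0 mulr1.
have [_ ->] := RI_torusS (sqintM (sqint_eb k) (sqint_eb l)).
have -> : (fun x : R => RI (torus n) (fun y => eb k (tcons (x, y)) * eb l (tcons (x, y)))) =
   (fun x => (([tuple of behead k] == [tuple of behead l])%:R) * (trig (thead k) x * trig (thead l) x)).
  apply/funext => x; rewrite -IH mulrC -RIZ; last exact: sqintM (sqint_eb _) (sqint_eb _).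
  by apply: eq_RI => y; rewrite !eb_cons; ring.
rewrite RIZ ?trig_orth; last exact: sqintM (sq_trig _ _) (sq_trig _ _).
rewrite -natrM mulnb; congr (nat_of_bool _)%:R.
apply/andP/eqP => [[/eqP h1 /eqP h2]|->]; last by rewrite !eqxx.
by rewrite (tuple_eta k) (tuple_eta l); apply: val_inj => /=; rewrite h2; congr cons; exact: (congr1 val h1).
Qed.

(** Induction on the dimension. For each multi-index [k] of the last variables, the partial
    coefficient [h k] has vanishing Fourier coefficients in the first variable, hence is null. The
    multi-indices being countable, one null set serves all of them, and off it the induction
    hypothesis applies to the sections of [f]. *)
Lemma torus_complete n (f : n.-tuple R -> R) : integ (torus n) f ->
  (forall k, RI (torus n) (fun x => f x * eb k x) = 0) ->
  RI (torus n) (fun x => `|f x|) = 0.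
Proof.
elim: n f => [|n IH] f fi f0.
  have f00 : f [tuple] = 0.
    rewrite -[RHS](f0 [tuple]) -[LHS](RI_cst (torus 0)); apply: eq_RI => x.
    by rewrite (tuple0 x) /eb big_ord0 mulr1.
  by rewrite -[RHS](RI_cst (torus 0)); apply: eq_RI => x; rewrite (tuple0 x) f00 normr0.
have mf := integ_meas fi.
have ifk k : integ (torus n.+1) (fun x => f x * eb k x).
  apply: (@integ_le _ _ _ _ _ (fun x => 2 ^+ n.+1 * `|f x|)).
  - by apply: measurable_funM => //; exact: measurable_eb.
  - by move=> x; rewrite normrM mulrC ler_wpM2r// eb_le.
  - by apply: integZ; exact: integ_abs.
pose h (k : n.-tuple nat) (x : R) := RI (torus n) (fun y => f (tcons (x, y)) * eb k y).
have ih k : integ U1 (h k).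
  have [+ _] := RI_torusS (ifk [tuple of 0%N :: k]); congr integ; apply/funext => x.
  by apply: eq_RI => y; rewrite eb_cons theadE /trig/= mul1r; congr (_ * eb _ _); exact/val_inj.
have h0 k : {ae U1, forall x : R, h k x = 0}.
  have hk0 j : RI U1 (fun x => h k x * trig j x) = 0.
    have [i1] := RI_torusS (ifk [tuple of j :: k]); rewrite f0 => e; rewrite [RHS]e.
    apply: ae_RI; [|exact: integ_meas i1|].
      apply: measurable_funM; [exact: integ_meas (ih k)|exact: measurable_trig].
    apply: (ae_imp _ (integ_section (ifk [tuple of 0%N :: k]))) => x ix.
    rewrite /h mulrC -RIZ.
      apply: eq_RI => y; rewrite eb_cons theadE mulrCA; congr (_ * (_ * eb _ _)); exact/val_inj.
    move: ix; congr integ; apply/funext => y.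
    by rewrite eb_cons theadE /trig/= mul1r; congr (_ * eb _ _); exact/val_inj.
  have := RI_eq0 (integ_abs (ih k)) (fun x => normr_ge0 _) (circle_complete (ih k) hk0).
  by apply: ae_imp => x /eqP; rewrite normr_eq0 => /eqP.
have hall : {ae U1, forall x : R, forall k, h k x = 0}.
  have : {ae U1, forall x : R, forall m, if unpickle m is Some k then h k x = 0 else True}.
    by apply: ae_foralln => m; case: unpickle => [k|]; [exact: h0|exact: aeW].
  by apply: ae_imp => x hx k; have := hx (pickle k); rewrite pickleK.
have [i1 ->] := RI_torusS (integ_abs fi).
rewrite -[RHS](RI_cst U1); apply: ae_RI => //; first exact: integ_meas i1.
have := integ_section fi; move/(conj hall) => [hh1 hh2].
have : {ae U1, forall x : R, (forall k, h k x = 0) /\ integ (torus n) (fun y => f (tcons (x, y)))}.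
  exact: (ae_and hh1 hh2).
by apply: ae_imp => x [hx ix]; exact: IH.
Qed.

End torus_fubini.

(** * Smooth functions *)

Section smooth_functions.
Context (R : realType).
Implicit Types V W U : normedModType R.

Lemma Ck_continuous V W k (f : V -> W) : Ck k f -> continuous f.
Proof. by case: k => [//|k] []. Qed.

Lemma Ck_pred V W k (f : V -> W) : Ck k.+1 f -> Ck k f.
Proof.
elim: k f => [|k IH] f; first exact: Ck_continuous.
move=> [cf df]; split => // v; split; first by have [] := df v.
by apply: IH; have [] := df v.
Qed.

Lemma Ck_cst V W k (w : W) : Ck k (fun _ : V => w).
Proof.
elim: k w => [|k IH] w; first by move=> x; exact: cvg_cst.
split; first by move=> x; exact: cvg_cst.
move=> v; split; first by move=> x; exact: derivable_cst.
have -> : (fun x : V => 'D_v (fun _ : V => w) x) = fun=> 0.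
  by apply/funext => x; exact: derive_cst.
exact: IH.
Qed.

Lemma CkD V W k (f g : V -> W) : Ck k f -> Ck k g -> Ck k (fun x => f x + g x).
Proof.
elim: k f g => [|k IH] f g; first by move=> cf cg x; apply: cvgD; [exact: cf|exact: cg].
move=> [cf df] [cg dg]; split; first by move=> x; apply: cvgD; [exact: cf|exact: cg].
move=> v; have [df1 df2] := df v; have [dg1 dg2] := dg v.
split; first by move=> x; apply: derivableD.
have -> : (fun x : V => 'D_v (fun x => f x + g x) x) = fun x => 'D_v f x + 'D_v g x.
  by apply/funext => x; rewrite -deriveD.
exact: IH.
Qed.

Lemma CkZ V W k (c : R) (f : V -> W) : Ck k f -> Ck k (fun x => c *: f x).
Proof.
elim: k f => [|k IH] f; first by move=> cf x; apply: cvgZ; [exact: cvg_cst|exact: cf].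
move=> [cf df]; split; first by move=> x; apply: cvgZ; [exact: cvg_cst|exact: cf].
move=> v; have [df1 df2] := df v.
split; first by move=> x; apply: derivableZ.
have -> : (fun x : V => 'D_v (fun x => c *: f x) x) = fun x => c *: 'D_v f x.
  by apply/funext => x; rewrite -deriveZ.
exact: IH.
Qed.

Lemma CkM V k (f g : V -> R) : Ck k f -> Ck k g -> Ck k (fun x => f x * g x).
Proof.
elim: k f g => [|k IH] f g; first by move=> cf cg x; apply: cvgM; [exact: cf|exact: cg].
move=> hf hg; have [cf df] := hf; have [cg dg] := hg.
split; first by move=> x; apply: cvgM; [exact: cf|exact: cg].
move=> v; have [df1 df2] := df v; have [dg1 dg2] := dg v.
split; first by move=> x; apply: derivableM.
have -> : (fun x : V => 'D_v (fun x => f x * g x) x) = fun x => f x * 'D_v g x + g x * 'D_v f x.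
  by apply/funext => x; exact: deriveM.
by apply: CkD; apply: IH => //; exact: Ck_pred.
Qed.

Lemma Ck_prod V k (I : Type) (s : seq I) (f : I -> V -> R) :
  (forall i, Ck k (f i)) -> Ck k (fun x => \prod_(i <- s) f i x).
Proof.
move=> cf; elim: s => [|i s IH].
  by under [X in Ck k X]eq_fun do rewrite big_nil; exact: Ck_cst.
by under [X in Ck k X]eq_fun do rewrite big_cons; exact: CkM.
Qed.

Lemma Ck_sum V W k (I : Type) (s : seq I) (f : I -> V -> W) :
  (forall i, Ck k (f i)) -> Ck k (fun x => \sum_(i <- s) f i x).
Proof.
move=> cf; elim: s => [|i s IH].
  by under [X in Ck k X]eq_fun do rewrite big_nil; exact: Ck_cst.
by under [X in Ck k X]eq_fun do rewrite big_cons; exact: CkD.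
Qed.

Lemma CkV V k (f : V -> R) : (forall x, f x != 0) -> Ck k f -> Ck k (fun x => (f x)^-1).
Proof.
move=> f0; elim: k => [|k IH]; first by move=> cf x; apply: cvgV => //; exact: cf.
move=> hf; have [cf df] := hf.
split; first by move=> x; apply: cvgV => //; exact: cf.
move=> v; have [df1 df2] := df v.
split; first by move=> x; apply: derivableV.
have -> : (fun x : V => 'D_v (fun x => (f x)^-1) x) =
    fun x => (-1) * ((f x)^-1 * (f x)^-1 * 'D_v f x).
  apply/funext => x; rewrite (@deriveV _ _ f x v)//.
  by rewrite mulN1r /GRing.scale/= mulNr -exprVn expr2.
have hk := IH (Ck_pred hf).
by apply: CkM; [exact: Ck_cst|apply: CkM => //; apply: CkM].
Qed.

(* Right composition with an affine map and left composition with a continuous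
   linear one act on the difference quotients. *)
Lemma derive_affine U V W (f : V -> W) (A : U -> V) (L : U -> V) u x :
  (forall h : R, A (h *: u + x) = h *: L u + A x) ->
  (derivable f (A x) (L u) -> derivable (fun y => f (A y)) x u) /\
  'D_u (fun y => f (A y)) x = 'D_(L u) f (A x).
Proof.
move=> AE.
have E : (fun h : R => h^-1 *: ((f \o A \o shift x) (h *: u) - (f \o A) x)) =
         (fun h : R => h^-1 *: ((f \o shift (A x)) (h *: L u) - f (A x))).
  by apply/funext => h /=; rewrite AE.
by split; [rewrite /derivable [X in _ -> cvg X]/= E|rewrite /derive [in LHS]E].
Qed.

Lemma Ck_affine U V W k (f : V -> W) (A : U -> V) (L : U -> V) :
  continuous A -> (forall u x (h : R), A (h *: u + x) = h *: L u + A x) ->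
  Ck k f -> Ck k (fun y => f (A y)).
Proof.
move=> cA AE; elim: k f => [|k IH] f.
  by move=> cf x; apply: continuous_comp; [exact: cA|exact: cf].
move=> [cf df]; split; first by move=> x; apply: continuous_comp; [exact: cA|exact: cf].
move=> u; have [df1 df2] := df (L u).
split; first by move=> x; have [h _] := derive_affine f (AE u x); exact: h.
have -> : (fun x => 'D_u (fun y => f (A y)) x) = fun x => 'D_(L u) f (A x).
  by apply/funext => x; have [_ ->] := derive_affine f (AE u x).
exact: IH df2.
Qed.

Lemma derive_linear V W U (f : V -> W) (T : {linear W -> U}) v x :
  continuous T -> derivable f x v ->
  derivable (fun y => T (f y)) x v /\ 'D_v (fun y => T (f y)) x = T ('D_v f x).
Proof.
move=> cT df.
have E : (fun h : R => h^-1 *: (((T \o f) \o shift x) (h *: v) - (T \o f) x)) =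
         T \o (fun h : R => h^-1 *: ((f \o shift x) (h *: v) - f x)).
  apply/funext => h.
  rewrite /=.
  by rewrite (linearZZ T) (linearB T).
have cv : (fun h : R => h^-1 *: (((T \o f) \o shift x) (h *: v) - (T \o f) x)) @ 0^' --> T ('D_v f x).
  by rewrite E; apply: continuous_cvg => //; exact: cT.
split; first by apply/cvg_ex; exists (T ('D_v f x)).
exact: (cvg_lim (@norm_hausdorff _ _) cv).
Qed.

Lemma Ck_linear V W U k (f : V -> W) (T : {linear W -> U}) :
  continuous T -> Ck k f -> Ck k (fun y => T (f y)).
Proof.
move=> cT; elim: k f => [|k IH] f.
  by move=> cf x; apply: continuous_comp; [exact: cf|exact: cT].
move=> [cf df]; split; first by move=> x; apply: continuous_comp; [exact: cf|exact: cT].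
move=> v; have [df1 df2] := df v.
split; first by move=> x; have [] := derive_linear cT (df1 x).
have -> : (fun x => 'D_v (fun y => T (f y)) x) = fun x => T ('D_v f x).
  by apply/funext => x; have [_ ->] := derive_linear cT (df1 x).
exact: IH.
Qed.

(** [Ck] asks for derivatives in every direction, so the ordinary derivative, taken along 1, is
    rescaled to the direction [v]. *)
Lemma derive_real (f : R -> R) (df v x : R) : is_derive x (1 : R) f df ->
  derivable f x v /\ 'D_v f x = v * df.
Proof.
move=> [dfx Df].
have [v0|v0] := eqVneq v 0.
  by rewrite v0 mul0r; split; [exact: derivable0|exact: derive0].
have /derivable1_diffP h := dfx; split; first exact: diff_derivable.
by rewrite deriveE// -Df -[X in 'd f x X]mulr1 [LHS](linearZ_LR ('d f x)) deriveE.
Qed.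

Lemma Ck_real (f df : R -> R) k : (forall x : R, is_derive x (1 : R) f (df x)) ->
  Ck k df -> Ck k.+1 f.
Proof.
move=> fdf cdf.
have dfx v x := derive_real v (fdf x).
split.
  move=> x; apply: differentiable_continuous; apply/derivable1_diffP.
  by have [] := dfx 1 x.
move=> v; split; first by move=> x; have [] := dfx v x.
have -> : (fun x => 'D_v f x) = fun x => v * df x.
  by apply/funext => x; have [_ ->] := dfx v x.
by apply: CkM => //; exact: Ck_cst.
Qed.

Lemma Ck_cos_sin_tw n k : Ck k (fun x : R => cos (tw n x)) /\ Ck k (fun x : R => sin (tw n x)).
Proof.
elim: k => [|k [IH1 IH2]]; first by split; [exact: continuous_cos_tw|exact: continuous_sin_tw].
split.
  apply: (Ck_real (@is_derive_cos_tw R n)).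
  under [X in Ck k X]eq_fun do rewrite -mulNr.
  by apply: CkM => //; exact: Ck_cst.
by apply: (Ck_real (@is_derive_sin_tw R n)); apply: CkM => //; exact: Ck_cst.
Qed.

Lemma smooth_trig k : smooth (@trig R k).
Proof.
move=> l; have [h1 h2] := Ck_cos_sin_tw (uphalf k) l.
rewrite /trig; case: (k == 0%N); first exact: Ck_cst.
by apply: CkM; [exact: Ck_cst|case: (odd k)].
Qed.

Lemma Ck_derive V W k (f : V -> W) v : Ck k.+1 f -> Ck k (fun x => 'D_v f x).
Proof. by move=> [_ /(_ v)[]]. Qed.

Lemma Ck_derivable V W k (f : V -> W) : Ck k.+1 f -> forall v x, derivable f x v.
Proof. by move=> [_ df] v; have [] := df v. Qed.

End smooth_functions.

Lemma double_difference_sym (R : realType) (p q r s : R) :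
  p - q - (r - s) = p - r - (q - s).
Proof. ring. Qed.

Lemma close_to_common (R : realType) (p a b e : R) :
  `|p - a| < e / 2 -> `|p - b| < e / 2 -> `|b - a| <= e.
Proof.
rewrite !ltr_norml ler_norml => /andP[? ?] /andP[? ?]; apply/andP; split; lra.
Qed.

Section schwarz.
Context (R : realType) (V : normedModType R).

Lemma line_derive (f : V -> R) (x v : V) (s : R) : derivable f (x + s *: v) v ->
  is_derive s (1 : R) (fun r : R => f (x + r *: v)) ('D_v f (x + s *: v)).
Proof.
move=> df; have AE (h : R) : x + (h *: (1 : R) + s) *: v = h *: v + (x + s *: v).
  by rewrite scalerDl /GRing.scale/= mulr1 addrCA.
have [h1 h2] := @derive_affine R R V R f (fun r : R => x + r *: v) (fun=> v) 1 s AE.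
by apply: DeriveDef; [exact: h1|rewrite h2].
Qed.

(** The second difference of [f] over the parallelogram spanned by [h *: a] and [h *: b] is
    symmetric in the two directions. Two applications of the mean value theorem, in either order,
    equate it with [h * h] times either mixed derivative at a point near [x]; continuity of both
    mixed derivatives concludes. *)
Lemma schwarz (f : V -> R) (a b x : V) : Ck 2 f ->
  'D_a (fun y => 'D_b f y) x = 'D_b (fun y => 'D_a f y) x.
Proof.
move=> Cf.
have [C1a C1b] := (Ck_derive a Cf, Ck_derive b Cf).
have [Cba Cab] := (Ck_derive b C1a, Ck_derive a C1b).
pose g h := f (x + h *: a + h *: b) - f (x + h *: a) - (f (x + h *: b) - f x).
have mv (c e : V) (h : R) : 0 < h -> exists xi eta : R, [/\ 0 < xi < h, 0 < eta < h &
   f (x + h *: c + h *: e) - f (x + h *: c) - (f (x + h *: e) - f x) =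
   h * h * 'D_e (fun y => 'D_c f y) (x + xi *: c + eta *: e)].
  move=> h0.
  have d1 (s : R) : is_derive s (1 : R) (fun r : R => f (x + h *: e + r *: c) - f (x + r *: c))
      ('D_c f (x + h *: e + s *: c) - 'D_c f (x + s *: c)).
    have i1 := line_derive (@Ck_derivable _ _ _ _ _ Cf c (x + h *: e + s *: c)).
    have i2 := line_derive (@Ck_derivable _ _ _ _ _ Cf c (x + s *: c)).
    exact: is_deriveB.
  have c1 : {within `[0, h], continuous (fun r : R => f (x + h *: e + r *: c) - f (x + r *: c))}.
    apply: continuous_subspaceT => s; apply: differentiable_continuous.
    by apply/derivable1_diffP; have [] := d1 s.
  have [xi xih E1] := MVT h0 (fun s _ => d1 s) c1.
  have d2 (s : R) : is_derive s (1 : R) (fun r : R => 'D_c f (x + xi *: c + r *: e))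
      ('D_e (fun y => 'D_c f y) (x + xi *: c + s *: e)).
    exact: line_derive (@Ck_derivable _ _ _ _ _ (Ck_derive c Cf) e (x + xi *: c + s *: e)).
  have c2 : {within `[0, h], continuous (fun r : R => 'D_c f (x + xi *: c + r *: e))}.
    apply: continuous_subspaceT => s; apply: differentiable_continuous.
    by apply/derivable1_diffP; have [] := d2 s.
  have [eta etah E2] := MVT h0 (fun s _ => d2 s) c2.
  exists xi, eta; split; [by move: xih; rewrite in_itv|by move: etah; rewrite in_itv|].
  move: E1 E2; rewrite !scale0r !addr0 subr0.
  rewrite [x + h *: e + xi *: c]addrAC [x + h *: e + h *: c]addrAC => E1 E2.
  rewrite E2 in E1.
  by rewrite E1; ring.
have near_val (q : V -> R) (c e : V) : {for x, continuous q} -> forall eps, 0 < eps ->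
   exists2 del : R, 0 < del & forall xi eta h : R, 0 < h < del -> 0 < xi < h -> 0 < eta < h ->
     `|q (x + xi *: c + eta *: e) - q x| < eps.
  move=> cq eps eps0.
  have /cvgrPdist_lt /(_ _ eps0) := cq.
  move=> /nbhs_ballP[r r0 hr].
  pose N := `|c| + `|e| + 1.
  have N0 : 0 < N by rewrite ltr_wpDl// addr_ge0.
  exists (r / N); first by rewrite divr_gt0.
  move=> xi eta h /andP[h0 hr'] /andP[xi0 xih] /andP[eta0 etah].
  rewrite distrC; apply: hr; rewrite -ball_normE/=.
  rewrite -addrA opprD addrA subrr add0r normrN.
  apply: (le_lt_trans (ler_normD _ _)); rewrite !normrZ !gtr0_norm//.
  apply: (@le_lt_trans _ _ (h * N)).
    rewrite /N !mulrDr mulr1.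
    have : xi * `|c| <= h * `|c| by rewrite ler_wpM2r// ltW.
    have : eta * `|e| <= h * `|e| by rewrite ler_wpM2r// ltW.
    lra.
  by rewrite -ltr_pdivlMr.
apply/eqP; rewrite -subr_eq0 -normr_le0; apply/ler_addgt0Pr => eps eps0; rewrite add0r.
have e2 : 0 < eps / 2 by rewrite divr_gt0.
have [d1 d10 h1] := near_val _ a b (@Ck_continuous _ _ _ _ _ Cba x) _ e2.
have [d2 d20 h2] := near_val _ b a (@Ck_continuous _ _ _ _ _ Cab x) _ e2.
pose h := Num.min d1 d2 / 2.
have m0 : 0 < Num.min d1 d2 by rewrite lt_min d10.
have h0 : 0 < h by rewrite divr_gt0.
have hd1 : 0 < h < d1 by rewrite h0/= (@lt_le_trans _ _ (Num.min d1 d2)) ?ge_min ?lexx// /h; lra.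
have hd2 : 0 < h < d2 by rewrite h0/= (@lt_le_trans _ _ (Num.min d1 d2)) ?ge_min ?lexx ?orbT// /h; lra.
have [xi [eta [i1 i2 E1]]] := mv a b h h0.
have [xi' [eta' [i3 i4 E2]]] := mv b a h h0.
have {h1}h1 := h1 _ _ _ hd1 i1 i2; have {h2}h2 := h2 _ _ _ hd2 i3 i4.
have E : 'D_b (fun y => 'D_a f y) (x + xi *: a + eta *: b) = 'D_a (fun y => 'D_b f y) (x + xi' *: b + eta' *: a).
  apply: (@mulfI _ (h * h)); first by rewrite mulf_neq0// gt_eqF.
  rewrite -E1 -E2 [x + h *: b + h *: a]addrAC; exact: double_difference_sym.
rewrite E in h1; exact: close_to_common h1 h2.
Qed.

End schwarz.

(** * A smooth step function *)

Section step_function.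
Context (R : realType).

(** The powers of [x^-1] close the family under differentiation: the derivative of [flat k] is a
    combination of [flat k.+1] and [flat k.+2], so one induction proves all of them smooth. *)
Definition flat (k : nat) (x : R) : R := if 0 < x then x^-1 ^+ k * expR (- x^-1) else 0.

Lemma flat_ge0 k x : 0 <= flat k x.
Proof.
rewrite /flat; case: ifPn => // x0.
by rewrite mulr_ge0 ?expR_ge0// exprn_ge0// invr_ge0 ltW.
Qed.

(** With [n = k + 2], the exponential of [x^-1] is at least [(x^-1 / n) ^+ n], which beats
    [x^-1 ^+ k] by [x ^+ 2]. The square makes the difference quotient at 0 vanish in the limit. *)
Lemma flat_le k : exists2 C, 0 <= C & forall x, flat k x <= C * x ^+ 2.
Proof.
pose n := k.+2; exists (n%:R ^+ n) => [|x]; first by rewrite exprn_ge0.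
rewrite /flat; case: ifPn => [x0|_]; last by rewrite mulr_ge0 ?sqr_ge0// exprn_ge0.
have n0 : 0 < n%:R :> R by rewrite ltr0n.
have h : (x^-1 / n%:R) ^+ n <= expR (x^-1).
  have -> : expR x^-1 = expR (x^-1 / n%:R) ^+ n.
    by rewrite -expRM_natl mulrC divfK// gt_eqF.
  rewrite lerXn2r ?nnegrE ?expR_ge0 ?divr_ge0 ?invr_ge0 ?ltW//.
  by apply: lt_le_trans (expR_ge1Dx _); rewrite ltrDr.
have xn : 0 < (x^-1 / n%:R) ^+ n by rewrite exprn_gt0// divr_gt0// invr_gt0.
rewrite expRN; apply: (@le_trans _ _ (x^-1 ^+ k * ((x^-1 / n%:R) ^+ n)^-1)).
  apply: ler_wpM2l; first by rewrite exprn_ge0// invr_ge0 ltW.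
  by rewrite lef_pV2 ?posrE ?expR_gt0.
rewrite -exprVn invf_div invrK exprMn mulrCA; apply: ler_wpM2l.
  by rewrite exprn_ge0// ltW.
by rewrite /n -addn2 exprD mulrA -exprMn mulVf ?gt_eqF// expr1n mul1r.
Qed.

Lemma is_derive_flat k (x : R) :
  is_derive x (1 : R) (flat k) (- k%:R * flat k.+1 x + flat k.+2 x).
Proof.
have [x0|x0|->] := ltgtP x 0.
- have -> : - k%:R * flat k.+1 x + flat k.+2 x = 0.
    by rewrite /flat !(ltNge 0) (ltW x0)/= mulr0 addr0.
  have hn : \near x, (fun=> 0 : R) x = flat k x.
    by near=> y; rewrite /flat ltNge ltW//; near: y; exact: lt_nbhsl.
  exact: near_eq_is_derive hn (is_derive_cst _ _ _).
- have xn0 : x != 0 by rewrite gt_eqF.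
  have d1 : is_derive x (1 : R) (fun y : R => y^-1) (- x^-1 ^+ 2).
    have := @is_deriveV _ (fun y : R => y) x 1 1 xn0 (is_derive_id _ _).
    by rewrite /GRing.scale/= mulr1 exprVn.
  have d2 : is_derive x (1 : R) (fun y : R => - y^-1) (x^-1 ^+ 2).
    by have := is_deriveN d1; rewrite opprK.
  have d3 := @is_derive1_comp R expR (fun y => - y^-1) x _ _ (is_derive_expR (- x^-1)) d2.
  have dk (m : nat) : is_derive x (1 : R) (fun y : R => y^-1 ^+ m) (- m%:R * x^-1 ^+ m.+1).
    elim: m => [|m IH].
      by under eq_fun do rewrite expr0; rewrite oppr0 mul0r; exact: is_derive_cst.
    under eq_fun do rewrite exprS.
    have := is_deriveM d1 IH; rewrite /GRing.scale/=.
    have -> : x^-1 * (- m%:R * x^-1 ^+ m.+1) + x^-1 ^+ m * - x^-1 ^+ 2 = - m.+1%:R * x^-1 ^+ m.+2.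
      by rewrite -natr1 !exprS expr0; ring.
    by [].
  have := is_deriveM (dk k) d3; rewrite /GRing.scale/= => d4.
  have hn : \near x, (fun y : R => y^-1 ^+ k * expR (- y^-1)) x = flat k x.
    by near=> y; rewrite /flat ifT//; near: y; exact: lt_nbhsr.
  have -> : - k%:R * flat k.+1 x + flat k.+2 x =
     x^-1 ^+ k * (expR (- x^-1) * x^-1 ^+ 2) + expR (- x^-1) * (- k%:R * x^-1 ^+ k.+1).
    by rewrite /flat x0 !exprS expr0; ring.
  exact: near_eq_is_derive hn d4.
- have -> : - k%:R * flat k.+1 0 + flat k.+2 0 = 0 by rewrite /flat ltxx mulr0 addr0.
  have [C C0 hC] := flat_le k.
  have f0 : flat k 0 = 0 by rewrite /flat ltxx.
  have cv : (fun h : R => h^-1 *: ((flat k \o shift 0) (h *: (1 : R)) - flat k 0)) @ 0^' --> (0 : R).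
    apply/cvgrPdist_le => e e0; near=> h.
    have h0 : h != 0 by near: h; exact: nbhs_dnbhs_neq.
    rewrite /= addr0 f0 subr0 sub0r normrN /GRing.scale/= mulr1 normrM normfV.
    rewrite ler_pdivrMl ?normr_gt0// ger0_norm ?flat_ge0//.
    apply: (le_trans (hC h)); rewrite -[h ^+ 2]real_normK ?num_real// expr2 mulrCA.
    rewrite ler_wpM2l//.
    apply: (@le_trans _ _ ((C + 1) * `|h|)); first by rewrite ler_wpM2r// lerDl.
    rewrite mulrC -ler_pdivlMr ?ltr_wpDl//.
    near: h; apply: dnbhs0_le; rewrite divr_gt0// ltr_wpDl//.
  apply: DeriveDef; first by apply/cvg_ex; exists 0.
  exact: (cvg_lim (@Rhausdorff _) cv).
Unshelve. all: by end_near. Qed.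

Lemma smooth_flat k : smooth (flat k).
Proof.
move=> l; elim: l k => [|l IH] k.
  move=> x; apply: differentiable_continuous; apply/derivable1_diffP.
  by have [] := is_derive_flat k x.
apply: (Ck_real (is_derive_flat k)); apply: CkD; last exact: IH.
by apply: CkM; [exact: Ck_cst|exact: IH].
Qed.

Definition step (x : R) : R := flat 0 x * (flat 0 x + flat 0 (1 - x))^-1.

Lemma flat_gt0 x : 0 < x -> 0 < flat 0 x.
Proof. by move=> x0; rewrite /flat x0 expr0 mul1r expR_gt0. Qed.

Lemma flat_eq0 x : x <= 0 -> flat 0 x = 0.
Proof. by move=> x0; rewrite /flat ltNge x0. Qed.

Lemma step_den x : 0 < flat 0 x + flat 0 (1 - x).
Proof.
have [x0|x0] := ltP 0 x; first by rewrite ltr_pwDl ?flat_gt0 ?flat_ge0.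
by rewrite ltr_wpDl ?flat_ge0// flat_gt0// subr_gt0 (le_lt_trans x0).
Qed.

Lemma step01 x : 0 <= step x <= 1.
Proof.
rewrite /step mulr_ge0 ?flat_ge0 ?invr_ge0 ?(ltW (step_den x))//=.
by rewrite ler_pdivrMr ?step_den// mul1r lerDl flat_ge0.
Qed.

Lemma step_le0 x : x <= 0 -> step x = 0.
Proof. by move=> x0; rewrite /step flat_eq0// mul0r. Qed.

Lemma step_ge1 x : 1 <= x -> step x = 1.
Proof.
move=> x1; have h := step_den x; move: h; rewrite /step.
rewrite [flat 0 (1 - x)]flat_eq0 ?subr_le0// addr0 => h.
by rewrite divff// gt_eqF.
Qed.

Lemma smooth_step : smooth step.
Proof.
move=> k; have h : Ck k (fun x : R => flat 0 (1 - x)).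
  apply: (@Ck_affine R R R R k (flat 0) (fun x => 1 - x) (fun u => - u)).
  - by move=> x; apply: cvgB; [exact: cvg_cst|exact: cvg_id].
  - by move=> u x h; rewrite /GRing.scale/=; ring.
  - exact: smooth_flat.
apply: CkM; first exact: smooth_flat.
apply: CkV; first by move=> x; rewrite gt_eqF// step_den.
by apply: CkD => //; exact: smooth_flat.
Qed.

End step_function.

Lemma two_approx (R : realType) (A B p q d : R) :
  `|A - p| <= d -> `|B - q| <= d -> `|q - p| <= d + d + `|A - B|.
Proof.
move=> h1 h2; have -> : q - p = (A - p) - (B - q) - (A - B) by ring.
apply: (le_trans (ler_normB _ _)); rewrite lerD2r.
by apply: (le_trans (ler_normB _ _)); exact: lerD.
Qed.

(** * Functions of time and a weak criterion for Lipschitz continuity *)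

Section time_interval.
Context (R : realType) (T : R).
Hypothesis hT : 0 < T.
Notation UT := (uniform_prob hT).

(** True without integrability: [fine] sends infinite values to 0 on both sides, and scaling by [T]
    preserves which integrals are infinite. *)
Lemma Rintegral_UT (f : R -> R) : measurable_fun setT f ->
  (\int[lebesgue_measure]_(t in `]0, T[) f t)%R = T * RI UT f.
Proof.
move=> mf; have mEf : measurable_fun setT (EFin \o f) by exact/measurable_EFinP.
have -> : (\int[lebesgue_measure]_(t in `]0, T[) f t)%R = (\int[lebesgue_measure]_(t in `[0, T]) f t)%R.
  rewrite /Rintegral; congr fine.
  rewrite integral_itv_bndo_bndc; last exact: measurable_funTS.
  by rewrite integral_itv_obnd_cbnd//; exact: measurable_funTS.
rewrite /RI /Rintegral integralE [in RHS]integralE.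
rewrite !integral_uniform//; last 2 first.
- exact: measurable_funeneg.
- exact: measurable_funepos.
rewrite subr0.
have key (a b : \bar R) : (0 <= a)%E -> (0 <= b)%E ->
    fine (a - b) = T * fine (T^-1%:E * a - T^-1%:E * b).
  have T'0 : 0 < T^-1 by rewrite invr_gt0.
  case: a b => [a| |] [b| |] //= _ _; rewrite ?gt0_muley ?lte_fin//= ?mulr0//.
  by rewrite -mulrBr mulrA divff ?mul1r// gt_eqF.
by apply: key; apply: integral_ge0.
Qed.

Lemma ae_UT (P : R -> Prop) :
  {ae @lebesgue_measure R, forall t, t \in `]0, T[ -> P t} ->
  {ae UT, forall t : R, (t \in `]0, T[) /\ P t}.
Proof.
move=> aeP.
have dom : UT.-negligible (~` [set t | t \in `]0, T[ -> P t]).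
  have [N [mN N0 PN]] := aeP; exists N; split => //.
  have /null_content_dominatesP := dominates_uniform_prob hT.
  by apply.
have n1 (z : R) : UT.-negligible [set z].
  exists [set z]; split => //.
  have /null_content_dominatesP := dominates_uniform_prob hT.
  by apply => //; exact: lebesgue_measure_set1.
have n2 : UT.-negligible (~` `[0, T]).
  exists (~` `[0, T]); split => //; first exact: measurableC.
  by rewrite /= /uniform_prob integral_uniform_pdf setICl integral_set0.
apply: (@negligibleS _ _ _ UT ((~` `[0, T] `|` [set 0]) `|` ([set T] `|` (~` [set t | t \in `]0, T[ -> P t])))); last first.
  by apply: negligibleU; apply: negligibleU.
move=> x /= h; apply: contrapT => /not_orP[/not_orP[h1 h2] /not_orP[h3 h4]]; apply: h.
move: h1 => /contrapT; rewrite in_itv/= => /andP[x0 x1].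
have xT : x \in `]0, T[.
  rewrite in_itv/=; apply/andP; split; [rewrite lt_neqAle x0 andbT eq_sym|rewrite lt_neqAle x1 andbT]; exact/eqP.
by split => //; move/contrapT : h4; apply.
Qed.

Lemma RI_UT_FTC (f F : R -> R) : continuous f ->
  (forall x : R, is_derive x (1 : R) F (f x)) -> RI UT f = T^-1 * (F T - F 0).
Proof.
move=> cf dF; have mf := continuous_measurable cf.
have := Rintegral_UT mf; rewrite /Rintegral => h.
apply: (@mulfI _ T); first by rewrite gt_eqF.
rewrite -h mulrA divff ?gt_eqF// mul1r.
rewrite integral_itv_bndo_bndc; last by apply: measurable_funTS; exact/measurable_EFinP.
rewrite integral_itv_obnd_cbnd//; last by apply: measurable_funTS; exact/measurable_EFinP.
rewrite (@continuous_FTC2 _ f F)//.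
- exact: continuous_subspaceT.
- have cF : continuous F.
    by move=> x; apply: differentiable_continuous; apply/derivable1_diffP; have [] := dF x.
  split.
  + by move=> x _; have [] := dF x.
  + exact/cvg_at_right_filter/cF.
  + exact/cvg_at_left_filter/cF.
- by move=> x _; rewrite derive1E; have [_ ->] := dF x.
Qed.

Definition dstep (x : R) : R := 'D_1 (@step R) x.

Lemma is_derive_step (x : R) : is_derive x (1 : R) (@step R) (dstep x).
Proof. by apply: DeriveDef => //; have [_ /(_ 1)[]] := @smooth_step R 1. Qed.

Lemma continuous_dstep : continuous dstep.
Proof. by have [_ /(_ 1)[_]] := @smooth_step R 1. Qed.

(** Outside [0, 1] the step is locally constant; at 0 and 1 the derivative vanishes by
    continuity. *)
Lemma dstep_out (x : R) : x <= 0 \/ 1 <= x -> dstep x = 0.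
Proof.
suff h (z : R) : z < 0 \/ 1 < z -> dstep z = 0.
  have cl (z : R) (A : set R) : (forall e, 0 < e -> exists2 w, `|z - w| < e & A w) -> (forall w, A w -> dstep w = 0) -> dstep z = 0.
    move=> near hA; apply/eqP; rewrite -normr_le0; apply/ler_addgt0Pr => e e0; rewrite add0r.
    have /cvgrPdist_le /(_ _ e0) /nbhs_ballP[r r0 hr] := @continuous_dstep z.
    have [w zw Aw] := near r r0.
    by have := hr w zw; rewrite /= (hA w Aw) subr0.
  case=> [x0|x1].
    apply: (cl x [set w | w < 0]) => [e e0|w w0]; last by apply: h; left.
    exists (x - e / 2); last by rewrite /=; lra.
    by rewrite opprB addrC subrK gtr0_norm; lra.
  apply: (cl x [set w | 1 < w]) => [e e0|w w0]; last by apply: h; right.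
  exists (x + e / 2); last by rewrite /=; lra.
  by rewrite opprD addrA subrr add0r normrN gtr0_norm; lra.
case=> hz; rewrite /dstep.
  rewrite (@near_eq_derive _ _ _ (@step R) (fun=> 0) z 1); first exact: derive_cst.
  near=> y; apply: step_le0; apply: ltW; near: y; exact: lt_nbhsl.
rewrite (@near_eq_derive _ _ _ (@step R) (fun=> 1) z 1); first exact: derive_cst.
near=> y; apply: step_ge1; apply: ltW; near: y; exact: lt_nbhsr.
Unshelve. all: by end_near. Qed.

Lemma dstep_bounded : exists2 M : R, 0 < M & forall x, `|dstep x| <= M.
Proof.
have c1 : {within `[0, 1], continuous (fun x => `|dstep x|)}.
  apply: continuous_subspaceT => x; apply: continuous_comp; first exact: continuous_dstep.
  exact: norm_continuous.
have [c c01 hc] := EVT_max (@ler01 R) c1.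
exists (`|dstep c| + 1); first by rewrite ltr_wpDl.
move=> x; have [/hc h|nx] := boolP (x \in `[0, 1]); first by rewrite (le_trans h)// lerDl.
rewrite dstep_out ?normr0 ?addr_ge0//; move: nx; rewrite in_itv/= negb_and -!ltNge.
by case/orP => /ltW; [left|right].
Qed.

(* [ramp e s] rises from 0 to 1 on [s, s + e]; its derivative is an approximate
   identity at [s]. *)
Definition ramp (e s t : R) : R := step ((t - s) / e).
Definition dramp (e s t : R) : R := e^-1 * dstep ((t - s) / e).

Lemma is_derive_ramp (e s t : R) : e != 0 -> is_derive t (1 : R) (ramp e s) (dramp e s t).
Proof.
move=> e0; have AE (h : R) : (h *: (1 : R) + t - s) / e = h *: (e^-1 : R) + (t - s) / e.
  by rewrite /GRing.scale/=; field.
have [h1 h2] := @derive_affine R R R R (@step R) (fun t => (t - s) / e) (fun=> e^-1) 1 t AE.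
have [h3 h4] := derive_real (e^-1) (is_derive_step ((t - s) / e)).
by apply: DeriveDef; [exact: h1|rewrite h2 h4].
Qed.

Lemma smooth_ramp (e s : R) : e != 0 -> smooth (ramp e s).
Proof.
move=> e0 k; apply: (@Ck_affine R R R R k (@step R) (fun t => (t - s) / e) (fun u => u / e)).
- move=> t; apply: cvgM; last exact: cvg_cst.
  by apply: cvgB; [exact: cvg_id|exact: cvg_cst].
- by move=> u x h; rewrite /GRing.scale/=; field.
- exact: smooth_step.
Qed.

Lemma continuous_dramp (e s : R) : continuous (dramp e s).
Proof.
move=> t; apply: cvgM; first exact: cvg_cst.
apply: continuous_comp; last exact: continuous_dstep.
apply: cvgM; last exact: cvg_cst.
by apply: cvgB; [exact: cvg_id|exact: cvg_cst].
Qed.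

Lemma UT_itv (s t : R) : 0 <= s -> s <= t -> t <= T -> RI UT (fun x => \1_(`[s, t]) x) = T^-1 * (t - s).
Proof.
move=> s0 st tT; apply: (@mulfI _ T); first by rewrite gt_eqF.
have m1 : measurable_fun setT (fun x : R => \1_(`[s, t]) x : R) by exact: measurable_indic.
rewrite -Rintegral_UT// mulrA divff ?gt_eqF// mul1r /Rintegral.
rewrite integral_itv_bndo_bndc; last by apply: measurable_funTS; exact/measurable_EFinP.
rewrite integral_itv_obnd_cbnd//; last by apply: measurable_funTS; exact/measurable_EFinP.
rewrite integral_indic//= setIidl.
  rewrite lebesgue_measure_itv /= lte_fin.
  by move: st; rewrite le_eqVlt => /orP[/eqP->|->]; rewrite ?ltxx ?subrr.
by move=> x /=; rewrite !in_itv/= => /andP[sx xt]; rewrite (le_trans s0)//= (le_trans xt).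
Qed.

Lemma RI_ramp (a : R -> R) (s : R) : continuous a -> 0 <= s < T ->
  forall d, 0 < d -> exists2 e0, 0 < e0 & forall e, 0 < e < e0 ->
   s + e < T /\ `|T * RI UT (fun t => a t * dramp e s t) - a s| <= d.
Proof.
move=> ca /andP[s0 sT] d d0; have [M M0 hM] := dstep_bounded.
have dM : 0 < d / M by rewrite divr_gt0.
have /cvgrPdist_le /(_ _ dM) /nbhs_ballP[r r0 hr] := ca s.
exists (Num.min r (T - s)); first by rewrite lt_min r0 subr_gt0.
move=> e /andP[e0]; rewrite lt_min => /andP[er eT].
split; first lra.
have en0 : e != 0 by rewrite gt_eqF.
have cd := @continuous_dramp e s.
have md := continuous_measurable cd.
have ma := continuous_measurable ca.
have dr_out t : t \notin `[s, s + e] -> dramp e s t = 0.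
  move=> ht; rewrite /dramp dstep_out ?mulr0//; move: ht; rewrite in_itv/= negb_and -!ltNge.
  case/orP => h; [left|right].
    by rewrite pmulr_lle0 ?invr_gt0//; lra.
  by rewrite ler_pdivlMr//; lra.
have dr_bd t : `|dramp e s t| <= e^-1 * M * \1_(`[s, s + e]) t.
  have [tin|tout] := boolP (t \in `[s, s + e]).
    rewrite indicE mem_set// mulr1 /dramp normrM gtr0_norm ?invr_gt0//.
    by rewrite ler_wpM2l// invr_ge0 ltW.
  rewrite dr_out// normr0 indicE memNset ?mulr0//; exact/negP.
have ii : integ UT (fun t => e^-1 * M * \1_(`[s, s + e]) t).
  apply: integZ; apply: (@integ_bdd _ _ _ _ _ 1); first exact: measurable_indic.
  by move=> x; rewrite indicE; case: (_ \in _); rewrite ?normr1 ?normr0.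
have id : integ UT (dramp e s) by exact: integ_le ii.
have I1 : T * RI UT (dramp e s) = 1.
  rewrite (RI_UT_FTC cd (fun t => is_derive_ramp s t en0)) mulrA divff ?gt_eqF// mul1r.
  rewrite /ramp step_ge1; last by rewrite ler_pdivlMr//; lra.
  by rewrite step_le0 ?subr0// pmulr_lle0 ?invr_gt0//; lra.
have diff t : `|a t * dramp e s t - a s * dramp e s t| <= (d / M) * (e^-1 * M * \1_(`[s, s + e]) t).
  rewrite -mulrBl normrM; have [tin|tout] := boolP (t \in `[s, s + e]).
    apply: ler_pM => //.
    rewrite distrC; apply: hr; rewrite /ball/=.
    move: tin; rewrite in_itv/= => /andP[t1 t2]; rewrite distrC ger0_norm; lra.
  rewrite dr_out// normr0 mulr0 mulr_ge0 ?(ltW dM)// mulr_ge0//.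
  by rewrite mulr_ge0 ?invr_ge0 ?(ltW e0) ?(ltW M0).
have iD : integ UT (fun t => a t * dramp e s t - a s * dramp e s t).
  apply: (@integ_le _ _ _ UT _ _ _ diff); last exact: integZ.
  by apply: measurable_funB; apply: measurable_funM.
have ia : integ UT (fun t => a t * dramp e s t).
  have := integD iD (integZ (a s) id); congr integ; apply/funext => t.
  by rewrite subrK.
have -> : T * RI UT (fun t => a t * dramp e s t) - a s = T * RI UT (fun t => a t * dramp e s t - a s * dramp e s t).
  rewrite RIB//; last exact: integZ.
  by rewrite RIZ// mulrBr [T * (a s * _)]mulrCA I1 mulr1.
rewrite normrM gtr0_norm//; apply: (@le_trans _ _ (T * ((d / M) * (e^-1 * M * (T^-1 * e))))).
  rewrite ler_pM2l//; apply: (le_trans (RI_abs iD)).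
  apply: (@le_trans _ _ (RI UT (fun t => (d / M) * (e^-1 * M * \1_(`[s, s + e]) t)))).
    by apply: RI_le => //; [exact: integ_abs|exact: integZ].
  rewrite RIZ//; rewrite RIZ; last first.
    apply: (@integ_bdd _ _ _ _ _ 1); first exact: measurable_indic.
    by move=> x; rewrite indicE; case: (_ \in _); rewrite ?normr1 ?normr0.
  by rewrite UT_itv//; [rewrite addrAC subrr add0r|lra|lra].
rewrite le_eqVlt; apply/orP; left; apply/eqP; field.
by rewrite !gt_eqF.
Qed.

(** The test function is the ramp at [s] minus the ramp at [t]: its derivative approximates the
    difference of the point masses at [s] and [t], and its L^1 norm tends to [t - s]. It vanishes at
    0, which removes initial data from the equations, and near [T]; this gives the estimate for
    interior times only, and continuity of [a] adds the endpoints. *)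
Lemma time_lipschitz (a : R -> R) (L : R) : continuous a -> 0 <= L ->
  (forall th : R -> R, smooth th -> (exists2 b, b < T & forall t, b <= t -> th t = 0) ->
     th 0 = 0 -> (forall t, `|th t| <= 1) ->
     `|T * RI UT (fun t => a t * 'D_1 th t)| <= L * (T * RI UT (fun t => `|th t|))) ->
  forall s t, 0 <= s -> s <= t -> t <= T -> `|a t - a s| <= L * (t - s).
Proof.
move=> ca L0 hth.
have inner (s t : R) : 0 < s -> s < t -> t < T -> `|a t - a s| <= L * (t - s).
  move=> s0 st tT; apply/ler_addgt0Pr => d d0.
  (* The total error is [d'] for each of the two ramps and [L * e <= L * d'] for their width. *)
  pose d' := d / (2 + L); have d'0 : 0 < d' by rewrite divr_gt0// ltr_wpDr.
  have [|e1 e10 h1] := @RI_ramp a s ca _ d' d'0; first by apply/andP; split; lra.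
  have [|e2 e20 h2] := @RI_ramp a t ca _ d' d'0; first by apply/andP; split; lra.
  pose e := Num.min d' (Num.min e1 e2) / 2.
  have m0 : 0 < Num.min d' (Num.min e1 e2) by rewrite !lt_min d'0 e10.
  have e0 : 0 < e by rewrite divr_gt0.
  have em : e < Num.min d' (Num.min e1 e2) by rewrite /e; lra.
  move: em; rewrite !lt_min => /and3P[ed' ee1 ee2].
  have [sT {}h1] : s + e < T /\ _ := h1 e (introT andP (conj e0 ee1)).
  have [teT {}h2] : t + e < T /\ _ := h2 e (introT andP (conj e0 ee2)).
  have en0 : e != 0 by rewrite gt_eqF.
  pose th x := ramp e s x - ramp e t x.
  have dth (x : R) : 'D_1 th x = dramp e s x - dramp e t x.
    have i1 := is_derive_ramp s x en0; have i2 := is_derive_ramp t x en0.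
    by have [_] := is_deriveB i1 i2.
  have th_in x : `|th x| <= \1_(`[s, t + e]) x.
    have /andP[r1 r2] := step01 ((x - s) / e); have /andP[r3 r4] := step01 ((x - t) / e).
    have [xin|xout] := boolP (x \in `[s, t + e]).
      by rewrite indicE mem_set//= ler_norml /th /ramp; apply/andP; split; lra.
    rewrite indicE memNset ?(negP xout)//=; last exact/negP.
    rewrite normr_le0; apply/eqP; rewrite /th /ramp.
    move: xout; rewrite in_itv/= negb_and -!ltNge => /orP[xs|xt].
      by rewrite !step_le0 ?subrr// pmulr_lle0 ?invr_gt0//; lra.
    by rewrite !step_ge1 ?subrr// ler_pdivlMr//; lra.
  have th_smooth : smooth th.
    move=> k; have := CkD (@smooth_ramp e s en0 k) (CkZ (-1) (@smooth_ramp e t en0 k)).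
    by congr Ck; apply/funext => x; rewrite /th scaleN1r.
  have th_end : exists2 b, b < T & forall x, b <= x -> th x = 0.
    exists (t + e) => // x hx; rewrite /th /ramp !step_ge1 ?subrr// ler_pdivlMr//; lra.
  have th0 : th 0 = 0.
    by rewrite /th /ramp !step_le0 ?subrr// pmulr_lle0 ?invr_gt0//; lra.
  have th1 x : `|th x| <= 1.
    by apply: (le_trans (th_in x)); rewrite indicE; case: (_ \in _).
  have := hth th th_smooth th_end th0 th1.
  have mth : measurable_fun setT th := continuous_measurable (th_smooth 0%N).
  have iind : integ UT (fun x => \1_(`[s, t + e]) x).
    apply: (@integ_bdd _ _ _ _ _ 1); first exact: measurable_indic.
    by move=> x; rewrite indicE; case: (_ \in _); rewrite ?normr1 ?normr0.
  have ith : integ UT th by exact: (@integ_le _ _ _ UT _ _ mth th_in iind).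
  have I1 : T * RI UT (fun x => `|th x|) <= t + e - s.
    rewrite mulrC -ler_pdivlMr//; apply: (@le_trans _ _ (RI UT (fun x => \1_(`[s, t + e]) x))).
      by apply: RI_le => //; exact: integ_abs.
    by rewrite UT_itv 1?mulrC//; lra.
  have ia (z : R) : integ UT (fun x => a x * dramp e z x).
    apply/integrableP; split.
      apply/measurable_EFinP; apply: measurable_funM; apply: continuous_measurable => //.
      exact: continuous_dramp.
    rewrite integral_uniform//=; last first.
      apply/measurable_EFinP; apply: measurableT_comp => //.
      apply: measurable_funM; apply: continuous_measurable => //.
      exact: continuous_dramp.
    have : (@lebesgue_measure R).-integrable `[0, T] (EFin \o (fun x => a x * dramp e z x)).
      apply: continuous_compact_integrable; first exact: segment_compact.
      apply: continuous_subspaceT => x; apply: cvgM; [exact: ca|exact: continuous_dramp].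
    by move=> /integrableP[_ h]; rewrite lte_mul_pinfty// ?lee_fin ?invr_ge0 ?subr0 ?ltW.
  under eq_RI do rewrite dth mulrBr.
  rewrite RIB// mulrBr => h3.
  have h4 : L * (T * RI UT (fun x => `|th x|)) <= L * (t + e - s) by rewrite ler_wpM2l.
  have ed : (2 + L) * d' = d by rewrite /d' mulrC divfK// gt_eqF// ltr_wpDr.
  have Le : L * e <= L * d' by rewrite ler_wpM2l// ltW.
  apply: (le_trans (two_approx h1 h2)).
  apply: (@le_trans _ _ (d' + d' + L * (t + e - s))).
    by rewrite lerD2l; apply: le_trans h3 h4.
  have -> : L * (t + e - s) = L * (t - s) + L * e by ring.
  lra.
(* For the closed interval, [s] and [t] are both moved inwards by a small [r], within the modulus of
   continuity of [a]. *)
move=> s t s0 st tT.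
apply/ler_addgt0Pr => d d0; have d4 : 0 < d / 4 by rewrite divr_gt0.
have /cvgrPdist_le /(_ _ d4) /nbhs_ballP[r1 r10 hr1] := ca s.
have /cvgrPdist_le /(_ _ d4) /nbhs_ballP[r2 r20 hr2] := ca t.
have [->|sn] := eqVneq s t; first by rewrite !subrr normr0 mulr0 add0r ltW.
have st' : s < t by rewrite lt_neqAle sn.
pose r := Num.min (Num.min r1 r2) (t - s) / 4.
have m0 : 0 < Num.min (Num.min r1 r2) (t - s) by rewrite !lt_min r10 r20 subr_gt0.
have r0 : 0 < r by rewrite divr_gt0.
have : r * 4 <= Num.min (Num.min r1 r2) (t - s) by rewrite /r divfK.
rewrite !le_min => /andP[/andP[rr1 rr2] rts].
have h0 : `|a (t - r) - a (s + r)| <= L * (t - r - (s + r)) by apply: inner; lra.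
have h1 : `|a s - a (s + r)| <= d / 4.
  by apply: hr1; rewrite /ball/= opprD addrA subrr add0r normrN gtr0_norm//; lra.
have h2 : `|a t - a (t - r)| <= d / 4.
  by apply: hr2; rewrite /ball/= opprB addrC subrK gtr0_norm//; lra.
have -> : a t - a s = (a t - a (t - r)) + (a (t - r) - a (s + r)) - (a s - a (s + r)) by ring.
apply: (le_trans (ler_normB _ _)); apply: (@le_trans _ _ ((d/4 + L * (t - r - (s + r))) + d/4)).
  apply: lerD => //; apply: (le_trans (ler_normD _ _)); exact: lerD.
have : L * (t - r - (s + r)) <= L * (t - s) by rewrite ler_wpM2l//; lra.
lra.
Qed.

End time_interval.

(** * Fourier analysis on the torus *)

Section torus_basis.
Context (R : realType) (n : nat).
Notation X := (n.-tuple R).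
Notation mu := (@torus R n).

(** The modes listed by natural numbers. [pickle_inv] succeeds only on exact codes, so every mode
    occurs at one index and distinct indices are orthogonal; other indices carry the zero
    function. *)
Definition te (m : nat) (x : X) : R :=
  if @pickle_inv (n.-tuple nat) m is Some k then eb k x else 0.

Lemma te_pickle k x : te (pickle k) x = eb k x.
Proof. by rewrite /te pickleK_inv. Qed.

Lemma teP m : (exists k, m = pickle k /\ te m = @eb R n k) \/ te m = fun=> 0.
Proof.
rewrite /te; case E : (pickle_inv m) => [k|]; last by right; apply/funext.
left; exists k; split; last exact/funext.
by have := @pickle_invK (n.-tuple nat) m; rewrite E.
Qed.

Lemma measurable_te m : measurable_fun setT (te m).
Proof. by have [[k [_ ->]]| ->] := teP m; [exact: measurable_eb|exact: measurable_cst]. Qed.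

Lemma te_le m x : `|te m x| <= 2 ^+ n.
Proof.
have [[k [_ ->]]| ->] := teP m; first exact: eb_le.
by rewrite normr0 exprn_ge0.
Qed.

Lemma sqint_te m : sqint mu (te m).
Proof. exact: sqint_bdd (measurable_te m) (te_le m). Qed.

Lemma te_orth m l : m != l -> RI mu (fun x => te m x * te l x) = 0.
Proof.
have [[k [-> ->]]| ->] := teP m; last first.
  by move=> _; under eq_RI do rewrite mul0r; rewrite RI_cst.
have [[k' [-> ->]]| ->] := teP l; last first.
  by move=> _; under eq_RI do rewrite mulr0; rewrite RI_cst.
by rewrite eb_orth; have [->|//] := eqVneq k k'; rewrite eqxx.
Qed.

Lemma te_norm m : RI mu (fun x => te m x ^+ 2) = 1 \/ (forall x, te m x = 0).
Proof.
have [[k [-> ->]]| ->] := teP m; last by right.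
by left; under eq_RI do rewrite expr2; rewrite eb_orth eqxx.
Qed.

Lemma te_complete f : sqint mu f -> (forall m, coef mu te f m = 0) ->
  RI mu (fun x => f x ^+ 2) = 0.
Proof.
move=> sf f0; have h : RI mu (fun x => `|f x|) = 0.
  apply: (torus_complete (sqint_int sf)) => k.
  by rewrite -[RHS](f0 (pickle k)); apply: eq_RI => x; rewrite te_pickle.
have := RI_eq0 (integ_abs (sqint_int sf)) (fun x => normr_ge0 _) h => ae.
rewrite -[RHS](RI_cst mu); apply: ae_RI => //.
  by apply: measurable_funX; exact: sqint_meas sf.
by apply: (ae_imp _ ae) => x /eqP; rewrite normr_eq0 => /eqP ->; rewrite expr0n.
Qed.

(** The mode [eb k] on row vectors, the domain on which test functions and their derivatives
    live. *)
Definition EE (k : n.-tuple nat) (x : 'rV[R]_n) : R :=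
  \prod_(i < n) trig (tnth k i) (x ord0 i).

Lemma EE_vec k (x : X) : EE k (vec x) = eb k x.
Proof. by apply: eq_bigr => i _; rewrite mxE. Qed.

Lemma smooth_EE k : smooth (EE k).
Proof.
move=> l; apply: Ck_prod => i.
apply: (@Ck_affine R _ _ _ l (@trig R (tnth k i)) (fun x : 'rV[R]_n => x ord0 i) (fun u => u ord0 i)).
- exact: coord_continuous.
- by move=> u x h; rewrite !mxE.
- exact: smooth_trig.
Qed.

Lemma periodic_EE k : Defs.periodic (EE k).
Proof.
move=> a x; apply: eq_bigr => i _; rewrite !mxE eqxx/=.
by case: eqP => _; rewrite ?addr0// trig_period.
Qed.

(** Differentiation sends each one-dimensional mode to its partner of the same frequency: [swp]
    exchanges sine and cosine and fixes the constant, and [wfreq] is the signed factor that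
    appears. *)
Definition swp (k : nat) : nat := if k == 0%N then 0%N else if odd k then k.+1 else k.-1.
Definition wfreq (k : nat) : R := (if odd k then 1 else -1) * (2 * pi * (uphalf k)%:R).

Lemma parity_case k : [\/ k = 0%N, exists j, k = j.*2.+1 | exists j, k = j.*2.+2].
Proof.
case: k => [|k]; first by constructor 1.
have := odd_double_half k; case: (odd k) => /= <-.
  by constructor 3; exists k./2.
by constructor 2; exists k./2.
Qed.

Lemma swp_odd j : swp j.*2.+1 = j.*2.+2.
Proof. by rewrite /swp /= odd_double. Qed.

Lemma swp_even j : swp j.*2.+2 = j.*2.+1.
Proof. by rewrite /swp /= odd_double. Qed.

Lemma uphalf_odd j : uphalf j.*2.+1 = j.+1.
Proof. by rewrite /= doubleK. Qed.

Lemma uphalf_even j : uphalf j.*2.+2 = j.+1.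
Proof. by rewrite /= uphalf_double. Qed.

Lemma swpK : involutive swp.
Proof.
move=> k; case: (parity_case k) => [->//|[j ->]|[j ->]].
  by rewrite swp_odd swp_even.
by rewrite swp_even swp_odd.
Qed.

Lemma uphalf_swp k : uphalf (swp k) = uphalf k.
Proof.
case: (parity_case k) => [->//|[j ->]|[j ->]].
  by rewrite swp_odd uphalf_even uphalf_odd.
by rewrite swp_even uphalf_even uphalf_odd.
Qed.

Lemma wfreq_sqr k : wfreq k ^+ 2 = (2 * pi * (uphalf k)%:R) ^+ 2.
Proof. by rewrite /wfreq; case: ifP => _; rewrite ?mul1r ?mulN1r ?sqrrN. Qed.

Lemma is_derive_trig k (x : R) : is_derive x (1 : R) (@trig R k) (wfreq k * trig (swp k) x).
Proof.
case: (parity_case k) => [->|[j ->]|[j ->]].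
- have -> : wfreq 0 * trig (swp 0) x = 0 by rewrite /wfreq /= !mulr0 mul0r.
  exact: is_derive_cst.
- rewrite swp_odd /wfreq uphalf_odd.
  have -> : @trig R j.*2.+1 = Num.sqrt 2 \*: (fun y => sin (tw j.+1 y)).
    by apply/funext => y; rewrite /trig uphalf_odd /= odd_double.
  have -> : @trig R j.*2.+2 x = Num.sqrt 2 * cos (tw j.+1 x).
    by rewrite /trig uphalf_even /= odd_double.
  have := is_deriveZ (Num.sqrt 2) (is_derive_sin_tw j.+1 x).
  by rewrite /= odd_double /= mul1r /GRing.scale/= mulrCA.
- rewrite swp_even /wfreq uphalf_even.
  have -> : @trig R j.*2.+2 = Num.sqrt 2 \*: (fun y => cos (tw j.+1 y)).
    by apply/funext => y; rewrite /trig uphalf_even /= odd_double.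
  have -> : @trig R j.*2.+1 x = Num.sqrt 2 * sin (tw j.+1 x).
    by rewrite /trig uphalf_odd /= odd_double.
  have := is_deriveZ (Num.sqrt 2) (is_derive_cos_tw j.+1 x).
  by rewrite /= odd_double /= mulN1r mulNr /GRing.scale/= mulrN mulrCA.
Qed.

Definition tswp (a : 'I_n) (k : n.-tuple nat) : n.-tuple nat :=
  [tuple (if i == a then swp (tnth k i) else tnth k i) | i < n].

Lemma tswpK a : involutive (tswp a).
Proof.
move=> k; apply: eq_from_tnth => i; rewrite !tnth_mktuple.
by case: eqP => // _; rewrite swpK.
Qed.

Lemma derive_EE (a : 'I_n) (k : n.-tuple nat) (x : 'rV[R]_n) :
  'D_(Defs.basis R a) (EE k) x = wfreq (tnth k a) * EE (tswp a k) x.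
Proof.
have AE (h : R) : (fun r : R => x + r *: Defs.basis R a) (h *: (1 : R) + 0) =
   h *: Defs.basis R a + (fun r : R => x + r *: Defs.basis R a) 0.
  by rewrite /= scale0r !addr0 /GRing.scale/= mulr1 addrC.
have [_] := @derive_affine R R _ R (EE k) (fun r : R => x + r *: Defs.basis R a) (fun=> Defs.basis R a) 1 0 AE.
rewrite scale0r addr0 => <-.
pose C := \prod_(i < n | i != a) trig (tnth k i) (x ord0 i).
have E : (fun r : R => EE k (x + r *: Defs.basis R a)) = (fun r : R => C * trig (tnth k a) (r + x ord0 a)).
  apply/funext => r; rewrite /EE (bigD1 a)//= mulrC; congr (_ * trig _ _); last first.
    by rewrite !mxE !eqxx/= mulr1 addrC.
  apply: eq_bigr => i ia; rewrite !mxE (negbTE ia) andbF mulr0 addr0//.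
rewrite E.
have AE2 (h : R) : (fun r : R => r + x ord0 a) (h *: (1 : R) + 0) = h *: (1 : R) + (fun r : R => r + x ord0 a) 0.
  by rewrite /= addr0 add0r.
have [h1 h2] := @derive_affine R R R R (@trig R (tnth k a)) (fun r : R => r + x ord0 a) (fun=> 1) 1 0 AE2.
have dt := is_derive_trig (tnth k a) (0 + x ord0 a).
have d1 : is_derive (0 : R) (1 : R) (fun r : R => trig (tnth k a) (r + x ord0 a)) (wfreq (tnth k a) * trig (swp (tnth k a)) (0 + x ord0 a)).
  by case: dt => d2 d3; apply: DeriveDef; [exact: h1|rewrite h2].
have [_ ->] := is_deriveZ C d1.
rewrite /GRing.scale/= add0r mulrCA; congr (_ * _).
rewrite /EE [in RHS](bigD1 a)//= tnth_mktuple eqxx mulrC; congr (_ * _).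
by apply: eq_bigr => i ia; rewrite tnth_mktuple (negbTE ia).
Qed.

Notation cf := (coef mu te).

Lemma is_wpd_coef a f g k : is_wpd a f g ->
  wfreq (tnth k a) * RI mu (fun x => f x * eb (tswp a k) x) = - RI mu (fun x => g x * eb k x).
Proof.
move=> [fi gi h]; have := h _ (@smooth_EE k) (@periodic_EE k).
have ifk : integ mu (fun x => f x * eb (tswp a k) x).
  apply: (@integ_le _ _ _ mu _ (fun x => 2 ^+ n * `|f x|)).
  - by apply: measurable_funM; [exact: integ_meas fi|exact: measurable_eb].
  - by move=> x; rewrite normrM mulrC ler_wpM2r// eb_le.
  - by apply: integZ; exact: integ_abs.
under eq_Rintegral do rewrite derive_EE EE_vec mulrCA.
under [X in _ = - X -> _]eq_Rintegral do rewrite EE_vec.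
by rewrite -[X in X = _ -> _]/(RI mu _) RIZ.
Qed.

Lemma is_wpd_coef_sqr a f g k : is_wpd a f g ->
  (2 * pi * (uphalf (tnth k a))%:R) ^+ 2 * cf f (pickle k) ^+ 2 = cf g (pickle (tswp a k)) ^+ 2.
Proof.
move=> fg; have := is_wpd_coef (tswp a k) fg; rewrite tswpK.
rewrite tnth_mktuple eqxx => h.
have -> : cf f (pickle k) = RI mu (fun x => f x * eb k x).
  by apply: eq_RI => x; rewrite te_pickle.
have -> : cf g (pickle (tswp a k)) = RI mu (fun x => g x * eb (tswp a k) x).
  by apply: eq_RI => x; rewrite te_pickle.
by rewrite -[RHS]sqrrN -h [RHS]exprMn wfreq_sqr uphalf_swp.
Qed.

(** Only finitely many multi-indices have all frequencies below [K], so their codes are bounded. *)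
Lemma high_freq K : exists N, forall m k, (N <= m)%N -> m = pickle k ->
  exists a : 'I_n, (K <= uphalf (tnth k a))%N.
Proof.
pose S := [seq pickle [tuple (nat_of_ord (t i)) | i < n] | t : {ffun 'I_n -> 'I_K.*2.+1}].
exists (\max_(m <- S) m).+1 => m k Nm mk; apply: contrapT => h.
have hk i : (tnth k i < K.*2.+1)%N.
  rewrite ltnS leqNgt; apply/negP => Kk; apply: h; exists i.
  by rewrite uphalf_half; have := odd_double_half (tnth k i); lia.
have mS : m \in S.
  apply/mapP; exists [ffun i => Ordinal (hk i)]; first by rewrite mem_enum.
  by rewrite mk; congr pickle; apply: eq_from_tnth => i; rewrite tnth_mktuple ffunE.
have : (m <= \max_(m <- S) m)%N by exact: leq_bigmax_seq.
by rewrite leqNgt Nm.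
Qed.

(** Every mode beyond [N] has frequency at least [K] in some direction [a]. There the squared
    coefficient of [f] is at most [eps] times that of [g a] at the partner mode, and Bessel's
    inequality sums these. [N] depends on [eps] alone, which makes the estimate uniform over
    sequences. *)
Lemma rellich (eps : R) : 0 < eps -> exists N, forall f (g : 'I_n -> X -> R),
  sqint mu f -> (forall a, sqint mu (g a)) -> (forall a, is_wpd a f (g a)) ->
  RI mu (fun x => f x ^+ 2) <=
    \sum_(0 <= m < N) cf f m ^+ 2 + eps * \sum_a RI mu (fun x => g a x ^+ 2).
Proof.
move=> eps0.
(* An integer above [eps^-1] suffices, because [(2 * pi * K) ^+ 2] is at least [K]. *)
pose K := (Num.truncn eps^-1).+1.
have Keps : (2 * pi * K%:R) ^- 2 <= eps.
  have K1 : eps^-1 < K%:R by rewrite real_truncnS_gt// num_real.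
  have p2 : (2 : R) <= pi := pi_ge2 R.
  have K1' : 1 <= K%:R :> R by rewrite ler1n.
  rewrite -[leRHS]invrK lef_pV2 ?posrE ?invr_gt0//; last first.
    by rewrite exprn_gt0// !mulr_gt0 ?ltr0n// pi_gt0.
  apply: (le_trans (ltW K1)); rewrite exprMn.
  have h4 : 1 <= (2 * pi) ^+ 2 :> R by rewrite exprn_ege1//; lra.
  apply: (@le_trans _ _ (K%:R ^+ 2)); first by rewrite expr2 ler_peMr.
  by rewrite ler_peMl// exprn_ge0.
have [N hN] := high_freq K.
exists N => f g sf sg fg.
apply/ler_addgt0Pr => del del0.
have [N' hN'] := fourier_tail sqint_te te_orth te_norm te_complete sf del0.
rewrite pythagoras ?iota_uniq// in hN'; last 3 first.
- exact: sqint_te.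
- exact: te_orth.
- exact: te_norm.
have cf0 m : (forall k : n.-tuple nat, m <> pickle k) -> cf f m = 0.
  move=> nk; have [[k [mk _]]|t0] := teP m; first by have := nk k.
  by rewrite -[RHS](RI_cst mu); apply: eq_RI => x; rewrite t0 mulr0.
have part a : \sum_(N <= m < N' | if pickle_inv m is Some k then (K <= uphalf (tnth (k : n.-tuple nat) a))%N else false) cf f m ^+ 2
   <= eps * RI mu (fun x => g a x ^+ 2).
  (* The code of the partner mode. Its injectivity on the indices selected in [s] is what allows
     Bessel's inequality for [g a]. *)
  pose sig m := if pickle_inv m is Some k then pickle (tswp a (k : n.-tuple nat)) else m.
  pose s := [seq m <- index_iota N N' | if pickle_inv m is Some k then (K <= uphalf (tnth (k : n.-tuple nat) a))%N else false].
  have us : uniq (map sig s).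
    rewrite map_inj_in_uniq ?filter_uniq ?iota_uniq// => m l.
    rewrite !mem_filter /sig; case E1: (pickle_inv m) => [k|//] /=; case E2: (pickle_inv l) => [k'|] //=.
    move=> _ _ /(pcan_inj pickleK) /(inv_inj (tswpK a)) kk.
    have := @pickle_invK (n.-tuple nat) m; have := @pickle_invK (n.-tuple nat) l.
    by rewrite E1 E2 /= kk => <- <-.
  have := bessel sqint_te te_orth te_norm (sg a) us.
  rewrite big_map => /(ler_wpM2l (ltW eps0)); apply: le_trans.
  have -> (G : nat -> R) : \sum_(N <= m < N' | if pickle_inv m is Some k then (K <= uphalf (tnth (k : n.-tuple nat) a))%N else false) G m = \sum_(m <- s) G m.
    by rewrite /s big_filter.
  rewrite big_distrr/= big_seq [leRHS]big_seq; apply: ler_sum => m.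
  rewrite mem_filter /sig; case E: (pickle_inv m) => [k|//] /andP[Kk _].
  have mk : m = pickle k by have := @pickle_invK (n.-tuple nat) m; rewrite E.
  have := is_wpd_coef_sqr k (fg a); rewrite -mk => <-.
  set w := (2 * pi * _) ^+ 2.
  have w1 : 1 <= eps * w.
    have w0 : 0 < (2 * pi * K%:R) ^+ 2 :> R.
      by rewrite exprn_gt0// !mulr_gt0 ?ltr0n// pi_gt0.
    apply: (@le_trans _ _ ((2 * pi * K%:R) ^- 2 * (2 * pi * K%:R) ^+ 2)); first by rewrite mulVf// gt_eqF.
    apply: ler_pM => //; first by rewrite invr_ge0 ltW.
      exact: ltW.
    rewrite lerXn2r ?nnegrE ?mulr_ge0 ?pi_ge0 ?ler0n//.
    by rewrite ler_wpM2l ?ler_nat// mulr_ge0 ?pi_ge0.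
  by rewrite mulrA ler_peMl ?sqr_ge0.
have tail : \sum_(N <= m < N') cf f m ^+ 2 <= eps * \sum_a RI mu (fun x => g a x ^+ 2).
  rewrite big_distrr/=; apply: le_trans (ler_sum _ (fun a _ => part a)).
  rewrite (exchange_big_dep xpredT)//=; rewrite big_nat [leRHS]big_nat; apply: ler_sum => m /andP[Nm mN'].
  case E: (pickle_inv m) => [k|].
    have mk : m = pickle k by have := @pickle_invK (n.-tuple nat) m; rewrite E.
    have [a Ka] := hN m k Nm mk.
    by rewrite (bigD1 a)//= lerDl sumr_ge0// => *; exact: sqr_ge0.
  rewrite big_pred0_eq cf0 ?expr0n//= => k mk.
  by rewrite mk pickleK_inv in E.
have le1 : \sum_(0 <= m < N') cf f m ^+ 2 <= \sum_(0 <= m < N) cf f m ^+ 2 + \sum_(N <= m < N') cf f m ^+ 2.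
  have [NN|/ltnW NN] := leqP N N'; first by rewrite -big_cat_nat.
  rewrite [X in _ + X]big_geq// addr0 [leRHS](@big_cat_nat _ _ _ N')//= lerDl.
  by rewrite sumr_ge0// => *; exact: sqr_ge0.
lra.
Qed.

End torus_basis.

(** * Measurability and integration on the slab *)

Section measurability.
Context (R : realType).

Lemma measurable_countable d (Y : measurableType d) (C : countType) (Z : Y -> C) (G : C -> R) :
  (forall c, measurable [set y | Z y = c]) -> measurable_fun setT (fun y => G (Z y)).
Proof.
move=> mZ _ B mB; rewrite setTI.
have -> : (fun y => G (Z y)) @^-1` B = \bigcup_k
   (if unpickle k is Some c then (if G c \in B then [set y | Z y = c] else set0) else set0).
  apply/seteqP; split => y /=.
    by move=> h; exists (pickle (Z y)) => //; rewrite pickleK mem_set.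
  by case=> k _; case: unpickle => [c|//]; case: ifPn => // /set_mem Gc /= ->.
by apply: bigcup_measurable => k _; case: unpickle => [c|//]; case: ifP.
Qed.

Lemma cvg_mx_entries m n (f : nat -> 'M[R]_(m, n)) (l : 'M[R]_(m, n)) :
  (forall e, 0 < e -> exists N, forall k, (N <= k)%N -> forall i j, `|l i j - f k i j| <= e) ->
  f @ \oo --> l.
Proof.
move=> h; apply/cvgrPdist_le => e e0; have [N hN] := h e e0.
exists N => // k /= /hN hk; rewrite [leLHS]mx_normrE.
apply: bigmax_le => //; first exact: ltW.
by move=> [i j] _; have := hk i j; rewrite !mxE.
Qed.

Lemma measurable_floor_level d (Y : measurableType d) (c : Y -> R) (z : int) :
  measurable_fun setT c -> measurable [set y | Num.floor (c y) = z].
Proof.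
move=> mc.
have -> : [set y | Num.floor (c y) = z] = c @^-1` [set` `[z%:~R, (z + 1)%:~R[ ].
  apply/seteqP; split => y /=; rewrite in_itv/=.
    by move=> <-; rewrite Num.Theory.floor_itv.
  by move=> h; apply/eqP; rewrite Num.Theory.floor_eq.
by rewrite -[X in measurable X]setTI; apply: mc.
Qed.

(** Measurability is given entry by entry. Rounding the entries down to multiples of [1 / (N + 1)]
    leaves countably many matrices, each attained on a measurable set, so any function of the
    rounded matrix is measurable; continuity of [L] gives the limit. *)
Lemma measurable_comp_mx d (Y : measurableType d) m n (L : 'M[R]_(m, n) -> R) (c : Y -> 'M[R]_(m, n)) :
  continuous L -> (forall i j, measurable_fun setT (fun y => c y i j)) ->
  measurable_fun setT (fun y => L (c y)).
Proof.
move=> cL mc.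
pose Z (N : nat) y : 'M[int]_(m, n) := \matrix_(i, j) Num.floor (N.+1%:R * c y i j).
pose G (N : nat) (z : 'M[int]_(m, n)) : 'M[R]_(m, n) := \matrix_(i, j) ((z i j)%:~R / N.+1%:R).
apply: (@measurable_fun_cvg _ _ _ setT (fun N y => L (G N (Z N y)))) => //.
  move=> N; apply: (@measurable_countable _ _ _ (Z N) (fun z => L (G N z))) => z.
  have -> : [set y | Z N y = z] = \bigcap_(i in [set: 'I_m]) \bigcap_(j in [set: 'I_n]) [set y | Num.floor (N.+1%:R * c y i j) = z i j].
    apply/seteqP; split => y /=.
      by move=> <- i _ j _; rewrite /= mxE.
    by move=> h; apply/matrixP => i j; rewrite mxE; exact: h.
  apply: fin_bigcap_measurable => [|i _]; first exact: finite_finset.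
  apply: fin_bigcap_measurable => [|j _]; first exact: finite_finset.
  by apply: measurable_floor_level; exact: measurable_funM.
move=> y _; suff h : (fun N => G N (Z N y)) @ \oo --> c y by exact: (continuous_cvg _ (cL (c y)) h).
apply: cvg_mx_entries => e e0.
exists (Num.truncn e^-1) => N hN i j; rewrite !mxE.
have N0 : 0 < N.+1%:R :> R by rewrite ltr0n.
have := Num.Theory.floor_itv (N.+1%:R * c y i j).
set z := (Num.floor _)%:~R => /andP[z1 z2].
rewrite intrD in z2.
have -> : c y i j - z / N.+1%:R = (N.+1%:R * c y i j - z) / N.+1%:R.
  by rewrite mulrBl [N.+1%:R * _]mulrC mulfK// gt_eqF.
rewrite normrM (gtr0_norm (x := _^-1)) ?invr_gt0// ler_pdivrMr// ger0_norm ?subr_ge0//.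
apply: (@le_trans _ _ 1); first by rewrite lerBlDl ltW.
rewrite -ler_pdivrMl// mulr1; apply: (@le_trans _ _ (Num.truncn e^-1).+1%:R).
  by rewrite ltW// real_truncnS_gt// num_real.
by rewrite ler_nat.
Qed.

Lemma continuous_head_tail n :
  continuous (fun w : 'rV[R]_(1 + n) => (w ord0 (lshift n ord0), rsubmx w)).
Proof.
move=> w; have h1 := @coord_continuous R 1 (1 + n) ord0 (lshift n ord0) w.
have h2 := @continuous_rsubmx R 1 1 n w.
exact: (cvg_pair h1 h2).
Qed.

Lemma measurable_comp_pair d (Y : measurableType d) n (L : R * 'rV[R]_n -> R) (c : Y -> R) (v : Y -> 'rV[R]_n) :
  continuous L -> measurable_fun setT c -> (forall i, measurable_fun setT (fun y => v y ord0 i)) ->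
  measurable_fun setT (fun y => L (c y, v y)).
Proof.
move=> cL mc mv.
pose L' (w : 'rV[R]_(1 + n)) := L (w ord0 (lshift n ord0), rsubmx w).
have -> : (fun y => L (c y, v y)) = fun y => L' (row_mx (c y)%:M (v y)).
  apply/funext => y; rewrite /L' row_mxKr; congr (L (_, _)).
  by rewrite row_mxEl mxE eqxx mulr1n.
apply: (@measurable_comp_mx _ _ _ _ L').
  move=> w; apply: continuous_comp; last exact: cL.
  exact: continuous_head_tail.
move=> i j; rewrite (ord1 i); case: (split_ordP j) => k ->.
  under eq_fun do rewrite row_mxEl (ord1 k) mxE eqxx mulr1n.
  exact: mc.
under eq_fun do rewrite row_mxEr.
exact: mv.
Qed.

Lemma periodic_int n (U : Type) (f : 'rV[R]_n -> U) a (z : int) x :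
  Defs.periodic f -> f (x + z%:~R *: Defs.basis R a) = f x.
Proof.
move=> pf; have pn (m : nat) y : f (y + m%:R *: Defs.basis R a) = f y.
  elim: m => [|m IH]; first by rewrite scale0r addr0.
  by rewrite -natr1 scalerDl scale1r addrA pf.
case: z => m; first exact: pn.
by rewrite NegzE mulrNz scaleNr -[in RHS](subrK (m.+1%:R *: Defs.basis R a) x) pn.
Qed.

Lemma periodic_cell n (U : Type) (f : 'rV[R]_n -> U) x : Defs.periodic f ->
  exists2 y : 'rV[R]_n, f y = f x & forall i, 0 <= y ord0 i <= 1.
Proof.
move=> pf.
have P (j : nat) : (j <= n)%N -> exists2 y : 'rV[R]_n, f y = f x & forall i : 'I_n, (i < j)%N -> 0 <= y ord0 i <= 1.
  elim: j => [_|j IH jn]; first by exists x.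
  have [y fy hy] := IH (ltnW jn); pose a := Ordinal jn.
  exists (y + (- Num.floor (y ord0 a))%:~R *: Defs.basis R a); first by rewrite periodic_int.
  move=> i ij; rewrite !mxE eqxx/=; have [->|ia] := eqVneq i a.
    rewrite mulr1 intrN; have /andP[f1 f2] := Num.Theory.floor_itv (y ord0 a).
    rewrite intrD in f2; apply/andP; split; lra.
  rewrite mulr0 addr0; apply: hy; move: ij; rewrite ltnS leq_eqVlt => /orP[/eqP ij|//].
  by move: ia; rewrite -val_eqE /= ij eqxx.
by have [y fy hy] := P n (leqnn n); exists y => // i; exact: hy.
Qed.

Lemma periodic_bounded n (f : R * 'rV[R]_n -> R) (T : R) : continuous f ->
  (forall t, Defs.periodic (fun x => f (t, x))) ->
  exists2 M, 0 <= M & forall t x, 0 <= t <= T -> `|f (t, x)| <= M.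
Proof.
move=> cf pf.
have [T0|T0] := ltP T 0.
  by exists 0 => // t x /andP[t0 /(le_trans t0)]; rewrite leNgt T0.
(* One compact cube for all coordinates: it contains the time interval in the first and a period
   cell in the others. *)
pose b := Num.max T 1.
pose A := [set v : 'rV[R]_(1 + n) | forall i, `[0, b]%classic (v ord0 i)].
have cA : compact A by apply: (@rV_compact _ _ (fun _ => `[0, b]%classic)) => i; exact: segment_compact.
pose g (w : 'rV[R]_(1 + n)) := `|f (w ord0 (lshift n ord0), rsubmx w)|.
have cg : continuous g.
  have cfg : continuous (fun w : 'rV[R]_(1 + n) => f (w ord0 (lshift n ord0), rsubmx w)).
    move=> w.
    apply: (@continuous_comp _ _ _ (fun w : 'rV[R]_(1 + n) => (w ord0 (lshift n ord0), rsubmx w)) f); last exact: cf.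
    exact: continuous_head_tail.
  move=> w.
  have h := @norm_continuous R R (f (w ord0 (lshift n ord0), rsubmx w)).
  have h2 := cvg_comp _ _ (cfg w) h.
  exact: h2.
have b0 : 0 <= b by rewrite /b le_max T0.
have [||c _ hc] := @EVT_max_rV R (1 + n) g A _ cA.
- by exists 0 => i; rewrite /= mxE in_itv/= lexx.
- exact: continuous_subspaceT.
exists (g c); first exact: normr_ge0.
move=> t x /andP[t0 tT]; have [y fy hy] := periodic_cell x (pf t).
rewrite -fy; have := hc (row_mx t%:M y) _; rewrite /g row_mxKr row_mxEl mxE eqxx mulr1n; apply.
rewrite inE => i; rewrite /= in_itv/=; case: (split_ordP i) => k ->.
  by rewrite row_mxEl (ord1 k) mxE eqxx mulr1n t0/= /b le_max tT.
rewrite row_mxEr; have /andP[-> /= h] := hy k.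
by rewrite /b le_max h orbT.
Qed.

End measurability.

(** * Integrals of functions not assumed measurable *)

Section ae_integrals.
Local Open Scope ereal_scope.
Context d (T : measurableType d) (R : realType) (mu : {measure set T -> \bar R}).
Import HBNNSimple.

Lemma aeS (P Q : T -> Prop) : (forall x, P x -> Q x) ->
  {ae mu, forall x, P x} -> {ae mu, forall x, Q x}.
Proof. by move=> PQ; apply: filterS. Qed.

Lemma ge0_integral_ae_le (f g : T -> \bar R) : (forall x, 0 <= f x) -> (forall x, 0 <= g x) ->
  {ae mu, forall x, f x <= g x} -> \int[mu]_x f x <= \int[mu]_x g x.
Proof.
move=> f0 g0 [N [mN N0 hN]]; rewrite [leLHS]ge0_integralTE// [leRHS]ge0_integralTE//.
apply: ge_ereal_sup => _ [h /= hf <-].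
have mC : measurable (~` N) by exact: measurableC.
apply: ereal_sup_ubound; exists (proj_nnsfun h mC) => /=.
  move=> x; rewrite mindicE; have [xN|xN] := boolP (x \in ~` N); last by rewrite mulr0.
  rewrite mulr1; apply: le_trans (hf x) _.
  by apply: contrapT => nle; move: xN; rewrite inE/=; apply; exact: hN.
have sE (k : {nnsfun T >-> R}) : sintegral mu k = \int[mu]_x (k x)%:E.
  by rewrite integral_nnsfun// patch_setT.
transitivity (sintegral mu (proj_nnsfun h mC)); first by [].
rewrite !sE; apply: ae_eq_integral => //.
- exact/measurable_EFinP.
- exact/measurable_EFinP.
exists N; split => // x /= hx; apply: contrapT => xN; apply: hx => _.
by rewrite mindicE mem_set// mulr1.
Qed.

(* No measurability is assumed: the integral of a nonnegative function is a
   supremum over the simple functions below it, which may be cut off on a null set. *)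
Lemma ae_integral_eq D (f g : T -> \bar R) : {ae mu, forall x, D x -> f x = g x} ->
  \int[mu]_(x in D) f x = \int[mu]_(x in D) g x.
Proof.
move=> fg; rewrite [LHS]integral_mkcond [RHS]integral_mkcond.
have {}fg : {ae mu, forall x, (f \_ D) x = (g \_ D) x}.
  move: fg; apply: filterS => x h; rewrite /patch; case: ifP => //.
  by rewrite inE => /h.
rewrite [LHS]integralE [RHS]integralE; congr (_ - _); apply/eqP; rewrite eq_le;
  apply/andP; split; apply: ge0_integral_ae_le; do ?[exact: funepos_ge0|exact: funeneg_ge0];
  by move: fg; apply: filterS => x; rewrite ?funeposE ?funenegE => ->.
Qed.

Lemma ae_integral_le D (f g : T -> \bar R) : (forall x, D x -> 0 <= f x) -> (forall x, D x -> 0 <= g x) ->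
  {ae mu, forall x, D x -> f x <= g x} ->
  \int[mu]_(x in D) f x <= \int[mu]_(x in D) g x.
Proof.
move=> f0 g0 fg; rewrite [leLHS]integral_mkcond [leRHS]integral_mkcond.
apply: ge0_integral_ae_le.
- by move=> x; rewrite /patch; case: ifP => //; rewrite inE => /f0.
- by move=> x; rewrite /patch; case: ifP => //; rewrite inE => /g0.
- by move: fg; apply: filterS => x h; rewrite /patch; case: ifP => //; rewrite inE => /h.
Qed.

End ae_integrals.

Lemma measurable_RI d d' (Y : measurableType d) (X : measurableType d') (R : realType)
    (mu : probability X R) (f : Y * X -> R) : measurable_fun setT f ->
  measurable_fun setT (fun y => RI mu (fun x => f (y, x))).
Proof.
move=> mf; apply: measurableT_comp => //.
have mEf : measurable_fun setT (EFin \o f) by exact/measurable_EFinP.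
under eq_fun do rewrite integralE.
apply: emeasurable_funB.
  have h := @measurable_fun_fubini_tonelli_F _ _ Y X R mu (fun z => (EFin \o f)^\+ z)%E (measurable_funepos mEf).
  have h0 z : (0 <= (EFin \o f)^\+ z)%E by exact: funepos_ge0.
  congr (measurable_fun setT _): (h h0); apply/funext => y.
  by apply: eq_integral => x _; rewrite !funeposE.
have h := @measurable_fun_fubini_tonelli_F _ _ Y X R mu (fun z => (EFin \o f)^\- z)%E (measurable_funeneg mEf).
have h0 z : (0 <= (EFin \o f)^\- z)%E by exact: funeneg_ge0.
congr (measurable_fun setT _): (h h0); apply/funext => y.
by apply: eq_integral => x _; rewrite !funenegE.
Qed.

Section spacetime.
Context (R : realType) (n : nat) (T : R).
Hypothesis hT : 0 < T.
Notation UT := (uniform_prob hT).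
Notation X := (n.-tuple R).
Notation mu := (@torus R n).

Definition jms (h : R -> X -> R) : Prop :=
  measurable_fun setT (fun z : measurableTypeR R * X => h z.1 z.2).

Lemma jms_slice h t : jms h -> measurable_fun setT (h t).
Proof. by move=> mh; exact: (measurableT_comp mh (pair1_measurable t)). Qed.

Lemma jms_RI h : jms h -> measurable_fun setT (fun t => RI mu (h t)).
Proof. exact: (@measurable_RI _ _ (measurableTypeR R) X R mu). Qed.

(** The integrand may contain weak derivatives that are not jointly measurable; it is enough that
    its integrals over space agree, at almost every time, with a measurable function of time. *)
Lemma STint_ae (h : R -> X -> R) (A : R -> R) : measurable_fun setT A ->
  {ae @lebesgue_measure R, forall t, t \in `]0, T[ -> RI mu (h t) = A t} ->
  STint T h = T * RI UT A.
Proof.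
move=> mA hA; rewrite -Rintegral_UT// /STint /Rintegral; congr fine.
by apply: ae_integral_eq; move: hA; apply: aeS => t ht t0T; congr EFin; apply: ht; exact: t0T.
Qed.

End spacetime.

(** * Real powers and the Frobenius norm *)

Section powers.
Context (R : realType).

Lemma powR_le (p x y : R) : 0 <= p -> 0 <= x -> x <= y -> x `^ p <= y `^ p.
Proof. by move=> p0 x0 xy; apply: ge0_ler_powR; rewrite ?nnegrE// (le_trans x0 xy). Qed.

Lemma powR2 (x : R) : 0 <= x -> x `^ 2 = x ^+ 2.
Proof. by move=> x0; rewrite -(powR_mulrn 2 x0). Qed.

Lemma powR_root (p e : R) : 0 < p -> 0 < e -> (e `^ p^-1) `^ p = e.
Proof. by move=> p0 e0; rewrite -powRrM mulVf ?gt_eqF// powRr1// ltW. Qed.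

Lemma powR_low (q p e : R) : 0 < q -> q <= p -> 0 < e ->
  exists2 C, 0 <= C & forall x, 0 <= x -> x `^ q <= e + C * x `^ p.
Proof.
move=> q0 qp e0; pose r := e `^ q^-1.
have r0 : 0 < r by exact: powR_gt0.
exists (r `^ (q - p)) => [|x x0]; first exact: powR_ge0.
have [xr|rx] := leP x r.
  by rewrite (le_trans (powR_le (ltW q0) x0 xr))// powR_root// lerDl mulr_ge0 ?powR_ge0.
have x0' : 0 < x by exact: lt_trans rx.
apply: (@le_trans _ _ (r `^ (q - p) * x `^ p)); last by rewrite lerDr ltW.
have -> : x `^ q = x `^ (q - p) * x `^ p.
  by rewrite -powRD ?subrK// gt_eqF// implybT.
rewrite ler_pM2r ?powR_gt0// -(opprB p q) !powRN lef_pV2 ?posrE ?powR_gt0//.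
by apply: powR_le; rewrite ?subr_ge0// ltW.
Qed.

Lemma powR_interpolation (q p e : R) : 0 < q -> q < p -> 0 < e ->
  exists2 C, 0 <= C & forall x, 0 <= x -> x `^ q <= e * (1 + x `^ p) + C * x ^+ 2.
Proof.
move=> q0 qp e0.
pose r := e `^ q^-1; pose s := (e^-1) `^ (p - q)^-1.
have r0 : 0 < r by exact: powR_gt0.
have s0 : 0 < s by rewrite powR_gt0// invr_gt0.
have pq0 : 0 < p - q by rewrite subr_gt0.
exists (s `^ q / r ^+ 2) => [|x x0]; first by rewrite divr_ge0 ?powR_ge0 ?exprn_ge0// ltW.
have h1 : 0 <= s `^ q / r ^+ 2 * x ^+ 2.
  by rewrite mulr_ge0 ?sqr_ge0// divr_ge0 ?powR_ge0 ?sqr_ge0.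
have h2 : 0 <= e * x `^ p by rewrite mulr_ge0 ?powR_ge0// ltW.
rewrite mulrDr mulr1.
have [xr|rx] := leP x r.
  have := powR_le (ltW q0) x0 xr; rewrite powR_root// => h; lra.
have x0' : 0 < x by exact: lt_trans rx.
have [xs|sx] := leP x s.
  have h3 := powR_le (ltW q0) x0 xs.
  have h4 : s `^ q <= s `^ q / r ^+ 2 * x ^+ 2.
    rewrite -mulrA ler_peMr ?powR_ge0// mulrC ler_pdivlMr ?exprn_gt0// mul1r.
    by rewrite lerXn2r ?nnegrE// ltW.
  lra.
have h3 : x `^ q <= e * x `^ p.
  have -> : x `^ p = x `^ (p - q) * x `^ q.
    by rewrite -powRD ?subrK// (gt_eqF x0') implybT.
  rewrite mulrA ler_peMl ?powR_ge0// mulrC -ler_pdivrMr// mul1r.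
  by rewrite -[leLHS](@powR_root (p - q)) ?invr_gt0//; apply: powR_le; exact: ltW.
lra.
Qed.

Lemma powR_le1D (q p x : R) : 0 <= q -> q <= p -> 0 <= x -> x `^ q <= 1 + x `^ p.
Proof.
move=> q0 qp x0; have [x1|x1] := leP x 1.
  by have := powR_le q0 x0 x1; rewrite powR1 => h; rewrite (le_trans h)// lerDl powR_ge0.
by rewrite (le_trans (ler_powR (ltW x1) qp))// lerDr.
Qed.

End powers.

Section frobenius.
Context (R : realType) (m n : nat).
Implicit Types A B : 'M[R]_(m, n).

Lemma msq_sum A : msq A = \sum_i \sum_j A i j ^+ 2.
Proof. by rewrite /msq /mdot; apply: eq_bigr => i _; apply: eq_bigr => j _; rewrite expr2. Qed.

Lemma msq_ge0 A : 0 <= msq A.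
Proof. by rewrite msq_sum; apply: sumr_ge0 => i _; apply: sumr_ge0 => j _; exact: sqr_ge0. Qed.

Lemma frob_ge0 A : 0 <= frob A. Proof. exact: sqrtr_ge0. Qed.

Lemma frob_sqr A : frob A ^+ 2 = msq A.
Proof. by rewrite sqr_sqrtr// msq_ge0. Qed.

Lemma entry_msq A i j : A i j ^+ 2 <= msq A.
Proof.
rewrite msq_sum (bigD1 i)//= (bigD1 j)//= -addrA lerDl addr_ge0// sumr_ge0// => k _.
  exact: sqr_ge0.
by apply: sumr_ge0 => l _; exact: sqr_ge0.
Qed.

Lemma frob_sum A : frob A <= \sum_i \sum_j `|A i j|.
Proof.
have s0 : 0 <= \sum_i \sum_j `|A i j| by apply: sumr_ge0 => i _; apply: sumr_ge0.
rewrite -[leRHS]ger0_norm// -sqrtr_sqr ler_wsqrtr// msq_sum expr2 mulr_suml.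
apply: ler_sum => i _; rewrite mulr_suml; apply: ler_sum => j _.
rewrite -real_normK ?num_real// expr2 ler_wpM2l// (bigD1 i)//= (bigD1 j)//= -addrA lerDl addr_ge0//.
  by apply: sumr_ge0.
by apply: sumr_ge0 => k _; apply: sumr_ge0.
Qed.

Lemma msqD A B : msq (A + B) <= 2 * (msq A + msq B).
Proof.
rewrite !msq_sum -big_split/= mulr_sumr; apply: ler_sum => i _.
rewrite -big_split/= mulr_sumr; apply: ler_sum => j _; rewrite mxE; exact: sqrD_le.
Qed.

Lemma frobN A : frob (- A) = frob A.
Proof.
rewrite /frob !msq_sum; congr Num.sqrt; apply: eq_bigr => i _; apply: eq_bigr => j _.
by rewrite mxE sqrrN.
Qed.

Lemma frobD A B : frob (A + B) <= 2 * Num.max (frob A) (frob B).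
Proof.
have h (C : 'M[R]_(m, n)) : frob C <= Num.max (frob A) (frob B) -> msq C <= Num.max (frob A) (frob B) ^+ 2.
  by move=> hC; rewrite -frob_sqr lerXn2r ?nnegrE ?frob_ge0// (le_trans (frob_ge0 C)).
have m0 : 0 <= 2 * Num.max (frob A) (frob B) by rewrite mulr_ge0// le_max frob_ge0.
rewrite -[leRHS]ger0_norm// -sqrtr_sqr ler_wsqrtr//.
apply: (le_trans (msqD A B)); have := h A; have := h B.
by rewrite !le_max !lexx orbT/= => /(_ isT) hB /(_ isT) hA; rewrite exprMn; lra.
Qed.

Lemma frobD_powR p A B : 0 <= p ->
  frob (A + B) `^ p <= 2 `^ p * (frob A `^ p + frob B `^ p).
Proof.
move=> p0; apply: (le_trans (powR_le p0 (frob_ge0 _) (frobD A B))).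
rewrite powRM ?le_max ?frob_ge0// ler_wpM2l ?powR_ge0//.
by rewrite /Num.max; case: ifP => _; rewrite ?lerDl ?lerDr powR_ge0.
Qed.

Lemma frobB_powR p A B : 0 <= p ->
  frob (A - B) `^ p <= 2 `^ p * (frob A `^ p + frob B `^ p).
Proof. by move=> p0; rewrite -(frobN B); exact: frobD_powR. Qed.

Lemma measurable_msq d (Y : measurableType d) (f : Y -> 'M[R]_(m, n)) :
  (forall i j, measurable_fun setT (fun y => f y i j)) ->
  measurable_fun setT (fun y => msq (f y)).
Proof.
move=> mf; under eq_fun do rewrite msq_sum.
by apply: measurable_sum => i; apply: measurable_sum => j; exact: measurable_funX.
Qed.

Lemma measurable_frob d (Y : measurableType d) (f : Y -> 'M[R]_(m, n)) :
  (forall i j, measurable_fun setT (fun y => f y i j)) ->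
  measurable_fun setT (fun y => frob (f y)).
Proof.
move=> mf; apply: measurableT_comp (measurable_msq mf).
by apply: continuous_measurable_fun => x; exact: sqrt_continuous.
Qed.

Lemma measurable_frob_powR p d (Y : measurableType d) (f : Y -> 'M[R]_(m, n)) :
  (forall i j, measurable_fun setT (fun y => f y i j)) ->
  measurable_fun setT (fun y => frob (f y) `^ p).
Proof.
move=> mf; apply: (measurableT_comp (f := fun x : R => x `^ p)); last exact: measurable_frob.
exact: measurable_powR.
Qed.

End frobenius.

(** * Lebesgue spaces of matrix-valued functions *)

Section Lp_spaces.
Context (R : realType) (d m n : nat).
Notation X := (d.-tuple R).
Notation mu := (@torus R d).
Implicit Types f g : X -> 'M[R]_(m, n).

Lemma LpN_powR p f : p != 0 ->
  (LpN p f `^ p = \int[mu]_x (frob (f x) `^ p)%:E)%E.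
Proof.
move=> p0; transitivity (\int[mu]_x (`|(frob (f x))%:E| `^ p))%E; first exact: poweR_Lnorm.
apply: eq_integral => x _ /=.
by rewrite ger0_norm ?frob_ge0.
Qed.

Lemma LpN_root p f : 0 < p ->
  LpN p f = ((\int[mu]_x (frob (f x) `^ p)%:E) `^ p^-1)%E.
Proof.
move=> p0; rewrite -LpN_powR ?gt_eqF// -poweRrM mulfV ?gt_eqF// poweRe1//.
exact: Lnorm_ge0.
Qed.

Lemma integ_Lp p f : (forall i j, measurable_fun setT (fun x => f x i j)) ->
  0 < p -> integ mu (fun x => frob (f x) `^ p) -> Lp p f.
Proof.
move=> mf p0 fi; split=> //; rewrite LpN_root// RI_EFin//.
by rewrite poweR_EFin ltry.
Qed.

Lemma Lp_integ p f : 0 < p -> Lp p f -> integ mu (fun x => frob (f x) `^ p).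
Proof.
move=> p0 [mf fi]; apply: integ_lty.
- exact: measurable_frob_powR.
- by move=> x; exact: powR_ge0.
- by rewrite -LpN_powR ?gt_eqF//; exact: poweR_lty.
Qed.

Lemma LpN_RI p f : 0 < p -> Lp p f ->
  LpN p f = ((RI mu (fun x => frob (f x) `^ p)) `^ p^-1)%:E.
Proof. by move=> p0 fp; rewrite LpN_root// RI_EFin//; exact: Lp_integ. Qed.

Lemma LpN_le p f M : 0 < p -> Lp p f ->
  (LpN p f <= M%:E)%E -> RI mu (fun x => frob (f x) `^ p) <= M `^ p.
Proof.
move=> p0 fp; rewrite LpN_RI// lee_fin => h.
have R0 : 0 <= RI mu (fun x => frob (f x) `^ p) by apply: RI_ge0 => x; exact: powR_ge0.
by have := powR_le (ltW p0) (powR_ge0 _ _) h; rewrite -powRrM mulVf ?gt_eqF// powRr1.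
Qed.

Lemma LpN_le_root p f M : 0 < p -> Lp p f ->
  RI mu (fun x => frob (f x) `^ p) <= M -> (LpN p f <= (M `^ p^-1)%:E)%E.
Proof.
move=> p0 fp h; rewrite LpN_RI// lee_fin; apply: powR_le => //; first by rewrite invr_ge0 ltW.
by apply: RI_ge0 => x; exact: powR_ge0.
Qed.

Lemma Lp_le q p f : 0 < q -> q <= p -> Lp p f -> Lp q f.
Proof.
move=> q0 qp fp; have mf := fp.1; apply: integ_Lp => //.
apply: (@integ_le _ _ _ mu _ (fun x => 1 + frob (f x) `^ p)).
- exact: measurable_frob_powR.
- by move=> x; rewrite ger0_norm ?powR_ge0// powR_le1D ?frob_ge0// ltW.
- by apply: integD; [exact: integ_cst|apply: Lp_integ => //; exact: lt_le_trans qp].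
Qed.

Lemma LpD_integ p f g : 0 < p -> (forall i j, measurable_fun setT (fun x => f x i j)) ->
  (forall i j, measurable_fun setT (fun x => g x i j)) ->
  integ mu (fun x => frob (f x) `^ p) -> integ mu (fun x => frob (g x) `^ p) ->
  integ mu (fun x => frob (f x - g x) `^ p).
Proof.
move=> p0 mf mg fi gi.
apply: (@integ_le _ _ _ mu _ (fun x => 2 `^ p * (frob (f x) `^ p + frob (g x) `^ p))).
- apply: measurable_frob_powR => i j; under eq_fun do rewrite !mxE.
  exact: measurable_funB.
- by move=> x; rewrite ger0_norm ?powR_ge0// frobB_powR// ltW.
- by apply: integZ; exact: integD.
Qed.

Lemma Lp2_sqint f i j : Lp 2 f -> sqint mu (fun x => f x i j).
Proof.
move=> fp; have mf := fp.1; split; first exact: mf.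
apply: (@integ_le _ _ _ mu _ (fun x => frob (f x) `^ 2)).
- exact: measurable_funX.
- by move=> x; rewrite powR2 ?frob_ge0// ger0_norm ?sqr_ge0// frob_sqr entry_msq.
- exact: Lp_integ.
Qed.

Lemma CLp_cont (T p : R) (f : R -> X -> 'M[R]_(m, n)) : 0 < p -> CLp T p f ->
  forall t e, 0 <= t <= T -> 0 < e -> exists2 del, 0 < del &
  forall s, 0 <= s <= T -> `|s - t| < del ->
  integ mu (fun x => frob (f s x - f t x) `^ p) /\
  RI mu (fun x => frob (f s x - f t x) `^ p) < e.
Proof.
move=> p0 [_ fL fC] t e tT e0.
have tT' : t \in `[0, T] by rewrite in_itv.
have r0 : 0 < e `^ p^-1 by exact: powR_gt0.
have /(_ (fun y => (y < (e `^ p^-1)%:E)%E)) := fC t tT'.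
have nb : nbhs (0%E : \bar R) (fun y => (y < (e `^ p^-1)%:E)%E).
  by apply: open_nbhs_nbhs; split; [exact: open_ereal_lt_ereal|rewrite /= lte_fin].
move=> /(_ nb); rewrite /nbhs/= /within/= => /nbhs_ballP [del /= del0 hd].
exists del => // s sT std.
have sT' : s \in `[0, T] by rewrite in_itv.
have bs : ball_ [eta Num.Def.normr] t del s by rewrite /ball_/= distrC.
have := hd s bs sT'.
have si : integ mu (fun x => frob (f s x - f t x) `^ p).
  have [ms _] := fL s sT'; have [mt _] := fL t tT'.
  by apply: LpD_integ => //; apply: Lp_integ => //; exact: fL.
rewrite LpN_root// RI_EFin// poweR_EFin lte_fin => h; split=> //.
rewrite ltNge; apply/negP => le; move: h; rewrite ltNge => /negP; apply.
by apply: powR_le => //; rewrite ?invr_ge0 ltW.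
Qed.

End Lp_spaces.

(** * Growth of the stress *)

Section stress_growth.
Context (R : realType) (d : nat).
Implicit Types F v : 'M[R]_d.

Lemma msqZ (t : R) F : msq (t *: F) = t ^+ 2 * msq F.
Proof.
rewrite !msq_sum mulr_sumr; apply: eq_bigr => i _; rewrite mulr_sumr; apply: eq_bigr => j _.
by rewrite mxE exprMn.
Qed.

Lemma msq_drop (t : R) F v : 0 <= t -> msq F - msq (F + t *: v) <= t * (msq F + msq v).
Proof.
move=> t0; rewrite !msq_sum -sumrB -big_split/= mulr_sumr; apply: ler_sum => i _.
rewrite -sumrB -big_split/= mulr_sumr; apply: ler_sum => j _; rewrite !mxE.
set a := F i j; set b := v i j.
have h1 : 0 <= t * (a + b) ^+ 2 by rewrite mulr_ge0 ?sqr_ge0.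
have h2 : 0 <= (t * b) ^+ 2 by exact: sqr_ge0.
nra.
Qed.

Lemma msq_delta i a : msq (delta_mx i a : 'M[R]_d) = 1.
Proof.
rewrite msq_sum (bigD1 i)//= (bigD1 a)//= mxE !eqxx expr1n big1 => [|j ja]; last first.
  by rewrite mxE eqxx (negbTE ja) expr0n.
rewrite big1 ?addr0// => k ki; rewrite big1// => j _.
by rewrite mxE (negbTE ki) expr0n.
Qed.

(** Convexity of [Wtilde] bounds its difference quotients towards [F + r *: v]. Removing the
    quadratic part costs the last summand, and the limit at 0 gives the derivative of [W] itself.
    Since [r] may have either sign, the derivative is bounded from both sides. *)
Lemma semiconvex_tangent (W : 'M[R]_d -> R) (K : R) F v (r : R) :
  W_semiconvex W K -> derivable W F v -> r != 0 ->
  r * 'D_v W F <= Wtilde W K (F + r *: v) - Wtilde W K F + K / 2 * (msq F + msq (r *: v)).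
Proof.
move=> [K0 cW] dW r0; set B := leRHS.
have quot (t : R) : 0 < t -> t <= 1 ->
    r * ((t * r)^-1 * (W ((t * r) *: v + F) - W F)) <= B.
  move=> t0 t1.
  have t01 : Itv.spec (@Itv.num_sem R) (Itv.Real `[0%Z, 1%Z]) t.
    by apply/andP; split; rewrite ?num_real//= in_itv/= (ltW t0).
  have := cW (Itv.mk t01) (F + r *: v) F (mem_set I) (mem_set I).
  rewrite !convRE /conv/=.
  have -> : t *: (F + r *: v) + unstable.onem t *: F = F + t *: (r *: v).
    by rewrite scalerDr addrAC -scalerDl addrC /unstable.onem addrC [t + _]addrC subrK scale1r.
  move=> h.
  have -> : r * ((t * r)^-1 * (W ((t * r) *: v + F) - W F)) = t^-1 * (W (F + t *: (r *: v)) - W F).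
    by rewrite scalerA (addrC F) mulrA invfM mulrCA divff// mulr1.
  rewrite mulrC ler_pdivrMr// /B.
  have := msq_drop F (r *: v) (ltW t0); move: h; rewrite /Wtilde /unstable.onem.
  set m0 := msq F; set mv := msq (r *: v); set mt := msq (F + t *: _); set mr := msq (F + r *: v).
  set w0 := W F; set wt := W (F + t *: _); set wr := W (F + r *: v).
  move=> h1 h2.
  have h3 : K / 2 * (m0 - mt) <= K / 2 * (t * (m0 + mv)) by rewrite ler_wpM2l// divr_ge0// ltW.
  move: h1 h3; rewrite mulrBr mulrBl mul1r; lra.
rewrite leNgt; apply/negP => lt.
have cr : (fun h => r * (h^-1 * (W (h *: v + F) - W F))) @ 0^' --> r * 'D_v W F.
  by apply: cvgM; [exact: cvg_cst|exact: dW].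
have [/= del del0 hd] : \forall h \near 0^', B < r * (h^-1 * (W (h *: v + F) - W F)).
  exact: (cvgr_gt _ cr).
(* Small enough that the increment [t * r] falls in the punctured neighbourhood where the quotient
   exceeds [B], yet within (0, 1] as convexity requires. *)
pose t := Num.min 1 (del / (2 * `|r|)).
have t0 : 0 < t by rewrite /t lt_min ltr01 divr_gt0// mulr_gt0// normr_gt0.
have t1 : t <= 1 by rewrite /t ge_min lexx.
have := hd (t * r); rewrite /= sub0r normrN; apply: contraPP => _ H.
have := quot t t0 t1; rewrite leNgt H//.
  rewrite normrM (gtr0_norm t0).
  have : t <= del / (2 * `|r|) by rewrite /t ge_min lexx orbT.
  rewrite ler_pdivlMr ?mulr_gt0 ?normr_gt0// mulrCA => h.
  by rewrite (lt_le_trans _ h)// ltr_pMl ?ltr1n// mulr_gt0// normr_gt0.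
by rewrite mulf_neq0// gt_eqF.
Qed.

Lemma stress_growth (W : 'M[R]_d -> R) (K p : R) : 2 <= p ->
  W_C3 W -> W_growth p W -> W_semiconvex W K ->
  exists2 C, 0 <= C & forall i a F,
  (1 + frob F) * `|partial W i a F| <= C * (1 + frob F `^ p).
Proof.
move=> p2 W3 [c [C [c0 C0 hW]]] cW; have [K0 _] := cW.
have p0 : 0 <= p by exact: le_trans p2.
pose A := C * (2 `^ p + 1) + 3 * K + c.
have P0 : 0 <= 2 `^ p :> R by exact: powR_ge0.
have A0 : 0 <= A.
  by rewrite /A !addr_ge0// ?mulr_ge0 ?addr_ge0// ltW.
exists (A * 2 `^ p) => [|i a F]; first exact: mulr_ge0.
set x := frob F; set r := 1 + x.
have x0 : 0 <= x by exact: frob_ge0.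
have r1 : 1 <= r by rewrite lerDl.
have r0 : 0 < r by exact: lt_le_trans r1.
have rp : r `^ p <= 2 `^ p * (1 + x `^ p).
  have : r <= 2 * Num.max 1 x by rewrite /r maxEle; case: ifP; lra.
  move=> /(powR_le p0 (ltW r0)) h; apply: (le_trans h).
  rewrite powRM ?le_max ?ler01// ler_wpM2l// maxEle.
  by case: ifP => _; rewrite ?powR1 ?lerDr ?lerDl ?powR_ge0.
have r2p : r ^+ 2 <= r `^ p by rewrite -powR2 ?ler_powR// ltW.
have r1p : 1 <= r `^ p by rewrite -[leLHS](powRr0 r) ler_powR.
suff main s : `|s| = r -> s * partial W i a F <= A * r `^ p.
  have h1 := main r (gtr0_norm r0); have h2 := main (- r).
  rewrite normrN (gtr0_norm r0) in h2; have {}h2 := h2 erefl.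
  apply: (@le_trans _ _ (A * r `^ p)); last by rewrite -mulrA ler_wpM2l.
  rewrite -{1}(gtr0_norm r0) -normrM ler_norml h1 andbT lerNl -mulNr; exact: h2.
move=> sr.
have dW : derivable W F (delta_mx i a) by apply: (@Ck_derivable _ _ _ 2).
have s0 : s != 0 by rewrite -normr_gt0 sr.
apply: (le_trans (semiconvex_tangent cW dW s0)).
rewrite msqZ msq_delta mulr1 -real_normK ?num_real// sr -frob_sqr -/x.
have fv : frob (F + s *: delta_mx i a) <= 2 * r.
  apply: (le_trans (frobD _ _)); rewrite ler_wpM2l// ge_max.
  by rewrite -/x {1}/frob msqZ msq_delta mulr1 sqrtr_sqr sr lexx /r lerDr ler01.
have /andP[_ h1] := hW (F + s *: delta_mx i a); have /andP[h2 _] := hW F.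
have h3 : frob (F + s *: delta_mx i a) `^ p <= 2 `^ p * r `^ p.
  by rewrite -powRM ?powR_le ?frob_ge0// ltW.
have h4 : msq (F + s *: delta_mx i a) <= 4 * r ^+ 2.
  rewrite -frob_sqr (_ : 4 * r ^+ 2 = (2 * r) ^+ 2); last by rewrite exprMn -natrX.
  by rewrite lerXn2r ?nnegrE ?frob_ge0// mulr_ge0// ltW.
rewrite /Wtilde -[msq F]frob_sqr -/x.
have x2 : x ^+ 2 <= r ^+ 2 by rewrite lerXn2r ?nnegrE// ?(ltW r0)// /r lerDr.
have xp : 0 <= c * x `^ p by rewrite mulr_ge0 ?powR_ge0// ltW.
move: h1 h2 h3 h4 r2p r1p; rewrite /A -/x.
set w1 := W _; set w0 := W F; set f1 := frob _ `^ p; set m1 := msq _; set rr := r `^ p.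
move=> h1 h2 h3 h4 r2p r1p.
have k1 : C * f1 <= C * (2 `^ p * rr) by rewrite ler_wpM2l// ltW.
have k2 : K / 2 * m1 <= K / 2 * (4 * rr) by rewrite ler_wpM2l ?divr_ge0// ?(ltW K0)//; lra.
have k3 : K / 2 * r ^+ 2 <= K / 2 * rr by rewrite ler_wpM2l ?divr_ge0// ltW.
have k4 : C <= C * rr by rewrite ler_peMr// ltW.
have k6 : 0 <= K * rr by rewrite mulr_ge0 ?ltW// (lt_le_trans _ r1p).
have k5 : c <= c * rr by rewrite ler_peMr// ltW.
nra.
Qed.

End stress_growth.

(** * Test functions *)

Section coordinates.
Context (R : realType) (m n : nat).

Definition coord_mx (i : 'I_m) (j : 'I_n) (A : 'M[R]_(m, n)) : R := A i j.

Fact coord_mx_is_linear i j : linear (@coord_mx i j : 'M[R]_(m, n) -> R^o).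
Proof. by move=> a A B; rewrite /coord_mx !mxE. Qed.

HB.instance Definition _ i j := GRing.isLinear.Build R 'M[R]_(m, n) R^o _ (coord_mx i j)
  (@coord_mx_is_linear i j).

Definition scale_mx (B : 'M[R]_(m, n)) (r : R^o) : 'M[R]_(m, n) := r *: B.

Fact scale_mx_is_linear B : linear (scale_mx B).
Proof. by move=> a r s; rewrite /scale_mx scalerDl scalerA. Qed.

HB.instance Definition _ B := GRing.isLinear.Build R R^o 'M[R]_(m, n) _ (scale_mx B)
  (scale_mx_is_linear B).

Lemma continuous_scale_mx B : continuous (scale_mx B).
Proof. by move=> r; apply: cvgZ; [exact: cvg_id|exact: cvg_cst]. Qed.

End coordinates.

Section test_function_calculus.
Context (R : realType) (d : nat).
Notation V := (R * 'rV[R]_d)%type.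
Implicit Types (psi : V -> R) (v : V).

Lemma smooth_periodic_linear (U U' : normedModType R) (phi : V -> U) (L : {linear U -> U'}) :
  continuous L -> smooth_periodic phi -> smooth_periodic (fun z => L (phi z)).
Proof.
move=> cL [sp pp]; split; first by move=> k; exact: Ck_linear.
by move=> t a x /=; rewrite pp.
Qed.

Lemma smooth_periodic_derive (U : normedModType R) (phi : V -> U) v :
  smooth_periodic phi -> smooth_periodic (fun z => 'D_v phi z).
Proof.
move=> [sp pp]; split; first by move=> k; exact: Ck_derive.
move=> t a x /=.
have AE (h : R) (u z : V) : (h *: u + z) + (0, Defs.basis R a) = h *: u + (z + (0, Defs.basis R a)).
  by rewrite addrA.
have E : (fun z => phi (z + (0, Defs.basis R a))) = phi.
  apply/funext => -[s y]; have -> : (s, y) + (0, Defs.basis R a) = (s, y + Defs.basis R a) :> V.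
    by rewrite /GRing.add/= /add_pair/= addr0.
  exact: pp.
have [_] := derive_affine phi (L := id) (A := fun z => z + (0, Defs.basis R a)) (fun h => AE h v (t, x)).
rewrite E => ->.
have -> // : (t, x + Defs.basis R a) = ((t, x) : V) + (0, Defs.basis R a).
by rewrite /GRing.add/= /add_pair/= addr0.
Qed.

Lemma derive_coord m n (phi : V -> 'M[R]_(m, n)) v z i j : smooth phi ->
  'D_v (fun z => phi z i j) z = ('D_v phi z) i j.
Proof.
move=> sp; have [_] := derive_linear (f := phi) (T := coord_mx i j) (@coord_continuous _ _ _ i j)
  (@Ck_derivable _ _ _ _ _ (sp 1%N) v z).
exact.
Qed.

Lemma smooth_periodic_coord m n (phi : V -> 'M[R]_(m, n)) i j :
  smooth_periodic phi -> smooth_periodic (fun z => phi z i j).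
Proof. exact: (smooth_periodic_linear (L := coord_mx i j) (@coord_continuous _ _ _ i j)). Qed.

Lemma smooth_periodic_scale m n psi (B : 'M[R]_(m, n)) :
  smooth_periodic psi -> smooth_periodic (fun z => psi z *: B).
Proof. exact: (smooth_periodic_linear (L := scale_mx B) (@continuous_scale_mx _ _ _ B)). Qed.

Lemma derive_scale_mx m n psi (B : 'M[R]_(m, n)) v z : smooth psi ->
  'D_v (fun z => psi z *: B) z = 'D_v psi z *: B.
Proof.
move=> sp; have [_] := derive_linear (f := psi) (T := scale_mx B) (@continuous_scale_mx _ _ _ B)
  (@Ck_derivable _ _ _ _ _ (sp 1%N) v z).
exact.
Qed.

Lemma slice_line t (h : R) (u x : 'rV[R]_d) :
  (t, h *: u + x) = h *: ((0, u) : V) + (t, x) :> V.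
Proof. by rewrite /GRing.scale/= /GRing.add/= /add_pair/= scaler0 add0r. Qed.

Lemma derive_slice psi t a x :
  'D_(Defs.basis R a) (fun y => psi (t, y)) x = dx a psi (t, x).
Proof.
have [_] := derive_affine psi (A := fun y => (t, y)) (L := fun u => (0, u))
  (fun h => slice_line t h (Defs.basis R a) x).
by [].
Qed.

Lemma continuous_slice t : continuous (fun y : 'rV[R]_d => (t, y) : V).
Proof.
move=> x; have h1 : (fun _ : 'rV[R]_d => t) @ x --> t by exact: (@cst_continuous _ _ t x).
have h2 : (fun y : 'rV[R]_d => y) @ x --> x by [].
exact: (cvg_pair h1 h2).
Qed.

Lemma smooth_slice psi t : smooth psi -> smooth (fun y => psi (t, y)).
Proof.
move=> sp k; apply: (Ck_affine (A := fun y => (t, y)) (L := fun u => (0, u))) => //.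
  exact: continuous_slice.
by move=> u x h; exact: slice_line.
Qed.

Lemma measurable_test (Y : Type) d' (Z : measurableType d') psi (c : Z -> R) (x : Z -> d.-tuple R) :
  continuous psi -> measurable_fun setT c -> measurable_fun setT x ->
  measurable_fun setT (fun z => psi (c z, vec (x z))).
Proof.
move=> cp mc mx; apply: measurable_comp_pair => // i; under eq_fun do rewrite mxE.
exact: (measurableT_comp (measurable_tnth i) mx).
Qed.

Definition tensor (th : R -> R) (e : 'rV[R]_d -> R) (z : V) : R := th z.1 * e z.2.

Lemma smooth_tensor th e : smooth th -> smooth e -> smooth (tensor th e).
Proof.
move=> st se k; apply: CkM.
  by apply: (Ck_affine (A := fst) (L := fst)) => // -[t x]; exact: cvg_fst.
by apply: (Ck_affine (A := snd) (L := snd)) => // -[t x]; exact: cvg_snd.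
Qed.

Lemma dt_tensor th e z : smooth th -> dt (tensor th e) z = 'D_1 th z.1 * e z.2.
Proof.
case: z => t x st; rewrite /dt /=.
have sl (h : R) : (h *: 1 + t, x) = h *: ((1, 0) : V) + (t, x) :> V.
  by rewrite /GRing.scale/= /GRing.add/= /add_pair/= scaler0 add0r.
have -> : 'D_((1 : R), (0 : 'rV[R]_d)) (tensor th e) (t, x) = 'D_1 (fun s => th s * e x) t.
  have [_ <-] := derive_affine (tensor th e) (A := fun s => (s, x)) (L := fun s => (s, 0)) sl.
  by [].
rewrite deriveM/=; last 2 first.
- exact: (@Ck_derivable _ _ _ _ _ (st 1%N)).
- exact: derivable_cst.
by rewrite derive_cst scaler0 add0r mulrC.
Qed.

Lemma dx_tensor th e a z : smooth e ->
  dx a (tensor th e) z = th z.1 * 'D_(Defs.basis R a) e z.2.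
Proof.
case: z => t x se; rewrite /dx /=.
have -> : 'D_((0 : R), Defs.basis R a) (tensor th e) (t, x) =
    'D_(Defs.basis R a) (fun y => th t * e y) x.
  by rewrite -[LHS]derive_slice.
rewrite deriveM/=; last 2 first.
- exact: derivable_cst.
- exact: (@Ck_derivable _ _ _ _ _ (se 1%N)).
by rewrite derive_cst scaler0 addr0.
Qed.

Lemma test_tensor (T : R) (th : R -> R) (e : 'rV[R]_d -> R) : smooth th -> (exists2 b, b < T & forall t, b <= t -> th t = 0) ->
  smooth e -> Defs.periodic e -> test T (tensor th e).
Proof.
move=> st [b bT hb] se pe; split.
  by split; [exact: smooth_tensor|move=> t a x; rewrite /tensor/= pe].
by exists b => // t x bt; rewrite /tensor/= hb// mul0r.
Qed.

Lemma test_scale T m n psi (B : 'M[R]_(m, n)) : test T psi -> test T (fun z => psi z *: B).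
Proof.
move=> [sp [b bT hb]]; split; first exact: smooth_periodic_scale.
by exists b => // t x bt; rewrite hb// scale0r.
Qed.

Lemma test_coord T m n (phi : V -> 'M[R]_(m, n)) i j : test T phi -> test T (fun z => phi z i j).
Proof.
move=> [sp [b bT hb]]; split; first exact: smooth_periodic_coord.
by exists b => // t x bt; rewrite hb// mxE.
Qed.

End test_function_calculus.

(** * Functions on the slab and their space-time integrals *)

Section slab.
Context (R : realType) (d : nat) (T : R).
Hypothesis hT : 0 < T.
Notation UT := (uniform_prob hT).
Notation X := (d.-tuple R).
Notation mu := (@torus R d).

Definition clamp (t : R) : R := Num.max 0 (Num.min t T).

Lemma clamp_itv t : 0 <= clamp t <= T.
Proof. by rewrite /clamp le_max lexx/= ge_max (ltW hT)/= ge_min lexx orbT. Qed.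

Lemma clampE t : 0 <= t <= T -> clamp t = t.
Proof. by move=> /andP[t0 tT]; rewrite /clamp min_l// max_r. Qed.

Lemma clamp_cases u : clamp u = if u <= 0 then 0 else if u <= T then u else T.
Proof.
rewrite /clamp maxEle minEle; have [uT|uT] := leP u T.
  by case: (ltrgtP u 0) => // ->.
by rewrite (ltW hT); case: leP => //; rewrite leNgt (lt_trans hT).
Qed.

Lemma clamp_lip s t : `|clamp s - clamp t| <= `|s - t|.
Proof.
have h1 := ler_norm (s - t); have h2 := ler_norm (t - s); rewrite distrC in h2.
rewrite ler_norml !clamp_cases; move: h1 h2; set N := `|s - t| => h1 h2.
have [s0|s0] := leP s 0; have [t0|t0] := leP t 0; have [sT|sT] := leP s T;
  have [tT|tT] := leP t T; apply/andP; split => /=; move: hT h1 h2; lra.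
Qed.

Lemma clamp_continuous : continuous clamp.
Proof.
move=> t; apply/cvgrPdist_lt => e e0; exists e => // s /= st.
exact: le_lt_trans (clamp_lip t s) st.
Qed.

Lemma measurable_clamp : measurable_fun setT (clamp : measurableTypeR R -> R).
Proof. exact: (continuous_measurable clamp_continuous). Qed.

(* Clamping the time makes functions that are only controlled on [0, T] jointly
   measurable on the whole of R x T^d. *)
Definition jmc (h : R -> X -> R) : Prop := jms (fun t => h (clamp t)).

(** The bounds are asked for at every time, since weak and strong limits are formed at each fixed
    time. *)
Definition L1b (M : R) (h : R -> X -> R) : Prop := jmc h /\
  forall t, 0 <= t <= T -> integ mu (h t) /\ RI mu (fun x => `|h t x|) <= M.

Definition L2b (M : R) (h : R -> X -> R) : Prop := jmc h /\
  forall t, 0 <= t <= T -> sqint mu (h t) /\ RI mu (fun x => h t x ^+ 2) <= M.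

Definition supb (M : R) (h : R -> X -> R) : Prop := jmc h /\
  forall t x, 0 <= t <= T -> `|h t x| <= M.

(** The space-time integral of the clamped integrand against a probability measure in time, rescaled
    by [T]. It agrees with [STint] on the class [L1b], and linearity and dominated convergence are
    available for it. *)
Definition ST (h : R -> X -> R) : R := T * RI UT (fun t => RI mu (h (clamp t))).

Lemma jmeas_jmc m n (f : R -> X -> 'M[R]_(m, n)) i j : jmeas T f -> jmc (fun t x => f t x i j).
Proof.
move=> mf; rewrite /jmc /jms.
have mg : measurable_fun setT (fun z : measurableTypeR R * X => (clamp z.1 : measurableTypeR R, z.2)).
  apply/measurable_fun_pair; last exact: measurable_snd.
  exact: (measurableT_comp measurable_clamp measurable_fst).
apply: (@measurable_comp _ _ _ _ _ _ (`[0, T] `*` setT) (fun z : measurableTypeR R * X => f z.1 z.2 i j) setT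
  (fun z : measurableTypeR R * X => (clamp z.1 : measurableTypeR R, z.2))) => //.
- by apply: measurableX => //; exact: measurable_itv.
- by move=> _ [z _ <-]; split => //=; rewrite in_itv/=; exact: clamp_itv.
Qed.

Lemma jmc_slice h t : jmc h -> 0 <= t <= T -> measurable_fun setT (h t).
Proof. by move=> mh tT; have := jms_slice t mh; rewrite /= clampE. Qed.

Lemma jmc_RI h : jmc h -> measurable_fun setT (fun t => RI mu (h (clamp t))).
Proof. exact: jms_RI. Qed.

Lemma jmcM f g : jmc f -> jmc g -> jmc (fun t x => f t x * g t x).
Proof. exact: measurable_funM. Qed.

Lemma L1b_integ M h : L1b M h -> integ UT (fun t => RI mu (h (clamp t))) /\
  forall t, `|RI mu (h (clamp t))| <= M.
Proof.
move=> [mh hM]; have b t : `|RI mu (h (clamp t))| <= M.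
  by have [hi hb] := hM _ (clamp_itv t); exact: le_trans (RI_abs hi) hb.
by split => //; apply: (@integ_bdd _ _ _ UT _ M) => //; exact: jmc_RI.
Qed.

(** The bridge for integration by parts: [h] may involve weak derivatives of the solution, while
    [h'] has them on the test function and is measurable; only the integrals over almost every slice
    need to agree. *)
Lemma STint_ST M h h' : L1b M h' ->
  {ae @lebesgue_measure R, forall t, t \in `]0, T[ -> RI mu (h t) = RI mu (h' t)} ->
  STint T h = ST h'.
Proof.
move=> [mh' _] hh; apply: (STint_ae hT); first exact: jmc_RI.
move: hh; apply: aeS => t ht t0T; rewrite ht// clampE//.
by move: t0T; rewrite in_itv/= => /andP[/ltW -> /ltW ->].
Qed.

Lemma STint_L1b M h : L1b M h -> STint T h = ST h.
Proof. by move=> hM; apply: (STint_ST hM); exact: aeW. Qed.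

Lemma L1bD M N f g : L1b M f -> L1b N g -> L1b (M + N) (fun t x => f t x + g t x).
Proof.
move=> [mf fM] [mg gN]; split; first exact: measurable_funD.
move=> t tT; have [fi fb] := fM t tT; have [gi gb] := gN t tT.
split; first exact: integD.
apply: (@le_trans _ _ (RI mu (fun x => `|f t x| + `|g t x|))).
  apply: RI_le; [by apply: integ_abs; exact: integD|by apply: integD; exact: integ_abs|].
  by move=> x; exact: ler_normD.
by rewrite RID ?lerD//; exact: integ_abs.
Qed.

Lemma L1b0 : L1b 0 (fun _ _ => 0).
Proof.
split; first exact: measurable_cst.
by move=> t _; split; [exact: integ_cst|under eq_RI do rewrite normr0; rewrite RI_cst].
Qed.

Lemma L1b_sum (I : Type) (s : seq I) (h : I -> R -> X -> R) :
  (forall i, exists M, L1b M (h i)) -> exists M, L1b M (fun t x => \sum_(i <- s) h i t x).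
Proof.
move=> hi; elim: s => [|i s [M IH]].
  by exists 0; under eq_fun do under eq_fun do rewrite big_nil; exact: L1b0.
have [N hN] := hi i; exists (N + M); under eq_fun do under eq_fun do rewrite big_cons.
exact: L1bD.
Qed.

Lemma STD M N f g : L1b M f -> L1b N g -> ST (fun t x => f t x + g t x) = ST f + ST g.
Proof.
move=> fM gN; rewrite /ST -mulrDr; congr (T * _).
have [fi _] := L1b_integ fM; have [gi _] := L1b_integ gN.
rewrite -RID//; apply: eq_RI => t; rewrite RID//.
  by have [_ /(_ _ (clamp_itv t))[]] := fM.
by have [_ /(_ _ (clamp_itv t))[]] := gN.
Qed.

Lemma ST_sum (I : Type) (s : seq I) (h : I -> R -> X -> R) :
  (forall i, exists M, L1b M (h i)) ->
  ST (fun t x => \sum_(i <- s) h i t x) = \sum_(i <- s) ST (h i).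
Proof.
move=> hi; elim: s => [|i s IH].
  rewrite big_nil /ST; under eq_RI do under eq_RI do rewrite big_nil.
  by under eq_RI do rewrite RI_cst; rewrite RI_cst mulr0.
have [N hN] := hi i; have [M hM] := L1b_sum s hi.
rewrite big_cons -IH -(STD hN hM) /ST; congr (T * _); apply: eq_RI => t; apply: eq_RI => x.
by rewrite big_cons.
Qed.

Lemma L1bM M N f g : L1b M f -> supb N g -> L1b (M * N) (fun t x => f t x * g t x).
Proof.
move=> [mf fM] [mg gN]; split; first exact: jmcM.
move=> t tT; have [fi fb] := fM t tT; have gm := jmc_slice mg tT.
have b x : `|f t x * g t x| <= N * `|f t x| by rewrite normrM mulrC ler_wpM2r ?gN.
have fgi : integ mu (fun x => f t x * g t x).
  apply: (@integ_le _ _ _ mu _ (fun x => N * `|f t x|)) => //.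
    by apply: measurable_funM => //; exact: integ_meas fi.
  by apply: integZ; exact: integ_abs.
have N0 : 0 <= N by rewrite (le_trans _ (gN t point tT)).
split => //; apply: (@le_trans _ _ (RI mu (fun x => N * `|f t x|))).
  by apply: RI_le => //; [exact: integ_abs|apply: integZ; exact: integ_abs].
have fa := integ_abs fi; rewrite (RIZ N fa) mulrC; exact: ler_wpM2r.
Qed.

Lemma L2b_L1b M f : L2b M f -> L1b (1 + M) f.
Proof.
move=> [mf fM]; split => // t tT; have [fi fb] := fM t tT.
split; first exact: sqint_int.
apply: (@le_trans _ _ (RI mu (fun x => 1 + f t x ^+ 2))); last first.
  by rewrite RID ?RI_cst ?lerD2l//; [exact: integ_cst|exact: sqint2].
apply: RI_le; first by apply: integ_abs; exact: sqint_int.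
  by apply: integD; [exact: integ_cst|exact: sqint2].
move=> x; rewrite -real_normK ?num_real//; set y := `|_|; nra.
Qed.

Lemma supb_sqint M g t : supb M g -> 0 <= t <= T -> sqint mu (g t).
Proof. by move=> [mg gM] tT; apply: (@sqint_bdd _ _ _ _ _ M); [exact: jmc_slice|move=> x; exact: gM]. Qed.

Lemma supb_test (psi : R * 'rV[R]_d -> R) : smooth_periodic psi ->
  exists2 M, 0 <= M & supb M (fun t x => psi (t, vec x)).
Proof.
move=> [sp pp]; have cp := Ck_continuous (sp 0%N).
have [M M0 hM] := periodic_bounded T cp pp; exists M => //; split; last first.
  by move=> t x; exact: hM.
apply: (@measurable_test _ _ X _ _ psi (fun z : measurableTypeR R * X => clamp z.1) snd) => //.
exact: (measurableT_comp measurable_clamp measurable_fst).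
Qed.

(** Dominated convergence in time, with the constant [M] as dominating function: convergence at each
    fixed time is all that has to be checked. *)
Lemma ST_cvg M (f : nat -> R -> X -> R) (g : R -> X -> R) :
  (forall n, L1b M (f n)) -> L1b M g ->
  (forall t, 0 <= t <= T -> RI mu (f n t) @[n --> \oo] --> RI mu (g t)) ->
  ST (f n) @[n --> \oo] --> ST g.
Proof.
move=> fM gM fg; apply: cvgM; first exact: cvg_cst.
apply: (proj2 (@RI_dct _ _ _ UT (fun n t => RI mu (f n (clamp t))) (fun t => RI mu (g (clamp t)))
  (fun=> M) _ _ _ _ _)).
- by move=> n; apply: jmc_RI; have [] := fM n.
- by apply: jmc_RI; have [] := gM.
- by apply: aeW => t; apply: fg; exact: clamp_itv.
- exact: integ_cst.
- by move=> n t; have [_ ->] := L1b_integ (fM n).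
Qed.

Lemma STint_mdot m n (f g : R -> X -> 'M[R]_(m, n)) :
  (forall i j, exists M, L1b M (fun t x => f t x i j * g t x i j)) ->
  STint T (fun t x => mdot (f t x) (g t x)) = \sum_i \sum_j ST (fun t x => f t x i j * g t x i j).
Proof.
move=> fg; have h i : exists M, L1b M (fun t x => \sum_j f t x i j * g t x i j).
  by apply: L1b_sum => j; exact: fg.
have [M hM] := L1b_sum (index_enum _) h.
rewrite (STint_L1b hM) ST_sum//; apply: eq_bigr => i _; exact: ST_sum.
Qed.

End slab.

(** * Weak derivatives and Sobolev norms *)

Section sobolev.
Context (R : realType) (d m n : nat).
Notation X := (d.-tuple R).
Notation mu := (@torus R d).
Implicit Types f : X -> 'M[R]_(m, n).

Lemma is_wpd_wpd b f i j : has_wpd b f ->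
  is_wpd b (fun x => f x i j) (fun x => wpd b f x i j).
Proof.
move=> /(_ i j) [g hg].
have -> : (fun x => wpd b f x i j) = wpd1 b (fun x => f x i j).
  by apply/funext => x; rewrite mxE.
exact: (xgetPex _ (ex_intro _ g hg)).
Qed.

Lemma Hk1_sqint b f i j : Hk 1 f -> sqint mu (fun x => wpd b f x i j).
Proof. by move=> [_ /(_ b)[_ h]]; exact: Lp2_sqint. Qed.

Lemma integ_msq f : (forall i j, sqint mu (fun x => f x i j)) ->
  integ mu (fun x => msq (f x)).
Proof.
move=> fs; under eq_fun do rewrite msq_sum.
by apply: integ_sum => i _; apply: integ_sum => j _; exact: sqint2.
Qed.

Lemma integ_grad2 f : Hk 1 f -> integ mu (grad2 f).
Proof. by move=> hf; apply: integ_sum => b _; apply: integ_msq => i j; exact: Hk1_sqint. Qed.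

Lemma grad2_ge0 f x : 0 <= grad2 f x.
Proof. by apply: sumr_ge0 => b _; exact: msq_ge0. Qed.

Lemma wpd_grad2 b f i j : Hk 1 f ->
  RI mu (fun x => wpd b f x i j ^+ 2) <= RI mu (grad2 f).
Proof.
move=> hf; apply: RI_le.
- by apply: sqint2; exact: Hk1_sqint.
- exact: integ_grad2.
- move=> x; apply: (le_trans (entry_msq _ _ _)).
  rewrite /grad2 (bigD1 b)//= lerDl; apply: sumr_ge0 => c _; exact: msq_ge0.
Qed.

Lemma Lp2_msq f : Lp 2 f -> integ mu (fun x => msq (f x)).
Proof. by move=> hf; apply: integ_msq => i j; exact: Lp2_sqint. Qed.

Lemma frob2_msq f : (fun x => frob (f x) `^ 2) = fun x => msq (f x).
Proof. by apply/funext => x; rewrite powR2 ?frob_ge0// frob_sqr. Qed.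

End sobolev.

Lemma ae_dense (R : realType) (T : R) (P : R -> Prop) : 0 < T ->
  {ae @lebesgue_measure R, forall t, t \in `]0, T[ -> P t} ->
  forall t del, 0 <= t <= T -> 0 < del -> exists s, [/\ 0 <= s <= T, `|s - t| < del & P s].
Proof.
move=> T0 [N [mN N0 hN]] t del /andP[t0 tT] del0; apply: contrapT => no.
pose a := Num.max 0 (t - del); pose b := Num.min T (t + del).
have ab : a < b.
  by rewrite /a /b lt_min !gt_max T0 /=; apply/and3P; split; lra.
have sub : `]a, b[ `<=` N.
  move=> s /=; rewrite in_itv/= /a /b gt_max lt_min => /andP[/andP[s0 s1] /andP[s2 s3]].
  apply: hN => /= h; apply: no; exists s; split; first by rewrite !ltW.
    by rewrite ltr_norml; apply/andP; split; lra.
  by apply: h; rewrite in_itv/= s0.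
have : (lebesgue_measure `]a, b[%classic <= 0 :> \bar R)%E.
  by rewrite -N0; apply: le_measure => //; rewrite inE//; exact: measurable_itv.
rewrite lebesgue_measure_itv/= lte_fin ab -EFinD lee_fin subr_le0.
by rewrite leNgt ab.
Qed.

(** Coercivity makes the potential energy nonnegative after adding [c], so each of the three parts
    of the energy is bounded separately. *)
Lemma energy_split (R : realFieldType) (c E U w G P : R) : 0 < c ->
  0 <= U -> 0 <= G -> 0 <= P -> 1 / 2 * U + w + 1 / 2 * G <= E -> c * (P - 1) <= w ->
  [/\ 0 <= E + c, U <= 2 * (E + c), c * P <= E + c & G <= 2 * (E + c)].
Proof.
move=> c0 U0 G0 P0; have cP : 0 <= c * P by rewrite mulr_ge0// ltW.
by rewrite mulrBr mulr1 => h1 h2; split; lra.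
Qed.

(** * Energy bounds *)

Section energy_bound.
Context (R : realType) (d : nat).
Notation X := (d.-tuple R).
Notation mu := (@torus R d).
Variables (p : R) (W : 'M[R]_d -> R).
Hypothesis hp : 2 <= p.
Hypothesis cW : continuous W.

Let p0 : 0 < p. Proof. exact: lt_le_trans hp. Qed.

Lemma integ_W c C (F : X -> 'M[R]_d) : 0 < c -> 0 < C ->
  (forall A, c * (frob A `^ p - 1) <= W A <= C * (frob A `^ p + 1)) ->
  Lp p F -> integ mu (fun x => W (F x)).
Proof.
move=> c0 C0 hW hF; apply: (@integ_le _ _ _ mu _ (fun x => (c + C) * (frob (F x) `^ p + 1))).
- by apply: measurable_comp_mx => // i j; have [h _] := hF; exact: h.
- move=> x; have /andP[h1 h2] := hW (F x); have h3 := powR_ge0 (frob (F x)) p.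
  have h4 : 0 <= c * frob (F x) `^ p by rewrite mulr_ge0// ltW.
  have h5 : 0 <= C * frob (F x) `^ p by rewrite mulr_ge0// ltW.
  rewrite ler_norml; apply/andP; split; nra.
- by apply: integZ; apply: integD; [exact: Lp_integ|exact: integ_cst].
Qed.

Lemma energy_integ c C (u : X -> 'rV[R]_d) (F : X -> 'M[R]_d) : 0 < c -> 0 < C ->
  (forall A, c * (frob A `^ p - 1) <= W A <= C * (frob A `^ p + 1)) ->
  Lp 2 u -> Lp p F -> Hk 1 F ->
  integ mu (energy W u F) /\
  RI mu (energy W u F) = 1 / 2 * RI mu (fun x => msq (u x)) + RI mu (fun x => W (F x))
    + 1 / 2 * RI mu (grad2 F).
Proof.
move=> c0 C0 hW hu hF hG.
have iu := Lp2_msq hu; have iW := integ_W c0 C0 hW hF; have iG := integ_grad2 hG.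
split.
  by apply: integD; [apply: integD => //; exact: integZ|exact: integZ].
rewrite RID; [|by apply: integD => //; exact: integZ|exact: integZ].
by rewrite RID//; [rewrite !RIZ|exact: integZ].
Qed.

Lemma energy_bound (T K B : R) : 0 < T -> W_growth p W -> exists2 M, 0 <= M &
  forall nu u0 F0 u F y, 0 < nu -> weak_solution T p W K nu u0 F0 u F y ->
  Lp 2 u0 -> Lp p F0 -> Hk 1 F0 ->
  RI mu (fun x => msq (u0 x)) <= B -> RI mu (fun x => frob (F0 x) `^ p) <= B ->
  RI mu (grad2 F0) <= B ->
  {ae @lebesgue_measure R, forall t, t \in `]0, T[ ->
    [/\ RI mu (fun x => msq (u t x)) <= M, RI mu (fun x => frob (F t x) `^ p) <= M,
     Hk 1 (F t) & RI mu (grad2 (F t)) <= M]}.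
Proof.
move=> T0 [c [C [c0 C0 hW]]].
(* [E] bounds the initial energy through the upper growth of [W]; the two summands of the next
   constant are the bounds given by [energy_split] for the quadratic parts and for the L^p part. *)
pose E := 1 / 2 * B + C * (B + 1) + 1 / 2 * B.
pose M := 2 * (E + c) + (E + c) / c.
exists (Num.max 0 M); first by rewrite le_max lexx.
move=> nu u0 F0 u F y nu0 sol hu0 hF0 hG0 bu0 bF0 bG0.
move: (ws_energy sol); apply: aeS => t ht t0T.
have tT : t \in `[0, T] by move: t0T; rewrite !in_itv/= => /andP[/ltW -> /ltW ->].
have hu : Lp 2 (u t) by have [[_ h _] _] := ws_u sol; exact: h.
have [[_ hF _] [_ hG _] _ _] := ws_F sol.
have {}hF := hF t tT; have {}hG := hG t tT.
have [i0 E0] := energy_integ c0 C0 hW hu0 hF0 hG0.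
have [i1 E1] := energy_integ c0 C0 hW hu hF hG.
have E0' : RI mu (energy W u0 F0) <= E.
  rewrite E0 /E !lerD//; first by rewrite ler_wpM2l// divr_ge0.
    apply: (@le_trans _ _ (RI mu (fun x => C * (frob (F0 x) `^ p + 1)))).
      apply: RI_le => //; first exact: integ_W hW hF0.
        by apply: integZ; apply: integD; [exact: Lp_integ|exact: integ_cst].
      by move=> x; have /andP[] := hW (F0 x).
    have iF := Lp_integ p0 hF0; have i1' := integ_cst mu 1.
    by rewrite (RIZ C (integD iF i1')) (RID iF i1') RI_cst ler_wpM2l ?lerD2r// ltW.
  by rewrite ler_wpM2l// divr_ge0.
have E1' : RI mu (energy W (u t) (F t)) <= E.
  have := ht t0T; rewrite (RI_EFin i1) (RI_EFin i0) => ht'.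
  apply: le_trans E0'; rewrite -lee_fin; apply: le_trans ht'.
  apply: leeDl; apply: mule_ge0; first by rewrite lee_fin ltW.
  by apply: integral_ge0 => s _; apply: integral_ge0 => x _; rewrite lee_fin msq_ge0.
have Wl : c * (RI mu (fun x => frob (F t x) `^ p) - 1) <= RI mu (fun x => W (F t x)).
  have iF := Lp_integ p0 hF; have i1' := integ_cst mu 1.
  rewrite -(RI_cst mu 1) -(RIB iF i1') -(RIZ c (integB iF i1')).
  apply: RI_le => //; first by apply: integZ; exact: integB.
    exact: integ_W hW hF.
  by move=> x; have /andP[] := hW (F t x).
have u1 : 0 <= RI mu (fun x => msq (u t x)) by apply: RI_ge0 => x; exact: msq_ge0.
have F1 : 0 <= RI mu (fun x => frob (F t x) `^ p) by apply: RI_ge0 => x; exact: powR_ge0.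
have G1 : 0 <= RI mu (grad2 (F t)) by apply: RI_ge0 => x; exact: grad2_ge0.
rewrite E1 in E1'.
have [Ec hU hP hG'] := energy_split c0 u1 G1 F1 E1' Wl.
have Ecc : 0 <= (E + c) / c by rewrite divr_ge0// ltW.
have E2 : 0 <= 2 * (E + c) by rewrite mulr_ge0.
split => //; rewrite le_max; apply/orP; right; rewrite /M.
- by rewrite (le_trans hU)// lerDl.
- by rewrite -(ler_pdivlMl _ _ c0) mulrC in hP; rewrite (le_trans hP)// lerDr.
- by rewrite (le_trans hG')// lerDl.
Qed.

End energy_bound.

(** * The equations tested against Fourier modes *)

Section time_continuity.
Context (R : realType) (d m n : nat) (T : R).
Hypothesis hT : 0 < T.
Notation UT := (uniform_prob hT).
Notation X := (d.-tuple R).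
Notation mu := (@torus R d).
Implicit Types f : R -> X -> 'M[R]_(m, n).

(** Times at which the bound holds are dense, and continuity in L^p compares any time with a nearby
    one of them, at distance less than 1. *)
Lemma CLp_bound p M f : 0 < p -> CLp T p f ->
  {ae @lebesgue_measure R, forall t, t \in `]0, T[ -> RI mu (fun x => frob (f t x) `^ p) <= M} ->
  forall t, 0 <= t <= T -> RI mu (fun x => frob (f t x) `^ p) <= 2 `^ p * (M + 1).
Proof.
move=> p0 cf fM t tT; have [del del0 hdel] := CLp_cont p0 cf tT (@ltr01 R).
have [s [sT std sM]] := ae_dense hT fM tT del0.
have [is1 r1] := hdel s sT std.
have fp r : 0 <= r <= T -> integ mu (fun x => frob (f r x) `^ p).
  by move=> rT; apply: Lp_integ => //; have [_ h _] := cf; apply: h; rewrite in_itv.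
have i2 := integD (fp s sT) is1.
apply: (@le_trans _ _ (2 `^ p * (RI mu (fun x => frob (f s x) `^ p) + RI mu (fun x => frob (f s x - f t x) `^ p)))).
  rewrite -(RID (fp s sT) is1) -(RIZ (2 `^ p) i2).
  apply: RI_le; [exact: fp|exact: integZ|move=> x].
  by rewrite -[X in frob X `^ p <= _](subKr (f s x)) frobB_powR// ltW.
by rewrite ler_wpM2l ?powR_ge0// lerD// ltW.
Qed.

Lemma CLp_entry p f : 2 <= p -> CLp T p f ->
  forall t e, 0 <= t <= T -> 0 < e -> exists2 del, 0 < del &
  forall s, 0 <= s <= T -> `|s - t| < del -> forall i j,
  RI mu (fun x => (f s x i j - f t x i j) ^+ 2) <= e.
Proof.
move=> p2 cf t e tT e0; have p0 : 0 < p by exact: lt_le_trans p2.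
have e2 : 0 < e / 2 by rewrite divr_gt0.
have [C C0 hC] := powR_low (ltr0n R 2) p2 e2.
have C1 : 0 < C + 1 by rewrite (lt_le_trans ltr01)// lerDr.
have e3 : 0 < e / 2 / (C + 1) by rewrite divr_gt0.
have [del del0 hdel] := CLp_cont p0 cf tT e3.
exists del => // s sT st i j; have [hi hr] := hdel s sT st.
have fs r : 0 <= r <= T -> sqint mu (fun x => f r x i j).
  move=> rT; apply: Lp2_sqint; apply: (Lp_le _ p2) => //.
  by have [_ h _] := cf; apply: h; rewrite in_itv.
have iC := integZ C hi.
apply: (@le_trans _ _ (RI mu (fun x => e / 2 + C * frob (f s x - f t x) `^ p))).
  apply: RI_le; [by apply: sqint2; apply: sqintB; exact: fs|by apply: integD; [exact: integ_cst|]|].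
  move=> x; apply: le_trans (hC _ (frob_ge0 _)); rewrite powR2 ?frob_ge0// frob_sqr.
  by have := entry_msq (f s x - f t x) i j; rewrite !mxE.
rewrite (RID (integ_cst mu (e / 2)) iC) RI_cst (RIZ C hi).
have : C * RI mu (fun x => frob (f s x - f t x) `^ p) <= (C + 1) * (e / 2 / (C + 1)).
  apply: ler_pM => //; last exact: ltW.
    by apply: RI_ge0 => x; exact: powR_ge0.
  by rewrite lerDl.
rewrite [(C + 1) * _]mulrC divfK ?gt_eqF// => h; lra.
Qed.

Lemma CLp_coef_continuous p f (g : X -> R) i j : 2 <= p -> CLp T p f -> sqint mu g ->
  continuous (fun t : R => RI mu (fun x => f (clamp T t) x i j * g x)).
Proof.
move=> p2 cf gs t; apply/cvgrPdist_le => e e0.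
(* This [c] makes the Young term with the fixed function [g] at most [e / 2]; the time difference is
   then taken so small that the other term is too. *)
pose c := 2 * (RI mu (fun x => g x ^+ 2) + 1) / e.
have G0 := RI_sqr_ge0 mu g.
have c0 : 0 < c by rewrite /c divr_gt0// mulr_gt0// (lt_le_trans ltr01)// lerDr.
have e1 : 0 < e / 2 / c by apply: divr_gt0 => //; exact: divr_gt0.
have [del del0 hdel] := CLp_entry p2 cf (clamp_itv hT t) e1.
exists del => // s /= st; rewrite distrC.
have sT := clamp_itv hT s; have tT := clamp_itv hT t.
rewrite distrC in st; have h := hdel _ sT (le_lt_trans (clamp_lip hT s t) st) i j.
have fs r : 0 <= r <= T -> sqint mu (fun x => f r x i j).
  move=> rT; apply: Lp2_sqint; apply: (Lp_le _ p2) => //.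
  by have [_ h' _] := cf; apply: h'; rewrite in_itv.
rewrite -(RIB (sqintM (fs _ sT) gs) (sqintM (fs _ tT) gs)).
rewrite (@eq_RI _ _ _ mu _ (fun x => (f (clamp T s) x i j - f (clamp T t) x i j) * g x)); last first.
  by move=> x; rewrite mulrBl.
apply: (le_trans (RI_young c0 (sqintB (fs _ sT) (fs _ tT)) gs)).
have h1 : c * RI mu (fun x => (f (clamp T s) x i j - f (clamp T t) x i j) ^+ 2) <= e / 2.
  by rewrite mulrC -ler_pdivlMr.
have h2 : c^-1 * RI mu (fun x => g x ^+ 2) <= e / 2.
  rewrite /c invf_div -mulrA ler_wpM2l ?(ltW e0)// invfM -mulrA ler_piMr ?invr_ge0//.
  by rewrite mulrC ler_pdivrMr ?mul1r ?lerDl// (lt_le_trans ltr01)// lerDr.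
by rewrite (le_trans (lerD h1 h2))// -splitr.
Qed.

End time_continuity.

Section lipschitz_coefficients.
Context (R : realType) (d : nat) (T : R).
Hypothesis hT : 0 < T.
Notation UT := (uniform_prob hT).
Notation X := (d.-tuple R).
Notation mu := (@torus R d).

Lemma UT_clamp (f g : R -> R) : continuous f -> continuous g ->
  RI UT (fun t => f t * g (clamp T t)) = RI UT (fun t => f t * g t).
Proof.
move=> cf cg.
have cgc : continuous (fun t : R => g (clamp T t)).
  by move=> t; apply: continuous_comp; [exact: clamp_continuous|exact: cg].
apply: ae_RI.
- by apply: measurable_funM; exact: continuous_measurable.
- by apply: measurable_funM; exact: continuous_measurable.
have := @ae_UT R T hT (fun _ => True) (aeW _ (fun _ _ => I)).
apply: ae_imp => t []; rewrite in_itv/= => /andP[/ltW t0 /ltW tT] _.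
by rewrite clampE// t0.
Qed.

Lemma ST_tensor (w : R -> X -> R) (e : X -> R) (th : R -> R) :
  (forall t, 0 <= t <= T -> integ mu (fun x => w t x * e x)) ->
  continuous (fun t : R => RI mu (fun x => w (clamp T t) x * e x)) -> continuous th ->
  ST hT (fun t x => w t x * (th t * e x)) =
  T * RI UT (fun t => RI mu (fun x => w (clamp T t) x * e x) * th t).
Proof.
move=> iw cw cth; rewrite -(UT_clamp cw cth) /ST; congr (T * _); apply: eq_RI => t.
rewrite mulrC -(RIZ (th (clamp T t)) (iw _ (clamp_itv hT t))); apply: eq_RI => x.
by rewrite mulrCA.
Qed.

(** The bound involves only the L^1 norm of the factor [th], which is the form [time_lipschitz] asks
    for. *)
Lemma ST_tensor_le M N (w : R -> X -> R) (e : X -> R) (th : R -> R) :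
  L1b T M w -> measurable_fun setT e -> (forall x, `|e x| <= N) -> continuous th ->
  `|ST hT (fun t x => w t x * (th t * e x))| <= M * N * (T * RI UT (fun t => `|th t|)).
Proof.
move=> wM me eN cth.
have se : supb T N (fun _ => e).
  split; last by move=> t x _.
  exact: (measurableT_comp me measurable_snd).
have [mwe weM] := L1bM wM se.
have cn : continuous (fun t : R => `|th t|).
  by move=> t; apply: cvg_norm; exact: cth.
have [b bth] : exists b, forall t, `|th (clamp T t)| <= b.
  have [c _ hc] := EVT_max (ltW hT) (continuous_subspaceT cn).
  by exists `|th c| => t; apply: hc; rewrite in_itv/=; exact: clamp_itv.
have cthc : continuous (fun t : R => `|th (clamp T t)|).
  by move=> t; apply: cvg_norm; apply: continuous_comp; [exact: clamp_continuous|exact: cth].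
have i1 : integ UT (fun t => M * N * `|th (clamp T t)|).
  apply: integZ; apply: (@integ_bdd _ _ _ UT _ b); first exact: continuous_measurable.
  by move=> t; rewrite normr_id.
have pw t : `|RI mu (fun x => w (clamp T t) x * (th (clamp T t) * e x))| <= M * N * `|th (clamp T t)|.
  have [ie be] := weM _ (clamp_itv hT t).
  rewrite (@eq_RI _ _ _ mu _ (fun x => th (clamp T t) * (w (clamp T t) x * e x))); last first.
    by move=> x; rewrite mulrCA.
  rewrite (RIZ _ ie) normrM mulrC ler_wpM2r//.
  exact: le_trans (RI_abs ie) be.
have mm : measurable_fun setT (fun t => RI mu (fun x => w (clamp T t) x * (th (clamp T t) * e x))).
  have mth : measurable_fun setT (fun t : R => th (clamp T t)).
    apply: continuous_measurable => t.
    by apply: continuous_comp; [exact: clamp_continuous|exact: cth].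
  have := measurable_funM mth (jmc_RI mwe); congr measurable_fun; apply/funext => t.
  have [ie _] := weM _ (clamp_itv hT t).
  by rewrite /= -(RIZ _ ie); apply: eq_RI => x; rewrite mulrCA.
have i2 : integ UT (fun t => RI mu (fun x => w (clamp T t) x * (th (clamp T t) * e x))).
  exact: (@integ_le _ _ _ UT _ _ mm pw i1).
rewrite /ST normrM (gtr0_norm hT) mulrCA ler_pM2l//.
apply: (le_trans (RI_abs i2)).
have i3 : integ UT (fun t => `|th (clamp T t)|).
  by apply: (@integ_bdd _ _ _ UT _ b) => [|t]; [exact: continuous_measurable|rewrite normr_id].
apply: (@le_trans _ _ (RI UT (fun t => M * N * `|th (clamp T t)|))).
  by apply: RI_le => //; exact: integ_abs.
rewrite (RIZ _ i3) le_eqVlt; apply/orP; left; apply/eqP; congr (_ * _).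
transitivity (RI UT (fun t => 1 * `|th (clamp T t)|)); first by apply: eq_RI => t; rewrite mul1r.
rewrite (UT_clamp (f := cst 1) _ cn); last by move=> t; exact: cvg_cst.
by apply: eq_RI => t; rewrite mul1r.
Qed.

End lipschitz_coefficients.

Section slab_scaling.
Context (R : realType) (d : nat) (T : R).
Hypothesis hT : 0 < T.
Notation X := (d.-tuple R).
Notation mu := (@torus R d).

Lemma L1bZ c M (f : R -> X -> R) : L1b T M f -> L1b T (`|c| * M) (fun t x => c * f t x).
Proof.
move=> [mf fM]; split; first exact: measurable_funM.
move=> t tT; have [fi fb] := fM t tT; split; first exact: integZ.
under eq_RI do rewrite normrM.
by rewrite (RIZ _ (integ_abs fi)) ler_wpM2l.
Qed.

Lemma STZ c M (f : R -> X -> R) : L1b T M f -> ST hT (fun t x => c * f t x) = c * ST hT f.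
Proof.
move=> hf; have [_ fM] := hf; have [fi _] := L1b_integ hT hf.
rewrite /ST mulrCA -(RIZ c fi); congr (T * _); apply: eq_RI => t.
by have [h _] := fM _ (clamp_itv hT t); rewrite (RIZ c h).
Qed.

End slab_scaling.

Section test_pairing.
Context (R : realType) (d : nat).
Notation X := (d.-tuple R).
Notation mu := (@torus R d).
Notation V := (R * 'rV[R]_d)%type.
Implicit Types psi : V -> R.

Lemma mdot_delta m n (A : 'M[R]_(m, n)) c i j : mdot A (c *: delta_mx i j) = A i j * c.
Proof.
rewrite /mdot (bigD1 i)//= (bigD1 j)//= !mxE !eqxx mulr1 big1 ?addr0 => [|l lj]; last first.
  by rewrite !mxE (negbTE lj) andbF !mulr0.
rewrite big1 ?addr0// => k ki; rewrite big1// => l _.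
by rewrite !mxE (negbTE ki) !mulr0.
Qed.

Lemma mdot_dgrad (A : 'M[R]_d) (eta : V -> R) i z : smooth eta ->
  mdot A (dgrad (fun z => eta z *: delta_mx ord0 i) z) = \sum_a A i a * dx a eta z.
Proof.
move=> se; rewrite /mdot (bigD1 i)//= [X in _ + X]big1 ?addr0 => [|k ki].
  by apply: eq_bigr => a _; rewrite !mxE /dx derive_scale_mx// !mxE !eqxx mulr1.
by apply: big1 => a _; rewrite !mxE /dx derive_scale_mx// !mxE (negbTE ki) !mulr0.
Qed.

Lemma wpd_test m n (f : X -> 'M[R]_(m, n)) b psi t i j : has_wpd b f -> smooth_periodic psi ->
  RI mu (fun x => wpd b f x i j * psi (t, vec x)) = - RI mu (fun x => f x i j * dx b psi (t, vec x)).
Proof.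
move=> /(is_wpd_wpd i j)[_ _ h] [sp pp].
have e := h _ (smooth_slice t sp) (pp t).
have -> : RI mu (fun x => f x i j * dx b psi (t, vec x)) =
    RI mu (fun x => f x i j * 'D_(Defs.basis R b) (fun y => psi (t, y)) (vec x)).
  by apply: eq_RI => x; rewrite derive_slice.
by rewrite [X in _ = - X]e opprK.
Qed.

Lemma test_slice psi t : 0 <= t -> smooth_periodic psi ->
  measurable_fun setT (fun x : X => psi (t, vec x)) /\
  exists N, forall x : X, `|psi (t, vec x)| <= N.
Proof.
move=> t0 sp; have cp := Ck_continuous (sp.1 0%N); split.
  exact: (@measurable_test _ _ X _ _ psi (fun _ => t) id).
have [N _ hN] := periodic_bounded t cp sp.2; exists N => x.
by apply: hN; rewrite t0 lexx.
Qed.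

Lemma sqint_test (g : X -> R) psi t : 0 <= t -> smooth_periodic psi -> sqint mu g ->
  integ mu (fun x => g x * psi (t, vec x)).
Proof.
move=> t0 sp gs; have [mp [N hN]] := test_slice t0 sp.
by apply: sqint_int; exact: sqintMb hN.
Qed.

Lemma laplacian_test (f : X -> 'M[R]_d) psi t i j : 0 <= t -> Hk 2 f -> smooth_periodic psi ->
  integ mu (fun x => laplacian f x i j * psi (t, vec x)) /\
  RI mu (fun x => laplacian f x i j * psi (t, vec x)) =
  \sum_b RI mu (fun x => f x i j * dx b (dx b psi) (t, vec x)).
Proof.
move=> t0 [_ hf] sp.
have ib b : integ mu (fun x => wpd b (wpd b f) x i j * psi (t, vec x)).
  have [_ [_ /(_ b)[_ h]]] := hf b; apply: sqint_test => //; exact: Lp2_sqint.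
have -> : (fun x => laplacian f x i j * psi (t, vec x)) =
    fun x => \sum_b wpd b (wpd b f) x i j * psi (t, vec x).
  by apply/funext => x; rewrite /laplacian summxE mulr_suml.
split; first exact: integ_sum.
rewrite RI_sum//; apply: eq_bigr => b _.
have [h1 [_ /(_ b)[h2 _]]] := hf b.
have spb := smooth_periodic_derive (0, Defs.basis R b) sp.
have e2 := wpd_test (psi := dx b psi) t i j h1 spb.
have e1 := wpd_test (psi := psi) t i j h2 sp.
by apply: (etrans e1); apply: (etrans (congr1 -%R e2)); exact: opprK.
Qed.

End test_pairing.

Section moved_equations.
Context (R : realType) (d : nat) (T p : R).
Hypothesis hT : 0 < T.
Hypothesis hp : 2 <= p.
Notation X := (d.-tuple R).
Notation mu := (@torus R d).
Notation V := (R * 'rV[R]_d)%type.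
Variable W : 'M[R]_d -> R.
Hypothesis W3 : W_C3 W.
Variable CS : R.
Hypothesis CS0 : 0 <= CS.
Hypothesis hCS : forall i a F, (1 + frob F) * `|partial W i a F| <= CS * (1 + frob F `^ p).

(** The momentum equation for one component and a scalar test function, with every spatial
    derivative moved: one integration by parts turns the viscous term into [+ nu] times the pairing
    of [u] with the Laplacian, and two turn the dispersive term into the pairing of [F] with third
    derivatives. *)
Definition momentum_eq nu (u0 : X -> 'rV[R]_d) (u : R -> X -> 'rV[R]_d) (F : R -> X -> 'M[R]_d)
    (eta : V -> R) i : Prop :=
  ST hT (fun t x => u t x ord0 i * dt eta (t, vec x))
  - \sum_a ST hT (fun t x => stress W (F t x) i a * dx a eta (t, vec x))
  + nu * \sum_a ST hT (fun t x => u t x ord0 i * dx a (dx a eta) (t, vec x))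
  + \sum_a \sum_b ST hT (fun t x => F t x i a * dx b (dx b (dx a eta)) (t, vec x))
  + RI mu (fun x => u0 x ord0 i * eta (0, vec x)) = 0.

Definition compat_eq (F0 : X -> 'M[R]_d) (u : R -> X -> 'rV[R]_d) (F : R -> X -> 'M[R]_d)
    (eta : V -> R) i j : Prop :=
  ST hT (fun t x => F t x i j * dt eta (t, vec x))
  - ST hT (fun t x => u t x ord0 i * dx j eta (t, vec x))
  + RI mu (fun x => F0 x i j * eta (0, vec x)) = 0.

Lemma continuous_partial i a : continuous (partial W i a).
Proof. exact: (@Ck_continuous _ _ _ 2 _ (@Ck_derive _ _ _ 2 W (delta_mx i a) W3)). Qed.

Definition bounded_flow M (u : R -> X -> 'rV[R]_d) (F : R -> X -> 'M[R]_d) : Prop :=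
  [/\ forall i, jmc T (fun t x => u t x ord0 i),
      forall i j, jmc T (fun t x => F t x i j) &
      forall t, 0 <= t <= T -> [/\ forall i, sqint mu (fun x => u t x ord0 i),
         RI mu (fun x => msq (u t x)) <= M, integ mu (fun x => frob (F t x) `^ p) &
         RI mu (fun x => frob (F t x) `^ p) <= M]].

Section bounded.
Variables (M : R) (u : R -> X -> 'rV[R]_d) (F : R -> X -> 'M[R]_d).
Hypothesis bnd : bounded_flow M u F.

Lemma L2b_velocity i : L2b T M (fun t x => u t x ord0 i).
Proof.
have [mu' _ b] := bnd; split => // t tT; have [su uM _ _] := b t tT; split => //.
apply: le_trans uM; apply: RI_le; first exact: sqint2.
  by apply: integ_msq => k j; rewrite (ord1 k).
by move=> x; exact: entry_msq.
Qed.

Lemma L2b_strain i j : L2b T (1 + M) (fun t x => F t x i j).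
Proof.
have [_ mF b] := bnd; split => // t tT; have [_ _ iF FM] := b t tT.
have m1 := jmc_slice (mF i j) tT.
have le2 x : F t x i j ^+ 2 <= 1 + frob (F t x) `^ p.
  apply: (le_trans (entry_msq _ _ _)); rewrite -frob_sqr -powR2 ?frob_ge0//.
  by apply: powR_le1D => //; exact: frob_ge0.
have i1 := integD (integ_cst mu 1) iF.
have sF : integ mu (fun x => F t x i j ^+ 2).
  apply: (integ_le _ _ i1); first exact: measurable_funX.
  by move=> x; rewrite ger0_norm ?sqr_ge0.
split; first by split.
apply: (@le_trans _ _ (RI mu (fun x => 1 + frob (F t x) `^ p))); first exact: RI_le.
by rewrite (RID (integ_cst mu 1) iF) RI_cst lerD2l.
Qed.

Lemma partial_le i a A : `|partial W i a A| <= CS * (1 + frob A `^ p).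
Proof.
apply: le_trans (hCS i a A); rewrite -[leLHS]mul1r ler_wpM2r//.
by rewrite lerDl frob_ge0.
Qed.

Lemma L1b_stress i a : L1b T (CS * (1 + M)) (fun t x => stress W (F t x) i a).
Proof.
have [_ mF b] := bnd; split.
  rewrite /jmc /jms; under eq_fun do rewrite mxE.
  apply: measurable_comp_mx; first exact: continuous_partial.
  by move=> k j; exact: mF.
move=> t tT; have [_ _ iF FM] := b t tT.
have i1 := integD (integ_cst mu 1) iF; have i2 := integZ CS i1.
have iS : integ mu (fun x => stress W (F t x) i a).
  apply: (integ_le _ _ i2).
    under eq_fun do rewrite mxE; apply: measurable_comp_mx; first exact: continuous_partial.
    by move=> k j; exact: jmc_slice (mF k j) tT.
  by move=> x; rewrite mxE; exact: partial_le.
split => //; apply: (@le_trans _ _ (RI mu (fun x => CS * (1 + frob (F t x) `^ p)))).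
  apply: RI_le => //; first exact: integ_abs.
  by move=> x; rewrite mxE; exact: partial_le.
by rewrite (RIZ _ i1) (RID (integ_cst mu 1) iF) RI_cst ler_wpM2l// lerD2l.
Qed.

End bounded.

Section weak.
Variables (K nu M : R) (u0 : X -> 'rV[R]_d) (F0 : X -> 'M[R]_d)
  (u : R -> X -> 'rV[R]_d) (F : R -> X -> 'M[R]_d) (y : R -> X -> 'rV[R]_d).
Hypothesis sol : weak_solution T p W K nu u0 F0 u F y.
Hypothesis hu0 : Lp 2 u0.
Hypothesis hF0 : Lp p F0.
Hypothesis bnd : bounded_flow M u F.

Lemma pairing M' (f : R -> X -> R) (psi : V -> R) : L1b T M' f -> smooth_periodic psi ->
  exists N, L1b T N (fun t x => f t x * psi (t, vec x)).
Proof. by move=> fM /(supb_test hT)[N N0 sN]; exists (M' * N); exact: L1bM. Qed.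

(** At almost every time the slices of [u] lie in H^1 and those of [F] in H^2, so the integrations
    by parts are carried out on each slice; [STint_ST] then replaces the space-time integrals by
    measurable ones. *)
Lemma moved_momentum (eta : V -> R) i : test T eta -> momentum_eq nu u0 u F eta i.
Proof.
move=> te; have [sp _] := te; have [se _] := sp.
have sd v : smooth_periodic (fun z => 'D_v eta z) := smooth_periodic_derive v sp.
have sdd v w : smooth_periodic (fun z => 'D_w (fun z => 'D_v eta z) z) :=
  smooth_periodic_derive w (sd v).
have sddd v w r : smooth_periodic (fun z => 'D_r (fun z => 'D_w (fun z => 'D_v eta z) z) z) :=
  smooth_periodic_derive r (sdd v w).
have uL := L2b_L1b (L2b_velocity bnd i).
have FL a := L2b_L1b (L2b_strain bnd i a).
have SL a := L1b_stress bnd i a.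
have := ws_momentum sol (test_scale (delta_mx ord0 i) te).
have -> : STint T (fun t x => mdot (u t x) (dt (fun z => eta z *: delta_mx ord0 i) (t, vec x))) =
    ST hT (fun t x => u t x ord0 i * dt eta (t, vec x)).
  have [N hN] := pairing uL (sd (1, 0)).
  rewrite -(STint_L1b hT hN); congr STint; apply/funext => t; apply/funext => x.
  by rewrite /dt derive_scale_mx// mdot_delta.
have -> : STint T (fun t x => mdot (stress W (F t x)) (dgrad (fun z => eta z *: delta_mx ord0 i) (t, vec x))) =
    \sum_a ST hT (fun t x => stress W (F t x) i a * dx a eta (t, vec x)).
  have h a := pairing (SL a) (sd (0, Defs.basis R a)).
  rewrite -(ST_sum hT (index_enum _) h); have [N hN] := L1b_sum (index_enum _) h.
  rewrite -(STint_L1b hT hN); congr STint; apply/funext => t; apply/funext => x.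
  by rewrite mdot_dgrad.
have -> : STint T (fun t x => mdot (grad (u t) x) (dgrad (fun z => eta z *: delta_mx ord0 i) (t, vec x))) =
    - \sum_a ST hT (fun t x => u t x ord0 i * dx a (dx a eta) (t, vec x)).
  have h a := pairing uL (sdd (0, Defs.basis R a) (0, Defs.basis R a)).
  have [N hN] := L1b_sum (index_enum _) h.
  rewrite -(ST_sum hT (index_enum _) h) -mulN1r -(STZ hT (-1) hN).
  apply: (STint_ST hT (L1bZ (-1) hN)).
  have [_ [_ h1 _]] := ws_u sol; move: h1; apply: aeS => t ht t0T.
  have t0 : 0 <= t by move: t0T; rewrite in_itv/= => /andP[/ltW].
  have tT : 0 <= t <= T by move: t0T; rewrite in_itv/= => /andP[/ltW -> /ltW ->].
  have [_ hH] := ht t0T.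
  rewrite (@eq_RI _ _ _ mu _ (fun x => \sum_a wpd a (u t) x ord0 i * dx a eta (t, vec x))); last first.
    by move=> x; rewrite mdot_dgrad//; apply: eq_bigr => a _; rewrite mxE.
  rewrite RI_sum; last first.
    by move=> a _; apply: sqint_test => //; [exact: sd|have [_ h2] := hH a; exact: Lp2_sqint].
  have ih a : integ mu (fun x => u t x ord0 i * dx a (dx a eta) (t, vec x)).
    by have [N' [_ /(_ t tT)[]]] := h a.
  rewrite (RIZ (-1) (integ_sum (index_enum _) (P := xpredT) (fun a _ => ih a))).
  rewrite RI_sum// mulN1r -sumrN; apply: eq_bigr => a _.
  by apply: (wpd_test (psi := dx a eta)); [have [] := hH a|exact: sd].
have -> : STint T (fun t x => mdot (laplacian (F t) x) (dgrad (fun z => eta z *: delta_mx ord0 i) (t, vec x))) =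
    \sum_a \sum_b ST hT (fun t x => F t x i a * dx b (dx b (dx a eta)) (t, vec x)).
  have h a b := pairing (FL a) (sddd (0, Defs.basis R a) (0, Defs.basis R b) (0, Defs.basis R b)).
  have h' a := L1b_sum (index_enum _) (h a).
  have [N hN] := L1b_sum (index_enum _) h'.
  have -> : \sum_a \sum_b ST hT (fun t x => F t x i a * dx b (dx b (dx a eta)) (t, vec x)) =
     ST hT (fun t x => \sum_a \sum_b F t x i a * dx b (dx b (dx a eta)) (t, vec x)).
    rewrite (ST_sum hT (index_enum _) h'); apply: eq_bigr => a _.
    by rewrite (ST_sum hT (index_enum _) (h a)).
  apply: (STint_ST hT hN).
  have [_ _ _ [_ h1 _]] := ws_F sol; move: h1; apply: aeS => t ht t0T.
  have t0 : 0 <= t by move: t0T; rewrite in_itv/= => /andP[/ltW].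
  have tT : 0 <= t <= T by move: t0T; rewrite in_itv/= => /andP[/ltW -> /ltW ->].
  have hH := ht t0T.
  rewrite (@eq_RI _ _ _ mu _ (fun x => \sum_a laplacian (F t) x i a * dx a eta (t, vec x))); last first.
    by move=> x; rewrite mdot_dgrad.
  have hl a := laplacian_test i a t0 hH (sd (0, Defs.basis R a)).
  rewrite RI_sum; last by move=> a _; have [] := hl a.
  have ih a b : integ mu (fun x => F t x i a * dx b (dx b (dx a eta)) (t, vec x)).
    by have [N' [_ /(_ t tT)[]]] := h a b.
  rewrite RI_sum; last by move=> a _; apply: integ_sum => b _; exact: ih.
  apply: eq_bigr => a _; have [_ h2] := hl a; apply: (etrans h2).
  by rewrite RI_sum// => b _; exact: ih.
rewrite /momentum_eq mulrN opprK => h; rewrite -[RHS]h; congr (_ + _).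
by apply: eq_RI => x; rewrite mdot_delta.
Qed.

Lemma moved_compat (eta : V -> R) i j : test T eta -> compat_eq F0 u F eta i j.
Proof.
move=> te; have [sp _] := te; have [se _] := sp.
have sd v : smooth_periodic (fun z => 'D_v eta z) := smooth_periodic_derive v sp.
have uL := L2b_L1b (L2b_velocity bnd i).
have FL := L2b_L1b (L2b_strain bnd i j).
have := ws_compat sol (test_scale (delta_mx i j) te).
have -> : STint T (fun t x => mdot (F t x) (dt (fun z => eta z *: delta_mx i j) (t, vec x))) =
    ST hT (fun t x => F t x i j * dt eta (t, vec x)).
  have [N hN] := pairing FL (sd (1, 0)).
  rewrite -(STint_L1b hT hN); congr STint; apply/funext => t; apply/funext => x.
  by rewrite /dt derive_scale_mx// mdot_delta.
have -> : STint T (fun t x => mdot (grad (u t) x) (eta (t, vec x) *: delta_mx i j)) =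
    - ST hT (fun t x => u t x ord0 i * dx j eta (t, vec x)).
  have [N hN] := pairing uL (sd (0, Defs.basis R j)).
  rewrite -mulN1r -(STZ hT (-1) hN); apply: (STint_ST hT (L1bZ (-1) hN)).
  have [_ [_ h1 _]] := ws_u sol; move: h1; apply: aeS => t ht t0T.
  have tT : 0 <= t <= T by move: t0T; rewrite in_itv/= => /andP[/ltW -> /ltW ->].
  have [_ hH] := ht t0T.
  rewrite (@eq_RI _ _ _ mu _ (fun x => wpd j (u t) x ord0 i * eta (t, vec x))); last first.
    by move=> x; rewrite mdot_delta mxE.
  have ih : integ mu (fun x => u t x ord0 i * dx j eta (t, vec x)).
    by have [_ /(_ t tT)[]] := hN.
  rewrite (RIZ (-1) ih) mulN1r.
  by apply: wpd_test => //; have [] := hH j.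
rewrite /compat_eq => h; rewrite -[RHS]h; congr (_ + _).
by apply: eq_RI => x; rewrite mdot_delta.
Qed.

End weak.

End moved_equations.

Lemma finite_uniform (R : realType) (I : finType) (P : I -> R -> Prop) :
  (forall i L L', L <= L' -> P i L -> P i L') ->
  (forall i, exists2 L, 0 <= L & P i L) -> exists2 L, 0 <= L & forall i, P i L.
Proof.
move=> mono hP.
have /choice[f hf] : forall i, exists L, 0 <= L /\ P i L.
  by move=> i; have [L L0 PL] := hP i; exists L.
exists (\sum_i f i) => [|i]; first by apply: sumr_ge0 => i _; have [] := hf i.
have [_ Pi] := hf i; apply: mono Pi; rewrite (bigD1 i)//= lerDl.
by apply: sumr_ge0 => j _; have [] := hf j.
Qed.

Lemma norm_le_sum3 (R : realDomainType) (A B C D b c d : R) : A - B + C + D = 0 ->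
  `|B| <= b -> `|C| <= c -> `|D| <= d -> `|A| <= b + c + d.
Proof.
move=> h hB hC hD; have -> : A = B - C - D by move: h; lra.
apply: (le_trans (ler_normB _ _)); apply: lerD => //.
by apply: (le_trans (ler_normB _ _)); apply: lerD.
Qed.

(** * Equi-Lipschitz Fourier coefficients *)

Section equi_lipschitz.
Context (R : realType) (d : nat) (T p : R).
Hypothesis hT : 0 < T.
Hypothesis hp : 2 <= p.
Notation UT := (uniform_prob hT).
Notation X := (d.-tuple R).
Notation mu := (@torus R d).
Notation V := (R * 'rV[R]_d)%type.
Variable W : 'M[R]_d -> R.
Hypothesis W3 : W_C3 W.
Variable CS : R.
Hypothesis CS0 : 0 <= CS.
Hypothesis hCS : forall i a F, (1 + frob F) * `|partial W i a F| <= CS * (1 + frob F `^ p).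
Implicit Types e : 'rV[R]_d -> R.

Definition smooth_per e : Prop := smooth e /\ Defs.periodic e.

Lemma smooth_per_derive a e : smooth_per e -> smooth_per (fun x => 'D_(Defs.basis R a) e x).
Proof.
move=> [se pe]; split; first by move=> k; exact: Ck_derive.
move=> b x; have AE (h : R) u z : (h *: u + z) + Defs.basis R b = h *: u + (z + Defs.basis R b).
  by rewrite addrA.
have E : (fun z => e (z + Defs.basis R b)) = e by apply/funext => z; exact: pe.
have [_] := derive_affine e (L := id) (A := fun z => z + Defs.basis R b) (fun h => AE h (Defs.basis R a) x).
by rewrite E => ->.
Qed.

Lemma smooth_per_bounded e : smooth_per e ->
  measurable_fun setT (fun x : X => e (vec x)) /\ exists2 N, 0 <= N & forall x : X, `|e (vec x)| <= N.
Proof.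
move=> [se pe].
have st : smooth_periodic (tensor (fun _ : R => 1) e).
  split; last by move=> t a x; rewrite /tensor/= pe.
  by apply: smooth_tensor => // k; exact: Ck_cst.
have [m [N hN]] := test_slice (lexx (0 : R)) st.
rewrite /tensor/= in m hN; split; first by under eq_fun do rewrite -[e _]mul1r.
exists (Num.max 0 N) => [|x]; first by rewrite le_max lexx.
by rewrite le_max; have := hN x; rewrite mul1r => ->; rewrite orbT.
Qed.

Lemma dx_tensorE (th : R -> R) e a : smooth e ->
  dx a (tensor th e) = tensor th (fun x => 'D_(Defs.basis R a) e x).
Proof. by move=> se; apply/funext => z; rewrite dx_tensor. Qed.

Lemma tensor_bound e M : smooth_per e -> 0 <= M -> exists2 L, 0 <= L &
  forall w th, L1b T M w -> smooth th ->
  `|ST hT (fun t x => w t x * tensor th e (t, vec x))| <= L * (T * RI UT (fun t => `|th t|)).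
Proof.
move=> spe M0; have [me [N N0 eN]] := smooth_per_bounded spe.
exists (M * N) => [|w th wM sth]; first exact: mulr_ge0.
exact: (ST_tensor_le hT wM me eN (Ck_continuous (sth 0%N))).
Qed.

Section family.
Variables (e : 'rV[R]_d -> R) (M nub : R).
Hypothesis spe : smooth_per e.
Hypothesis M0 : 0 <= M.

Let cf (w : R -> X -> R) (t : R) := RI mu (fun x => w (clamp T t) x * e (vec x)).

Lemma ST_dt_tensor w th : (exists N, L2b T N w) -> continuous (cf w) -> smooth th ->
  ST hT (fun t x => w t x * dt (tensor th e) (t, vec x)) = T * RI UT (fun t => cf w t * 'D_1 th t).
Proof.
move=> [N [_ wN]] cw sth; have [me [B B0 eB]] := smooth_per_bounded spe.
have [se _] := spe.
rewrite -(ST_tensor hT _ cw); last first.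
- exact: (@Ck_continuous _ _ _ 1 _ (@Ck_derive _ _ _ 1 th 1 (sth 2%N))).
- by move=> t tT; have [ws _] := wN t tT; apply: sqint_int; exact: sqintMb eB.
by rewrite /ST; congr (T * _); apply: eq_RI => t; apply: eq_RI => x; rewrite dt_tensor.
Qed.

Lemma lipschitz_of_bound w (L : R) : (exists N, L2b T N w) -> continuous (cf w) -> 0 <= L ->
  (forall th : R -> R, smooth th -> (exists2 b, b < T & forall t, b <= t -> th t = 0) -> th 0 = 0 ->
    `|ST hT (fun t x => w t x * dt (tensor th e) (t, vec x))| <= L * (T * RI UT (fun t => `|th t|))) ->
  forall s t, 0 <= s -> s <= t -> t <= T -> `|cf w t - cf w s| <= L * (t - s).
Proof.
move=> wb cw L0 hL; apply: (@time_lipschitz R T hT (cf w) L cw L0) => th sth bth th0 _.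
by rewrite -(ST_dt_tensor wb cw sth); exact: hL.
Qed.

Let init (f : X -> R) (th : R -> R) : th 0 = 0 -> RI mu (fun x => f x * tensor th e (0, vec x)) = 0.
Proof.
by move=> th0; rewrite -[RHS](RI_cst mu); apply: eq_RI => x; rewrite /tensor/= th0 mul0r mulr0.
Qed.

(** The constant is chosen before the flow: it depends only on the mode and on [M], and is therefore
    common to the whole sequence. Compatibility expresses the time derivative by the velocity paired
    with derivatives of the mode. *)
Lemma strain_lipschitz : exists2 L, 0 <= L & forall F0 u F i j,
  bounded_flow T p M u F -> continuous (cf (fun t x => F t x i j)) ->
  (forall eta, test T eta -> compat_eq hT F0 u F eta i j) ->
  forall s t, 0 <= s -> s <= t -> t <= T ->
  `|cf (fun t x => F t x i j) t - cf (fun t x => F t x i j) s| <= L * (t - s).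
Proof.
have M1 : 0 <= 1 + M by rewrite addr_ge0.
have Th0 (th : R -> R) : 0 <= T * RI UT (fun t => `|th t|).
  by apply: mulr_ge0; [exact: ltW|apply: RI_ge0].
have [L L0 hL] : exists2 L, 0 <= L & forall a w th, L1b T (1 + M) w -> smooth th ->
  `|ST hT (fun t x => w t x * dx a (tensor th e) (t, vec x))| <= L * (T * RI UT (fun t => `|th t|)).
  apply: finite_uniform => [a L L' LL h w th wM sth|a].
    by apply: (le_trans (h w th wM sth)); exact: ler_wpM2r.
  have [L L0 h] := tensor_bound (smooth_per_derive a spe) M1; exists L; first exact: L0.
  move=> w th wM sth.
  by rewrite dx_tensorE; [exact: h|have [] := spe].
exists L => // F0 u F i j bnd cF eqs.
apply: lipschitz_of_bound => //.
  by exists (1 + M); exact: (L2b_strain hp bnd).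
move=> th sth bth th0; have [se pe] := spe.
have := eqs _ (test_tensor sth bth se pe); rewrite /compat_eq init// addr0 => /subr0_eq ->.
by apply: hL => //; apply: L2b_L1b; exact: (L2b_velocity bnd).
Qed.

Lemma velocity_lipschitz : exists2 L, 0 <= L & forall nu u0 u F i,
  `|nu| <= nub -> bounded_flow T p M u F -> continuous (cf (fun t x => u t x ord0 i)) ->
  (forall eta, test T eta -> momentum_eq hT W nu u0 u F eta i) ->
  forall s t, 0 <= s -> s <= t -> t <= T ->
  `|cf (fun t x => u t x ord0 i) t - cf (fun t x => u t x ord0 i) s| <= L * (t - s).
Proof.
have M1 : 0 <= 1 + M by rewrite addr_ge0.
have M2 : 0 <= 1 + (1 + M) by rewrite !addr_ge0.
have M3 : 0 <= CS * (1 + M) by rewrite mulr_ge0.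
have Th0 (th : R -> R) : 0 <= T * RI UT (fun t => `|th t|).
  by apply: mulr_ge0; [exact: ltW|apply: RI_ge0].
have [L1 L10 hL1] : exists2 L, 0 <= L & forall a w th, L1b T (CS * (1 + M)) w -> smooth th ->
  `|ST hT (fun t x => w t x * dx a (tensor th e) (t, vec x))| <= L * (T * RI UT (fun t => `|th t|)).
  apply: finite_uniform => [a L L' LL h w th wM sth|a].
    by apply: (le_trans (h w th wM sth)); exact: ler_wpM2r.
  have [L L0 h] := tensor_bound (smooth_per_derive a spe) M3; exists L; first exact: L0.
  move=> w th wM sth.
  by rewrite dx_tensorE; [exact: h|have [] := spe].
have [L2 L20 hL2] : exists2 L, 0 <= L & forall a w th, L1b T (1 + M) w -> smooth th ->
  `|ST hT (fun t x => w t x * dx a (dx a (tensor th e)) (t, vec x))| <= L * (T * RI UT (fun t => `|th t|)).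
  apply: finite_uniform => [a L L' LL h w th wM sth|a].
    by apply: (le_trans (h w th wM sth)); exact: ler_wpM2r.
  have s1 := smooth_per_derive a spe.
  have [L L0 h] := tensor_bound (smooth_per_derive a s1) M1; exists L; first exact: L0.
  move=> w th wM sth.
  by rewrite dx_tensorE; [rewrite dx_tensorE; [exact: h|have [] := s1]|have [] := spe].
have [L3 L30 hL3] : exists2 L, 0 <= L & forall (ab : 'I_d * 'I_d) w th, L1b T (1 + (1 + M)) w -> smooth th ->
  `|ST hT (fun t x => w t x * dx ab.2 (dx ab.2 (dx ab.1 (tensor th e))) (t, vec x))| <= L * (T * RI UT (fun t => `|th t|)).
  apply: finite_uniform => [a L L' LL h w th wM sth|[a b]].
    by apply: (le_trans (h w th wM sth)); exact: ler_wpM2r.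
  have s1 := smooth_per_derive a spe; have s2 := smooth_per_derive b s1.
  have [L L0 h] := tensor_bound (smooth_per_derive b s2) M2; exists L; first exact: L0.
  move=> w th wM sth.
  rewrite /= dx_tensorE; last by have [] := spe.
  rewrite dx_tensorE; last by have [] := s1.
  by rewrite dx_tensorE; [exact: h|have [] := s2].
have nub0 : 0 <= `|nub| by [].
(* The three summands bound the stress, viscous and dispersive terms; the factors [d] count the
   directions summed over, and the viscosities are at most the absolute value of [nub]. *)
exists (d%:R * L1 + `|nub| * (d%:R * L2) + d%:R * (d%:R * L3)).
  by rewrite !addr_ge0// !mulr_ge0.
move=> nu u0 u F i hnu bnd cu eqs.
apply: lipschitz_of_bound => //.
- by exists M; exact: (L2b_velocity bnd).
- by rewrite !addr_ge0// !mulr_ge0.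
move=> th sth bth th0; have [se pe] := spe.
have := eqs _ (test_tensor sth bth se pe); rewrite /momentum_eq init// addr0.
move=> eqn; set t0 := T * _.
have sumd (f : 'I_d -> R) c : (forall a, `|f a| <= c) -> `|\sum_a f a| <= d%:R * c.
  move=> h; apply: (le_trans (ler_norm_sum _ _ _)); apply: (le_trans (ler_sum _ (fun a _ => h a))).
  by rewrite sumr_const card_ord mulr_natl.
have -> : (d%:R * L1 + `|nub| * (d%:R * L2) + d%:R * (d%:R * L3)) * t0 =
  d%:R * (L1 * t0) + `|nub| * (d%:R * (L2 * t0)) + d%:R * (d%:R * (L3 * t0)) by ring.
apply: (norm_le_sum3 eqn).
- by apply: sumd => a; apply: hL1 => //; exact: (L1b_stress W3 CS0 hCS bnd).
- rewrite normrM; apply: ler_pM => //; first exact: le_trans hnu (ler_norm _).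
  by apply: sumd => a; apply: hL2 => //; apply: L2b_L1b; exact: (L2b_velocity bnd).
- apply: (sumd (fun a => _)) => a; apply: (sumd (fun b => _)) => b.
  by apply: (hL3 (a, b)) => //; apply: L2b_L1b; exact: (L2b_strain hp bnd).
Qed.

End family.
End equi_lipschitz.

(** * Extraction of a subsequence *)

Section extraction.
Context (R : realType).

Lemma strictly_increasing_ge (s : nat -> nat) : (forall n, (s n < s n.+1)%N) ->
  forall n, (n <= s n)%N.
Proof. by move=> h; elim=> // n IH; exact: leq_ltn_trans IH (h n). Qed.

Lemma strictly_increasing_homo (s : nat -> nat) : (forall n, (s n < s n.+1)%N) ->
  {homo s : m n / (m < n)%N}.
Proof. by move=> h; apply: homo_ltn => //; exact: ltn_trans. Qed.

Lemma nat_uniform (q : nat) (P : nat -> nat -> Prop) :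
  (forall i N N', (N <= N')%N -> P i N -> P i N') ->
  (forall i, exists N, P i N) -> exists N, forall i, (i <= q)%N -> P i N.
Proof.
move=> mono hP; elim: q => [|q [N IH]].
  by have [N PN] := hP 0%N; exists N => i; rewrite leqn0 => /eqP ->.
have [N' PN'] := hP q.+1; exists (maxn N N') => i; rewrite leq_eqVlt => /orP[/eqP ->|iq].
  by apply: mono PN'; exact: leq_maxr.
by apply: mono (IH i iq); exact: leq_maxl.
Qed.

(* Compactness of a countable product of intervals replaces the usual nested
   extractions: a cluster point of the sequence in the product is the pointwise limit
   of a subsequence. *)
Lemma diagonal_extraction (b : nat -> nat -> R) (C : nat -> R) : (forall n k, `|b n k| <= C k) ->
  exists s : nat -> nat, (forall n, (s n < s n.+1)%N) /\
  exists z : nat -> R, forall k e, 0 < e -> exists N, forall j, (N <= j)%N -> `|b (s j) k - z k| <= e.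
Proof.
move=> bC.
pose K := [set w : prod_topology (fun _ : nat => R : topologicalType) |
  forall k, `[- C k, C k]%classic (w k)].
have cK : compact K by apply: (@tychonoff nat (fun _ => R) (fun k => `[- C k, C k]%classic)) => k; exact: segment_compact.
pose Ff : set_system (prod_topology (fun _ : nat => R : topologicalType)) := b @ \oo.
have FK : Ff K.
  by exists 0%N => // n _ k; rewrite /= in_itv/= -ler_norml bC.
have [z [_ hz]] := cK Ff (fmap_proper_filter _ _) FK.
have near_z j e : 0 < e -> nbhs z (fun w : nat -> R => forall k, (k < j)%N -> `|w k - z k| < e).
  move=> e0; elim: j => [|j IH]; first by apply: filterS filterT => w _ k.
  have nz : nbhs z (fun w : nat -> R => `|w j - z j| < e).
    have pj := @proj_continuous nat (fun _ => R) j z.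
    have ne : nbhs (z j) (fun y : R => `|y - z j| < e) by exists e => // y /=; rewrite distrC.
    exact: (pj _ ne).
  apply: filterS (filterI IH nz) => w [h1 h2] k; rewrite ltnS leq_eqVlt => /orP[/eqP -> //|]; exact: h1.
have pick (jN : nat * nat) : exists n, (jN.2 <= n)%N /\ forall k, (k < jN.1)%N -> `|b n k - z k| < jN.1.+1%:R^-1.
  case: jN => j N.
  have FA : Ff (b @` [set n | (N <= n)%N]) by exists N => // n /= Nn; exists n.
  have j0 : 0 < j.+1%:R^-1 :> R by rewrite invr_gt0.
  have [w [[n Nn <-] hw]] := hz _ _ FA (near_z j _ j0).
  by exists n.
have [f hf] := choice pick.
pose s := fix s j := if j is i.+1 then f (i.+1, (s i).+1) else f (0, 0)%N.
have sS j : s j.+1 = f (j.+1, (s j).+1) by [].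
have sinc n : (s n < s n.+1)%N by rewrite sS; have [] := hf (n.+1, (s n).+1).
exists s; split => //; exists z => k e e0.
pose N := maxn k.+1 (Num.truncn e^-1).+1; exists N => j Nj.
have j0 : (0 < j)%N by apply: leq_trans Nj; rewrite leq_max.
case: j j0 Nj => // j _ Nj; have [_ h] := hf (j.+1, (s j).+1).
have kj : (k < j.+1)%N by apply: leq_trans Nj; rewrite leq_max leqnn.
apply: (le_trans (ltW (h k kj))); rewrite /= -[leRHS]invrK lef_pV2 ?posrE ?invr_gt0//.
have h1 : e^-1 < (Num.truncn e^-1).+1%:R by rewrite real_truncnS_gt// num_real.
apply: (le_trans (ltW h1)); rewrite ler_nat; apply: leq_trans (leqnSn _).
by apply: leq_trans Nj; rewrite leq_max leqnn orbT.
Qed.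

(** Pointwise extraction on the countable set of all pairs of an index [c] and a rational grid point
    of [0, T]; the common Lipschitz constant carries convergence on a fine grid to uniform
    convergence. *)
Lemma ascoli (I : countType) (a : nat -> I -> R -> R) (T : R) : 0 < T ->
  (forall c, exists L, forall n, (forall t, 0 <= t <= T -> `|a n c t| <= L) /\
     forall r t, 0 <= r -> r <= t -> t <= T -> `|a n c t - a n c r| <= L * (t - r)) ->
  exists s : nat -> nat, (forall n, (s n < s n.+1)%N) /\
  forall c e, 0 < e -> exists N, forall i j, (N <= i)%N -> (N <= j)%N ->
    forall t, 0 <= t <= T -> `|a (s i) c t - a (s j) c t| <= e.
Proof.
move=> T0 /choice[L hL].
pose gr (i q : nat) : R := if (i <= q)%N then T * i%:R / q.+1%:R else 0.
have gr_itv i q : 0 <= gr i q <= T.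
  rewrite /gr; case: ifP => iq; last by rewrite lexx ltW.
  rewrite divr_ge0 ?mulr_ge0 ?(ltW T0)//= ler_pdivrMr// ler_wpM2l ?(ltW T0)//.
  by rewrite ler_nat (leq_trans iq).
pose b n m := if @unpickle (I * (nat * nat))%type m is Some x then a n x.1 (gr x.2.1 x.2.2) else 0.
pose C m := if @unpickle (I * (nat * nat))%type m is Some x then L x.1 else 0.
have bC n m : `|b n m| <= C m.
  rewrite /b /C; case: unpickle => [x|]; last by rewrite normr0.
  by have [h _] := hL x.1 n; exact: h.
have [s [sinc [z hz]]] := diagonal_extraction bC.
exists s; split => // c e e0.
have L0 : 0 <= L c.
  by have [h _] := hL c 0%N; apply: (le_trans _ (h 0 _)) => //; rewrite lexx ltW.
(* The mesh [T / q.+1] is so fine that a function varies by at most [e / 4] between a time and the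
   grid point before it; two such errors and two from the convergence at the grid point add up to
   [e]. *)
pose q := (Num.truncn (4 * L c * T / e)).+1.
have qe : L c * (T / q.+1%:R) <= e / 4.
  have h : 4 * L c * T / e < q%:R by rewrite real_truncnS_gt// num_real.
  rewrite mulrA ler_pdivrMr// mulrAC ler_pdivlMr//.
  rewrite ltr_pdivrMr// in h; have h2 : q%:R <= q.+1%:R :> R by rewrite ler_nat.
  have h3 := ler_wpM2l (ltW e0) h2; lra.
pose P i N := forall j, (N <= j)%N -> `|a (s j) c (gr i q) - z (pickle (c, (i, q)))| <= e / 4.
have [|i|N hN] := @nat_uniform q P.
- by move=> i N N' NN h j N'j; apply: h; exact: leq_trans NN N'j.
- have [|N hN] := hz (pickle (c, (i, q))) (e / 4); first by rewrite divr_gt0.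
  by exists N => j /hN; rewrite /b pickleK.
exists N => i j Ni Nj t /andP[t0 tT].
pose l := Num.truncn (t * q.+1%:R / T).
have tq0 : 0 <= t * q.+1%:R / T by rewrite divr_ge0 ?mulr_ge0// ltW.
have /andP[l1 l2] : l%:R <= t * q.+1%:R / T < l.+1%:R by exact: truncn_itv.
(* At [t = T] the truncation gives [q.+1], one past the last grid point; the minimum steps back,
   still within one mesh of [t]. *)
pose k := minn l q.
have kq : (k <= q)%N by rewrite geq_minr.
have [g0 gt gd] : [/\ 0 <= gr k q, gr k q <= t & t - gr k q <= T / q.+1%:R].
  have q0 : 0 < q.+1%:R :> R by [].
  rewrite /gr kq; split; first by rewrite divr_ge0 ?mulr_ge0// ltW.
    rewrite ler_pdivrMr// mulrC -ler_pdivlMr//; apply: le_trans l1.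
    by rewrite ler_nat geq_minl.
  rewrite lerBlDr -mulrDl -{1}[T]mulr1 -mulrDr ler_pdivlMr//.
  rewrite /k; have [lq|ql] := leqP l q.
    by rewrite ltr_pdivrMr// in l2; rewrite [T * _]mulrC nat1r; exact: ltW.
  by rewrite nat1r; exact: ler_pM.
have [_ li] := hL c (s i); have [_ lj] := hL c (s j).
have d1 := li _ _ g0 gt tT; have d2 := lj _ _ g0 gt tT.
have d3 := hN k kq i Ni; have d4 := hN k kq j Nj.
have d5 : L c * (t - gr k q) <= e / 4 by apply: le_trans qe; exact: ler_wpM2l.
have := le_trans d1 d5; have := le_trans d2 d5; move: d3 d4.
rewrite !ler_norml => /andP[? ?] /andP[? ?] /andP[? ?] /andP[? ?]; apply/andP; split; lra.
Qed.

Lemma fast_subsequence (P : nat -> nat -> nat -> Prop) :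
  (forall j, exists N, forall m n, (N <= m)%N -> (N <= n)%N -> P j m n) ->
  exists s : nat -> nat, (forall n, (s n < s n.+1)%N) /\ forall j, P j (s j) (s j.+1).
Proof.
move=> /choice[N hN].
pose s := fix s j := if j is i.+1 then maxn (N i.+1) (s i).+1 else N 0%N.
have sS j : s j.+1 = maxn (N j.+1) (s j).+1 by [].
have sinc n : (s n < s n.+1)%N by rewrite sS leq_max leqnn orbT.
have sN j : (N j <= s j)%N by case: j => [|j]; rewrite ?sS ?leq_max leqnn.
exists s; split => // j; apply: hN => //; exact: leq_trans (sN j) (ltnW (sinc j)).
Qed.

End extraction.

(** * Differences of strains in L^2 *)

Section differences.
Context (R : realType) (d : nat).
Notation X := (d.-tuple R).
Notation mu := (@torus R d).
Notation te := (@te R d).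

Lemma sqr_sum3 (x y z : R) : (x + y + z) ^+ 2 <= 3 * (x ^+ 2 + y ^+ 2 + z ^+ 2).
Proof.
have := sqr_ge0 (x - y); have := sqr_ge0 (y - z); have := sqr_ge0 (x - z); rewrite !expr2; nra.
Qed.

Lemma RI_sqr_sum3 (f g h : X -> R) : sqint mu f -> sqint mu g -> sqint mu h ->
  RI mu (fun x => (f x + g x + h x) ^+ 2) <=
  3 * (RI mu (fun x => f x ^+ 2) + RI mu (fun x => g x ^+ 2) + RI mu (fun x => h x ^+ 2)).
Proof.
move=> sf sg sh; have [f2 g2 h2] := And3 (sqint2 sf) (sqint2 sg) (sqint2 sh).
rewrite -(RID f2 g2) -(RID (integD f2 g2) h2) -(RIZ 3 (integD (integD f2 g2) h2)).
apply: RI_le; [by apply: sqint2; apply: sqintD => //; exact: sqintD| |move=> x; exact: sqr_sum3].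
by apply: integZ; apply: integD => //; exact: integD.
Qed.

Lemma RI_sqrB_le (f g : X -> R) M : sqint mu f -> sqint mu g ->
  RI mu (fun x => f x ^+ 2) <= M -> RI mu (fun x => g x ^+ 2) <= M ->
  RI mu (fun x => (f x - g x) ^+ 2) <= 4 * M.
Proof.
move=> sf sg fM gM; have [f2 g2] := (sqint2 sf, sqint2 sg).
apply: (@le_trans _ _ (RI mu (fun x => 2 * (f x ^+ 2 + g x ^+ 2)))).
  apply: RI_le; [by apply: sqint2; exact: sqintB|by apply: integZ; exact: integD|].
  by move=> x; have := sqrD_le (f x) (- g x); rewrite sqrrN.
rewrite (RIZ 2 (integD f2 g2)) (RID f2 g2); lra.
Qed.

Lemma is_wpdB a (f g f' g' : X -> R) : is_wpd a f f' -> is_wpd a g g' ->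
  is_wpd a (fun x => f x - g x) (fun x => f' x - g' x).
Proof.
move=> [fi fi' hf] [gi gi' hg]; split; [exact: integB|exact: integB|].
move=> phi sp pp; have [mp [N N0 hN]] := smooth_per_bounded (conj sp pp).
have [mdp [N' N'0 hN']] := smooth_per_bounded (smooth_per_derive a (conj sp pp)).
have im (h : X -> R) (k : X -> R) c : integ mu h -> measurable_fun setT k ->
    (forall x, `|k x| <= c) -> integ mu (fun x => h x * k x).
  move=> ih mk kc; apply: (@integ_le _ _ _ mu _ (fun x => c * `|h x|)).
  - by apply: measurable_funM => //; exact: integ_meas ih.
  - by move=> x; rewrite normrM mulrC ler_wpM2r.
  - by apply: integZ; exact: integ_abs.
have i1 := im _ _ _ fi mdp hN'; have i2 := im _ _ _ gi mdp hN'.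
have i3 := im _ _ _ fi' mp hN; have i4 := im _ _ _ gi' mp hN.
have -> : \int[mu]_x ((f x - g x) * 'D_(Defs.basis R a) phi (vec x)) =
  RI mu (fun x => f x * 'D_(Defs.basis R a) phi (vec x)) - RI mu (fun x => g x * 'D_(Defs.basis R a) phi (vec x)).
  by rewrite -(RIB i1 i2); apply: eq_RI => x; rewrite mulrBl.
have -> : \int[mu]_x ((f' x - g' x) * phi (vec x)) =
  RI mu (fun x => f' x * phi (vec x)) - RI mu (fun x => g' x * phi (vec x)).
  by rewrite -(RIB i3 i4); apply: eq_RI => x; rewrite mulrBl.
have e1 : RI mu (fun x => f x * 'D_(Defs.basis R a) phi (vec x)) = - RI mu (fun x => f' x * phi (vec x)) := hf _ sp pp.
have e2 : RI mu (fun x => g x * 'D_(Defs.basis R a) phi (vec x)) = - RI mu (fun x => g' x * phi (vec x)) := hg _ sp pp.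
by rewrite e1 e2 opprB opprK addrC.
Qed.

Lemma coef_bound (f : X -> R) m : sqint mu f -> `|coef mu te f m| <= 1 + RI mu (fun x => f x ^+ 2).
Proof.
move=> sf; have := bessel (@sqint_te R d) (@te_orth R d) (@te_norm R d) sf (s := [:: m]) isT.
rewrite big_seq1 -real_normK ?num_real//; set y := `|_|; set z := RI _ _ => h.
have y0 : 0 <= y by rewrite /y normr_ge0. nra.
Qed.

(* Rellich's theorem in quantitative form: the H^1 bound turns smallness of finitely
   many Fourier coefficients into smallness in L^2. *)
Lemma rellich_cauchy (B e : R) : 0 <= B -> 0 < e -> exists N, exists2 del, 0 < del &
  forall f g : X -> 'M[R]_d, Hk 1 f -> Hk 1 g ->
  RI mu (grad2 f) <= B -> RI mu (grad2 g) <= B -> forall i j,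
  (forall m, (m < N)%N -> `|coef mu te (fun x => f x i j) m - coef mu te (fun x => g x i j) m| <= del) ->
  RI mu (fun x => (f x i j - g x i j) ^+ 2) <= e.
Proof.
move=> B0 e0; pose c := d%:R * (4 * B) + 1.
have c0 : 0 < c by rewrite ltr_wpDl// !mulr_ge0.
have e1 : 0 < e / 2 / c by rewrite !divr_gt0.
have [N hN] := rellich d e1.
pose del := Num.min 1 (e / 2 / N.+1%:R).
exists N, del; first by rewrite lt_min ltr01 !divr_gt0.
move=> f g hf hg fB gB i j hm.
have sf : sqint mu (fun x => f x i j) by apply: Lp2_sqint; have [] := hf.
have sg : sqint mu (fun x => g x i j) by apply: Lp2_sqint; have [] := hg.
have sw b : sqint mu (fun x => wpd b f x i j - wpd b g x i j).
  by apply: sqintB; exact: Hk1_sqint.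
have ww b : is_wpd b (fun x => f x i j - g x i j) (fun x => wpd b f x i j - wpd b g x i j).
  apply: is_wpdB; apply: is_wpd_wpd.
    by have [_ /(_ b)[]] := hf.
  by have [_ /(_ b)[]] := hg.
apply: (le_trans (hN _ _ (sqintB sf sg) sw ww)).
have h1 : \sum_(0 <= m < N) coef mu te (fun x => f x i j - g x i j) m ^+ 2 <= e / 2.
  apply: (@le_trans _ _ (\sum_(0 <= m < N) e / 2 / N.+1%:R)).
    rewrite big_nat [leRHS]big_nat; apply: ler_sum => m /andP[_ mN].
    rewrite (coef_sub (@sqint_te R d) m sf sg).
    have := hm m mN; rewrite -real_normK ?num_real//; set y := `|_| => hy.
    have y0 : 0 <= y by rewrite /y normr_ge0.
    have y1 : y <= 1 by rewrite (le_trans hy)// ge_min lexx.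
    by rewrite (@le_trans _ _ y)//; [rewrite expr2 ler_piMl|rewrite (le_trans hy)// ge_min lexx orbT].
  rewrite sumr_const_nat subn0 -[_ *+ N]mulr_natr -mulrA ler_piMr ?divr_ge0 ?(ltW e0)//.
  by rewrite mulrC ler_pdivrMr// mul1r ler_nat.
have h2 : e / 2 / c * \sum_a RI mu (fun x => (wpd a f x i j - wpd a g x i j) ^+ 2) <= e / 2.
  rewrite -[leRHS](divfK (lt0r_neq0 c0)) ler_wpM2l//; first exact: ltW.
  apply: (@le_trans _ _ (\sum_(a < d) 4 * B)).
    apply: ler_sum => a _; apply: RI_sqrB_le; do ?exact: Hk1_sqint.
      by apply: le_trans fB; exact: wpd_grad2.
    by apply: le_trans gB; exact: wpd_grad2.
  by rewrite sumr_const card_ord -[_ *+ d]mulr_natl /c lerDl.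
by rewrite (le_trans (lerD h1 h2))// -splitr.
Qed.

End differences.

Lemma aeI d (Y : measurableType d) (R : realType) (nu : {measure set Y -> \bar R}) (P Q : Y -> Prop) :
  {ae nu, forall x, P x} -> {ae nu, forall x, Q x} -> {ae nu, forall x, P x /\ Q x}.
Proof. by move=> hP hQ; exact: filterI. Qed.

Lemma sum3_ninth (R : realFieldType) (x y z e : R) :
  x <= e / 9 -> y <= e / 9 -> z <= e / 9 -> 3 * (x + y + z) <= e.
Proof. lra. Qed.

(** * Compactness of the sequence of solutions *)

Section compactness.
Context (R : realType) (d : nat) (T p : R).
Hypothesis hT : 0 < T.
Hypothesis hp : 2 <= p.
Notation X := (d.-tuple R).
Notation mu := (@torus R d).
Notation te := (@te R d).
Notation cf := (coef mu te).
Variable W : 'M[R]_d -> R.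
Hypothesis W3 : W_C3 W.
Variable CS : R.
Hypothesis CS0 : 0 <= CS.
Hypothesis hCS : forall i a F, (1 + frob F) * `|partial W i a F| <= CS * (1 + frob F `^ p).
Variables (M nub : R) (nu : nat -> R).
Variables (u0 : nat -> X -> 'rV[R]_d) (F0 : nat -> X -> 'M[R]_d).
Variables (u : nat -> R -> X -> 'rV[R]_d) (F : nat -> R -> X -> 'M[R]_d).
Hypothesis M0 : 0 <= M.
Hypothesis hnu : forall n, `|nu n| <= nub.
Hypothesis bnd : forall n, bounded_flow T p M (u n) (F n).
Hypothesis cu : forall n, CLp T 2 (u n).
Hypothesis cF : forall n, CLp T p (F n).
Hypothesis hu0 : forall n i, sqint mu (fun x => u0 n x ord0 i) /\
  RI mu (fun x => u0 n x ord0 i ^+ 2) <= M.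
Hypothesis hF0 : forall n, Hk 1 (F0 n) /\ RI mu (grad2 (F0 n)) <= M.
Hypothesis bF0 : forall n i j, RI mu (fun x => F0 n x i j ^+ 2) <= M.
Hypothesis hF1 : forall n, {ae @lebesgue_measure R, forall t, t \in `]0, T[ ->
  Hk 1 (F n t) /\ RI mu (grad2 (F n t)) <= M}.
Hypothesis mom : forall n eta, test T eta -> forall i, momentum_eq hT W (nu n) (u0 n) (u n) (F n) eta i.
Hypothesis cpt : forall n eta, test T eta -> forall i j, compat_eq hT (F0 n) (u n) (F n) eta i j.

(** Velocities, strains and both initial data form one family, the data being constant in time, so
    that a single extraction serves all four. *)
Let fam n (c : ('I_d + 'I_d * 'I_d) + ('I_d + 'I_d * 'I_d)) (t : R) (x : X) : R :=
  match c with
  | inl (inl i) => u n t x ord0 i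
  | inl (inr ij) => F n t x ij.1 ij.2
  | inr (inl i) => u0 n x ord0 i
  | inr (inr ij) => F0 n x ij.1 ij.2
  end.

Let fam_bound n c t : 0 <= t <= T -> sqint mu (fam n c t) /\
  RI mu (fun x => fam n c t x ^+ 2) <= 1 + M.
Proof.
move=> tT; case: c => [[i|[i j]]|[i|[i j]]] /=.
- have [_ /(_ t tT)[h1 h2]] := L2b_velocity (bnd n) i.
  by split=> //; rewrite (le_trans h2)// lerDr.
- by have [_ /(_ t tT)] := L2b_strain hp (bnd n) i j.
- by have [h1 h2] := hu0 n i; split=> //; rewrite (le_trans h2)// lerDr.
- have [h1 _] := hF0 n; split; first by apply: Lp2_sqint; have [] := h1.
  by rewrite (le_trans (bF0 n i j))// lerDr.
Qed.

Let coef_te (w : R -> X -> R) k t : cf (w t) (pickle k) = RI mu (fun x => w t x * EE k (vec x)).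
Proof. by apply: eq_RI => x; rewrite te_pickle EE_vec. Qed.

Let fam_lipschitz c m : exists L, forall n r t, 0 <= r -> r <= t -> t <= T ->
  `|cf (fam n c t) m - cf (fam n c r) m| <= L * (t - r).
Proof.
have [[k [mk _]]|t0] := @teP R d m; last first.
  exists 0 => n r t _ _ _; have z s : cf (fam n c s) m = 0.
    by rewrite -[RHS](RI_cst mu); apply: eq_RI => x; rewrite t0 mulr0.
  by rewrite !z subrr normr0 mul0r.
have spe : smooth_per (@EE R d k) by split; [exact: smooth_EE|exact: periodic_EE].
have cl r t : 0 <= r -> r <= t -> t <= T -> clamp T t = t /\ clamp T r = r.
  by move=> r0 rt tT; split; apply: clampE; rewrite ?tT ?r0 ?(le_trans r0 rt) ?(le_trans rt tT).
have sE : sqint mu (fun x : X => EE k (vec x)).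
  have -> : (fun x : X => EE k (vec x)) = eb k by apply/funext => x; rewrite EE_vec.
  exact: sqint_eb.
case: c => [[i|[i j]]|c]; last first.
- exists 0 => n r t _ _ _; case: c => [i|[i j]] /=; by rewrite subrr normr0 mul0r.
- have [L L0 hL] := strain_lipschitz hT hp spe M0; exists L => n r t r0 rt tT.
  have := hL (F0 n) (u n) (F n) i j (bnd n) (CLp_coef_continuous hT hp (cF n) sE)
    (fun eta te => cpt n te i j) r t r0 rt tT.
  by have [-> ->] := cl _ _ r0 rt tT; rewrite mk !coef_te.
- have [L L0 hL] := velocity_lipschitz hT hp W3 CS0 hCS nub spe M0; exists L => n r t r0 rt tT.
  have := hL (nu n) (u0 n) (u n) (F n) i (hnu n) (bnd n) (CLp_coef_continuous hT (lexx 2) (cu n) sE)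
    (fun eta te => mom n te i) r t r0 rt tT.
  by have [-> ->] := cl _ _ r0 rt tT; rewrite mk !coef_te.
Qed.

(** The H^1 bound holds at almost every time only, and Rellich's estimate compares two members of
    the sequence: a common good time is needed, arbitrarily close to the given one. *)
Let hk_dense (a b : nat) t del : 0 <= t <= T -> 0 < del -> exists s, [/\ 0 <= s <= T, `|s - t| < del,
  Hk 1 (F a s) /\ RI mu (grad2 (F a s)) <= M & Hk 1 (F b s) /\ RI mu (grad2 (F b s)) <= M].
Proof.
move=> tT del0.
have : {ae @lebesgue_measure R, forall t, t \in `]0, T[ ->
  (Hk 1 (F a t) /\ RI mu (grad2 (F a t)) <= M) /\ (Hk 1 (F b t) /\ RI mu (grad2 (F b t)) <= M)}.
  have := aeI (hF1 a) (hF1 b); apply: aeS => s [h1 h2] sT; by split; [exact: h1|exact: h2].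
by move=> /(ae_dense hT) /(_ t del tT del0)[s [sT st [h1 h2]]]; exists s.
Qed.

Lemma subsequence : exists s : nat -> nat, (forall n, (s n < s n.+1)%N) /\
  [/\ forall i m t e, 0 <= t <= T -> 0 < e -> exists N, forall a b, (N <= a)%N -> (N <= b)%N ->
        `|cf (fun x => u (s a) t x ord0 i) m - cf (fun x => u (s b) t x ord0 i) m| <= e,
      forall i m e, 0 < e -> exists N, forall a b, (N <= a)%N -> (N <= b)%N ->
        `|cf (fun x => u0 (s a) x ord0 i) m - cf (fun x => u0 (s b) x ord0 i) m| <= e,
      forall a t i j, 0 <= t <= T ->
        RI mu (fun x => (F (s a.+1) t x i j - F (s a) t x i j) ^+ 2) <= (1 / 4) ^+ a &
      forall a i j, RI mu (fun x => (F0 (s a.+1) x i j - F0 (s a) x i j) ^+ 2) <= (1 / 4) ^+ a].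
Proof.
have fb c : exists L, forall n, (forall t, 0 <= t <= T -> `|cf (fam n c.1 t) c.2| <= L) /\
     forall r t, 0 <= r -> r <= t -> t <= T -> `|cf (fam n c.1 t) c.2 - cf (fam n c.1 r) c.2| <= L * (t - r).
  have [L hL] := fam_lipschitz c.1 c.2; exists (Num.max L (1 + (1 + M))) => n; split.
    move=> t tT; have [h1 h2] := fam_bound n c.1 tT.
    by apply: (le_trans (coef_bound _ h1)); rewrite le_max lerD2l h2 orbT.
  move=> r t r0 rt tT; apply: (le_trans (hL n r t r0 rt tT)).
  by rewrite ler_wpM2r ?subr_ge0// le_max lexx.
have [s [sinc hs]] := ascoli hT fb.
have s_ge := strictly_increasing_ge sinc.
have small c e : 0 < e -> forall N, exists N', forall a b, (N' <= a)%N -> (N' <= b)%N ->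
    forall m, (m < N)%N -> forall t, 0 <= t <= T -> `|cf (fam (s a) c t) m - cf (fam (s b) c t) m| <= e.
  move=> e0 N.
  pose P m N' := forall a b, (N' <= a)%N -> (N' <= b)%N -> forall t, 0 <= t <= T ->
     `|cf (fam (s a) c t) m - cf (fam (s b) c t) m| <= e.
  have [|m|N' hN'] := @nat_uniform N P.
  - by move=> m K K' KK h a b Ka Kb; apply: h; exact: leq_trans KK _.
  - exact: hs (c, m) e e0.
  - by exists N' => a b Na Nb m mN; apply: hN' => //; exact: ltnW.
have zT : 0 <= (0 : R) <= T by rewrite lexx ltW.
(* At a time [t] where the H^1 bound may fail, both strains are moved to a common good time [r] by
   continuity and compared there through their low modes. Three terms, and the factor 3 of the
   squared sum, account for [e / 9]; the resulting [N] does not depend on [t]. *)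
have strain e i j : 0 < e -> exists N, forall a b, (N <= a)%N -> (N <= b)%N -> forall t, 0 <= t <= T ->
    RI mu (fun x => (F (s a) t x i j - F (s b) t x i j) ^+ 2) <= e.
  move=> e0; have e9 : 0 < e / 9 by rewrite divr_gt0.
  have [K [del del0 hK]] := rellich_cauchy d M0 e9.
  have [N hN] := small (inl (inr (i, j))) del del0 K; exists N => a b Na Nb t tT.
  have [d1 d10 hd1] := CLp_entry hp (cF (s a)) tT e9.
  have [d2 d20 hd2] := CLp_entry hp (cF (s b)) tT e9.
  have d0 : 0 < Num.min d1 d2 by rewrite lt_min d10.
  have [r [rT]] := hk_dense (s a) (s b) tT d0.
  rewrite lt_min => /andP[rd1 rd2] [h1 h2] [h3 h4].
  have sF n q : 0 <= q <= T -> sqint mu (fun x => F n q x i j).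
    by move=> qT; have [_ /(_ q qT)[]] := L2b_strain hp (bnd n) i j.
  have k1 := hd1 r rT rd1 i j; have k2 := hd2 r rT rd2 i j.
  have k3 := hK _ _ h1 h3 h2 h4 i j (fun m mK => hN a b Na Nb m mK r rT).
  have e1 : (fun x => (F (s a) t x i j - F (s b) t x i j) ^+ 2) =
     fun x => ((F (s a) t x i j - F (s a) r x i j) + (F (s a) r x i j - F (s b) r x i j) +
       (F (s b) r x i j - F (s b) t x i j)) ^+ 2.
    by apply/funext => x; congr (_ ^+ 2); ring.
  rewrite e1; apply: (le_trans (RI_sqr_sum3 _ _ _)); do ?[by apply: sqintB; exact: sF].
  have k1' : RI mu (fun x => (F (s a) t x i j - F (s a) r x i j) ^+ 2) <= e / 9.
    apply: le_trans k1; rewrite le_eqVlt; apply/orP; left; apply/eqP; apply: eq_RI => x.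
    by rewrite -sqrrN opprB.
  exact: sum3_ninth.
have strain0 e i j : 0 < e -> exists N, forall a b, (N <= a)%N -> (N <= b)%N ->
    RI mu (fun x => (F0 (s a) x i j - F0 (s b) x i j) ^+ 2) <= e.
  move=> e0; have [K [del del0 hK]] := rellich_cauchy d M0 e0.
  have [N hN] := small (inr (inr (i, j))) del del0 K; exists N => a b Na Nb.
  have [h1 h2] := hF0 (s a); have [h3 h4] := hF0 (s b).
  exact: (hK _ _ h1 h3 h2 h4 i j (fun m mK => hN a b Na Nb m mK 0 zT)).
pose P k a b := forall i j, (forall t, 0 <= t <= T ->
    RI mu (fun x => (F (s b) t x i j - F (s a) t x i j) ^+ 2) <= (1 / 4) ^+ k) /\
    RI mu (fun x => (F0 (s b) x i j - F0 (s a) x i j) ^+ 2) <= (1 / 4) ^+ k.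
(* A second thinning imposes the rate that [riesz_fischer] requires, uniformly in time. *)
have [|r [rinc hr]] := @fast_subsequence P.
  move=> k; have e0 : 0 < (1 / 4 : R) ^+ k by rewrite exprn_gt0// divr_gt0.
  pose Q (ij : 'I_d * 'I_d) N := forall a b, (N <= a)%N -> (N <= b)%N -> (forall t, 0 <= t <= T ->
    RI mu (fun x => (F (s b) t x ij.1 ij.2 - F (s a) t x ij.1 ij.2) ^+ 2) <= (1 / 4) ^+ k) /\
    RI mu (fun x => (F0 (s b) x ij.1 ij.2 - F0 (s a) x ij.1 ij.2) ^+ 2) <= (1 / 4) ^+ k.
  have /choice[N hN] : forall ij, exists N, Q ij N.
    move=> [i j]; have [N1 h1] := strain _ i j e0; have [N2 h2] := strain0 _ i j e0.
    exists (maxn N1 N2) => a b; rewrite !geq_max => /andP[a1 a2] /andP[b1 b2]; split.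
      by move=> t tT; exact: h1.
    exact: h2.
  exists (\max_ij N ij) => a b Na Nb i j.
  by apply: (hN (i, j)); [apply: leq_trans Na|apply: leq_trans Nb]; exact: leq_bigmax.
have r_ge := strictly_increasing_ge rinc.
exists (s \o r); split.
  by move=> n /=; apply: (strictly_increasing_homo sinc).
split => /=.
- move=> i m t e tT e0; have [N hN] := hs (inl (inl i), m) e e0; exists N => a b Na Nb.
  apply: (hN (r a) (r b) _ _ t tT); [exact: leq_trans Na _|exact: leq_trans Nb _].
- move=> i m e e0; have [N hN] := hs (inr (inl i), m) e e0; exists N => a b Na Nb.
  apply: (hN (r a) (r b) _ _ 0 zT); [exact: leq_trans Na _|exact: leq_trans Nb _].
- by move=> a t i j tT; have [h _] := hr a i j; exact: h.
- by move=> a i j; have [_ h] := hr a i j.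
Qed.

End compactness.

Lemma fatou_RI d (Y : measurableType d) (R : realType) (mu : probability Y R)
    (h : nat -> Y -> R) (l : Y -> R) M :
  (forall n, integ mu (h n)) -> (forall n x, 0 <= h n x) -> (forall n, RI mu (h n) <= M) ->
  measurable_fun setT l -> (forall x, 0 <= l x) ->
  {ae mu, forall x, h n x @[n --> \oo] --> l x} -> integ mu l /\ RI mu l <= M.
Proof.
move=> ih h0 hM ml l0 hl.
have mE n : measurable_fun setT (EFin \o h n) by apply/measurable_EFinP; exact: integ_meas (ih n).
have le : (\int[mu]_x (l x)%:E <= M%:E)%E.
  have F : (\int[mu]_x limn_einf (fun n => (h n x)%:E) <= limn_einf (fun n => \int[mu]_x (h n x)%:E))%E.
    by apply: (@fatou _ _ _ mu setT measurableT (fun n x => (h n x)%:E) mE) => n x _; rewrite lee_fin.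
  have -> : (\int[mu]_x (l x)%:E = \int[mu]_x limn_einf (fun n => (h n x)%:E))%E.
    apply: ae_integral_eq; move: hl; apply: aeS => x hx _.
    apply/esym; have /cvg_limn_einf_sup[-> _] // : (fun n => (h n x)%:E) @ \oo --> (l x)%:E.
    by apply: cvg_EFin => //; exact: nearW.
  apply: (le_trans F); rewrite limn_einf_lim; apply: lime_le; first exact: is_cvg_einfs.
  apply: nearW => n; apply: (@le_trans _ _ (\int[mu]_x (h n x)%:E)%E).
    by apply: ereal_inf_lbound; exists n => //=.
  by rewrite RI_EFin// lee_fin.
have il : integ mu l by apply: integ_lty => //; exact: le_lt_trans le (ltry _).
by split => //; rewrite -lee_fin -RI_EFin.
Qed.

Lemma real_cauchy (R : realType) (b : nat -> R) :
  (forall e, 0 < e -> exists N, forall i j, (N <= i)%N -> (N <= j)%N -> `|b i - b j| <= e) ->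
  exists l : R, b @ \oo --> l.
Proof.
move=> h; suff : cvgn b by move=> /cvg_ex[l hl]; exists l.
apply/cauchy_cvgP; apply: cauchy_exP => e e0.
have [N hN] := h (e / 2) (divr_gt0 e0 (ltr0n R 2)).
exists (b N); exists N => // n /= Nn; rewrite /ball/=.
by apply: (le_lt_trans (hN _ _ _ Nn)) => //; lra.
Qed.

(** * Convergence of the strains and the stresses *)

Section weak_limits.
Context (R : realType) (d : nat).
Notation X := (d.-tuple R).
Notation mu := (@torus R d).
Notation te := (@te R d).
Notation cf := (coef mu te).

(** The test function is replaced by a partial Fourier sum, on which convergence is that of finitely
    many coefficients; the L^2 bounds make the remainder uniformly small. *)
Lemma weak_cvg (f : nat -> X -> R) (l g : X -> R) M : (forall n, sqint mu (f n)) -> sqint mu l ->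
  (forall n, RI mu (fun x => f n x ^+ 2) <= M) -> RI mu (fun x => l x ^+ 2) <= M ->
  (forall m, cf (f n) m @[n --> \oo] --> cf l m) -> sqint mu g ->
  RI mu (fun x => f n x * g x) @[n --> \oo] --> RI mu (fun x => l x * g x).
Proof.
move=> sf sl fM lM fl sg; apply/cvgrPdist_le => e e0.
have M0 : 0 <= M := le_trans (RI_sqr_ge0 _ _) lM.
(* With this weight, the Young term of [l - f n], whose square integral is at most [4 * M], is at
   most [e / 4]; the truncation of [g] is then taken to precision [c * (e / 4)] for the other
   term. *)
pose c := e / 2 / (4 * M + 1) / 2.
have D0 : 0 < 4 * M + 1 by rewrite ltr_wpDl// mulr_ge0.
have c0 : 0 < c by rewrite /c !divr_gt0.
have ce : 0 < c * (e / 4) by rewrite mulr_gt0// divr_gt0.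
have [N hN] := fourier_tail (@sqint_te R d) (@te_orth R d) (@te_norm R d) (@te_complete R d) sg ce.
set gN := lin te (index_iota 0 N) (cf g) in hN.
have sgN : sqint mu gN := sqint_lin (@sqint_te R d) _ _.
have sr : sqint mu (fun x => g x - gN x) := sqintB sg sgN.
have cN : (fun n => RI mu (fun x => f n x * gN x)) @ \oo --> RI mu (fun x => l x * gN x).
  rewrite (RI_mul_lin (@sqint_te R d) _ _ sl).
  have -> : (fun n => RI mu (fun x => f n x * gN x)) =
      fun n => \sum_(m <- index_iota 0 N) cf g m * cf (f n) m.
    by apply/funext => n; rewrite (RI_mul_lin (@sqint_te R d) _ _ (sf n)).
  by apply: cvg_big => [|m _]; [exact: add_continuous|apply: cvgM; [exact: cvg_cst|exact: fl]].
have e4 : 0 < e / 4 by rewrite divr_gt0.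
move/cvgrPdist_le : cN => /(_ _ e4); apply: filterS => n hn.
have sd : sqint mu (fun x => l x - f n x) := sqintB sl (sf n).
have dM : RI mu (fun x => (l x - f n x) ^+ 2) <= 4 * M by exact: RI_sqrB_le.
have -> : RI mu (fun x => l x * g x) - RI mu (fun x => f n x * g x) =
  (RI mu (fun x => l x * gN x) - RI mu (fun x => f n x * gN x)) +
  RI mu (fun x => (l x - f n x) * (g x - gN x)).
  have i1 := sqintM sl sg; have i2 := sqintM (sf n) sg.
  have i3 := sqintM sl sgN; have i4 := sqintM (sf n) sgN; have i5 := sqintM sd sr.
  rewrite -(RIB i1 i2) -(RIB i3 i4) -(RID (integB i3 i4) i5).
  by apply: eq_RI => x; ring.
apply: (le_trans (ler_normD _ _)).
have h2 : `|RI mu (fun x => (l x - f n x) * (g x - gN x))| <= 3 / 4 * e.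
  apply: (le_trans (RI_young c0 sd sr)).
  have k1 : c * RI mu (fun x => (l x - f n x) ^+ 2) <= e / 4.
    apply: (@le_trans _ _ (c * (4 * M + 1))).
      by rewrite ler_wpM2l ?(ltW c0)// (le_trans dM)// lerDl.
    by rewrite /c mulrAC divfK ?gt_eqF//; lra.
  have k2 : c^-1 * RI mu (fun x => (g x - gN x) ^+ 2) <= e / 4.
    by rewrite mulrC ler_pdivrMr// mulrC.
  lra.
lra.
Qed.

(** Bessel's inequality passes to the limiting coefficients, which are measurable in the parameter
    as limits; [synthesis] turns them into one jointly measurable function with the same bound. *)
Lemma weak_limit d' (P : measurableType d') (f : nat -> P -> X -> R) M :
  (forall n m, measurable_fun setT (fun t => cf (f n t) m)) ->
  (forall n t, sqint mu (f n t) /\ RI mu (fun x => f n t x ^+ 2) <= M) ->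
  (forall t m e, 0 < e -> exists N, forall a b, (N <= a)%N -> (N <= b)%N ->
     `|cf (f a t) m - cf (f b t) m| <= e) ->
  exists g : P -> X -> R, measurable_fun setT (fun z : P * X => g z.1 z.2) /\
  forall t, [/\ sqint mu (g t), RI mu (fun x => g t x ^+ 2) <= M &
    forall m, cf (f n t) m @[n --> \oo] --> cf (g t) m].
Proof.
move=> mf fM cauchy.
have cv t m : exists l : R, cf (f n t) m @[n --> \oo] --> l.
  by apply: real_cauchy => e e0; exact: cauchy.
pose a t m := lims (fun n => cf (f n t) m).
have ha t m : cf (f n t) m @[n --> \oo] --> a t m.
  by have [l hl] := cv t m; rewrite /a (lims_cvg hl).
have ma m : measurable_fun setT (a ^~ m) by exact: measurable_lims.
have aM t N : \sum_(0 <= m < N) a t m ^+ 2 <= M.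
  have c1 : (fun n => \sum_(0 <= m < N) cf (f n t) m ^+ 2) @ \oo --> \sum_(0 <= m < N) a t m ^+ 2.
    by apply: cvg_big => [|m _]; [exact: add_continuous|apply: cvgM; exact: ha].
  rewrite -(cvg_lim (@norm_hausdorff _ _) c1); apply: limr_le; first by apply/cvg_ex; eexists; exact: c1.
  apply: nearW => n; have [sf fM'] := fM n t; apply: le_trans fM'.
  by apply: (bessel (@sqint_te R d) (@te_orth R d) (@te_norm R d) sf); exact: iota_uniq.
have ae t m : a t m * enorm mu te m = a t m.
  have c1 : (fun n => cf (f n t) m * enorm mu te m) @ \oo --> a t m * enorm mu te m.
    by apply: cvgM; [exact: ha|exact: cvg_cst].
  have c2 : (fun n => cf (f n t) m * enorm mu te m) = fun n => cf (f n t) m.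
    by apply/funext => n; apply: coef_enorm; exact: te_norm.
  rewrite c2 in c1; exact: (cvg_unique _ c1 (ha t m)).
have [U [mU hU]] := synthesis (@sqint_te R d) (@te_orth R d) (@te_norm R d) ma aM ae.
exists U; split => // t; have [sU cU UM] := hU t; split => // m.
by rewrite cU; exact: ha.
Qed.

End weak_limits.

Lemma norm_quarter (R : realFieldType) (e a b c d : R) : 0 < e ->
  `|a - b| <= e / 4 -> `|c - d| <= e / 4 -> `|b - d| <= e / 4 -> `|a - c| <= e.
Proof.
by move=> e0; rewrite !ler_norml => /andP[? ?] /andP[? ?] /andP[? ?]; apply/andP; split; lra.
Qed.

Section frobenius_continuity.
Context (R : realType) (m n : nat).

Lemma continuous_msq : continuous (@msq R m n).
Proof.
have -> : @msq R m n = fun A : 'M[R]_(m, n) => \sum_i \sum_j A i j * A i j by [].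
apply: (@Ck_sum R 'M[R]_(m, n) R 0) => i; apply: (@Ck_sum R 'M[R]_(m, n) R 0) => j.
by apply: (@CkM R _ 0); exact: coord_continuous.
Qed.

Lemma continuous_frob : continuous (@frob R m n).
Proof.
move=> A; apply: (@continuous_comp _ _ _ (@msq R m n) Num.sqrt); first exact: continuous_msq.
exact: sqrt_continuous.
Qed.

Lemma cvg_entries (f : nat -> 'M[R]_(m, n)) (l : 'M[R]_(m, n)) :
  (forall i j, f k i j @[k --> \oo] --> l i j) -> f @ \oo --> l.
Proof.
move=> h; apply: cvg_mx_entries => e e0.
have /choice[N hN] : forall ij : 'I_m * 'I_n, exists N, forall k, (N <= k)%N -> `|l ij.1 ij.2 - f k ij.1 ij.2| <= e.
  move=> [i j]; have /cvgrPdist_le /(_ e e0)[N _ hN] := h i j.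
  by exists N => k Nk; exact: hN.
exists (\max_ij N ij) => k Nk i j; apply: (hN (i, j)).
by apply: leq_trans Nk; exact: leq_bigmax.
Qed.

(** At a positive limit the power is differentiable; at the limit 0, convergence follows from
    monotonicity. *)
Lemma cvg_powR (p : R) (b : nat -> R) (l : R) : 0 < p -> (forall k, 0 <= b k) -> 0 <= l ->
  b @ \oo --> l -> b k `^ p @[k --> \oo] --> l `^ p.
Proof.
move=> p0 b0 l0 bl; have [l1|l1] := eqVneq l 0.
  rewrite l1 in bl *; rewrite powR0 ?gt_eqF//; apply/cvgrPdist_le => e e0.
  have r0 : 0 < e `^ p^-1 by exact: powR_gt0.
  move/cvgrPdist_le : bl => /(_ _ r0); apply: filterS => k.
  rewrite !sub0r !normrN (ger0_norm (b0 k)) ger0_norm ?powR_ge0// => h.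
  by rewrite -(powR_root p0 e0); apply: powR_le => //; exact: ltW.
have lp : 0 < l by rewrite lt_neqAle eq_sym l1.
apply: (@continuous_cvg _ _ _ _ _ _ (fun x : R => x `^ p)) => //.
have dp : derivable ((@powR R) ^~ p) l 1 by apply: derivable_powR; rewrite in_itv/= lp.
by apply: differentiable_continuous; exact/derivable1_diffP.
Qed.

Lemma cvg_frob_powR (p : R) (f : nat -> 'M[R]_(m, n)) (l : 'M[R]_(m, n)) : 0 < p ->
  (forall i j, f k i j @[k --> \oo] --> l i j) ->
  frob (f k) `^ p @[k --> \oo] --> frob l `^ p.
Proof.
move=> p0 h; apply: cvg_powR => // [k||]; do ?exact: frob_ge0.
by apply: continuous_cvg; [exact: continuous_frob|exact: cvg_entries].
Qed.

End frobenius_continuity.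

Section strong_limits.
Context (R : realType) (d : nat) (p : R).
Hypothesis hp : 2 <= p.
Notation X := (d.-tuple R).
Notation mu := (@torus R d).

Let p0 : 0 < p. Proof. exact: lt_le_trans hp. Qed.

(** Entrywise upper limits at every point: applied to strains depending on time, this is jointly
    measurable with no choice of representatives. *)
Definition mlims (f : nat -> X -> 'M[R]_d) (x : X) : 'M[R]_d :=
  \matrix_(i, j) lims (fun n => f n x i j).

Section limit.
Variables (f : nat -> X -> 'M[R]_d) (M : R).
Hypothesis sf : forall n i j, sqint mu (fun x => f n x i j).
Hypothesis fast : forall n i j, RI mu (fun x => (f n.+1 x i j - f n x i j) ^+ 2) <= (1 / 4) ^+ n.
Hypothesis fp : forall n, integ mu (fun x => frob (f n x) `^ p).
Hypothesis fM : forall n, RI mu (fun x => frob (f n x) `^ p) <= M.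

Lemma mlims_entry i j : sqint mu (fun x => mlims f x i j) /\
  forall n, RI mu (fun x => (f n x i j - mlims f x i j) ^+ 2) <= 4 * (1 / 4) ^+ n.
Proof.
have -> : (fun x => mlims f x i j) = fun x => lims ((fun n x => f n x i j) ^~ x).
  by apply/funext => x; rewrite mxE.
have [h1 h2] := riesz_fischer (fun n => sf n i j) (fun n => fast n i j); split => // n.
by apply: le_trans (h2 n); rewrite le_eqVlt; apply/orP; left; apply/eqP; apply: eq_RI => x; rewrite mxE.
Qed.

Lemma mlims_meas i j : measurable_fun setT (fun x => mlims f x i j).
Proof. by have [[]] := mlims_entry i j. Qed.

Lemma mlims_ae : {ae mu, forall x, forall i j, f n x i j @[n --> \oo] --> mlims f x i j}.
Proof.
have h (ij : 'I_d * 'I_d) : {ae mu, forall x, f n x ij.1 ij.2 @[n --> \oo] --> mlims f x ij.1 ij.2}.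
  have := riesz_fischer_ae (fun n => sf n ij.1 ij.2) (fun n => fast n ij.1 ij.2).
  by apply: ae_imp => x; rewrite mxE.
have : {ae mu, forall x, forall ij : 'I_d * 'I_d, f n x ij.1 ij.2 @[n --> \oo] --> mlims f x ij.1 ij.2}.
  have all (s : seq ('I_d * 'I_d)) : {ae mu, forall x, forall ij, ij \in s -> f n x ij.1 ij.2 @[n --> \oo] --> mlims f x ij.1 ij.2}.
    elim: s => [|a s IH]; first by apply: aeW => x ij; rewrite in_nil.
    have := ae_and (h a) IH; apply: ae_imp => x [h1 h2] ij; rewrite inE => /orP[/eqP ->//|]; exact: h2.
  by have := all (index_enum _); apply: ae_imp => x hx ij; apply: hx; exact: mem_index_enum.
by apply: ae_imp => x hx i j; exact: (hx (i, j)).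
Qed.

Lemma mlims_Lp : integ mu (fun x => frob (mlims f x) `^ p) /\
  RI mu (fun x => frob (mlims f x) `^ p) <= M.
Proof.
apply: (@fatou_RI _ _ _ mu (fun n x => frob (f n x) `^ p)) => //.
- by move=> n x; exact: powR_ge0.
- by apply: measurable_frob_powR => i j; exact: mlims_meas.
- by move=> x; exact: powR_ge0.
- by have := mlims_ae; apply: ae_imp => x hx; exact: cvg_frob_powR.
Qed.

Section stress_convergence.
Variable (W : 'M[R]_d -> R) (CS : R) (i a : 'I_d).
Hypothesis cW : continuous (partial W i a).
Hypothesis CS0 : 0 <= CS.
Hypothesis hCS : forall F, (1 + frob F) * `|partial W i a F| <= CS * (1 + frob F `^ p).

Let S := partial W i a.
(** A continuous cutoff, equal to 1 for norms up to [r] and to 0 from [r + 1] on. *)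
Let chi (r : R) (A : 'M[R]_d) : R := step (r + 1 - frob A).

Let chi_cont r : continuous (chi r).
Proof.
move=> A; apply: (@continuous_comp _ _ _ (fun A => r + 1 - frob A) (@step R)).
  have h1 := @cst_continuous 'M[R]_d R (r + 1) A.
  exact: (cvgB h1 (@continuous_frob R d d A)).
exact: (Ck_continuous (@smooth_step R 0%N)).
Qed.

Let S_le A : `|S A| <= CS * (1 + frob A `^ p).
Proof. by apply: le_trans (hCS A); rewrite ler_peMl// lerDl frob_ge0. Qed.

Let Schi_bdd r A : 0 <= r -> `|S A * chi r A| <= CS * (1 + (r + 1) `^ p).
Proof.
move=> r0; have [rA|Ar] := leP (r + 1) (frob A).
  by rewrite /chi step_le0 ?subr_le0// mulr0 normr0 mulr_ge0// addr_ge0 ?powR_ge0.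
have /andP[c0 c1] := step01 (r + 1 - frob A).
rewrite normrM (ger0_norm c0) -[leRHS]mulr1 ler_pM//.
apply: (le_trans (S_le A)); rewrite ler_wpM2l// lerD2l powR_le ?frob_ge0 ?(ltW p0)//.
exact: ltW.
Qed.

(** The discarded part lives where the norm exceeds [r], and there the extra factor [1 + frob A] in
    the growth of the stress yields the decay [1 / (1 + r)]. *)
Let Schi_tail r A : 0 <= r -> `|S A - S A * chi r A| <= CS / (1 + r) * (1 + frob A `^ p).
Proof.
move=> r0; have r1 : 0 < 1 + r by rewrite ltr_pwDl.
have pp : 0 <= 1 + frob A `^ p by rewrite addr_ge0 ?powR_ge0.
have [Ar|rA] := leP (frob A) r.
  rewrite /chi step_ge1; last by rewrite -addrAC lerDr subr_ge0.
  by rewrite mulr1 subrr normr0 mulr_ge0// divr_ge0// ltW.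
have /andP[c0 c1] := step01 (r + 1 - frob A).
rewrite -[X in X - _]mulr1 -mulrBr normrM.
apply: (@le_trans _ _ `|S A|).
  by rewrite ler_piMr// ger0_norm ?subr_ge0// lerBlDr lerDl.
rewrite mulrAC ler_pdivlMr// mulrC; apply: le_trans (hCS A).
by rewrite ler_wpM2r// lerD2l ltW.
Qed.

(** The truncated stress is bounded and continuous, so it converges by domination along strains that
    converge almost everywhere. The discarded part is small uniformly in [n], for the limit as well
    because the limit inherits the L^p bound. *)
Lemma stress_cvg (g : X -> R) N : measurable_fun setT g -> (forall x, `|g x| <= N) ->
  RI mu (fun x => S (f n x) * g x) @[n --> \oo] --> RI mu (fun x => S (mlims f x) * g x).
Proof.
move=> mg gN; apply/cvgrPdist_le => e e0.
have N0 : 0 <= N := le_trans (normr_ge0 _) (gN point).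
have M0 : 0 <= M by apply: le_trans (fM 0%N); apply: RI_ge0 => x; exact: powR_ge0.
have mf n k l : measurable_fun setT (fun x => f n x k l) by exact: sqint_meas.
have [iL LM] := mlims_Lp.
(* The tail is at most [N * CS * (1 + M) / (1 + r)], and [r = Q / (e / 4)] brings it below [e / 4];
   the added 1 keeps [Q] positive. *)
pose Q := N * CS * (1 + M) + 1.
have Q0 : 0 < Q by rewrite ltr_wpDl// !mulr_ge0// addr_ge0.
pose r := Q / (e / 4).
have r0 : 0 <= r by rewrite divr_ge0 ?divr_ge0// ltW.
have tail (h : X -> 'M[R]_d) : (forall k l, measurable_fun setT (fun x => h x k l)) ->
    integ mu (fun x => frob (h x) `^ p) -> RI mu (fun x => frob (h x) `^ p) <= M ->
    [/\ integ mu (fun x => S (h x) * g x), integ mu (fun x => S (h x) * chi r (h x) * g x) &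
    `|RI mu (fun x => S (h x) * g x) - RI mu (fun x => S (h x) * chi r (h x) * g x)| <= e / 4].
  move=> mh ih hM; have i1 := integD (integ_cst mu 1) ih.
  have mS : measurable_fun setT (fun x => S (h x)) by exact: measurable_comp_mx.
  have mc : measurable_fun setT (fun x => chi r (h x)) by apply: measurable_comp_mx => //; exact: chi_cont.
  have iS : integ mu (fun x => S (h x) * g x).
    apply: (@integ_le _ _ _ mu _ (fun x => CS * N * (1 + frob (h x) `^ p))).
    - exact: measurable_funM.
    - by move=> x; rewrite normrM mulrAC; apply: ler_pM => //; exact: S_le.
    - exact: integZ.
  have iC : integ mu (fun x => S (h x) * chi r (h x) * g x).
    apply: (@integ_bdd _ _ _ mu _ (CS * (1 + (r + 1) `^ p) * N)).
      by apply: measurable_funM => //; exact: measurable_funM.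
    by move=> x; rewrite normrM; apply: ler_pM => //; exact: Schi_bdd.
  split => //; rewrite -(RIB iS iC); apply: (le_trans (RI_abs (integB iS iC))).
  have i2 := integZ (CS / (1 + r) * N) i1.
  apply: (@le_trans _ _ (RI mu (fun x => CS / (1 + r) * N * (1 + frob (h x) `^ p)))).
    apply: RI_le => //; first by apply: integ_abs; exact: integB.
    move=> x; rewrite -mulrBl normrM [leRHS]mulrAC; apply: ler_pM => //; exact: Schi_tail.
  rewrite (RIZ _ i1) (RID (integ_cst mu 1) ih) RI_cst.
  apply: (@le_trans _ _ (CS / (1 + r) * N * (1 + M))).
    by rewrite ler_wpM2l ?lerD2l// mulr_ge0// divr_ge0// addr_ge0.
  have r1 : 0 < 1 + r by rewrite ltr_pwDl.
  rewrite (_ : _ * _ = N * CS * (1 + M) / (1 + r)); last by field; rewrite gt_eqF.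
  rewrite ler_pdivrMr//.
  have -> : e / 4 * (1 + r) = e / 4 + Q by rewrite /r mulrDr mulr1 mulrCA mulfV ?mulr1// gt_eqF// divr_gt0.
  by rewrite /Q addrCA lerDl addr_ge0// divr_ge0// ltW.
have [_ _ tL] := tail _ mlims_meas iL LM.
have mid : RI mu (fun x => S (f n x) * chi r (f n x) * g x) @[n --> \oo] -->
    RI mu (fun x => S (mlims f x) * chi r (mlims f x) * g x).
  apply: (proj2 (@RI_dct _ _ _ mu (fun n x => S (f n x) * chi r (f n x) * g x) _
    (fun=> CS * (1 + (r + 1) `^ p) * N) _ _ _ _ _)).
  - move=> n; apply: measurable_funM => //; apply: measurable_funM.
      exact: measurable_comp_mx.
    by apply: measurable_comp_mx => //; exact: chi_cont.
  - apply: measurable_funM => //; apply: measurable_funM.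
      by apply: measurable_comp_mx => //; exact: mlims_meas.
    by apply: measurable_comp_mx; [exact: chi_cont|exact: mlims_meas].
  - have := mlims_ae; apply: ae_imp => x hx; apply: cvgM; last exact: cvg_cst.
    have cx := cvg_entries hx.
    by apply: cvgM; apply: continuous_cvg => //; [exact: cW|exact: chi_cont].
  - exact: integ_cst.
  - by move=> n x; rewrite normrM; apply: ler_pM => //; exact: Schi_bdd.
have e4 : 0 < e / 4 by rewrite divr_gt0.
move/cvgrPdist_le : mid => /(_ _ e4); apply: filterS => n hn.
have [_ _ tn] := tail _ (mf n) (fp n) (fM n).
exact: (norm_quarter e0 tL tn hn).
Qed.

End stress_convergence.
End limit.
End strong_limits.

Lemma limit_eq0 (R : realType) (a : nat -> R) (l : R) : (forall n, a n = 0) -> a @ \oo --> l -> l = 0.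
Proof.
move=> a0 al; have e : a = fun _ => 0 by apply/funext.
by rewrite e in al; exact: (cvg_unique (@norm_hausdorff _ _) al (cvg_cst 0)).
Qed.

(** * Passage to the limit in the equations *)

Section limit_passage.
Context (R : realType) (d : nat) (T p : R).
Hypothesis hT : 0 < T.
Hypothesis hp : 2 <= p.
Notation X := (d.-tuple R).
Notation mu := (@torus R d).
Notation te := (@te R d).
Notation cf := (coef mu te).
Notation V := (R * 'rV[R]_d)%type.
Variables (M : R).
Variables (u0 : nat -> X -> 'rV[R]_d) (F0 : nat -> X -> 'M[R]_d).
Variables (u : nat -> R -> X -> 'rV[R]_d) (F : nat -> R -> X -> 'M[R]_d).
Hypothesis M0 : 0 <= M.
Hypothesis bnd : forall n, bounded_flow T p M (u n) (F n).
Hypothesis hu0 : forall n i, sqint mu (fun x => u0 n x ord0 i) /\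
  RI mu (fun x => u0 n x ord0 i ^+ 2) <= M.
Hypothesis sF0 : forall n i j, sqint mu (fun x => F0 n x i j).
Hypothesis pF0 : forall n, integ mu (fun x => frob (F0 n x) `^ p) /\
  RI mu (fun x => frob (F0 n x) `^ p) <= M.
Hypothesis cauchy_u : forall i m t e, 0 <= t <= T -> 0 < e -> exists N, forall a b, (N <= a)%N -> (N <= b)%N ->
  `|cf (fun x => u a t x ord0 i) m - cf (fun x => u b t x ord0 i) m| <= e.
Hypothesis cauchy_u0 : forall i m e, 0 < e -> exists N, forall a b, (N <= a)%N -> (N <= b)%N ->
  `|cf (fun x => u0 a x ord0 i) m - cf (fun x => u0 b x ord0 i) m| <= e.
Hypothesis fast_F : forall a t i j, 0 <= t <= T ->
  RI mu (fun x => (F a.+1 t x i j - F a t x i j) ^+ 2) <= (1 / 4) ^+ a.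
Hypothesis fast_F0 : forall a i j, RI mu (fun x => (F0 a.+1 x i j - F0 a x i j) ^+ 2) <= (1 / 4) ^+ a.

Lemma velocity_limit : exists uh : R -> X -> 'rV[R]_d,
  (forall i, jms (fun t x => uh t x ord0 i)) /\
  forall t i, [/\ sqint mu (fun x => uh t x ord0 i), RI mu (fun x => uh t x ord0 i ^+ 2) <= M &
    forall m, cf (fun x => u n (clamp T t) x ord0 i) m @[n --> \oo] --> cf (fun x => uh t x ord0 i) m].
Proof.
have h i := @weak_limit R d _ (measurableTypeR R) (fun n t x => u n (clamp T t) x ord0 i) M.
have /choice[U hU] i : exists U : R -> X -> R, jms U /\ forall t, [/\ sqint mu (U t),
    RI mu (fun x => U t x ^+ 2) <= M &
    forall m, cf (fun x => u n (clamp T t) x ord0 i) m @[n --> \oo] --> cf (U t) m].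
  apply: h.
  - move=> n m; have [mu' _ _] := bnd n.
    apply: (@measurable_RI _ _ (measurableTypeR R) X R mu (fun z => u n (clamp T z.1) z.2 ord0 i * te m z.2)).
    apply: measurable_funM; first exact: mu'.
    exact: (measurableT_comp (measurable_te m) measurable_snd).
  - by move=> n t; have [_ /(_ _ (clamp_itv hT t))] := L2b_velocity (bnd n) i.
  - by move=> t m e e0; apply: cauchy_u => //; exact: clamp_itv.
have E i t : (fun x => (\row_i U i t x) ord0 i) = U i t by apply/funext => x; rewrite mxE.
exists (fun t x => \row_i U i t x); split=> [i|t i].
  by have [+ _] := hU i; rewrite /jms; congr measurable_fun; apply/funext => z; rewrite mxE.
have [_ /(_ t)[h1 h2 h3]] := hU i; split; rewrite ?E//.
by apply: le_trans h2; rewrite le_eqVlt; apply/orP; left; apply/eqP; apply: eq_RI => x; rewrite mxE.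
Qed.

Lemma initial_velocity_limit : exists uh0 : X -> 'rV[R]_d,
  forall i, [/\ sqint mu (fun x => uh0 x ord0 i), RI mu (fun x => uh0 x ord0 i ^+ 2) <= M &
    forall m, cf (fun x => u0 n x ord0 i) m @[n --> \oo] --> cf (fun x => uh0 x ord0 i) m].
Proof.
have h i := @weak_limit R d _ unit (fun n _ x => u0 n x ord0 i) M.
have /choice[U hU] i : exists U : X -> R, [/\ sqint mu U,
    RI mu (fun x => U x ^+ 2) <= M &
    forall m, cf (fun x => u0 n x ord0 i) m @[n --> \oo] --> cf U m].
  have [||_ m e e0|U [_ /(_ tt) hU]] := h i; last by exists (U tt).
  - by move=> n m; exact: measurable_cst.
  - by move=> n _; exact: hu0.
  - exact: cauchy_u0.
have E i : (fun x => (\row_i U i x) ord0 i) = U i by apply/funext => x; rewrite mxE.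
exists (fun x => \row_i U i x) => i; have [h1 h2 h3] := hU i; split; rewrite ?E//.
by apply: le_trans h2; rewrite le_eqVlt; apply/orP; left; apply/eqP; apply: eq_RI => x; rewrite mxE.
Qed.

Definition strain_limit (t : R) : X -> 'M[R]_d := mlims (fun n => F n (clamp T t)).

Let sF n t i j : 0 <= t <= T -> sqint mu (fun x => F n t x i j).
Proof. by move=> tT; have [_ /(_ t tT)[]] := L2b_strain hp (bnd n) i j. Qed.

Let Fp n t : 0 <= t <= T -> integ mu (fun x => frob (F n t x) `^ p) /\
  RI mu (fun x => frob (F n t x) `^ p) <= M.
Proof. by move=> tT; have [_ _ /(_ t tT)[_ _ h1 h2]] := bnd n. Qed.

Lemma strain_limit_jms i j : jms (fun t x => strain_limit t x i j).
Proof.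
rewrite /jms; under eq_fun do rewrite mxE.
apply: (@measurable_lims _ _ R (fun n z => F n (clamp T z.1) z.2 i j)) => n.
by have [_ mF _] := bnd n; exact: mF.
Qed.

Lemma strain_limit_entry t i j : sqint mu (fun x => strain_limit t x i j) /\
  forall n, RI mu (fun x => (F n (clamp T t) x i j - strain_limit t x i j) ^+ 2) <= 4 * (1 / 4) ^+ n.
Proof.
have tT := clamp_itv hT t.
apply: mlims_entry => n k l; [exact: sF|exact: fast_F].
Qed.

Lemma strain_limit_Lp t : integ mu (fun x => frob (strain_limit t x) `^ p) /\
  RI mu (fun x => frob (strain_limit t x) `^ p) <= M.
Proof.
have tT := clamp_itv hT t.
apply: (mlims_Lp hp) => n; do ?[move=> k l; exact: sF|move=> k l; exact: fast_F].
  by have [] := Fp n tT.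
by have [] := Fp n tT.
Qed.

Definition initial_strain_limit : X -> 'M[R]_d := mlims F0.

Lemma initial_strain_limit_entry i j : sqint mu (fun x => initial_strain_limit x i j) /\
  forall n, RI mu (fun x => (F0 n x i j - initial_strain_limit x i j) ^+ 2) <= 4 * (1 / 4) ^+ n.
Proof. exact: mlims_entry. Qed.

Lemma initial_strain_limit_Lp : integ mu (fun x => frob (initial_strain_limit x) `^ p).
Proof.
by have [] := @mlims_Lp _ _ _ hp F0 M sF0 fast_F0 (fun n => (pF0 n).1) (fun n => (pF0 n).2).
Qed.

Lemma fast_cvg (f : nat -> X -> R) (l g : X -> R) : (forall n, sqint mu (f n)) -> sqint mu l ->
  (forall n, RI mu (fun x => (f n x - l x) ^+ 2) <= 4 * (1 / 4) ^+ n) -> sqint mu g ->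
  RI mu (fun x => f n x * g x) @[n --> \oo] --> RI mu (fun x => l x * g x).
Proof.
move=> sf sl fl sg.
have q0 : (fun n => 4 * (1 / 4 : R) ^+ n) @ \oo --> 4 * (0 : R).
  by apply: cvgM; [exact: cvg_cst|apply: cvg_expr; rewrite ger0_norm ?divr_ge0//; lra].
rewrite mulr0 in q0; apply/cvgrPdist_le => e e0.
pose c := (RI mu (fun x => g x ^+ 2) + 1) / (e / 2).
have G0 := RI_sqr_ge0 mu g.
have c0 : 0 < c by rewrite divr_gt0 ?divr_gt0// ltr_wpDl.
have ec0 : 0 < e / 2 / c by apply: divr_gt0 => //; exact: divr_gt0.
move/cvgrPdist_le : q0 => /(_ _ ec0); apply: filterS => n.
rewrite sub0r normrN ger0_norm ?mulr_ge0 ?exprn_ge0 ?divr_ge0// => hn.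
rewrite distrC -(RIB (sqintM (sf n) sg) (sqintM sl sg)).
rewrite (@eq_RI _ _ _ mu _ (fun x => (f n x - l x) * g x)); last by move=> x; rewrite mulrBl.
apply: (le_trans (RI_young c0 (sqintB (sf n) sl) sg)).
have h1 : c * RI mu (fun x => (f n x - l x) ^+ 2) <= e / 2.
  by rewrite mulrC -ler_pdivlMr//; apply: le_trans (fl n) hn.
have h2 : c^-1 * RI mu (fun x => g x ^+ 2) <= e / 2.
  rewrite /c invf_div mulrAC ler_pdivrMr ?ltr_wpDl// ler_wpM2l ?lerDl//.
  by rewrite divr_ge0// ltW.
by rewrite (le_trans (lerD h1 h2))// -splitr.
Qed.

Section equations.
Variables (uh : R -> X -> 'rV[R]_d) (uh0 : X -> 'rV[R]_d).
Hypothesis juh : forall i, jms (fun t x => uh t x ord0 i).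
Hypothesis huh : forall t i, [/\ sqint mu (fun x => uh t x ord0 i), RI mu (fun x => uh t x ord0 i ^+ 2) <= M &
  forall m, cf (fun x => u n (clamp T t) x ord0 i) m @[n --> \oo] --> cf (fun x => uh t x ord0 i) m].
Hypothesis huh0 : forall i, [/\ sqint mu (fun x => uh0 x ord0 i), RI mu (fun x => uh0 x ord0 i ^+ 2) <= M &
  forall m, cf (fun x => u0 n x ord0 i) m @[n --> \oo] --> cf (fun x => uh0 x ord0 i) m].

(** Each component of the limit velocity has square integral at most [M], so the full vector may
    need [d * M]; this constant serves both the sequence and its limit. *)
Let M2 := M + d%:R * M.
Let dM0 : 0 <= d%:R * M. Proof. by rewrite mulr_ge0. Qed.

Let bnd2 n : bounded_flow T p M2 (u n) (F n).
Proof.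
have [h1 h2 h3] := bnd n; split => // t tT; have [k1 k2 k3 k4] := h3 t tT.
by split => //; [apply: (le_trans k2)|apply: (le_trans k4)]; rewrite lerDl.
Qed.

Lemma jms_jmc (h : R -> X -> R) : jms h -> jmc T h.
Proof.
move=> mh; rewrite /jmc /jms.
apply: (@measurableT_comp _ _ _ _ _ _ (fun z : measurableTypeR R * X => h z.1 z.2)
  _ (fun z : measurableTypeR R * X => (clamp T z.1 : measurableTypeR R, z.2))) => //.
apply/measurable_fun_pair; last exact: measurable_snd.
exact: (measurableT_comp (measurable_clamp hT) measurable_fst).
Qed.

Lemma bounded_limit : bounded_flow T p M2 uh strain_limit.
Proof.
split.
- by move=> i; exact: jms_jmc.
- by move=> i j; apply: jms_jmc; exact: strain_limit_jms.
move=> t tT; have [h1 h2] := strain_limit_Lp t; split => //.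
- by move=> i; have [] := huh t i.
- have -> : (fun x => msq (uh t x)) = fun x => \sum_i uh t x ord0 i ^+ 2.
    by apply/funext => x; rewrite msq_sum big_ord1.
  rewrite RI_sum; last by move=> i _; apply: sqint2; have [] := huh t i.
  apply: (@le_trans _ _ (\sum_(i < d) M)); first by apply: ler_sum => i _; have [] := huh t i.
  by rewrite sumr_const card_ord -[_ *+ d]mulr_natl /M2 lerDr.
- by apply: (le_trans h2); rewrite lerDl.
Qed.

Lemma weak_velocity t i (g : X -> R) : 0 <= t <= T -> sqint mu g ->
  RI mu (fun x => u n t x ord0 i * g x) @[n --> \oo] --> RI mu (fun x => uh t x ord0 i * g x).
Proof.
move=> tT sg; have [h1 h2 h3] := huh t i; rewrite (clampE tT) in h3.
apply: (weak_cvg _ h1 _ h2 h3 sg) => n; by have [_ /(_ t tT)[]] := L2b_velocity (bnd n) i.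
Qed.

Lemma weak_strain t i j (g : X -> R) : 0 <= t <= T -> sqint mu g ->
  RI mu (fun x => F n t x i j * g x) @[n --> \oo] --> RI mu (fun x => strain_limit t x i j * g x).
Proof.
move=> tT sg; have [h1 h2] := strain_limit_entry t i j; rewrite (clampE tT) in h2.
by apply: (fast_cvg _ h1 h2 sg) => n; exact: sF.
Qed.

Lemma ST_velocity (psi : V -> R) i : smooth_periodic psi ->
  ST hT (fun t x => u n t x ord0 i * psi (t, vec x)) @[n --> \oo] -->
  ST hT (fun t x => uh t x ord0 i * psi (t, vec x)).
Proof.
move=> sp; have [N N0 sN] := supb_test hT sp.
apply: (@ST_cvg R d T hT ((1 + M2) * N)).
- by move=> n; apply: L1bM sN; apply: L2b_L1b; exact: (L2b_velocity (bnd2 n)).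
- by apply: L1bM sN; apply: L2b_L1b; exact: (L2b_velocity bounded_limit).
- by move=> t tT; apply: weak_velocity => //; exact: supb_sqint sN tT.
Qed.

Lemma ST_strain (psi : V -> R) i j : smooth_periodic psi ->
  ST hT (fun t x => F n t x i j * psi (t, vec x)) @[n --> \oo] -->
  ST hT (fun t x => strain_limit t x i j * psi (t, vec x)).
Proof.
move=> sp; have [N N0 sN] := supb_test hT sp.
apply: (@ST_cvg R d T hT ((1 + (1 + M2)) * N)).
- by move=> n; apply: L1bM sN; apply: L2b_L1b; exact: (L2b_strain hp (bnd2 n)).
- by apply: L1bM sN; apply: L2b_L1b; exact: (L2b_strain hp bounded_limit).
- by move=> t tT; apply: weak_strain => //; exact: supb_sqint sN tT.
Qed.

Lemma compat_limit (eta : V -> R) i j : test T eta ->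
  (forall n, compat_eq hT (F0 n) (u n) (F n) eta i j) ->
  compat_eq hT initial_strain_limit uh strain_limit eta i j.
Proof.
move=> [sp _] eqs.
have sd v : smooth_periodic (fun z => 'D_v eta z) := smooth_periodic_derive v sp.
have [h1 h2] := initial_strain_limit_entry i j.
have [m0 [N0 hN0]] := test_slice (lexx (0 : R)) sp.
have c3 := fast_cvg (fun n => sF0 n i j) h1 h2 (sqint_bdd mu m0 hN0).
rewrite /compat_eq in eqs *; apply: (limit_eq0 eqs).
apply: cvgD; last exact: c3.
by apply: cvgB; [exact: (@ST_strain _ i j (sd (1, 0)))|exact: (@ST_velocity _ i (sd (0, Defs.basis R j)))].
Qed.

Section momentum.
Variables (nu : nat -> R) (W : 'M[R]_d -> R) (CS : R).
Hypothesis W3 : W_C3 W.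
Hypothesis CS0 : 0 <= CS.
Hypothesis hCS : forall i a F, (1 + frob F) * `|partial W i a F| <= CS * (1 + frob F `^ p).
Hypothesis nu0 : nu @ \oo --> (0 : R).

Lemma ST_stress (psi : V -> R) i a : smooth_periodic psi ->
  ST hT (fun t x => stress W (F n t x) i a * psi (t, vec x)) @[n --> \oo] -->
  ST hT (fun t x => stress W (strain_limit t x) i a * psi (t, vec x)).
Proof.
move=> sp; have [N N0 sN] := supb_test hT sp.
apply: (@ST_cvg R d T hT (CS * (1 + M2) * N)).
- by move=> n; apply: L1bM sN; exact: (L1b_stress W3 CS0 hCS (bnd2 n)).
- by apply: L1bM sN; exact: (L1b_stress W3 CS0 hCS bounded_limit).
move=> t tT; have [mN hN] := sN; have mpsi := jmc_slice mN tT.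
have := @stress_cvg R d p hp (fun n => F n (clamp T t)) M _ _ _ _ W CS i a
   (@continuous_partial _ _ _ W3 i a) CS0 (hCS i a) (fun x => psi (t, vec x)) N mpsi (fun x => hN t x tT).
have cT := clamp_itv hT t.
have E (G : R -> X -> 'M[R]_d) r : RI mu (fun x => stress W (G r x) i a * psi (t, vec x)) =
   RI mu (fun x => partial W i a (G r x) * psi (t, vec x)).
  by apply: eq_RI => x; rewrite mxE.
rewrite E; have -> : (fun n => RI mu (fun x => stress W (F n t x) i a * psi (t, vec x))) =
    fun n => RI mu (fun x => partial W i a (F n (clamp T t) x) * psi (t, vec x)).
  by apply/funext => n; rewrite E (clampE tT).
apply.
- by move=> n k l; exact: sF.
- by move=> n k l; exact: fast_F.
- by move=> n; have [] := Fp n cT.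
- by move=> n; have [] := Fp n cT.
Qed.

Lemma momentum_limit (eta : V -> R) i : test T eta ->
  (forall n, momentum_eq hT W (nu n) (u0 n) (u n) (F n) eta i) ->
  momentum_eq hT W 0 uh0 uh strain_limit eta i.
Proof.
move=> [sp _] eqs.
have sd v : smooth_periodic (fun z => 'D_v eta z) := smooth_periodic_derive v sp.
have sdd v w : smooth_periodic (fun z => 'D_w (fun z => 'D_v eta z) z) :=
  smooth_periodic_derive w (sd v).
have sddd v w r : smooth_periodic (fun z => 'D_r (fun z => 'D_w (fun z => 'D_v eta z) z) z) :=
  smooth_periodic_derive r (sdd v w).
have [h1 h2 h3] := huh0 i.
have [m0 [N0 hN0]] := test_slice (lexx (0 : R)) sp.
have c5 := weak_cvg (fun n => (hu0 n i).1) h1 (fun n => (hu0 n i).2) h2 h3 (sqint_bdd mu m0 hN0).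
have c1 := @ST_velocity _ i (sd (1, 0)).
have c2 : (fun n => \sum_a ST hT (fun t x => stress W (F n t x) i a * dx a eta (t, vec x))) @ \oo -->
    \sum_a ST hT (fun t x => stress W (strain_limit t x) i a * dx a eta (t, vec x)).
  by apply: cvg_big => [|a _]; [exact: add_continuous|exact: (@ST_stress _ i a (sd (0, Defs.basis R a)))].
(* The sum converges to the pairing with the limit velocity, so its product with the vanishing
   viscosity tends to 0. *)
have c3 : (fun n => nu n * \sum_a ST hT (fun t x => u n t x ord0 i * dx a (dx a eta) (t, vec x))) @ \oo -->
    0 * \sum_a ST hT (fun t x => uh t x ord0 i * dx a (dx a eta) (t, vec x)).
  apply: cvgM; first exact: nu0.
  apply: cvg_big => [|a _]; first exact: add_continuous.
  exact: (@ST_velocity _ i (sdd (0, Defs.basis R a) (0, Defs.basis R a))).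
have c4 : (fun n => \sum_a \sum_b ST hT (fun t x => F n t x i a * dx b (dx b (dx a eta)) (t, vec x))) @ \oo -->
    \sum_a \sum_b ST hT (fun t x => strain_limit t x i a * dx b (dx b (dx a eta)) (t, vec x)).
  apply: cvg_big => [|a _]; first exact: add_continuous.
  apply: cvg_big => [|b _]; first exact: add_continuous.
  exact: (@ST_strain _ i a (sddd (0, Defs.basis R a) (0, Defs.basis R b) (0, Defs.basis R b))).
rewrite /momentum_eq in eqs *; apply: (limit_eq0 eqs).
apply: cvgD; last exact: c5.
apply: cvgD; last exact: c4.
apply: cvgD; last exact: c3.
by apply: cvgB; [exact: c1|exact: c2].
Qed.

End momentum.
End equations.
End limit_passage.

Lemma nbhs0_ereal (R : realType) (A : set (\bar R)) : nbhs (0%E : \bar R) A ->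
  exists2 e : R, 0 < e & forall x : \bar R, (0 <= x)%E -> (x <= e%:E)%E -> A x.
Proof.
move=> /= [e /= e0 hA]; exists (e / 2); first by rewrite divr_gt0.
case=> [r| |] //; rewrite !lee_fin => r0 re; apply: hA; rewrite /= sub0r normrN ger0_norm//.
by apply: (le_lt_trans re); lra.
Qed.

(** * Modes of convergence *)

Section CLp_convergence.
Context (R : realType) (d m n : nat) (T : R).
Notation X := (d.-tuple R).
Notation mu := (@torus R d).
Implicit Types f : R -> X -> 'M[R]_(m, n).

Lemma LpN_small q (h : X -> 'M[R]_(m, n)) e : 0 < q -> 0 < e -> Lp q h ->
  RI mu (fun x => frob (h x) `^ q) <= e `^ q -> (LpN q h <= e%:E)%E.
Proof.
move=> q0 e0 hq hle; have := LpN_le_root q0 hq hle.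
by rewrite -powRrM mulfV ?gt_eqF// powRr1// ltW.
Qed.

Lemma CLp_intro q f : 0 < q -> jmeas T f -> (forall t, 0 <= t <= T -> Lp q (f t)) ->
  (forall t e, 0 <= t <= T -> 0 < e -> exists2 del, 0 < del &
     forall s, 0 <= s <= T -> `|s - t| < del -> RI mu (fun x => frob (f s x - f t x) `^ q) <= e) ->
  CLp T q f.
Proof.
move=> q0 jf fq fc; split => // t; rewrite in_itv/= => tT.
move=> A /nbhs0_ereal[e e0 hA].
have [del del0 hdel] := fc t _ tT (powR_gt0 q e0).
rewrite /nbhs/= /within/=; apply/nbhs_ballP; exists del => //= s st.
rewrite in_itv/= => sT; apply: hA; first exact: Lnorm_ge0.
apply: LpN_small => //; last by apply: hdel => //; rewrite distrC.
have [ms _] := fq s sT; have [mt _] := fq t tT.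
apply: integ_Lp => //; first by move=> i j; under eq_fun do rewrite !mxE; exact: measurable_funB.
by apply: LpD_integ => //; apply: Lp_integ => //; exact: fq.
Qed.

Lemma RI_powR_low q p : 0 < q -> q <= p -> forall e, 0 < e -> exists2 C, 0 <= C &
  forall h : X -> 'M[R]_(m, n), (forall i j, measurable_fun setT (fun x => h x i j)) ->
  integ mu (fun x => frob (h x) `^ p) -> RI mu (fun x => frob (h x) `^ q) <=
  e + C * RI mu (fun x => frob (h x) `^ p).
Proof.
move=> q0 qp e e0; have [C C0 hC] := powR_low q0 qp e0; exists C => // h mh hp.
have iC := integZ C hp.
rewrite -(RIZ C hp); have E := RID (integ_cst mu e) iC; rewrite RI_cst in E; rewrite -E.
apply: RI_le; [|by apply: integD => //; exact: integ_cst|by move=> x; apply: hC; exact: frob_ge0].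
apply: (@Lp_integ R d m n q h q0); apply: (@Lp_le R d m n q p) => //.
by apply: integ_Lp => //; exact: lt_le_trans qp.
Qed.

Lemma CLp_le q p f : 0 < q -> q <= p -> CLp T p f -> CLp T q f.
Proof.
move=> q0 qp cf; have p0 : 0 < p by exact: lt_le_trans qp.
have [jf fp _] := cf.
have fp' t : 0 <= t <= T -> Lp p (f t) by move=> tT; apply: fp; rewrite in_itv.
apply: CLp_intro => // [t tT|t e tT e0]; first by apply: (Lp_le q0 qp); exact: fp'.
have e2 : 0 < e / 2 by rewrite divr_gt0.
have [C C0 hC] := RI_powR_low q0 qp e2.
have C1 : 0 < C + 1 by rewrite ltr_wpDl.
have e3 : 0 < e / 2 / (C + 1) by rewrite divr_gt0.
have [del del0 hdel] := CLp_cont p0 cf tT e3.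
exists del => // s sT st; have [hi hr] := hdel s sT st.
have [ms _] := fp' s sT; have [mt _] := fp' t tT.
apply: (le_trans (hC _ _ hi)).
  by move=> i j; under eq_fun do rewrite !mxE; exact: measurable_funB.
have : C * RI mu (fun x => frob (f s x - f t x) `^ p) <= (C + 1) * (e / 2 / (C + 1)).
  apply: ler_pM => //; last exact: ltW.
    by apply: RI_ge0 => x; exact: powR_ge0.
  by rewrite lerDl.
rewrite [(C + 1) * _]mulrC divfK ?gt_eqF// => h.
by rewrite [leRHS]splitr lerD2l.
Qed.

Lemma frob_sum3 q (A B C : 'M[R]_(m, n)) : 0 <= q ->
  frob (A + B + C) `^ q <= 2 `^ q * 2 `^ q * (frob A `^ q + frob B `^ q + frob C `^ q).
Proof.
move=> q0; apply: (le_trans (frobD_powR _ _ q0)).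
have c1 : 1 <= 2 `^ q :> R by rewrite -[leLHS](powRr0 2) ler_powR// ler1n.
have c0 : 0 <= 2 `^ q :> R by exact: powR_ge0.
rewrite -mulrA ler_wpM2l// mulrDr lerD ?frobD_powR//.
by rewrite ler_peMl// powR_ge0.
Qed.

End CLp_convergence.

(** * Uniform convergence of the strains in time *)

Section strain_convergence.
Context (R : realType) (d : nat) (T p M : R).
Hypothesis hT : 0 < T.
Hypothesis hp : 2 <= p.
Notation X := (d.-tuple R).
Notation mu := (@torus R d).
Variables (F : nat -> R -> X -> 'M[R]_d) (Fh : R -> X -> 'M[R]_d).
Hypothesis M0 : 0 <= M.
Hypothesis cF : forall n, CLp T p (F n).
Hypothesis FM : forall n t, 0 <= t <= T -> RI mu (fun x => frob (F n t x) `^ p) <= M.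
Hypothesis jFh : forall i j, jms (fun t x => Fh t x i j).
Hypothesis hFh : forall t, integ mu (fun x => frob (Fh t x) `^ p) /\ RI mu (fun x => frob (Fh t x) `^ p) <= M.
Hypothesis FFh : forall n t i j, 0 <= t <= T -> sqint mu (fun x => F n t x i j - Fh t x i j) /\
  RI mu (fun x => (F n t x i j - Fh t x i j) ^+ 2) <= 4 * (1 / 4) ^+ n.

Let p0 : 0 < p. Proof. exact: lt_le_trans hp. Qed.

Let mF n t i j : 0 <= t <= T -> measurable_fun setT (fun x => F n t x i j).
Proof. by move=> tT; have [_ /(_ t)h _] := cF n; have [] := h _; rewrite ?in_itv. Qed.

Let mFh t i j : measurable_fun setT (fun x => Fh t x i j).
Proof. exact: jms_slice (jFh i j). Qed.

Let iF n t : 0 <= t <= T -> integ mu (fun x => frob (F n t x) `^ p).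
Proof. by move=> tT; apply: Lp_integ => //; have [_ h _] := cF n; apply: h; rewrite in_itv. Qed.

Let msq_diff n t : 0 <= t <= T -> integ mu (fun x => msq (F n t x - Fh t x)) /\
  RI mu (fun x => msq (F n t x - Fh t x)) <= d%:R * (d%:R * (4 * (1 / 4) ^+ n)).
Proof.
move=> tT.
have E : (fun x => msq (F n t x - Fh t x)) = fun x => \sum_i \sum_j (F n t x i j - Fh t x i j) ^+ 2.
  by apply/funext => x; rewrite msq_sum; apply: eq_bigr => i _; apply: eq_bigr => j _; rewrite !mxE.
have i1 i j : integ mu (fun x => (F n t x i j - Fh t x i j) ^+ 2).
  by apply: sqint2; have [] := FFh n i j tT.
rewrite E; split; first by apply: integ_sum => i _; exact: integ_sum.
rewrite RI_sum; last by move=> i _; exact: integ_sum.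
apply: (@le_trans _ _ (\sum_(i < d) d%:R * (4 * (1 / 4) ^+ n))); last first.
  by rewrite sumr_const card_ord -[_ *+ d]mulr_natl.
apply: ler_sum => i _; rewrite RI_sum//.
apply: (@le_trans _ _ (\sum_(j < d) (4 * (1 / 4) ^+ n))); last first.
  by rewrite sumr_const card_ord -[_ *+ d]mulr_natl.
by apply: ler_sum => j _; have [] := FFh n i j tT.
Qed.

Lemma strain_uniform q e : 0 < q -> q < p -> 0 < e -> exists N, forall n t, (N <= n)%N -> 0 <= t <= T ->
  RI mu (fun x => frob (F n t x - Fh t x) `^ q) <= e.
Proof.
move=> q0 qp e0; pose B := 1 + 2 `^ p * (M + M).
have B0 : 0 < B by rewrite ltr_pwDl// mulr_ge0 ?powR_ge0// addr_ge0.
have e1 : 0 < e / 2 / B by rewrite !divr_gt0.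
have [C C0 hC] := powR_interpolation q0 qp e1.
have q0' : (fun n => C * (d%:R * (d%:R * (4 * (1 / 4 : R) ^+ n)))) @ \oo --> C * (d%:R * (d%:R * (4 * (0 : R)))).
  do 4 (apply: cvgM; first exact: cvg_cst).
  by apply: cvg_expr; rewrite ger0_norm ?divr_ge0//; lra.
rewrite !mulr0 in q0'; have e2 : 0 < e / 2 by rewrite divr_gt0.
move/cvgrPdist_le : q0' => /(_ _ e2)[N _ hN]; exists N => n t Nn tT.
have [i2 h2] := msq_diff n tT.
have i3 : integ mu (fun x => frob (F n t x - Fh t x) `^ p).
  apply: LpD_integ => //; [by move=> i j; exact: mF|exact: iF|].
  by have [] := hFh t.
have p3 : RI mu (fun x => frob (F n t x - Fh t x) `^ p) <= 2 `^ p * (M + M).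
  have i4 := iF n tT; have [i5 h5] := hFh t.
  apply: (@le_trans _ _ (RI mu (fun x => 2 `^ p * (frob (F n t x) `^ p + frob (Fh t x) `^ p)))).
    apply: RI_le => //; first by apply: integZ; exact: integD.
    by move=> x; rewrite frobB_powR// ltW.
  rewrite (RIZ _ (integD i4 i5)) (RID i4 i5); apply: ler_wpM2l; first exact: powR_ge0.
  exact: (lerD (FM n tT) h5).
have i6 := integD (integ_cst mu 1) i3.
have i7 := integZ (e / 2 / B) i6; have i8 := integZ C i2.
apply: (@le_trans _ _ (RI mu (fun x => e / 2 / B * (1 + frob (F n t x - Fh t x) `^ p) + C * msq (F n t x - Fh t x)))).
  apply: RI_le; [|exact: integD|].
    apply: Lp_integ => //; apply: (Lp_le q0 (ltW qp)); apply: integ_Lp => // i j.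
    by under eq_fun do rewrite !mxE; apply: measurable_funB => //; exact: mF.
  by move=> x; rewrite -frob_sqr; apply: hC; exact: frob_ge0.
rewrite (RID i7 i8) (RIZ _ i6) (RIZ _ i2) (RID (integ_cst mu 1) i3) RI_cst.
have k1 : e / 2 / B * (1 + RI mu (fun x => frob (F n t x - Fh t x) `^ p)) <= e / 2.
  by rewrite -[leRHS](divfK (lt0r_neq0 B0)) ler_wpM2l ?(ltW e1)// lerD2l.
have k2 : C * RI mu (fun x => msq (F n t x - Fh t x)) <= e / 2.
  apply: (le_trans (ler_wpM2l C0 h2)); have := hN n Nn.
  by rewrite /= sub0r normrN; apply: le_trans; exact: ler_norm.
by rewrite [leRHS]splitr lerD.
Qed.

Lemma jms_jmeas : jmeas T Fh.
Proof. by move=> i j; apply: (@measurable_funS _ _ _ _ setT) => //; exact: jFh. Qed.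

Lemma Fh_Lp q t : 0 < q -> q <= p -> Lp q (Fh t).
Proof.
move=> q0 qp; apply: (Lp_le q0 qp); apply: integ_Lp => //.
by have [] := hFh t.
Qed.

Lemma diff_Lp q n t : 0 < q -> q <= p -> 0 <= t <= T -> Lp q (fun x => F n t x - Fh t x).
Proof.
move=> q0 qp tT; apply: integ_Lp => //.
  by move=> i j; under eq_fun do rewrite !mxE; apply: measurable_funB => //; exact: mF.
apply: LpD_integ => //; [by move=> i j; exact: mF| |].
  apply: Lp_integ => //; apply: (Lp_le q0 qp); apply: integ_Lp => //; [by move=> i j; exact: mF|exact: iF].
by apply: Lp_integ => //; exact: Fh_Lp.
Qed.

(** A uniform limit of continuous functions: the difference at two times passes through one member
    of the sequence, and [c] is the constant of [frob_sum3]. *)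
Lemma Fh_CLp q : 0 < q -> q < p -> CLp T q Fh.
Proof.
move=> q0 qp; apply: CLp_intro => //; first exact: jms_jmeas.
  by move=> t tT; apply: Fh_Lp => //; exact: ltW.
move=> t e tT e0; pose c : R := 2 `^ q * 2 `^ q.
have c0 : 0 < c by rewrite mulr_gt0 ?powR_gt0.
have e3 : 0 < e / 3 / c by rewrite !divr_gt0.
have [N hN] := strain_uniform q0 qp e3.
have [del del0 hdel] := CLp_cont q0 (CLp_le q0 (ltW qp) (cF N)) tT e3.
exists del => // s sT st; have [i2 h2] := hdel s sT st.
have h1 := hN N s (leqnn N) sT; have h3 := hN N t (leqnn N) tT.
have i1 := Lp_integ q0 (diff_Lp N q0 (ltW qp) sT).
have i3 := Lp_integ q0 (diff_Lp N q0 (ltW qp) tT).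
have i4 := integD (integD i1 i2) i3; have i5 := integZ c i4.
apply: (@le_trans _ _ (RI mu (fun x => c * (frob (F N s x - Fh s x) `^ q + frob (F N s x - F N t x) `^ q + frob (F N t x - Fh t x) `^ q)))).
  apply: RI_le; [|exact: i5|move=> x].
    apply: LpD_integ; [exact: q0|exact: mFh|exact: mFh| |];
      by apply: Lp_integ => //; apply: Fh_Lp => //; exact: ltW.
  have -> : Fh s x - Fh t x = - (F N s x - Fh s x) + (F N s x - F N t x) + (F N t x - Fh t x).
    by apply/matrixP => i j; rewrite !mxE; ring.
  by rewrite -[frob (F N s x - Fh s x)]frobN; apply: frob_sum3; exact: ltW.
rewrite (RIZ c i4) (RID (integD i1 i2) i3) (RID i1 i2).
have -> : e = c * (e / 3 / c + e / 3 / c + e / 3 / c) by field; rewrite gt_eqF.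
exact: (ler_wpM2l (ltW c0) (lerD (lerD h1 (ltW h2)) h3)).
Qed.

Lemma strain_cvg_CLp q : 0 < q -> q < p -> cvg_CLp T q F Fh.
Proof.
move=> q0 qp; split; [by move=> k; exact: CLp_le q0 (ltW qp) (cF k)|exact: Fh_CLp|].
move=> A /nbhs0_ereal[e e0 hA].
have [N hN] := strain_uniform q0 qp (powR_gt0 q e0).
exists N => // k /= Nk; apply: hA.
  apply: (@le_trans _ _ (LpN q (fun x => F k 0 x - Fh 0 x))); first exact: Lnorm_ge0.
  by apply: ereal_sup_ubound; exists 0 => //; rewrite /= in_itv/= lexx ltW.
apply: ge_ereal_sup => _ [t /= tT <-]; rewrite in_itv/= in tT.
by apply: LpN_small => //; [apply: diff_Lp => //; exact: ltW|exact: hN].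
Qed.

End strain_convergence.

(** The constant [1 + M] is cruder than the square root of [M]; what matters is that the bound is
    linear in [G], the L^2 norm of a test function that is merely integrable in time. *)
Lemma RI_cauchy_schwarz d (Y : measurableType d) (R : realType) (mu : probability Y R) (f g : Y -> R) M G :
  sqint mu f -> sqint mu g -> RI mu (fun x => f x ^+ 2) <= M -> 0 <= G ->
  RI mu (fun x => g x ^+ 2) <= G ^+ 2 -> `|RI mu (fun x => f x * g x)| <= (1 + M) * G.
Proof.
move=> sf sg fM G0 gG; have M0 : 0 <= M := le_trans (RI_sqr_ge0 _ _) fM.
apply/ler_addgt0Pr => e e0.
(* Positive even if [G] is 0; both Young terms together are at most [(1 + M) * c], which is the
   claim up to [e]. *)
pose c := G + e / (1 + M).
have M1 : 0 < 1 + M by rewrite ltr_pwDl.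
have e1 : 0 < e / (1 + M) by rewrite divr_gt0.
have c0 : 0 < c by rewrite /c ltr_wpDl.
apply: (le_trans (RI_young c0 sf sg)).
have k1 : c * RI mu (fun x => f x ^+ 2) <= c * M by rewrite ler_wpM2l// ltW.
have k2 : c^-1 * RI mu (fun x => g x ^+ 2) <= c.
  rewrite mulrC ler_pdivrMr//; apply: (le_trans gG).
  by rewrite -expr2 lerXn2r ?nnegrE// ?(ltW c0)// /c lerDl ltW.
apply: (le_trans (lerD k1 k2)).
have -> : (1 + M) * G + e = (1 + M) * c.
  by rewrite /c mulrDr [X in _ = _ + X]mulrC divfK// gt_eqF.
by rewrite [leRHS]mulrDl mul1r addrC [M * c]mulrC.
Qed.

(** * Weak-* convergence of the velocities *)

Section weak_star.
Context (R : realType) (d : nat) (T M : R).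
Hypothesis hT : 0 < T.
Notation UT := (uniform_prob hT).
Notation X := (d.-tuple R).
Notation mu := (@torus R d).

Lemma Lp2_intro (f : X -> 'rV[R]_d) : (forall i, sqint mu (fun x => f x ord0 i)) -> Lp 2 f.
Proof.
move=> sf; apply: integ_Lp => //; first by move=> i j; rewrite (ord1 i); exact: sqint_meas.
by rewrite frob2_msq; apply: integ_msq => i j; rewrite (ord1 i).
Qed.

Lemma bounded_LinfL2 (f : R -> X -> 'rV[R]_d) : jmeas T f ->
  (forall t, 0 <= t <= T -> (forall i, sqint mu (fun x => f t x ord0 i)) /\
     RI mu (fun x => msq (f t x)) <= M) -> LinfLp T 2 f.
Proof.
move=> jf fM; split => //; exists (M `^ 2^-1); apply: aeW => t; rewrite in_itv/= => /andP[/ltW t0 /ltW tT].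
have [sf hM] : (forall i, sqint mu (fun x => f t x ord0 i)) /\ RI mu (fun x => msq (f t x)) <= M.
  by apply: fM; rewrite t0.
have hL := Lp2_intro sf; split => //.
by apply: LpN_le_root => //; rewrite frob2_msq.
Qed.

Variables (u : nat -> R -> X -> 'rV[R]_d) (uh : R -> X -> 'rV[R]_d).
Hypothesis M0 : 0 <= M.
Hypothesis ju : forall n, jmeas T (u n).
Hypothesis juh : jmeas T uh.
Hypothesis uM : forall n t i, 0 <= t <= T -> sqint mu (fun x => u n t x ord0 i) /\
  RI mu (fun x => u n t x ord0 i ^+ 2) <= M.
Hypothesis suh : forall t i, 0 <= t <= T -> sqint mu (fun x => uh t x ord0 i).
Hypothesis weak : forall t i (g : X -> R), 0 <= t <= T -> sqint mu g ->
  RI mu (fun x => u n t x ord0 i * g x) @[n --> \oo] --> RI mu (fun x => uh t x ord0 i * g x).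

Lemma mdot_row (a b : 'rV[R]_d) : mdot a b = \sum_i a ord0 i * b ord0 i.
Proof. by rewrite /mdot big_ord1. Qed.

Lemma jmc_mdot (f g : R -> X -> 'rV[R]_d) : jmeas T f -> jmeas T g ->
  jmc T (fun t x => mdot (f t x) (g t x)).
Proof.
move=> jf jg; rewrite /jmc /jms; under eq_fun do rewrite mdot_row.
by apply: measurable_sum => i; apply: measurable_funM;
  [exact: (jmeas_jmc hT ord0 i jf)|exact: (jmeas_jmc hT ord0 i jg)].
Qed.

(** At each time where the test function lies in L^2, weak convergence of the velocities gives
    convergence of the spatial pairing. These pairings are dominated by a multiple of the L^2 norm
    [G], which is integrable in time. *)
Lemma pairing_cvg (g : R -> X -> 'rV[R]_d) : jmeas T g ->
  (\int[lebesgue_measure]_(t in `]0%R, T[) LpN 2 (g t) < +oo)%E ->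
  STint T (fun t x => mdot (u n t x) (g t x)) @[n --> \oo] -->
  STint T (fun t x => mdot (uh t x) (g t x)).
Proof.
move=> jg gfin.
have mg i : jmc T (fun t x => g t x ord0 i) by exact: jmeas_jmc.
pose N2 t := (\int[mu]_x (frob (g (clamp T t) x) `^ 2)%:E)%E.
have N20 t : (0 <= N2 t)%E by apply: integral_ge0 => x _; rewrite lee_fin powR_ge0.
have mN2 : measurable_fun setT (N2 : measurableTypeR R -> \bar R).
  have mz : measurable_fun setT (fun z : measurableTypeR R * X => (frob (g (clamp T z.1) z.2) `^ 2)%:E).
    apply/measurable_EFinP; apply: measurable_frob_powR => i j; rewrite (ord1 i); exact: mg.
  have := @measurable_fun_fubini_tonelli_F _ _ (measurableTypeR R) X R mu _ mz.
  by apply => z; rewrite lee_fin powR_ge0.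
pose f t : \bar R := (N2 t `^ 2^-1)%E.
have fE t : f t = LpN 2 (g (clamp T t)) by rewrite /f LpN_root.
have mf : measurable_fun setT (f : measurableTypeR R -> \bar R).
  exact: (measurableT_comp (measurable_poweR _) mN2).
have f0 t : (0 <= f t)%E by exact: poweR_ge0.
have fi : UT.-integrable setT f.
  apply/integrableP; split; first exact: mf.
  under eq_integral do rewrite gee0_abs//.
  rewrite integral_uniform// subr0.
  have -> : (\int[lebesgue_measure]_(t in `[0%R, T]) f t = \int[lebesgue_measure]_(t in `]0%R, T[) LpN 2 (g t))%E.
    rewrite -integral_itv_obnd_cbnd; last exact: measurable_funTS.
    rewrite -integral_itv_bndo_bndc; last exact: measurable_funTS.
    apply: eq_integral => t; rewrite inE/= in_itv/= => /andP[/ltW t0 /ltW tT].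
    by rewrite fE clampE// t0.
  move: gfin; set I := integral _ _ _ => gfin.
  have I0 : (0 <= I)%E by apply: integral_ge0 => t _; exact: Lnorm_ge0.
  by rewrite -(@fineK _ I) ?ge0_fin_numE// -EFinM ltry.
(* A test function in L^1(0,T;L^2) may leave L^2 on a null set of times, where its slices cannot be
   paired; [good] is the complement. *)
pose good : set R := [set t | (N2 t < +oo)%E].
have mgood : measurable (good : set (measurableTypeR R)).
  by have := emeasurable_fun_infty_o measurableT mN2 +oo%E; rewrite setTI.
have aegood : {ae UT, forall t, good t}.
  have := integrable_ae measurableT fi; apply: ae_imp => t /(_ I) ft.
  rewrite /good/= ltNge leye_eq; apply/negP => /eqP h.
  by move: ft; rewrite /f h poweRyr// invr_neq0.
pose G t := fine (f t).
have Gg t : good t -> (forall i, sqint mu (fun x => g (clamp T t) x ord0 i)) /\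
    forall i, RI mu (fun x => g (clamp T t) x ord0 i ^+ 2) <= G t ^+ 2.
  move=> gt; have tT := clamp_itv hT t.
  have mgt i j : measurable_fun setT (fun x => g (clamp T t) x i j).
    by rewrite (ord1 i); exact: jmc_slice (mg j) tT.
  have hL : Lp 2 (g (clamp T t)).
    apply: integ_Lp => //; apply: integ_lty => //; first exact: measurable_frob_powR.
    by move=> x; exact: powR_ge0.
  have s i : sqint mu (fun x => g (clamp T t) x ord0 i) by exact: Lp2_sqint.
  split => // i; rewrite /G fE LpN_RI//= frob2_msq.
  have r0 : 0 <= RI mu (fun x => msq (g (clamp T t) x)) by apply: RI_ge0 => x; exact: msq_ge0.
  rewrite powR12_sqrt// sqr_sqrtr//; apply: RI_le; [exact: sqint2|exact: Lp2_msq|].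
  by move=> x; exact: entry_msq.
have G0 t : 0 <= G t by rewrite fine_ge0.
have mG : measurable_fun setT (G : measurableTypeR R -> R) by exact: measurableT_comp.
have iG : integ UT G.
  apply: integ_lty => //; apply: (@le_lt_trans _ _ (\int[UT]_t f t)%E).
    apply: ge0_le_integral => //; first by move=> t _; rewrite lee_fin.
      exact/measurable_EFinP.
    by move=> t _; rewrite /G; have := f0 t; case: (f t) => [r| |] //=; rewrite leey.
  have /integrableP[_] := fi; apply: le_lt_trans.
  apply: ge0_le_integral => //; first exact: measurableT_comp.
  by move=> t _; rewrite gee0_abs.
pose A n t := RI mu (fun x => mdot (u n (clamp T t) x) (g (clamp T t) x)).
pose Ah t := RI mu (fun x => mdot (uh (clamp T t) x) (g (clamp T t) x)).
have mA n : measurable_fun setT (A n : measurableTypeR R -> R) := jmc_RI (jmc_mdot (ju n) jg).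
have mAh : measurable_fun setT (Ah : measurableTypeR R -> R) := jmc_RI (jmc_mdot juh jg).
have mI : measurable_fun setT (\1_good : measurableTypeR R -> R) by exact: measurable_indic.
(* The indicator of [good] changes the integrals over time by nothing and makes the convergence and
   the domination below valid at every time. *)
have STA (v : R -> X -> 'rV[R]_d) (B : measurableTypeR R -> R) : measurable_fun setT B ->
    (forall t, B t = RI mu (fun x => mdot (v (clamp T t) x) (g (clamp T t) x))) ->
    STint T (fun t x => mdot (v t x) (g t x)) = T * RI UT (fun t => \1_good t * B t).
  move=> mB BE; rewrite (STint_ae hT mB); last first.
    apply: aeW => t; rewrite in_itv/= => /andP[/ltW t0 /ltW tT].
    by rewrite BE clampE// t0.
  congr (T * _); apply: ae_RI => //; first exact: measurable_funM.
  by move: aegood; apply: ae_imp => t gt; rewrite indicE mem_set// mul1r.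
rewrite (STA uh Ah mAh)//.
have -> : (fun n => STint T (fun t x => mdot (u n t x) (g t x))) =
    fun n => T * RI UT (fun t => \1_good t * A n t).
  by apply/funext => n; rewrite (STA (u n) (A n)).
apply: cvgM; first exact: cvg_cst.
have AE n t : good t -> A n t = \sum_i RI mu (fun x => u n (clamp T t) x ord0 i * g (clamp T t) x ord0 i).
  move=> gt; have [sg _] := Gg t gt; have tT := clamp_itv hT t.
  rewrite -RI_sum; first by apply: eq_RI => x; rewrite mdot_row.
  by move=> i _; apply: sqintM => //; have [] := uM n i tT.
apply: (proj2 (@RI_dct _ _ _ UT (fun n t => \1_good t * A n t) _ (fun t => d%:R * ((1 + M) * G t)) _ _ _ _ _)).
- by move=> n; exact: measurable_funM.
- exact: measurable_funM.
- apply: aeW => t; have [gt|bt] := pselect (good t); last first.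
    under eq_fun do rewrite indicE memNset// mul0r; rewrite indicE memNset// mul0r; exact: cvg_cst.
  apply: cvgM; first exact: cvg_cst.
  have [sg _] := Gg t gt; have tT := clamp_itv hT t.
  have -> : Ah t = \sum_i RI mu (fun x => uh (clamp T t) x ord0 i * g (clamp T t) x ord0 i).
    rewrite -RI_sum; first by apply: eq_RI => x; rewrite mdot_row.
    by move=> i _; apply: sqintM => //; exact: suh.
  have -> : A ^~ t = fun n => \sum_i RI mu (fun x => u n (clamp T t) x ord0 i * g (clamp T t) x ord0 i).
    by apply/funext => n; exact: AE.
  by apply: cvg_big => [|i _]; [exact: add_continuous|exact: weak].
- by apply: integZ; exact: integZ.
move=> n t; have [gt|bt] := pselect (good t); last first.
  rewrite indicE memNset// mul0r normr0 mulr_ge0// mulr_ge0//.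
  by rewrite addr_ge0.
rewrite indicE mem_set// mul1r AE//; have [sg gG] := Gg t gt; have tT := clamp_itv hT t.
apply: (le_trans (ler_norm_sum _ _ _)).
apply: (@le_trans _ _ (\sum_(i < d) (1 + M) * G t)).
  by apply: ler_sum => i _; have [su hM] := uM n i tT; exact: RI_cauchy_schwarz.
by rewrite sumr_const card_ord -[_ *+ d]mulr_natl.
Qed.

End weak_star.

(** * Solutions of the limit system *)

Section vector_tests.
Context (R : realType) (d : nat).
Notation V := (R * 'rV[R]_d)%type.

Lemma derive_big_sum (I : Type) (s : seq I) (f : I -> V -> R) v z :
  (forall i, smooth (f i)) -> 'D_v (fun z => \sum_(i <- s) f i z) z = \sum_(i <- s) 'D_v (f i) z.
Proof.
move=> sf; have sm (r : seq I) : smooth (fun z => \sum_(i <- r) f i z).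
  by move=> k; apply: Ck_sum => i; exact: sf.
elim: s => [|i s IH].
  rewrite big_nil -[RHS](derive_cst (0 : R) z v); congr ('D_ _ _ _).
  by apply/funext => y; rewrite big_nil.
have E : (fun z => \sum_(j <- i :: s) f j z) = f i + (fun z => \sum_(j <- s) f j z).
  by apply/funext => y; rewrite big_cons.
rewrite E deriveD ?big_cons ?IH//.
- exact: (@Ck_derivable _ _ _ _ _ (sf i 1%N)).
- exact: (@Ck_derivable _ _ _ _ _ (sm s 1%N)).
Qed.

Lemma dlap_smooth_periodic (phi : V -> 'rV[R]_d) : smooth_periodic phi -> smooth_periodic (dlap phi).
Proof.
move=> sp.
have sdd b := smooth_periodic_derive (0, Defs.basis R b) (smooth_periodic_derive (0, Defs.basis R b) sp).
split; first by move=> k; apply: Ck_sum => b; have [h _] := sdd b; exact: h.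
move=> t a x; rewrite /dlap; apply: eq_bigr => b _; have [_ h] := sdd b; exact: (h t a x).
Qed.

(** The limit system is tested against the gradient of a Laplacian, whereas the moved equation
    carries the Laplacian of a derivative; the two agree by symmetry of mixed derivatives, used once
    for each of the two derivatives of the Laplacian. *)
Lemma dgrad_dlap (phi : V -> 'rV[R]_d) i a z : smooth_periodic phi ->
  dgrad (dlap phi) z i a = \sum_b dx b (dx b (dx a (fun z => phi z ord0 i))) z.
Proof.
move=> sp; have [sphi _] := sp; have [sl _] := dlap_smooth_periodic sp.
have s1 (f : V -> R) v : smooth f -> smooth (fun z => 'D_v f z).
  by move=> sf k; exact: Ck_derive.
have si : smooth (fun z => phi z ord0 i) by have [] := smooth_periodic_coord ord0 i sp.
rewrite mxE /dx -derive_coord//.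
have -> : (fun z => dlap phi z ord0 i) = fun z => \sum_b dx b (dx b (fun z => phi z ord0 i)) z.
  apply/funext => y; rewrite /dlap summxE; apply: eq_bigr => b _.
  have sb : smooth (dx b phi) by have [] := smooth_periodic_derive (0, Defs.basis R b) sp.
  have E : (fun w => dx b phi w ord0 i) = dx b (fun z => phi z ord0 i).
    by apply/funext => w; exact: (esym (derive_coord _ _ _ _ sphi)).
  by rewrite -E; exact: (esym (derive_coord _ _ _ _ sb)).
rewrite derive_big_sum; last by move=> b; exact: (s1 _ _ (s1 _ _ si)).
apply: eq_bigr => b _.
have c2 (f : V -> R) : smooth f -> Ck 2 f by move=> h; exact: h.
have E : (fun y => dx a (dx b (fun z => phi z ord0 i)) y) = fun y => dx b (dx a (fun z => phi z ord0 i)) y.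
  by apply/funext => y; exact: (schwarz _ _ _ (c2 _ si)).
have e1 := schwarz (0, Defs.basis R a) (0, Defs.basis R b) z (c2 _ (s1 _ (0, Defs.basis R b) si)).
have e2 := congr1 (fun f : V -> R => 'D_(0, Defs.basis R b) f z) E.
exact: (etrans e1 e2).
Qed.

End vector_tests.

Section inviscid_solution.
Context (R : realType) (d : nat) (T p M : R).
Hypothesis hT : 0 < T.
Hypothesis hp : 2 <= p.
Notation X := (d.-tuple R).
Notation mu := (@torus R d).
Notation V := (R * 'rV[R]_d)%type.
Variables (W : 'M[R]_d -> R) (CS : R).
Hypothesis W3 : W_C3 W.
Hypothesis CS0 : 0 <= CS.
Hypothesis hCS : forall i a F, (1 + frob F) * `|partial W i a F| <= CS * (1 + frob F `^ p).
Variables (u0 : X -> 'rV[R]_d) (F0 : X -> 'M[R]_d) (u : R -> X -> 'rV[R]_d) (F : R -> X -> 'M[R]_d).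
Hypothesis bnd : bounded_flow T p M u F.
Hypothesis ju : jmeas T u.
Hypothesis jF : jmeas T F.
Hypothesis su0 : forall i, sqint mu (fun x => u0 x ord0 i).
Hypothesis sF0 : forall i j, sqint mu (fun x => F0 x i j).
Hypothesis pF0 : integ mu (fun x => frob (F0 x) `^ p).
Hypothesis mom : forall eta, test T eta -> forall i, momentum_eq hT W 0 u0 u F eta i.
Hypothesis cpt : forall eta, test T eta -> forall i j, compat_eq hT F0 u F eta i j.
Hypothesis curl : forall zeta, test T zeta -> forall i a b,
  ST hT (fun t x => F t x i b * dx a zeta (t, vec x)) = ST hT (fun t x => F t x i a * dx b zeta (t, vec x)).

Let uL i := L2b_L1b (L2b_velocity bnd i).
Let FL i j := L2b_L1b (L2b_strain hp bnd i j).
Let SL i a := L1b_stress W3 CS0 hCS bnd i a.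

(** A vector test function is split into its components, each a scalar test function, and the scalar
    equations at viscosity 0 are summed. *)
Lemma inviscid_momentum (phi : V -> 'rV[R]_d) : test T phi ->
    STint T (fun t x => mdot (u t x) (dt phi (t, vec x)))
    - STint T (fun t x => mdot (stress W (F t x)) (dgrad phi (t, vec x)))
    + STint T (fun t x => mdot (F t x) (dgrad (dlap phi) (t, vec x)))
    + \int[torus d]_x mdot (u0 x) (phi (0, vec x)) = 0.
Proof.
move=> tphi; have [sp _] := tphi; have [sphi _] := sp.
pose eta i := fun z => phi z ord0 i.
have teta i : test T (eta i) := test_coord ord0 i tphi.
have spe i : smooth_periodic (eta i) by have [] := teta i.
have sd i v : smooth_periodic (fun z => 'D_v (eta i) z) := smooth_periodic_derive v (spe i).
have sdd i v w : smooth_periodic (fun z => 'D_w (fun z => 'D_v (eta i) z) z) :=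
  smooth_periodic_derive w (sd i v).
have sddd i v w r : smooth_periodic (fun z => 'D_r (fun z => 'D_w (fun z => 'D_v (eta i) z) z) z) :=
  smooth_periodic_derive r (sdd i v w).
have dE v z i : ('D_v phi z) ord0 i = 'D_v (eta i) z by rewrite derive_coord.
have -> : STint T (fun t x => mdot (u t x) (dt phi (t, vec x))) =
    \sum_i ST hT (fun t x => u t x ord0 i * dt (eta i) (t, vec x)).
  have h i := pairing hT (uL i) (sd i (1, 0)).
  rewrite -(ST_sum hT (index_enum _) h); have [N hN] := L1b_sum (index_enum _) h.
  rewrite -(STint_L1b hT hN); congr STint; apply/funext => t; apply/funext => x.
  by rewrite mdot_row; apply: eq_bigr => i _; rewrite /dt dE.
have -> : STint T (fun t x => mdot (stress W (F t x)) (dgrad phi (t, vec x))) =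
    \sum_i \sum_a ST hT (fun t x => stress W (F t x) i a * dx a (eta i) (t, vec x)).
  have h i a := pairing hT (SL i a) (sd i (0, Defs.basis R a)).
  rewrite (STint_mdot hT).
    apply: eq_bigr => i _; apply: eq_bigr => a _; congr (ST hT _).
    by apply/funext => t; apply/funext => x; rewrite [dgrad _ _ _ _]mxE /dx dE.
  move=> i a; have [N hN] := h i a; exists N; move: hN; congr (L1b _ _ _).
  by apply/funext => t; apply/funext => x; rewrite [dgrad _ _ _ _]mxE /dx dE.
have -> : STint T (fun t x => mdot (F t x) (dgrad (dlap phi) (t, vec x))) =
    \sum_i \sum_a \sum_b ST hT (fun t x => F t x i a * dx b (dx b (dx a (eta i))) (t, vec x)).
  have h i a b := pairing hT (FL i a) (sddd i (0, Defs.basis R a) (0, Defs.basis R b) (0, Defs.basis R b)).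
  have E i a : (fun t x => F t x i a * dgrad (dlap phi) (t, vec x) i a) =
      fun t x => \sum_b F t x i a * dx b (dx b (dx a (eta i))) (t, vec x).
    by apply/funext => t; apply/funext => x; rewrite dgrad_dlap// mulr_sumr.
  rewrite (STint_mdot hT).
    apply: eq_bigr => i _; apply: eq_bigr => a _; rewrite E; exact: (ST_sum hT (index_enum _) (h i a)).
  by move=> i a; rewrite E; exact: L1b_sum (h i a).
have -> : \int[torus d]_x mdot (u0 x) (phi (0, vec x)) = \sum_i RI mu (fun x => u0 x ord0 i * eta i (0, vec x)).
  rewrite -RI_sum; first by apply: eq_RI => x; rewrite mdot_row.
  by move=> i _; apply: sqint_test.
rewrite -sumrB -!big_split/=; apply: big1 => i _.
by have := mom (teta i) i; rewrite /momentum_eq mul0r addr0.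
Qed.

Lemma inviscid_compat (psi : V -> 'M[R]_d) : test T psi ->
    STint T (fun t x => mdot (F t x) (dt psi (t, vec x)))
    - STint T (fun t x => mdot (u t x) (ddiv psi (t, vec x)))
    + \int[torus d]_x mdot (F0 x) (psi (0, vec x)) = 0.
Proof.
move=> tpsi; have [sp _] := tpsi; have [spsi _] := sp.
pose eta i j := fun z => psi z i j.
have teta i j : test T (eta i j) := test_coord i j tpsi.
have spe i j : smooth_periodic (eta i j) by have [] := teta i j.
have sd i j v : smooth_periodic (fun z => 'D_v (eta i j) z) := smooth_periodic_derive v (spe i j).
have dE v z i j : ('D_v psi z) i j = 'D_v (eta i j) z by rewrite derive_coord.
have -> : STint T (fun t x => mdot (F t x) (dt psi (t, vec x))) =
    \sum_i \sum_j ST hT (fun t x => F t x i j * dt (eta i j) (t, vec x)).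
  have h i j := pairing hT (FL i j) (sd i j (1, 0)).
  have E i j : (fun t x => F t x i j * dt psi (t, vec x) i j) =
      fun t x => F t x i j * dt (eta i j) (t, vec x).
    by apply/funext => t; apply/funext => x; rewrite /dt dE.
  rewrite (STint_mdot hT); last by move=> i j; rewrite E.
  by apply: eq_bigr => i _; apply: eq_bigr => j _; rewrite E.
have -> : STint T (fun t x => mdot (u t x) (ddiv psi (t, vec x))) =
    \sum_i \sum_j ST hT (fun t x => u t x ord0 i * dx j (eta i j) (t, vec x)).
  have h i j := pairing hT (uL i) (sd i j (0, Defs.basis R j)).
  have h' i := L1b_sum (index_enum _) (h i).
  have -> : \sum_i \sum_j ST hT (fun t x => u t x ord0 i * dx j (eta i j) (t, vec x)) =
      ST hT (fun t x => \sum_i \sum_j u t x ord0 i * dx j (eta i j) (t, vec x)).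
    rewrite (ST_sum hT (index_enum _) h'); apply: eq_bigr => i _.
    by rewrite (ST_sum hT (index_enum _) (h i)).
  have [N hN] := L1b_sum (index_enum _) h'.
  rewrite -(STint_L1b hT hN); congr STint; apply/funext => t; apply/funext => x.
  rewrite mdot_row; apply: eq_bigr => i _; rewrite mxE mulr_sumr; apply: eq_bigr => j _.
  by rewrite /dx dE.
have -> : \int[torus d]_x mdot (F0 x) (psi (0, vec x)) = \sum_i \sum_j RI mu (fun x => F0 x i j * eta i j (0, vec x)).
  have h i j : integ mu (fun x => F0 x i j * eta i j (0, vec x)) by exact: sqint_test.
  have -> : \sum_i \sum_j RI mu (fun x => F0 x i j * eta i j (0, vec x)) =
     RI mu (fun x => \sum_i \sum_j F0 x i j * eta i j (0, vec x)); last by [].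
  rewrite RI_sum; last by move=> i _; exact: integ_sum.
  by apply: eq_bigr => i _; rewrite RI_sum.
rewrite -sumrB -!big_split/=; apply: big1 => i _.
rewrite -sumrB -!big_split/=; apply: big1 => j _.
exact: cpt (teta i j) i j.
Qed.

Lemma inviscid_stress :
  (\int[lebesgue_measure]_(t in `]0%R, T[) \int[torus d]_x (frob (stress W (F t x)))%:E < +oo)%E.
Proof.
pose B : R := d%:R * (d%:R * (CS * (1 + M))).
apply: (@le_lt_trans _ _ (\int[lebesgue_measure]_(t in `]0%R, T[) B%:E)%E); last first.
  by rewrite integral_cst//= lebesgue_measure_itv/= lte_fin hT -EFinB -EFinM ltry.
have key t : 0 <= t <= T -> (\int[mu]_x (frob (stress W (F t x)))%:E <= B%:E)%E.
  move=> tT; have [_ _ /(_ t tT)[_ _ iF FM]] := bnd.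
  have i1 := integD (integ_cst mu 1) iF.
  have i2 := integZ CS i1; have i3 := integZ d%:R i2; have i4 := integZ d%:R i3.
  apply: (@le_trans _ _ (\int[mu]_x (d%:R * (d%:R * (CS * (1 + frob (F t x) `^ p))))%:E)%E).
    apply: ae_integral_le.
    - by move=> x _; rewrite lee_fin frob_ge0.
    - by move=> x _; rewrite lee_fin !mulr_ge0// addr_ge0 ?powR_ge0.
    apply: aeW => x _; rewrite lee_fin; apply: (le_trans (frob_sum _)).
    apply: (@le_trans _ _ (\sum_(i < d) d%:R * (CS * (1 + frob (F t x) `^ p)))); last first.
      by rewrite sumr_const card_ord -[_ *+ d]mulr_natl.
    apply: ler_sum => i _.
    apply: (@le_trans _ _ (\sum_(j < d) CS * (1 + frob (F t x) `^ p))); last first.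
      by rewrite sumr_const card_ord -[_ *+ d]mulr_natl.
    by apply: ler_sum => j _; rewrite mxE; exact: (partial_le hCS).
  rewrite (RI_EFin i4) lee_fin (RIZ _ i3) (RIZ _ i2) (RIZ _ i1) (RID (integ_cst mu 1) iF) RI_cst /B.
  by do 3 (apply: ler_wpM2l => //); rewrite lerD2l.
have B0 : 0 <= B.
  rewrite -lee_fin; apply: (le_trans _ (key 0 _)); last by rewrite lexx ltW.
  by apply: integral_ge0 => x _; rewrite lee_fin frob_ge0.
apply: ae_integral_le => //.
  by move=> t _; apply: integral_ge0 => x _; rewrite lee_fin frob_ge0.
by apply: aeW => t; rewrite /= in_itv/= => /andP[/ltW t0 /ltW tT]; apply: key; rewrite t0.
Qed.

Lemma inviscid_solution : weak_solution0 T p W u0 F0 u F.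
Proof.
have p0 : 0 < p by exact: lt_le_trans hp.
split.
- by split; [exact: Lp2_intro|apply: integ_Lp => // i j; exact: sqint_meas].
- by apply: (@bounded_LinfL2 R d T M) => // t tT; have [_ _ /(_ t tT)[]] := bnd.
- split => //; exists (M `^ p^-1); apply: aeW => t; rewrite in_itv/= => /andP[/ltW t0 /ltW tT].
  have tT' : 0 <= t <= T by rewrite t0.
  have [_ _ /(_ t tT')[_ _ iF FM]] := bnd.
  have hL : Lp p (F t).
    apply: integ_Lp => // i j; apply: (@sqint_meas _ _ _ mu).
    by have [_ /(_ t tT')[]] := L2b_strain hp bnd i j.
  by split => //; exact: LpN_le_root.
- exact: inviscid_stress.
- exact: inviscid_momentum.
- exact: inviscid_compat.
- move=> zeta tz i a b; have [sp _] := tz.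
  have sd v : smooth_periodic (fun z => 'D_v zeta z) := smooth_periodic_derive v sp.
  have [N hN] := pairing hT (FL i b) (sd (0, Defs.basis R a)).
  have [N' hN'] := pairing hT (FL i a) (sd (0, Defs.basis R b)).
  by rewrite (STint_L1b hT hN) (STint_L1b hT hN'); exact: curl.
Qed.

End inviscid_solution.

Section solution_properties.
Context (R : realType) (d : nat) (T p : R).
Hypothesis hT : 0 < T.
Hypothesis hp : 2 <= p.
Notation X := (d.-tuple R).
Notation mu := (@torus R d).
Notation V := (R * 'rV[R]_d)%type.

(** At almost every time the strain is the gradient of [y], so each side is minus the pairing of [y]
    with a mixed second derivative of [zeta], and these are symmetric. *)
Lemma solution_curl W K nu u0 F0 u F y M : weak_solution T p W K nu u0 F0 u F y ->
  bounded_flow T p M u F -> forall zeta : V -> R, test T zeta -> forall i a b,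
  ST hT (fun t x => F t x i b * dx a zeta (t, vec x)) = ST hT (fun t x => F t x i a * dx b zeta (t, vec x)).
Proof.
move=> sol bnd zeta [sp _] i a b.
have sd v : smooth_periodic (fun z => 'D_v zeta z) := smooth_periodic_derive v sp.
have FL c := L2b_L1b (L2b_strain hp bnd i c).
have [N hN] := pairing hT (FL b) (sd (0, Defs.basis R a)).
have [N' hN'] := pairing hT (FL a) (sd (0, Defs.basis R b)).
rewrite -(STint_L1b hT hN); apply: (STint_ST hT hN').
have [_ [_ [My hy]] _ _] := ws_y sol.
have := aeI hy (ws_grad sol); apply: aeS => t [h1 h2] tT.
have [[_ hH] _] := h1 tT; have hF := h2 tT.
have tT' : 0 <= t <= T by move: tT; rewrite in_itv/= => /andP[/ltW -> /ltW ->].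
have t0 : 0 <= t by have /andP[] := tT'.
have key c e : RI mu (fun x => F t x i c * dx e zeta (t, vec x)) =
    - RI mu (fun x => y t x ord0 i * dx c (dx e zeta) (t, vec x)).
  have [hc hL] := hH c.
  rewrite -(wpd_test t ord0 i hc (sd (0, Defs.basis R e))).
  have [mz _] := test_slice t0 (sd (0, Defs.basis R e)).
  apply: ae_RI.
  - apply: measurable_funM mz; apply: (@sqint_meas _ _ _ mu).
    by have [_ /(_ t tT')[]] := L2b_strain hp bnd i c.
  - by apply: measurable_funM mz; have [m _] := hL; exact: m.
  - by move: hF; apply: ae_imp => x ->; rewrite mxE.
have [sz _] := sp.
apply: (etrans (key b a)); apply: (etrans _ (esym (key a b))); apply: (congr1 -%R).
by apply: eq_RI => x; apply: (congr1 ( *%R _)); exact: (schwarz _ _ _ (sz 2%N)).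
Qed.

Lemma gradient_bound (f : X -> 'M[R]_d) M : Hk 1 f ->
  ('N[mu]_(2%:E)[EFin \o (fun x => Num.sqrt (grad2 f x))] <= M%:E)%E ->
  RI mu (grad2 f) <= M `^ 2.
Proof.
(* The scalar density is viewed as a 1 by 1 matrix, so that the bound between an L^p norm and its
   integral applies to it. *)
move=> hf fM; pose g (x : X) : 'M[R]_1 := (Num.sqrt (grad2 f x))%:M.
have gE x : frob (g x) = Num.sqrt (grad2 f x).
  rewrite /frob msq_sum !big_ord1 mxE eqxx mulr1n sqr_sqrtr//; exact: grad2_ge0.
have gN : LpN 2 g = 'N[mu]_(2%:E)[EFin \o (fun x => Num.sqrt (grad2 f x))]%E.
  by rewrite /LpN; congr Lnorm; apply/funext => x /=; rewrite gE.
have mg : measurable_fun setT (grad2 f) := integ_meas (integ_grad2 hf).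
have hg : Lp 2 g.
  split; last by rewrite gN (le_lt_trans fM)// ltry.
  move=> i j; rewrite (ord1 i) (ord1 j); under eq_fun do rewrite mxE eqxx mulr1n.
  by apply: measurableT_comp mg; apply: continuous_measurable => x; exact: sqrt_continuous.
rewrite -gN in fM; have := LpN_le (ltr0n R 2) hg fM.
rewrite frob2_msq; congr (_ <= _); apply: eq_RI => x.
by rewrite -frob_sqr gE sqr_sqrtr//; exact: grad2_ge0.
Qed.

Lemma solution_bounded W K nu u0 F0 u F y M : weak_solution T p W K nu u0 F0 u F y ->
  {ae @lebesgue_measure R, forall t, t \in `]0, T[ ->
    RI mu (fun x => msq (u t x)) <= M /\ RI mu (fun x => frob (F t x) `^ p) <= M} -> 0 <= M ->
  bounded_flow T p (2 `^ 2 * (M + 1) + 2 `^ p * (M + 1)) u F.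
Proof.
move=> sol hM M0; have p0 : 0 < p by exact: lt_le_trans hp.
have [[cu _] [cF _ _ _]] := (ws_u sol, ws_F sol).
have M1 : 0 <= M + 1 by rewrite addr_ge0.
have ub := CLp_bound hT (ltr0n R 2) cu (M := M).
have Fb := CLp_bound hT p0 cF (M := M).
split.
- by move=> i; apply: (jmeas_jmc hT ord0 i); have [] := cu.
- by move=> i j; apply: (jmeas_jmc hT i j); have [] := cF.
move=> t tT; split.
- by move=> i; apply: Lp2_sqint; have [_ h _] := cu; apply: h; rewrite in_itv.
- rewrite -frob2_msq; apply: (@le_trans _ _ (2 `^ 2 * (M + 1))).
    apply: ub => //; move: hM; apply: aeS => s h sT; rewrite frob2_msq; exact: (h sT).1.
  by rewrite lerDl mulr_ge0 ?powR_ge0.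
- by apply: Lp_integ => //; have [_ h _] := cF; apply: h; rewrite in_itv.
- apply: (@le_trans _ _ (2 `^ p * (M + 1))).
    by apply: Fb => //; move: hM; apply: aeS => s h sT; exact: (h sT).2.
  by rewrite lerDr mulr_ge0 ?powR_ge0.
Qed.

Lemma bounded_flow_le M N (u : R -> X -> 'rV[R]_d) (F : R -> X -> 'M[R]_d) : M <= N ->
  bounded_flow T p M u F -> bounded_flow T p N u F.
Proof.
move=> MN [h1 h2 h3]; split => // t tT; have [k1 k2 k3 k4] := h3 t tT.
by split => //; [apply: le_trans k2 MN|apply: le_trans k4 MN].
Qed.

End solution_properties.

(** * From the bounds on the data to the limit solution *)

Lemma cvg_seq_bound (R : realType) (b : nat -> R) (l : R) : b @ \oo --> l ->
  exists c, forall n, `|b n| <= c.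
Proof.
move=> bl; have cb : cvgn b by apply/cvg_ex; exists l.
have [c [_ hc]] := cvg_seq_bounded cb.
by exists (c + 1) => n; apply: (hc (c + 1) _ n I); rewrite ltrDl.
Qed.

Theorem theorem6p1 (R : realType) (d : nat) (hd : d = 2%N \/ d = 3%N)
  (T p : R) (hT : 0 < T) (hp : 2 <= p)
  (W : 'M[R]_d -> R) (K : R)
  (hW1 : W_C3 W) (hW2 : W_growth p W) (hW3 : W_semiconvex W K)
  (nu : nat -> R) (hnu : forall n, 0 < nu n) (hnu0 : nu n @[n --> \oo] --> 0)
  (u0 : nat -> d.-tuple R -> 'rV[R]_d) (F0 : nat -> d.-tuple R -> 'M[R]_d)
  (u : nat -> R -> d.-tuple R -> 'rV[R]_d)
  (F : nat -> R -> d.-tuple R -> 'M[R]_d)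
  (hsol : forall n, exists y : R -> d.-tuple R -> 'rV[R]_d,
     weak_solution T p W K (nu n) (u0 n) (F0 n) (u n) (F n) y)
  (hF0grad : forall n, is_gradient (F0 n))
  (hdata : forall n, [/\ Lp 2 (u0 n), Lp p (F0 n) & Hk 1 (F0 n)])
  (hbound : exists M : R, forall n,
     [/\ (LpN 2 (u0 n) <= M%:E)%E,
         ('N[torus d]_(2%:E)[EFin \o (fun x => Num.sqrt (grad2 (F0 n) x))]
            <= M%:E)%E &
         (LpN p (F0 n) <= M%:E)%E]) :
  exists (sigma : nat -> nat)
    (uhat0 : d.-tuple R -> 'rV[R]_d) (Fhat0 : d.-tuple R -> 'M[R]_d)
    (uhat : R -> d.-tuple R -> 'rV[R]_d) (Fhat : R -> d.-tuple R -> 'M[R]_d),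
    [/\ {homo sigma : m n / (m < n)%N},
        weak_solution0 T p W uhat0 Fhat0 uhat Fhat,
        weak_star_LinfL2 T (fun n => u (sigma n)) uhat &
        forall q : R, 1 <= q -> q < p ->
          cvg_CLp T q (fun n => F (sigma n)) Fhat].
Proof.
have p0 : 0 < p by exact: lt_le_trans hp.
have [M hM] := hbound.
have /choice[y sol] := hsol.
have [CS CS0 hCS] := stress_growth hp hW1 hW2 hW3.
pose B := M `^ 2 + M `^ p.
have Mp0 : 0 <= M `^ p by exact: powR_ge0.
have M20 : 0 <= M `^ 2 by exact: powR_ge0.
have [M1 M10 hM1] := @energy_bound R d p W hp (Ck_continuous hW1) T K B hT hW2.
have bu0 n : RI (torus d) (fun x => msq (u0 n x)) <= B.
  have [h1 _ _] := hdata n; have [k1 _ _] := hM n.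
  rewrite -frob2_msq; apply: (le_trans (LpN_le (ltr0n R 2) h1 k1)); rewrite /B lerDl//.
have bF0 n : RI (torus d) (fun x => frob (F0 n x) `^ p) <= B.
  have [_ h2 _] := hdata n; have [_ _ k3] := hM n.
  by apply: (le_trans (LpN_le p0 h2 k3)); rewrite /B lerDr.
have bG0 n : RI (torus d) (grad2 (F0 n)) <= B.
  have [_ _ h3] := hdata n; have [_ k2 _] := hM n.
  by apply: (le_trans (gradient_bound h3 k2)); rewrite /B lerDl.
have en n : {ae @lebesgue_measure R, forall t, t \in `]0, T[ ->
    [/\ RI (torus d) (fun x => msq (u n t x)) <= M1, RI (torus d) (fun x => frob (F n t x) `^ p) <= M1,
     Hk 1 (F n t) & RI (torus d) (grad2 (F n t)) <= M1]}.
  have [h1 h2 h3] := hdata n.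
  exact: (hM1 _ _ _ _ _ _ (hnu n) (sol n) h1 h2 h3 (bu0 n) (bF0 n) (bG0 n)).
pose A := 2 `^ 2 * (M1 + 1) + 2 `^ p * (M1 + 1).
have A0 : 0 <= A by rewrite /A addr_ge0// mulr_ge0 ?powR_ge0// addr_ge0.
pose N := A + M1 + B + 1.
have B0 : 0 <= B by rewrite /B addr_ge0.
have AN : A <= N by rewrite /N; lra.
have M1N : M1 <= N by rewrite /N; lra.
have BN : B <= N by rewrite /N; lra.
have B1N : 1 + B <= N by rewrite /N; lra.
have N0 : 0 <= N by exact: le_trans AN.
have bnd n : bounded_flow T p N (u n) (F n).
  apply: (bounded_flow_le AN); apply: (solution_bounded hT hp (sol n) _ M10).
  by have := en n; apply: aeS => t h tT; have [h1 h2 _ _] := h tT.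
have hF1 n : {ae @lebesgue_measure R, forall t, t \in `]0, T[ ->
    Hk 1 (F n t) /\ RI (torus d) (grad2 (F n t)) <= N}.
  have := en n; apply: aeS => t h tT; have [_ _ h3 h4] := h tT.
  by split => //; exact: le_trans h4 M1N.
have cu n : CLp T 2 (u n) by have [] := ws_u (sol n).
have cF n : CLp T p (F n) by have [] := ws_F (sol n).
have hu0 n i : sqint (torus d) (fun x => u0 n x ord0 i) /\ RI (torus d) (fun x => u0 n x ord0 i ^+ 2) <= N.
  have [h1 _ _] := hdata n; have s1 := Lp2_sqint ord0 i h1; split => //.
  apply: le_trans (le_trans (bu0 n) BN); apply: RI_le; [exact: sqint2|exact: Lp2_msq|].
  by move=> x; exact: entry_msq.
have sF0 n i j : sqint (torus d) (fun x => F0 n x i j).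
  by have [_ _ [h3 _]] := hdata n; exact: Lp2_sqint.
have pF0 n : integ (torus d) (fun x => frob (F0 n x) `^ p) /\ RI (torus d) (fun x => frob (F0 n x) `^ p) <= N.
  have [_ h2 _] := hdata n; split; first exact: Lp_integ.
  exact: le_trans (bF0 n) BN.
have bF0' n i j : RI (torus d) (fun x => F0 n x i j ^+ 2) <= N.
  have [i1 _] := pF0 n; have i2 := integ_cst (torus d : probability _ R) 1.
  apply: (@le_trans _ _ (RI (torus d) (fun x => 1 + frob (F0 n x) `^ p))).
    apply: RI_le; [by apply: sqint2; exact: sF0|exact: integD|move=> x].
    apply: (le_trans (entry_msq _ _ _)); rewrite -frob_sqr -powR2 ?frob_ge0//.
    by apply: powR_le1D => //; exact: frob_ge0.
  rewrite (RID i2 i1) RI_cst; apply: le_trans B1N; rewrite lerD2l; exact: bF0.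
have hF0 n : Hk 1 (F0 n) /\ RI (torus d) (grad2 (F0 n)) <= N.
  by have [_ _ h3] := hdata n; split => //; exact: le_trans (bG0 n) BN.
have mom n eta : test T eta -> forall i, momentum_eq hT W (nu n) (u0 n) (u n) (F n) eta i.
  by move=> te i; have [h1 h2 _] := hdata n; exact: (moved_momentum hT hp hW1 CS0 hCS (sol n) (bnd n)).
have cpt n eta : test T eta -> forall i j, compat_eq hT (F0 n) (u n) (F n) eta i j.
  by move=> te i j; have [h1 h2 _] := hdata n; exact: (moved_compat hT hp (sol n) (bnd n)).
have [nub hnub] := cvg_seq_bound hnu0.
have [s [sinc [c1 c2 c3 c4]]] := subsequence hp hW1 CS0 hCS N0 hnub bnd cu cF hu0 hF0 bF0' hF1 mom cpt.
have s_ge := strictly_increasing_ge sinc.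
have nus0 : (fun n => nu (s n)) @ \oo --> (0 : R).
  apply/cvgrPdist_le => e e0; move/cvgrPdist_le : hnu0 => /(_ e e0)[K' _ hK].
  by exists K' => // n /= Kn; apply: hK => /=; exact: leq_trans Kn (s_ge n).
have bs n := bnd (s n).
have [uh [juh huh]] := velocity_limit hT bs c1.
(* The data of the limit are limits of the given data along the same subsequence: weak in L^2 for
   the velocity here, strong in L^2 for the strain below. *)
have [uh0 huh0] := initial_velocity_limit (fun n => hu0 (s n)) c2.
pose Fh := strain_limit T (fun n => F (s n)).
pose Fh0 := initial_strain_limit (fun n => F0 (s n)).
have sF0s n := sF0 (s n); have pF0s n := pF0 (s n).
have bl := bounded_limit hT hp N0 bs c3 juh huh.
have jFh i j : jms (fun t x => Fh t x i j) := strain_limit_jms bs i j.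
have jmuh : jmeas T uh.
  by move=> i j; apply: (@measurable_funS _ _ _ _ setT) => //; rewrite (ord1 i); exact: juh.
have suh t i : 0 <= t <= T -> sqint (torus d) (fun x => uh t x ord0 i) by have [] := huh t i.
have jus n : jmeas T (u (s n)) by have [] := cu (s n).
exists s, uh0, Fh0, uh, Fh; split.
- exact: strictly_increasing_homo.
- apply: (@inviscid_solution R d T p _ hT hp _ _ hW1 CS0 hCS _ _ _ _ bl).
  + exact: jmuh.
  + exact: jms_jmeas.
  + by move=> i; have [] := huh0 i.
  + by move=> i j; have [] := initial_strain_limit_entry sF0s c4 i j.
  + exact: (initial_strain_limit_Lp hp sF0s pF0s c4).
  + move=> eta te i.
    apply: (momentum_limit hp N0 bs (fun n => hu0 (s n)) c3 juh huh huh0 hW1 CS0 hCS nus0 te) => n.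
    exact: mom.
  + move=> eta te i j; apply: (compat_limit hp N0 bs sF0s c3 c4 juh huh te) => n.
    exact: cpt.
  (* The constraint is linear in the strain, so it passes to the limit from the members of the
     sequence. *)
  + move=> zeta tz i a b; have [sp _] := tz.
    have L c j : (fun n => ST hT (fun t x => F (s n) t x i j * dx c zeta (t, vec x))) @ \oo -->
        ST hT (fun t x => Fh t x i j * dx c zeta (t, vec x)).
      have sd := smooth_periodic_derive (0, Defs.basis R c) sp.
      exact: (ST_strain (hT := hT) hp N0 bs c3 juh huh (i := i) (j := j) sd).
    have E : (fun n => ST hT (fun t x => F (s n) t x i b * dx a zeta (t, vec x))) =
        fun n => ST hT (fun t x => F (s n) t x i a * dx b zeta (t, vec x)).
      by apply/funext => n; exact: (solution_curl hT hp (sol (s n)) (bnd (s n)) tz).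
    have la := L a b; rewrite E in la.
    exact: (cvg_unique (@norm_hausdorff _ _) la (L b a)).
- split.
  + move=> k; apply: (@bounded_LinfL2 R d T N) => // t tT.
    by have [_ _ /(_ t tT)[]] := bs k.
  + apply: (@bounded_LinfL2 R d T (N + d%:R * N)) => // t tT.
    by have [_ _ /(_ t tT)[]] := bl.
  + move=> g jg gfin; apply: (@pairing_cvg R d T N hT _ _ N0 jus jmuh) => //.
      by move=> n t i tT; have [_ /(_ t tT)] := L2b_velocity (bs n) i.
    by move=> t i g' tT sg; exact: (weak_velocity bs huh (i := i) tT sg).
- move=> q q1 qp; have q0 : 0 < q by exact: lt_le_trans q1.
  apply: (@strain_cvg_CLp R d T p N hT hp) => //.
  + by move=> n t tT; have [_ _ /(_ t tT)[]] := bs n.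
  + by move=> t; exact: (strain_limit_Lp hT hp bs c3 t).
  + move=> n t i j tT; have [h1 h2] := strain_limit_entry hT hp bs c3 t i j.
    rewrite (clampE tT) in h2; split; last exact: h2.
    by apply: sqintB => //; have [_ /(_ t tT)[]] := L2b_strain hp (bs n) i j.
Qed.
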